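(* Let $a<b$ be real numbers and let $f:\mathbb{R}\to\mathbb{R}$ be a Lipschitz function. Assume that $u\in H^{\frac12}(\mathbb{R},\mathbb{R})$ satisfies $$\begin{cases}(-\Delta)^{\frac12}u=f(u)&\text{weakly in }(a,b) \\ u=0&\text{in }(a,b)^c,\end{cases}$$ and assume moreover that $u^2\in C^2([a,b])$. Then $$\int_a^bu'(x)(-\Delta)^{\frac12}u(x)\,dx=\frac\pi8\left[\lim_{x\to a^+}\frac{u^2(x)}{x-a}-\lim_{x\to b^-}\frac{u^2(x)}{b-x}\right]$$ and $$\int_a^bu'(x)\,x\,(-\Delta)^{\frac12}u(x)\,dx=\frac\pi8\left[\lim_{x\to a^+}\frac{u^2(x)}{x-a}\,a-\lim_{x\to b^-}\frac{u^2(x)}{b-x}\,b\right].$$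
   Context: $(-\Delta)^s$ is the Fourier multiplier $|\xi|^{2s}$ on $\mathbb{R}$ (so that $(-\Delta)^{\frac12}\varphi(x)=\frac1\pi\,PV\int_{\mathbb{R}}\frac{\varphi(x)-\varphi(y)}{|x-y|^2}dy$ for Schwartz $\varphi$). ''Weakly in $(a,b)$'' means $\int_{\mathbb{R}}(-\Delta)^{\frac14}u\,(-\Delta)^{\frac14}\varphi\,dx=\int f(u)\varphi\,dx$ for all $\varphi\in C_c^\infty((a,b))$. ''$u^2\in C^2([a,b])$'' means that $(u^2)''$ is well defined on $(a,b)$ and extends to a bounded continuous function on $[a,b]$ (then so do $u^2$ and $(u^2)'$). *)

(* Defs.v *)
From HB Require Import structures.
From mathcomp Require Import all_boot all_order all_algebra.
From mathcomp Require Import all_classical all_reals all_analysis.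

Set Implicit Arguments.
Unset Strict Implicit.
Unset Printing Implicit Defensive.

Import Order.TTheory GRing.Theory Num.Theory.
Import numFieldNormedType.Exports.

Local Open Scope ring_scope.
Local Open Scope classical_set_scope.

(* The L^2 Fourier transform of a real function [u], with the convention
     \hat u (xi) = \int_R u x * e^{- i x xi} dx,
   where the integral is the L^2 limit of the integrals over [-n, n].
   [A] and [B] are the real and the imaginary part of \hat u. *)
Definition is_fourier (R : realType) (u A B : R -> R) : Prop :=
  [/\ u \in Lfun (@lebesgue_measure R) 2%:E,
      A \in Lfun (@lebesgue_measure R) 2%:E,
      B \in Lfun (@lebesgue_measure R) 2%:E
    & (fun n : nat => (\int[@lebesgue_measure R]_xi
        ((A xi - \int[@lebesgue_measure R]_(x in `[- n%:R, n%:R])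
                    (u x * cos (x * xi))) ^+ 2
       + (B xi + \int[@lebesgue_measure R]_(x in `[- n%:R, n%:R])
                    (u x * sin (x * xi))) ^+ 2)%:E)%E) @ \oo --> 0%E].

(* [u] belongs to the Sobolev space H^s(R, R), for s >= 0. *)
Definition sobolev (R : realType) (s : R) (u : R -> R) : Prop :=
  exists A B : R -> R, is_fourier u A B /\
    (\int[@lebesgue_measure R]_xi
       ((1 + xi ^+ 2) `^ s * (A xi ^+ 2 + B xi ^+ 2))%:E < +oo)%E.

(* [w] = (-Delta)^s [u] in L^2. Such a [w] is unique up to null sets, and it
   exists when [u] belongs to H^{2s}. It is real because the multiplier is
   even. *)
Definition is_frac_laplacian (R : realType) (s : R) (u w : R -> R) : Prop :=
  exists A B : R -> R, is_fourier u A B /\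
    is_fourier w (fun xi => `|xi| `^ (2 * s) * A xi)
                 (fun xi => `|xi| `^ (2 * s) * B xi).

Definition test_function (R : realType) (a b : R) (phi : R -> R) : Prop :=
  (forall (n : nat) (x : R), derivable (derive1n n phi) x 1) /\
  exists K : set R,
    [/\ compact K, K `<=` `]a, b[ & forall x, ~ K x -> phi x = 0].

(* (-Delta)^(1/2) u = g weakly in (a, b). *)
Definition weak_half_laplacian (R : realType) (a b : R) (u g : R -> R) : Prop :=
  forall phi w z : R -> R, test_function a b phi ->
    is_frac_laplacian 4^-1 u w -> is_frac_laplacian 4^-1 phi z ->
    \int[@lebesgue_measure R]_x (w x * z x) =
    \int[@lebesgue_measure R]_(x in `]a, b[) (g x * phi x).

Definition weak_derivative (R : realType) (a b : R) (u p : R -> R) : Prop :=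
  locally_integrable `]a, b[ p /\
  forall phi : R -> R, test_function a b phi ->
    \int[@lebesgue_measure R]_(x in `]a, b[) (u x * derive1 phi x) =
    - \int[@lebesgue_measure R]_(x in `]a, b[) (p x * phi x).

(* [v''] exists on (a, b) and extends continuously to [a, b]; the extension is
   bounded by compactness. The values of [v] at [a] and [b] play no role. *)
Definition C2_closed (R : realType) (a b : R) (v : R -> R) : Prop :=
  (forall x, a < x < b -> derivable v x 1 /\ derivable (derive1 v) x 1) /\
  exists h : R -> R, {within `[a, b], continuous h} /\
    forall x, a < x < b -> derive1n 2 v x = h x.

(* Main.v *)
(**
Write E for the quadratic form 1/(2 pi) \int |xi| |\hat w(xi)|^2 dxi.

Finiteness of E(u) gives ||u(. + h) - u||^2 = o(h) in L^2. This forbids a jump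
of v = u^2 at a or b and a change of sign of u inside {v > 0}, so that u agrees
almost everywhere with U = s sqrt v, where s = +-1 is locally constant on
{v > 0}. Near an end point U is alpha Q(distance to it) plus a remainder with
bounded derivative, where Q(t) = sqrt t exp(-t) for t > 0 and alpha^2 is the
one-sided slope of v, i.e. La or Lb.

For c in {a, b} and h > 0 the dilation U_h(x) = U(x + h (x - c)) still vanishes
outside (a, b), and E(U_h) = E(U). Hence E(U, U_h - U) = - E(U_h - U) / 2. By
the equation the left side is \int f(U) (U_h - U) = - h \int F(U) + o(h), with
F' = f and F(0) = 0. On the right only the singularity at the end point other
than c survives, and since |\hat Q(xi)|^2 = (pi / 4) (1 + xi^2)^(-3/2) the
limit of E(Q(. + h) - Q) / h is pi / 4. Taking c = a and c = b,
\int F(U) = pi / 8 (b - a) Lb = pi / 8 (b - a) La; finally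
\int f(U) U' = 0 and \int x f(U) U' = - \int F(U).
*)
Require Import Defs.
From HB Require Import structures.
From mathcomp Require Import all_boot all_order all_algebra.
From mathcomp Require Import all_classical all_reals all_analysis.
From mathcomp Require Import measurable_realfun ring lra.

Set Implicit Arguments.
Unset Strict Implicit.
Unset Printing Implicit Defensive.

Import Order.TTheory GRing.Theory Num.Theory.
Import numFieldNormedType.Exports.

Local Open Scope ring_scope.
Local Open Scope classical_set_scope.

(** The natural multipliers u' and x u' cannot be tested with: where the slope of v at an end point
    is nonzero, u' grows like the inverse square root of the distance and is not even
    square-integrable. Difference quotients along dilations replace them. Such a dilation preserves
    E because order 1/2 is critical in dimension one, so the defect E(U_h - U) is all that is left,
    and the square root at an end point makes it of order h. The model Q combines this singularity
    with exponential decay, which makes it integrable and its spectrum explicit. Since U_h need not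
    be compactly supported in (a, b), it is first shrunk about the midpoint and then mollified. The
    hypotheses see the sign of u only up to null sets, hence the reconstruction of s. The values of
    U lie in a bounded interval, so f may be replaced by a compactly supported function, whose
    primitive F is an integral from minus infinity, normalised at 0. Everything stays real: the
    Hartley transform replaces the complex one. Limits are taken along h = 1 / (n + 1), and [energy]
    is 2 pi E, so that the constant pi / 4 appears as pi^2 / 2. *)

Section Derive.
Context {R : realType}.
Implicit Types (f g : R -> R) (x a b c : R).

Lemma isd_eq f x a b : is_derive x 1 f a -> a = b -> is_derive x 1 f b.
Proof. by move=> h <-. Qed.

Lemma isd_cst c x : is_derive x 1 (fun _ : R => c) 0.
Proof. exact: is_derive_cst. Qed.

Lemma isd_id x : is_derive x 1 (fun y : R => y) 1.
Proof. exact: is_derive_id. Qed.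

Lemma isdD f g x a b : is_derive x 1 f a -> is_derive x 1 g b ->
  is_derive x 1 (fun y => f y + g y) (a + b).
Proof. by move=> hf hg; exact: is_deriveD. Qed.

Lemma isdN f x a : is_derive x 1 f a -> is_derive x 1 (fun y => - f y) (- a).
Proof. by move=> hf; exact: is_deriveN. Qed.

Lemma isdM f g x a b : is_derive x 1 f a -> is_derive x 1 g b ->
  is_derive x 1 (fun y => f y * g y) (a * g x + f x * b).
Proof.
move=> hf hg; have h := @is_deriveM _ _ f g x 1 a b hf hg.
by apply: isd_eq h _; rewrite /GRing.scale/= addrC; congr (_ + _); rewrite mulrC.
Qed.

Lemma isd_comp f g x a b : is_derive (f x) 1 g a -> is_derive x 1 f b ->
  is_derive x 1 (fun y => g (f y)) (a * b).
Proof.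
move=> hg hf; have h := @is_derive1_comp _ g f x a b hg hf.
by apply: isd_eq h _.
Qed.

Lemma isd_expR f x a : is_derive x 1 f a ->
  is_derive x 1 (fun y => expR (f y)) (expR (f x) * a).
Proof. by move=> hf; apply: (isd_comp (g := expR)) hf; exact: is_derive_expR. Qed.

Lemma isd_cos f x a : is_derive x 1 f a ->
  is_derive x 1 (fun y => cos (f y)) (- sin (f x) * a).
Proof. by move=> hf; apply: (isd_comp (g := cos)) hf; exact: is_derive_cos. Qed.

Lemma isd_sin f x a : is_derive x 1 f a ->
  is_derive x 1 (fun y => sin (f y)) (cos (f x) * a).
Proof. by move=> hf; apply: (isd_comp (g := sin)) hf; exact: is_derive_sin. Qed.

Lemma isdX f x a n : is_derive x 1 f a ->
  is_derive x 1 (fun y => f y ^+ n) (n%:R * f x ^+ n.-1 * a).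
Proof.
case: n => [|n] hf.
  by apply: isd_eq (isd_cst 1 x) _; rewrite !mul0r.
elim: n => [|n IH].
  by rewrite expr0 mulr1 mul1r.
have := isdM hf IH; rewrite (_ : (fun y => _ * _) = (fun y => f y ^+ n.+2)); last first.
  by apply/funext => y; rewrite -exprS.
by move=> h; apply: isd_eq h _; rewrite /= -natr1 exprS; ring.
Qed.

Lemma isdV f x a : f x != 0 -> is_derive x 1 f a ->
  is_derive x 1 (fun y => (f y)^-1) (- a / f x ^+ 2).
Proof.
move=> fx hf; have h := is_deriveV fx hf.
by apply: isd_eq h _; rewrite /GRing.scale/= !mulNr mulrC.
Qed.

Lemma isd_sqrt f x a : 0 < f x -> is_derive x 1 f a ->
  is_derive x 1 (fun y => Num.sqrt (f y)) (a / (2 * Num.sqrt (f x))).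
Proof.
move=> fx hf; have h := isd_comp (is_derive1_sqrt fx) hf.
by apply: isd_eq h _; rewrite mulrC.
Qed.

Lemma isd_continuous f x a : is_derive x 1 f a -> {for x, continuous f}.
Proof.
by move=> [h _]; apply: differentiable_continuous; apply/derivable1_diffP.
Qed.

End Derive.

(** The derivative is an existential variable filled in by recursion on the shape of the function;
    [isd] then leaves the equation between the value found and the value claimed. *)
Ltac isd_step := lazymatch goal with
  | |- is_derive _ _ (fun _ => ?c) _ => eapply isd_cst
  | |- is_derive _ _ (fun y => y) _ => eapply isd_id
  | |- is_derive _ _ (fun y => GRing.add (@?f y) (@?g y)) _ => eapply (@isdD _ f g)
  | |- is_derive _ _ (fun y => GRing.opp (@?f y)) _ => eapply (@isdN _ f)
  | |- is_derive _ _ (fun y => GRing.mul (@?f y) (@?g y)) _ => eapply (@isdM _ f g)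
  | |- is_derive _ _ (fun y => GRing.exp (@?f y) ?n) _ => eapply (@isdX _ f)
  | |- is_derive _ _ (fun y => GRing.inv (@?f y)) _ => eapply (@isdV _ f)
  | |- is_derive _ _ (fun y => expR (@?f y)) _ => eapply (@isd_expR _ f)
  | |- is_derive _ _ (fun y => cos (@?f y)) _ => eapply (@isd_cos _ f)
  | |- is_derive _ _ (fun y => sin (@?f y)) _ => eapply (@isd_sin _ f)
  | |- is_derive _ _ (fun y => Num.sqrt (@?f y)) _ => eapply (@isd_sqrt _ f)
  | |- is_derive _ _ _ _ => eassumption
  end.
Ltac isd := eapply isd_eq; [repeat isd_step; cbv beta|cbv beta].
(* Leaves the side conditions [_ != 0] of inverses and square roots. *)
Ltac isd_cont := eapply isd_continuous; repeat isd_step; cbv beta.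

Lemma cvg_EFinP {R : realType} {I : Type} (F : set_system I) {FF : Filter F}
    (f : I -> R) (a : R) :
  (f x)%:E @[x --> F] --> a%:E <-> f x @[x --> F] --> a.
Proof.
split=> [/fine_cvgP[]//|h]; apply/fine_cvgP; split => //; exact: nearW.
Qed.

Lemma measurable_EFin {d} {T : measurableType d} {R : realType} (D : set T)
    (f : T -> R) :
  measurable_fun D f -> measurable_fun D (fun x => (f x)%:E).
Proof. by move=> mf; apply/(measurable_EFinP D f). Qed.

Lemma cvgn_le {R : realType} (u v : nat -> R) (a b : R) :
  u @ \oo --> a -> v @ \oo --> b -> (forall n, u n <= v n) -> a <= b.
Proof.
move=> ua vb uv; rewrite -(cvg_lim _ ua)// -(cvg_lim _ vb)//.
by apply: ler_lim; [exact: cvgP ua|exact: cvgP vb|exact: nearW].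
Qed.

(** * Integrals on the real line *)

Section RealIntegral.
Context {R : realType}.
Implicit Types (f g h : R -> R) (c : R).
Local Notation mu := (@lebesgue_measure R).

Definition L1 f := mu.-integrable setT (EFin \o f).

(** This is the finite part of an extended integral, so it reads 0 when the integral is infinite;
    the algebraic rules below therefore carry [L1] hypotheses. *)
Definition Int f := \int[mu]_x f x.

Lemma L1_meas f : L1 f -> measurable_fun setT f.
Proof. by move=> /integrableP[/measurable_EFinP]. Qed.

Lemma eq_L1 f g : f =1 g -> L1 f -> L1 g.
Proof. by move=> /funext ->. Qed.

Lemma eq_Int f g : f =1 g -> Int f = Int g.
Proof. by move=> /funext ->. Qed.

Lemma L1_le g f : L1 g -> measurable_fun setT f -> (forall x, `|f x| <= g x) ->
  L1 f.
Proof.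
move=> Lg mf fg; apply: (le_integrable _ _ _ Lg) => //; first exact/measurable_EFinP.
by move=> x _ /=; rewrite lee_fin (le_trans (fg x))// ler_norm.
Qed.

Lemma L1D f g : L1 f -> L1 g -> L1 (fun x => f x + g x).
Proof. by move=> Lf Lg; exact: (integrableD _ Lf Lg). Qed.

Lemma L1B f g : L1 f -> L1 g -> L1 (fun x => f x - g x).
Proof. by move=> Lf Lg; exact: (integrableB _ Lf Lg). Qed.

Lemma L1Z c f : L1 f -> L1 (fun x => c * f x).
Proof. by move=> Lf; exact: (integrableZl _ _ Lf). Qed.

Lemma L1N f : L1 f -> L1 (fun x => - f x).
Proof. by move=> /(L1Z (-1)); apply: eq_L1 => x; rewrite mulN1r. Qed.

Lemma L1_norm f : L1 f -> L1 (fun x => `|f x|).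
Proof. by move=> Lf; exact: (integrable_norm Lf). Qed.

Lemma IntD f g : L1 f -> L1 g -> Int (fun x => f x + g x) = Int f + Int g.
Proof. by move=> Lf Lg; rewrite /Int RintegralD. Qed.

Lemma IntB f g : L1 f -> L1 g -> Int (fun x => f x - g x) = Int f - Int g.
Proof. by move=> Lf Lg; rewrite /Int RintegralB. Qed.

Lemma IntZ c f : L1 f -> Int (fun x => c * f x) = c * Int f.
Proof. by move=> Lf; rewrite /Int RintegralZl. Qed.

Lemma IntN f : L1 f -> Int (fun x => - f x) = - Int f.
Proof. by move=> Lf; rewrite -mulN1r -IntZ//; apply: eq_Int => x; rewrite mulN1r. Qed.

Lemma Int0 : Int (fun _ => 0) = 0.
Proof. by rewrite /Int /Rintegral integral0. Qed.

Lemma Int_ge0 f : (forall x, 0 <= f x) -> 0 <= Int f.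
Proof. by move=> f0; apply: Rintegral_ge0. Qed.

Lemma Int_le f g : L1 f -> L1 g -> (forall x, f x <= g x) -> Int f <= Int g.
Proof. by move=> Lf Lg fg; apply: le_Rintegral. Qed.

Lemma Int_norm f : L1 f -> `|Int f| <= Int (fun x => `|f x|).
Proof. by move=> Lf; apply: le_normr_Rintegral. Qed.

Lemma EFin_Int f : L1 f -> (\int[mu]_x (f x)%:E)%E = (Int f)%:E.
Proof.
by move=> Lf; rewrite /Int /Rintegral fineK//; exact: integrable_fin_num Lf.
Qed.

Lemma Int_DCT (F : nat -> R -> R) f g :
  (forall n, measurable_fun setT (F n)) -> measurable_fun setT f ->
  {ae mu, forall x, F ^~ x @ \oo --> f x} ->
  L1 g -> (forall n x, `|F n x| <= g x) ->
  L1 f /\ (fun n => Int (F n)) @ \oo --> Int f.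
Proof.
move=> mF mf Ff Lg Fg.
have LF n : L1 (F n) by apply: (L1_le Lg).
have [||||/= Lf _ cv] := @dominated_convergence _ _ _ mu setT measurableT
  (fun n x => (F n x)%:E) (fun x => (f x)%:E) (fun x => (g x)%:E) _ _ _ Lg.
- by move=> n; exact: (measurable_EFin (mF n)).
- exact: (measurable_EFin mf).
- case: Ff => N [mN N0 sN]; exists N; split => // x /= h; apply: sN => /= h2.
  by apply: h => _; exact/cvg_EFinP.
- by apply: aeW => x n _ /=; rewrite lee_fin.
split => //.
move: cv; rewrite EFin_Int//; under eq_fun do rewrite EFin_Int//.
by move/cvg_EFinP.
Qed.

Lemma L1_pos_lty f : measurable_fun setT f -> (forall x, 0 <= f x) ->
  (\int[mu]_x (f x)%:E < +oo)%E -> L1 f.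
Proof.
move=> mf f0 h; apply/integrableP; split; first exact: measurable_EFin.
by under eq_integral do rewrite /= ger0_norm//.
Qed.

(** Serves where no majorant is at hand: a uniform bound on the integrals makes the limit
    integrable. Improper integrals, the square integrability of a transform and the completeness of
    L^2 all go through it. *)
Lemma Int_Fatou (F : nat -> R -> R) f c :
  (forall n, L1 (F n)) -> (forall n x, 0 <= F n x) ->
  (forall x, F ^~ x @ \oo --> f x) -> (forall n, Int (F n) <= c) ->
  L1 f /\ Int f <= c.
Proof.
move=> LF F0 Ff Fc.
have mf : measurable_fun setT f.
  by apply: (@measurable_fun_cvg _ _ _ _ F) => [n|x _]; [exact: L1_meas|exact: Ff].
have f0 x : 0 <= f x.
  by apply: (cvgn_le (cvg_cst 0) (Ff x)) => n; exact: F0.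
have le : (\int[mu]_x (f x)%:E <= c%:E)%E.
  have := @fatou _ _ _ mu setT measurableT (fun n x => (F n x)%:E).
  move=> /(_ (fun n => measurable_EFin (L1_meas (LF n)))); move=> /(_ (fun n x _ => F0 n x)) h.
  apply: le_trans (le_trans h _).
    rewrite le_eqVlt; apply/orP; left; apply/eqP; apply: eq_integral => x _.
    rewrite is_cvg_limn_einfE; last by apply/cvg_ex; exists (f x)%:E; exact/cvg_EFinP/Ff.
    by apply/esym/cvg_lim => //; exact/cvg_EFinP/Ff.
  rewrite limn_einf_lim; apply: lime_le; first exact: is_cvg_einfs.
  apply: nearW => n; apply: ereal_inf_le; exists (Int (F n))%:E; last by rewrite lee_fin.
  by exists n => //=; rewrite EFin_Int.
have Lf : L1 f by apply: L1_pos_lty => //; rewrite (le_lt_trans le)// ltry.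
by split=> //; rewrite -lee_fin -EFin_Int.
Qed.

End RealIntegral.

(** * Affine changes of variable *)

Section Affine.
Context {R : realType}.
Implicit Types (f g h : R -> R) (c l t : R).
Local Notation mu := (@lebesgue_measure R).

Lemma measurable_affine l t : measurable_fun setT (fun x : R => l * x + t).
Proof.
apply: continuous_measurable_fun => x; apply: cvgD; last exact: cvg_cst.
by apply: cvgM; [exact: cvg_cst|exact: cvg_id].
Qed.

Lemma measurable_comp_affine f l t : measurable_fun setT f ->
  measurable_fun setT (fun x : R => f (l * x + t)).
Proof. by move=> mf; exact: (measurableT_comp mf (measurable_affine l t)). Qed.

(** By uniqueness of Lebesgue measure it is enough to compare both sides on half-open intervals. A
    negative [l] reverses the interval and moves the open end, which leaves its length alone. *)
Lemma lebesgue_measure_affine l t (A : set R) : l != 0 -> measurable A ->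
  (mu A = `|l|%:E * mu ((fun x : R => l * x + t)%R @^-1` A))%E.
Proof.
move=> l0 mA.
have nl : 0 <= `|l| by [].
pose M (x : measurableTypeR R) : measurableTypeR R := l * x + t.
have mM : measurable_fun setT M by exact: measurable_affine.
pose m' : {measure set (measurableTypeR R) -> \bar R} := mscale (NngNum nl)
  (measure_function_pushforward__canonical__measure_function_Measure mu mM).
rewrite (@lebesgue_measure_unique R m' _ A mA)// => X [[c d] /= cd <-].
rewrite /m' /mscale /= /pushforward.
have [{}l0|{}l0|] := ltgtP 0 l; last by move=> l0'; rewrite l0' eqxx in l0.
  have -> : M @^-1` `]c, d] = `](c - t) / l, (d - t) / l].
    apply/seteqP; split => x /=; rewrite !in_itv/=;
      by rewrite ltr_pdivrMr// ler_pdivlMr// ltrBlDr lerBrDr (mulrC x).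
  rewrite !lebesgue_measure_itv/= !lte_fin ltr_pM2r ?invr_gt0// ltrD2r.
  case: ifPn; last by rewrite mule0.
  move=> _; rewrite -EFinB -EFinM; congr EFin; rewrite gtr0_norm//.
  by field; rewrite gt_eqF.
have -> : M @^-1` `]c, d] = `[(d - t) / l, (c - t) / l[.
  apply/seteqP; split => x /=; rewrite !in_itv/=;
    by rewrite ltr_ndivlMr// ler_ndivrMr// ltrBlDr lerBrDr (mulrC x) andbC.
rewrite !lebesgue_measure_itv/= !lte_fin ltr_nM2r ?invr_lt0// ltrD2r.
case: ifPn; last by rewrite mule0.
move=> _; rewrite -EFinB -EFinM; congr EFin; rewrite ltr0_norm//.
by field; rewrite lt_eqF.
Qed.

Lemma ge0_integral_affine f l t : l != 0 -> measurable_fun setT f ->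
  (forall x, 0 <= f x) ->
  (\int[mu]_x (f x)%:E = `|l|%:E * \int[mu]_x (f (l * x + t))%:E)%E.
Proof.
move=> l0 mf f0.
have nl : 0 <= `|l| by [].
pose M (x : measurableTypeR R) : measurableTypeR R := l * x + t.
have mM : measurable_fun setT M by exact: measurable_affine.
pose m' : {measure set (measurableTypeR R) -> \bar R} := mscale (NngNum nl)
  (measure_function_pushforward__canonical__measure_function_Measure mu mM).
rewrite (@eq_measure_integral _ _ _ setT m' mu); last first.
  by move=> A mA _; first [exact: (lebesgue_measure_affine t l0 mA) | exact: (esym (lebesgue_measure_affine t l0 mA))].
rewrite ge0_integral_mscale//=; last 2 first.
- exact: (measurable_EFin mf).
- by move=> x _; rewrite lee_fin.
congr (_ * _)%E.
rewrite ge0_integral_pushforward//.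
- exact: (measurable_EFin mf).
- by move=> x _; rewrite lee_fin.
Qed.

Lemma L1_affine f l t : l != 0 -> L1 f -> L1 (fun x => f (l * x + t)).
Proof.
move=> l0 Lf; have mf := L1_meas Lf.
have mg : measurable_fun setT (fun x => f (l * x + t)) by exact: measurable_comp_affine.
apply: (L1_le (g := fun x => `|f (l * x + t)|)) => //.
apply: L1_pos_lty => //; first exact: measurableT_comp.
have Ln := L1_norm Lf.
have := @ge0_integral_affine (fun x => `|f x|) l t l0 (L1_meas Ln) (fun x => normr_ge0 _).
rewrite EFin_Int// => h.
rewrite ltNge leye_eq; apply/negP => /eqP e; move: h; rewrite e.
by rewrite gt0_muley// lte_fin normr_gt0.
Qed.

Lemma Int_affine f l t : l != 0 -> L1 f ->
  Int (fun x => f (l * x + t)) = `|l|^-1 * Int f.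
Proof.
move=> l0 Lf.
have ge0 g : L1 g -> (forall x, 0 <= g x) ->
    Int (fun x => g (l * x + t)) = `|l|^-1 * Int g.
  move=> Lg g0; have := ge0_integral_affine t l0 (L1_meas Lg) g0.
  rewrite !EFin_Int//; last exact: L1_affine.
  by move=> [->]; rewrite mulKf// normr_eq0.
have Lnf := L1_norm Lf.
have LD := L1D Lnf Lf.
have hD := ge0 _ LD (fun x => ltac:(rewrite -lerBlDr sub0r -normrN; exact: ler_norm)).
have hn := ge0 _ Lnf (fun x => normr_ge0 _).
(* Signed functions reduce to nonnegative ones through f = (|f| + f) - |f|. *)
rewrite (@eq_Int _ _ (fun x => (`|f (l * x + t)| + f (l * x + t)) - `|f (l * x + t)|)); last by move=> x; rewrite [X in _ = X]addrAC subrr add0r.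
rewrite (IntB (f := fun x => `|f (l * x + t)| + f (l * x + t))); last 2 first.
- exact: (L1_affine t l0 LD).
- exact: (L1_affine t l0 Lnf).
by rewrite hD hn IntD//; ring.
Qed.

Lemma Int_shift f t : L1 f -> Int (fun x => f (x + t)) = Int f.
Proof.
move=> Lf; rewrite -[RHS]mul1r -[X in X * _]invr1 -[in RHS](@normr1 R).
by rewrite -(@Int_affine f 1 t)// ?oner_eq0//; apply: eq_Int => x; rewrite mul1r.
Qed.

Lemma L1_shift f t : L1 f -> L1 (fun x => f (x + t)).
Proof.
move=> Lf; have := @L1_affine f 1 t (oner_neq0 _) Lf.
by apply: eq_L1 => x; rewrite mul1r.
Qed.

Lemma L1_opp f : L1 f -> L1 (fun x => f (- x)).
Proof.
move=> Lf; have h : (-1 : R) != 0 by rewrite oppr_eq0 oner_eq0.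
by have := L1_affine 0 h Lf; apply: eq_L1 => x; rewrite mulN1r addr0.
Qed.

Lemma Int_opp f : L1 f -> Int (fun x => f (- x)) = Int f.
Proof.
move=> Lf; have h : (-1 : R) != 0 by rewrite oppr_eq0 oner_eq0.
have := Int_affine 0 h Lf; rewrite normrN normr1 invr1 mul1r => <-.
by apply: eq_Int => x; rewrite mulN1r addr0.
Qed.

End Affine.

Section AeEq.
Context {R : realType}.
Implicit Types (f g h : R -> R).
Local Notation mu := (@lebesgue_measure R).

Lemma L1_ae f g : measurable_fun setT g -> {ae mu, forall x, f x = g x} -> L1 f ->
  L1 g /\ Int f = Int g.
Proof.
move=> mg fg Lf; have mf := L1_meas Lf.
(* Dominated convergence along the constant sequence [f], which converges to [g] almost
   everywhere. *)
have [] := @Int_DCT R (fun _ => f) g (fun x => `|f x|).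
- by [].
- by [].
- case: fg => N [mN N0 sN]; exists N; split => // x /= h; apply: sN => /= e.
  by apply: h; rewrite e; exact: cvg_cst.
- exact: L1_norm.
- by [].
move=> Lg h; split => //.
by have /cvg_lim <- // := h; rewrite lim_cst.
Qed.

End AeEq.

(** * Fubini's theorem for real-valued integrals *)

Section Fubini.
Context {R : realType}.
Local Notation mu := (@lebesgue_measure R).

(** Slices are integrable for every point, not for almost every point, so that the iterated [Int]
    needs no modification on null sets. Integrability over the product comes from Tonelli's theorem
    applied to the absolute value. *)
Lemma Int_Fubini (F : R * R -> R) : measurable_fun setT F ->
  (forall x, L1 (fun y => F (x, y))) -> (forall y, L1 (fun x => F (x, y))) ->
  L1 (fun x => Int (fun y => `|F (x, y)|)) ->
  [/\ L1 (fun x => Int (fun y => F (x, y))),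
      L1 (fun y => Int (fun x => F (x, y))) &
      Int (fun x => Int (fun y => F (x, y))) = Int (fun y => Int (fun x => F (x, y)))].
Proof.
move=> mF L L' Ln.
have mE : measurable_fun setT (fun z => (F z)%:E) by exact: measurable_EFin.
have iF : (mu \x mu)%E.-integrable setT (fun z => (F z)%:E).
  apply/integrable12ltyP => //.
  under eq_integral do under eq_integral do rewrite /=.
  rewrite (_ : (fun x => _) = fun x => (Int (fun y => `|F (x, y)|))%:E); last first.
    by apply/funext => x; rewrite -EFin_Int//; exact: L1_norm.
  by rewrite EFin_Int// ltry.
have i1 := integrable_fubini_F iF.
have m2 := measurable_fubini_G iF.
have e1 : fubini_F mu (fun z => (F z)%:E) = EFin \o (fun x => Int (fun y => F (x, y))).
  by apply/funext => x; rewrite /fubini_F /= -EFin_Int.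
have e2 : fubini_G mu (fun z => (F z)%:E) = EFin \o (fun y => Int (fun x => F (x, y))).
  by apply/funext => x; rewrite /fubini_G /= -EFin_Int.
have {}i1 : L1 (fun x => Int (fun y => F (x, y))) by rewrite /L1 -e1; exact: i1.
have {}m2 : measurable_fun setT (fun y => Int (fun x => F (x, y))).
  by apply/measurable_EFinP; rewrite -e2; exact: m2.
have mN : measurable_fun setT (fun z => `|(F z)%:E|%E) by exact: measurableT_comp.
have e3 : fubini_G mu (fun z => `|(F z)%:E|%E) = EFin \o (fun y => Int (fun x => `|F (x, y)|)).
  by apply/funext => y; rewrite /fubini_G /= -EFin_Int//; exact: L1_norm.
have e4 : fubini_F mu (fun z => `|(F z)%:E|%E) = EFin \o (fun x => Int (fun y => `|F (x, y)|)).
  by apply/funext => x; rewrite /fubini_F /= -EFin_Int//; exact: L1_norm.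
have LN : L1 (fun y => Int (fun x => `|F (x, y)|)).
  apply: L1_pos_lty; first apply/measurable_EFinP; first rewrite -e3.
    exact: (@measurable_fun_fubini_tonelli_G _ _ _ _ R mu _ mN (fun z => abse_ge0 _)).
  - by move=> y; exact: Int_ge0.
  - suff <- : (\int[mu]_x (Int (fun y => `|F (x, y)|))%:E =
      \int[mu]_y (Int (fun x => `|F (x, y)|))%:E)%E by rewrite EFin_Int// ltry.
    rewrite -[LHS](f_equal (fun h => \int[mu]_x h x)%E e4).
    rewrite -[RHS](f_equal (fun h => \int[mu]_x h x)%E e3).
    exact: (@fubini_tonelli _ _ _ _ _ mu mu _ mN (fun z => abse_ge0 _)).
have i2 : L1 (fun y => Int (fun x => F (x, y))).
  by apply: (L1_le LN) => // y; exact: Int_norm.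
split => //.
apply: EFin_inj; rewrite -!EFin_Int//.
have := Fubini iF.
by move: e1 e2; rewrite /fubini_F /fubini_G => -> ->.
Qed.

Lemma measurable_Int_norm (F : R * R -> R) : measurable_fun setT F ->
  (forall x, L1 (fun y => F (x, y))) ->
  measurable_fun setT (fun x => Int (fun y => `|F (x, y)|)).
Proof.
move=> mF L.
have mk : measurable_fun setT (fun z : R * R => (`|F z|)%:E).
  by apply: measurable_EFin; apply: measurableT_comp.
have := @measurable_fun_fubini_tonelli_F _ _ _ _ R mu _ mk (fun z => ltac:(by rewrite lee_fin)).
rewrite /fubini_F /= (_ : (fun x => _) = EFin \o (fun x => Int (fun y => `|F (x, y)|))).
  by move/measurable_EFinP.
by apply/funext => x; rewrite EFin_Int//; exact: L1_norm.
Qed.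

Lemma Int_Fubini_le (F : R * R -> R) (G : R -> R) : measurable_fun setT F ->
  (forall x, L1 (fun y => F (x, y))) -> (forall y, L1 (fun x => F (x, y))) ->
  L1 G -> (forall x, Int (fun y => `|F (x, y)|) <= G x) ->
  [/\ L1 (fun x => Int (fun y => F (x, y))),
      L1 (fun y => Int (fun x => F (x, y))) &
      Int (fun x => Int (fun y => F (x, y))) = Int (fun y => Int (fun x => F (x, y)))].
Proof.
move=> mF L L' LG FG; apply: Int_Fubini => //; apply: (L1_le LG).
  exact: measurable_Int_norm.
by move=> x; rewrite ger0_norm// Int_ge0.
Qed.

Lemma measurable_pair_fst (f : R -> R) : measurable_fun setT f ->
  measurable_fun setT (fun z : R * R => f z.1).
Proof. by move=> mf; exact: (measurableT_comp mf measurable_fst). Qed.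

Lemma measurable_pair_snd (f : R -> R) : measurable_fun setT f ->
  measurable_fun setT (fun z : R * R => f z.2).
Proof. by move=> mf; exact: (measurableT_comp mf measurable_snd). Qed.

Lemma Int_Fubini_prod (f g : R -> R) (K : R * R -> R) (c : R) : L1 f -> L1 g ->
  measurable_fun setT K -> (forall z, `|K z| <= c) ->
  [/\ L1 (fun x => f x * Int (fun y => g y * K (x, y))),
      L1 (fun y => g y * Int (fun x => f x * K (x, y))) &
      Int (fun x => f x * Int (fun y => g y * K (x, y))) =
      Int (fun y => g y * Int (fun x => f x * K (x, y)))].
Proof.
move=> Lf Lg mK Kc.
have mf := L1_meas Lf; have mg := L1_meas Lg.
have mKx x : measurable_fun setT (fun y => K (x, y)) by exact: measurableT_comp.
have mKy y : measurable_fun setT (fun x => K (x, y)) by exact: measurableT_comp.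
have LfK y : L1 (fun x => f x * K (x, y)).
  apply: (L1_le (L1Z c (L1_norm Lf))); first exact: measurable_funM.
  by move=> x; rewrite normrM mulrC ler_wpM2r.
have LgK x : L1 (fun y => g y * K (x, y)).
  apply: (L1_le (L1Z c (L1_norm Lg))); first exact: measurable_funM.
  by move=> y; rewrite normrM mulrC ler_wpM2r.
have e1 : (fun x => f x * Int (fun y => g y * K (x, y))) =
    (fun x => Int (fun y => f x * (g y * K (x, y)))).
  by apply/funext => x; rewrite IntZ.
have e2 : (fun y => g y * Int (fun x => f x * K (x, y))) =
    (fun y => Int (fun x => f x * (g y * K (x, y)))).
  apply/funext => y; rewrite -IntZ//; apply: eq_Int => x; ring.
rewrite e1 e2.
have mF : measurable_fun setT (fun z : R * R => f z.1 * (g z.2 * K z)).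
  apply: measurable_funM; first exact: measurable_pair_fst.
  by apply: measurable_funM => //; exact: measurable_pair_snd.
apply: (@Int_Fubini_le (fun z => f z.1 * (g z.2 * K z))
  (fun x => (c * Int (fun y => `|g y|)) * `|f x|) mF) => /=.
- by move=> x; exact: L1Z.
- by move=> y; have := L1Z (g y) (LfK y); apply: eq_L1 => x /=; ring.
- by apply: L1Z; exact: L1_norm.
move=> x; under eq_Int do rewrite normrM.
rewrite IntZ; last exact: L1_norm.
rewrite mulrC ler_wpM2r// -IntZ; last exact: L1_norm.
apply: Int_le; [exact: L1_norm| by apply: L1Z; exact: L1_norm|].
by move=> y; rewrite normrM mulrC ler_wpM2r.
Qed.

End Fubini.

Lemma cvgn_squeeze {R : realType} (u v : nat -> R) (l : R) :
  (forall n, `|u n - l| <= v n) -> v @ \oo --> 0 -> u @ \oo --> l.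
Proof.
move=> uv v0; apply/cvgrPdist_lt => e e0; move/cvgrPdist_lt : v0 => /(_ e e0).
apply: filterS => n; rewrite sub0r normrN => h; rewrite distrC.
by rewrite (le_lt_trans (uv n))// (le_lt_trans (ler_norm _)).
Qed.

Ltac L1_auto := solve [repeat (first [assumption | apply: L1B | apply: L1D |
  apply: L1Z | apply: L1N | apply: L1_norm])].
(** * Square-integrable functions *)

Section SquareIntegrable.
Context {R : realType}.
Implicit Types (f g h : R -> R) (c l t : R).

Definition L2 f := measurable_fun setT f /\ L1 (fun x => f x ^+ 2).

Definition sqnorm f := Int (fun x => f x ^+ 2).

Lemma sqnorm_ge0 f : 0 <= sqnorm f.
Proof. by apply: Int_ge0 => x; exact: sqr_ge0. Qed.

Lemma L2_mul f g : L2 f -> L2 g -> L1 (fun x => f x * g x).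
Proof.
move=> [mf Lf] [mg Lg]; apply: (L1_le (L1D Lf Lg)); first exact: measurable_funM.
move=> x; rewrite ler_norml; apply/andP; split; nra.
Qed.

Lemma L2D f g : L2 f -> L2 g -> L2 (fun x => f x + g x).
Proof.
move=> Lf Lg; have Lfg := L2_mul Lf Lg; case: Lf Lg => [mf Lf] [mg Lg].
split; first exact: measurable_funD.
by apply: eq_L1 (L1D (L1D Lf Lg) (L1Z 2 Lfg)) => x; ring.
Qed.

Lemma L2Z c f : L2 f -> L2 (fun x => c * f x).
Proof.
move=> [mf Lf]; split; first exact: measurable_funM.
by apply: eq_L1 (L1Z (c ^+ 2) Lf) => x; ring.
Qed.

Lemma eq_L2 f g : f =1 g -> L2 f -> L2 g.
Proof. by move=> /funext ->. Qed.

Lemma L2B f g : L2 f -> L2 g -> L2 (fun x => f x - g x).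
Proof.
by move=> Lf Lg; apply: eq_L2 (L2D Lf (L2Z (-1) Lg)) => x; rewrite mulN1r.
Qed.

Lemma L2_le f g : L2 g -> measurable_fun setT f -> (forall x, `|f x| <= g x) -> L2 f.
Proof.
move=> [mg Lg] mf fg; split => //; apply: (L1_le Lg); first exact: measurable_funX.
by move=> x; rewrite normrX lerXn2r ?nnegrE// (le_trans _ (fg x)).
Qed.

Lemma L2_affine f l t : l != 0 -> L2 f -> L2 (fun x => f (l * x + t)).
Proof.
move=> l0 [mf Lf]; split; first exact: measurable_comp_affine.
exact: L1_affine l0 Lf.
Qed.

Lemma sqnorm_affine f l t : l != 0 -> L2 f ->
  sqnorm (fun x => f (l * x + t)) = `|l|^-1 * sqnorm f.
Proof. by move=> l0 [mf Lf]; exact: (Int_affine t l0 Lf). Qed.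

Lemma sqnormD2 f g : L2 f -> L2 g ->
  sqnorm (fun x => f x + g x) = sqnorm f + 2 * Int (fun x => f x * g x) + sqnorm g.
Proof.
move=> Lf Lg; have Lfg := L2_mul Lf Lg; case: Lf Lg => [mf Lf] [mg Lg].
have L' := L1Z 2 Lfg; have L'' := L1D Lf L'.
rewrite /sqnorm -IntZ// -(IntD Lf L') -(IntD L'' Lg).
by apply: eq_Int => x; ring.
Qed.

Lemma sqnormZ c f : L2 f -> sqnorm (fun x => c * f x) = c ^+ 2 * sqnorm f.
Proof. by move=> [mf Lf]; rewrite /sqnorm -IntZ//; apply: eq_Int => x; ring. Qed.

(** Pointwise this is c (f - g / c)^2 >= 0 and c (f + g / c)^2 >= 0. The parameter stays free so
    that [dot_CS] and later estimates can choose it. *)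
Lemma dot_young f g c : 0 < c -> L2 f -> L2 g ->
  `|Int (fun x => f x * g x)| <= (c * sqnorm f + c^-1 * sqnorm g) / 2.
Proof.
move=> c0 Lf Lg; have Lfg := L2_mul Lf Lg; case: Lf Lg => [mf Lf] [mg Lg].
rewrite ler_pdivlMr// mulrC -[2]gtr0_norm// -normrM -IntZ//.
apply: le_trans (Int_norm _) _; first exact: L1Z.
rewrite /sqnorm -!IntZ// -IntD; try L1_auto.
apply: Int_le; try L1_auto.
move=> x; have e : 0 <= c * (f x - c^-1 * g x) ^+ 2 by rewrite mulr_ge0 ?sqr_ge0// ltW.
have e' : 0 <= c * (f x + c^-1 * g x) ^+ 2 by rewrite mulr_ge0 ?sqr_ge0// ltW.
have E1 : c * (f x - c^-1 * g x) ^+ 2 = c * f x ^+ 2 + c^-1 * g x ^+ 2 - 2 * (f x * g x).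
  by field; rewrite gt_eqF.
have E2 : c * (f x + c^-1 * g x) ^+ 2 = c * f x ^+ 2 + c^-1 * g x ^+ 2 + 2 * (f x * g x).
  by field; rewrite gt_eqF.
rewrite ler_norml; apply/andP; split; lra.
Qed.

Lemma dot_CS f g : L2 f -> L2 g ->
  `|Int (fun x => f x * g x)| <= Num.sqrt (sqnorm f) * Num.sqrt (sqnorm g).
Proof.
move=> Lf Lg; set I := `|_|; have I0 : 0 <= I := normr_ge0 _.
have a0 := sqnorm_ge0 f; have b0 := sqnorm_ge0 g.
have H c : 0 < c -> I <= (c * sqnorm f + c^-1 * sqnorm g) / 2.
  by move=> c0; exact: dot_young.
rewrite -sqrtrM// -[I]ger0_norm// -sqrtr_sqr ler_wsqrtr//.
have [I1|I1] := eqVneq I 0; first by rewrite I1 expr0n/= mulr_ge0.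
have Ip : 0 < I by rewrite lt_def I1.
have [f0|f0] := eqVneq (sqnorm f) 0.
  (* If [f] has norm zero, the parameter (|g|^2 + 1) / I, with |g|^2 for [sqnorm g], bounds I by I
     |g|^2 / (2 (|g|^2 + 1)), which is less than I. *)
  exfalso; have h : 0 < (sqnorm g + 1) / I by rewrite divr_gt0// ltr_wpDl.
  have := H _ h; rewrite f0 mulr0 add0r invf_div => h2.
  have gp : 0 < sqnorm g + 1 by rewrite ltr_wpDl.
  have kp : 0 < I / (sqnorm g + 1) by rewrite divr_gt0.
  have e : I = I / (sqnorm g + 1) * (sqnorm g + 1) by rewrite divfK// gt_eqF.
  by move: h2 e kp; set k := I / _; nra.
have fp : 0 < sqnorm f by rewrite lt_def f0.
(* The optimal parameter: the first term becomes I, and the inequality turns into I^2 <= |f|^2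
   |g|^2. *)
have := H (I / sqnorm f) ltac:(by rewrite divr_gt0).
rewrite divfK// invf_div => h.
have e : sqnorm f * sqnorm g = I * (sqnorm f / I * sqnorm g) by field.
by rewrite e expr2 ler_pM2l//; lra.
Qed.

Lemma sqnormD_le f g : L2 f -> L2 g ->
  sqnorm (fun x => f x + g x) <= 2 * sqnorm f + 2 * sqnorm g.
Proof.
move=> Lf Lg; have [mfg Lfg] := L2D Lf Lg; case: Lf Lg => [mf Lf] [mg Lg].
rewrite /sqnorm -!IntZ// -IntD; try L1_auto.
apply: Int_le; try L1_auto.
by move=> x; have := sqr_ge0 (f x - g x); nra.
Qed.

Definition cvg2 (F : nat -> R -> R) f :=
  [/\ forall n, L2 (F n), L2 f & (fun n => sqnorm (fun x => F n x - f x)) @ \oo --> 0].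

Lemma cvg_sqrt0 (u : nat -> R) : u @ \oo --> 0 -> (fun n => Num.sqrt (u n)) @ \oo --> 0.
Proof. by move=> u0; rewrite -[X in _ --> X]sqrtr0; apply: continuous_cvg u0; exact: sqrt_continuous. Qed.

Lemma cvg2_dot (F G : nat -> R -> R) f g : cvg2 F f -> cvg2 G g ->
  (fun n => Int (fun x => F n x * G n x)) @ \oo --> Int (fun x => f x * g x).
Proof.
move=> [LF Lf Ff] [LG Lg Gg].
have H n : `|Int (fun x => F n x * G n x) - Int (fun x => f x * g x)| <=
   Num.sqrt (sqnorm (fun x => F n x - f x)) * Num.sqrt (sqnorm (fun x => G n x - g x)) +
   Num.sqrt (sqnorm f) * Num.sqrt (sqnorm (fun x => G n x - g x)) +
   Num.sqrt (sqnorm (fun x => F n x - f x)) * Num.sqrt (sqnorm g).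
  have Ld1 := L2B (LF n) Lf; have Ld2 := L2B (LG n) Lg.
  rewrite (_ : _ - _ = Int (fun x => (F n x - f x) * (G n x - g x)) +
    Int (fun x => f x * (G n x - g x)) + Int (fun x => (F n x - f x) * g x)); last first.
    have l1 := L2_mul Ld1 Ld2; have l2 := L2_mul Lf Ld2; have l3 := L2_mul Ld1 Lg.
    rewrite -(IntD l1 l2) -(IntD (L1D l1 l2) l3).
    by rewrite -(IntB (L2_mul (LF n) (LG n)) (L2_mul Lf Lg)); apply: eq_Int => x; ring.
  apply: le_trans (ler_normD _ _) _; apply: lerD; last exact: dot_CS.
  by apply: le_trans (ler_normD _ _) _; apply: lerD; exact: dot_CS.
have a0 := cvg_sqrt0 Ff; have b0 := cvg_sqrt0 Gg.
apply: cvgn_squeeze H _.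
rewrite [X in _ --> X](_ : 0 = 0 * 0 + Num.sqrt (sqnorm f) * 0 + 0 * Num.sqrt (sqnorm g)); last by ring.
apply: cvgD; last by apply: cvgM => //; exact: cvg_cst.
by apply: cvgD; apply: cvgM => //; exact: cvg_cst.
Qed.

Lemma cvg2_sqnorm (F : nat -> R -> R) f : cvg2 F f ->
  (fun n => sqnorm (F n)) @ \oo --> sqnorm f.
Proof.
by move=> h; have := cvg2_dot h h.
Qed.

Definition clip c (x : R) : R := Num.max (- c) (Num.min c x).

Lemma clip_norm c x : 0 <= c -> `|clip c x| <= c.
Proof.
by move=> c0; rewrite /clip /Num.max /Num.min ler_norml; case: ifP; case: ifP; lra.
Qed.

Lemma clip_lip c x y : 0 <= c -> `|clip c x - clip c y| <= `|x - y|.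
Proof.
move=> c0; rewrite /clip /Num.max /Num.min ler_norml; apply/andP.
by case: (lerP 0 (x - y)) => h; [rewrite (ger0_norm h)|rewrite (ltr0_norm h)];
  do !case: ifPn; rewrite ?ltNge ?negbK; lra.
Qed.

Lemma clip_id c x : `|x| <= c -> clip c x = x.
Proof.
rewrite ler_norml => /andP[a b]; rewrite /clip /Num.max /Num.min.
by case: ifP; case: ifP; lra.
Qed.

Lemma clip_le c x : 0 <= c -> `|clip c x| <= `|x|.
Proof.
by move=> c0; have := clip_lip x 0 c0; rewrite subr0 (@clip_id c 0) ?subr0// normr0.
Qed.

Lemma clip_continuous c : 0 <= c -> continuous (clip c).
Proof.
move=> c0 x; apply/cvgrPdist_lt => e e0.
near=> y; apply: le_lt_trans (clip_lip _ _ c0) _; near: y.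
by have /cvgrPdist_lt := @cvg_id _ (nbhs x); exact.
Unshelve. all: by end_near. Qed.

Definition box c (x : R) : R := if `|x| <= c then 1 else 0.

Lemma box_in c x : `|x| <= c -> box c x = 1.
Proof. by rewrite /box => ->. Qed.

Lemma box_out c x : c < `|x| -> box c x = 0.
Proof. by rewrite /box ltNge => /negbTE ->. Qed.

Lemma box_itv c : box c = \1_(`[- c, c]%classic).
Proof.
apply/funext => x; rewrite /box indicE; case: ifP => h; symmetry.
  by rewrite mem_set//= in_itv/= -ler_norml h.
by rewrite memNset//= in_itv/= -ler_norml h.
Qed.

Lemma L1_box c : L1 (box c).
Proof.
by rewrite box_itv; exact: integrable_indic_itv.
Qed.

Lemma box_meas c : measurable_fun setT (box c).
Proof. exact: L1_meas (L1_box c). Qed.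

End SquareIntegrable.

(** * Density of compactly supported continuous functions in L^2 *)

Section Density.
Context {R : realType}.
Implicit Types (f g h : R -> R) (c l t : R).
Local Notation mu := (@lebesgue_measure R).

Lemma ler_sqr_norm (x y : R) : `|x| <= `|y| -> x ^+ 2 <= y ^+ 2.
Proof.
move=> h; rewrite -(@real_normK _ x) ?num_real// -(@real_normK _ y) ?num_real//.
by rewrite lerXn2r ?nnegrE.
Qed.

Lemma L1_patch (E : set R) f : measurable E ->
  mu.-integrable E (EFin \o f) <-> L1 (f \_ E).
Proof. by move=> mE; rewrite /L1 -restrict_EFin; exact: integrable_mkcond. Qed.

Lemma Int_patch (E : set R) f : \int[mu]_(x in E) f x = Int (f \_ E).
Proof. exact: Rintegral_mkcond. Qed.

Lemma sqnormB_sym f g : sqnorm (fun x => f x - g x) = sqnorm (fun x => g x - f x).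
Proof. by apply: eq_Int => x; ring. Qed.

Lemma truncate_L2 f (n : nat) : L2 f ->
  L2 (fun x => box n%:R x * clip n%:R (f x)).
Proof.
move=> [mf Lf]; split; last first.
  apply: (L1_le Lf) => [|x].
    apply: measurable_funX; apply: measurable_funM; first exact: box_meas.
    apply: measurableT_comp mf; apply: continuous_measurable_fun.
    exact: clip_continuous.
  rewrite ger0_norm ?sqr_ge0// exprMn.
  have h : clip n%:R (f x) ^+ 2 <= f x ^+ 2 by apply: ler_sqr_norm; exact: clip_le.
  by rewrite /box; case: ifP; rewrite ?expr1n ?mul1r// expr0n mul0r sqr_ge0.
apply: measurable_funM; first exact: box_meas.
apply: measurableT_comp mf; apply: continuous_measurable_fun.
exact: clip_continuous.
Qed.

Lemma near_nat_ge (c : R) : \forall n \near \oo, c <= n%:R.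
Proof.
near=> n; rewrite (le_trans (ler_norm _))// ltW//.
by near: n; exact: nbhs_infty_gtr.
Unshelve. all: by end_near. Qed.

Lemma truncate_cvg2 f : L2 f ->
  cvg2 (fun n x => box n%:R x * clip n%:R (f x)) f.
Proof.
move=> Lf; split => //; first by move=> n; exact: truncate_L2.
rewrite -[X in _ --> X](Int0 (R := R)).
have [_ mL] := Lf.
apply: (@Int_DCT R _ _ (fun x => f x ^+ 2) _ _ _ mL _).2 => //.
- by move=> n; have [m _] := L2B (truncate_L2 n Lf) Lf; exact: measurable_funX.
- apply: aeW => x; apply: cvg_near_cst.
  near=> n; rewrite /box clip_id.
    rewrite ifT ?mul1r ?subrr ?expr0n//.
    by near: n; exact: near_nat_ge.
  by near: n; exact: near_nat_ge.
- move=> n x; rewrite ger0_norm ?sqr_ge0// /box; case: ifP => _; last by rewrite mul0r sub0r sqrrN.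
  rewrite mul1r; have n0 : 0 <= n%:R :> R by [].
  apply: ler_sqr_norm.
  move: (f x) => y; rewrite /clip /Num.max /Num.min.
  have [y0|y0] := lerP 0 y; [rewrite (ger0_norm y0)|rewrite (ltr0_norm y0)];
    rewrite ler_norml; apply/andP; do !case: ifPn; rewrite -?leNgt; lra.
Unshelve. all: by end_near. Qed.

Definition cut c (x : R) : R := Num.max 0 (Num.min 1 (c + 1 - `|x|)).

Lemma cut01 c x : 0 <= cut c x <= 1.
Proof. by rewrite /cut /Num.max /Num.min; do !case: ifPn; rewrite -?leNgt; lra. Qed.

Lemma cut1 c x : `|x| <= c -> cut c x = 1.
Proof. by move=> h; rewrite /cut /Num.max /Num.min; do !case: ifPn; rewrite -?leNgt; lra. Qed.

Lemma cut0 c x : c + 1 <= `|x| -> cut c x = 0.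
Proof. by move=> h; rewrite /cut /Num.max /Num.min; do !case: ifPn; rewrite -?leNgt; lra. Qed.

Lemma cut_continuous c : continuous (cut c).
Proof.
have E : cut c = fun x => Num.max 0 (Num.min 1 (c + 1 - `|x|)) by [].
move=> x; rewrite E; apply: (@continuous_max _ _ (fun=> 0) (fun x => Num.min 1 (c + 1 - `|x|)));
  first exact: cvg_cst.
apply: (@continuous_min _ _ (fun=> 1) (fun x => c + 1 - `|x|)); first exact: cvg_cst.
by apply: cvgB; [exact: cvg_cst|exact: norm_continuous].
Qed.

(** Truncating both the domain and the values reduces to bounded functions on a bounded interval.
    There L^1 approximation by continuous functions suffices, because the square of a bounded
    difference is controlled by its absolute value. *)
Lemma dense_continuous f e : L2 f -> 0 < e -> exists g (N : R),
  [/\ 0 <= N, continuous g, forall x, `|g x| <= N * box N x &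
      sqnorm (fun x => f x - g x) <= e].
Proof.
move=> Lf e0.
have [_ _ /cvgrPdist_lt /(_ (e / 4)) ] := truncate_cvg2 Lf.
have e4 : 0 < e / 4 by rewrite divr_gt0.
move=> /(_ e4) [n _ /(_ n (leqnn n))]; rewrite /= sub0r normrN ger0_norm ?sqnorm_ge0// => he.
have Lft := truncate_L2 n Lf.
set ft := (fun x => box n%:R x * clip n%:R (f x)) in he Lft.
have n0 : 0 <= n%:R :> R by [].
have ftn x : `|ft x| <= n%:R.
  rewrite /ft normrM /box; case: ifP => _; rewrite ?normr0 ?normr1 ?mul0r ?mul1r//.
  exact: clip_norm.
pose E := (`[- (n%:R + 1), n%:R + 1]%classic : set R).
have mE : measurable E by exact: measurable_itv.
have muE : (mu E < +oo)%E.
  by rewrite /E lebesgue_measure_itv/=; case: ifP => // _; rewrite -EFinB ltry.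
have iE : mu.-integrable E (EFin \o ft).
  apply: measurable_bounded_integrable => //; first exact: measurable_funTS Lft.1.
  exists n%:R; split; first exact: num_real.
  by move=> M nM x _ /=; rewrite (le_trans (ftn x))// ltW.
have [g_ [cg ig]] := approximation_continuous_integrable mE muE iE.
move=> cv.
(* Since |ft - g|^2 <= 2 n |ft - g_k|, this L^1 precision makes the squared L^2 error at most e /
   4. *)
have d0 : 0 < e / 8 / (n%:R + 1) by rewrite !divr_gt0// ltr_wpDl.
have /fine_cvgP[hfin /cvgrPdist_lt /(_ _ d0)] := cv.
move=> hd; near \oo => k.
have h1 : (\int[mu]_(z in E) `|(ft z - g_ k z)%:E|)%E \is a fin_num by near: k.
have h2 : fine (\int[mu]_(z in E) `|(ft z - g_ k z)%:E|)%E < e / 8 / (n%:R + 1).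
  rewrite (le_lt_trans (ler_norm _))// -normrN -[X in `|X|]add0r.
  by near: k.
pose g x := cut n%:R x * clip n%:R (g_ k x).
have cg' : continuous g.
  move=> x; apply: cvgM; first exact: cut_continuous.
  by apply: continuous_comp; [exact: cg|exact: clip_continuous].
exists g, (n%:R + 1); split => //.
  move=> x; rewrite /g normrM /box; case: ifPn => hx.
    rewrite mulr1; have /andP[a0 a1] := cut01 n%:R x.
    have := clip_norm (g_ k x) n0; rewrite (ger0_norm a0).
    by set y := `|_|; have y0 : 0 <= y := normr_ge0 _; nra.
  by rewrite cut0 ?normr0 ?mul0r ?mulr0// ltW// ltNge.
have Lg : L2 g.
  apply: (L2_le (g := fun x => n%:R * box (n%:R + 1) x)).
  - split; first by apply: measurable_funM => //; exact: box_meas.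
    apply: eq_L1 (L1Z (n%:R ^+ 2) (L1_box (n%:R + 1))) => x.
    by rewrite exprMn /box; case: ifP; rewrite ?expr1n ?expr0n.
  - exact: continuous_measurable_fun.
  - move=> x; rewrite /g normrM /box; case: ifPn => hx.
      rewrite mulr1; have /andP[a0 a1] := cut01 n%:R x.
      have := clip_norm (g_ k x) n0; rewrite (ger0_norm a0).
      by set y := `|_|; have y0 : 0 <= y := normr_ge0 _; nra.
    by rewrite cut0 ?normr0 ?mul0r ?mulr0// ltW// ltNge.
have Lfft := L2B Lf Lft; have Lfg := L2B Lft Lg.
have -> : sqnorm (fun x => f x - g x) = sqnorm (fun x => (f x - ft x) + (ft x - g x)).
  by apply: eq_Int => x; ring.
apply: le_trans (sqnormD_le Lfft Lfg) _.
rewrite sqnormB_sym.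
suff : sqnorm (fun x => ft x - g x) <= e / 4 by lra.
pose d (x : R) : R := `|ft x - g_ k x|.
have LD : L1 (d \_ E).
  have h1' := (L1_patch ft mE).1 iE; have h2' := (L1_patch (g_ k) mE).1 (ig k).
  apply: eq_L1 (L1_norm (L1B h1' h2')) => x.
  by rewrite !patchE; case: ifP => // _; rewrite subrr normr0.
have ID : Int (d \_ E) < e / 8 / (n%:R + 1) by rewrite -Int_patch.
apply: le_trans (_ : 2 * n%:R * Int (d \_ E) <= _); last first.
  have i0 : 0 <= Int (d \_ E).
    by apply: Int_ge0 => x; rewrite patchE; case: ifP => // _; exact: normr_ge0.
  move: ID; rewrite ltr_pdivlMr ?ltr_wpDl//; nra.
rewrite -IntZ//; apply: Int_le; [exact: Lfg.2|exact: L1Z|] => x.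
rewrite patchE; case: ifPn => [_|]; last first.
  rewrite mem_setE /E /= in_itv/= -ler_norml => hx.
  have -> : g x = 0 by rewrite /g cut0 ?mul0r// ltW// ltNge.
  have -> : ft x = 0.
    by rewrite /ft /box ifF ?mul0r//; apply/negP => h; move/negP: hx; apply; lra.
  by rewrite subrr expr0n/= mulr0.
have -> : ft x - g x = cut n%:R x * (ft x - clip n%:R (g_ k x)).
  rewrite mulrBr; congr (_ - _); rewrite /ft /box; case: ifPn => hx.
    by rewrite cut1// !mul1r.
  by rewrite !mul0r mulr0.
rewrite -(@real_normK _ (_ * _)) ?num_real// normrM.
have /andP[a0 a1] := cut01 n%:R x; rewrite (ger0_norm a0).
have e1 : `|ft x - clip n%:R (g_ k x)| <= d x.
  by rewrite -(clip_id (ftn x)); exact: clip_lip.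
have e2 : `|ft x - clip n%:R (g_ k x)| <= 2 * n%:R.
  rewrite (le_trans (ler_normB _ _))//; have := clip_norm (g_ k x) n0; have := ftn x; lra.
have d0' : 0 <= d x := normr_ge0 _.
move: e1 e2; set y := `|_|; have y0 : 0 <= y := normr_ge0 _.
move=> e1 e2; apply: (@le_trans _ _ (y ^+ 2)); last by rewrite expr2; exact: ler_pM.
by rewrite lerXn2r ?nnegrE ?mulr_ge0// ler_piMl.
Unshelve. all: by end_near. Qed.

End Density.

Lemma cvg_sqr {R : realType} {T : Type} (F : set_system T) {FF : Filter F}
    (u : T -> R) (l : R) : u x @[x --> F] --> l -> u x ^+ 2 @[x --> F] --> l ^+ 2.
Proof. by move=> ul; rewrite expr2; under eq_fun do rewrite expr2; apply: cvgM. Qed.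

(** * Continuity of affine substitutions in L^2 *)

Section L2Continuity.
Context {R : realType}.
Implicit Types (f g h : R -> R) (c l t : R).

(* The maps x |-> l_n x + t_n tend to the identity. *)
Lemma cvg2_affine f (l t : nat -> R) : L2 f -> (forall n, 2^-1 <= l n) ->
  l @ \oo --> (1 : R) -> t @ \oo --> (0 : R) -> cvg2 (fun n x => f (l n * x + t n)) f.
Proof.
move=> Lf l2 l1 t0.
have lp n : 0 < l n by rewrite (lt_le_trans _ (l2 n)).
have ln0 n : l n != 0 by rewrite gt_eqF.
split => //; first by move=> n; exact: L2_affine.
apply/cvgrPdist_le => /= e e0.
(* Each of the three pieces of the splitting costs at most 4 e / 16: the first has factor 2 and
   Jacobian 1 / l <= 2, the other two have factor 4. *)
have [g [N [N0 cg gN dg]]] := @dense_continuous R f (e / 16) Lf ltac:(by rewrite divr_gt0).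
have mg : measurable_fun setT g by exact: continuous_measurable_fun.
have Lg : L2 g.
  apply: (L2_le (g := fun x => N * box N x)) => //.
  split; first by apply: measurable_funM => //; exact: box_meas.
  apply: eq_L1 (L1Z (N ^+ 2) (L1_box N)) => x.
  by rewrite exprMn /box; case: ifP; rewrite ?expr1n ?expr0n.
have [T hT] : exists T, forall n, `|t n| <= T.
  have /cvg_seq_bounded [M [_ hM]] := cvgP _ t0.
  by exists (M + 1) => n; apply: hM => //; rewrite ltrDl.
have T0 : 0 <= T by rewrite (le_trans _ (hT 0%N)).
have cvG : (fun n => sqnorm (fun x => g (l n * x + t n) - g x)) @ \oo --> 0.
  rewrite -[X in _ --> X](Int0 (R := R)).
  (* For |x| > 2 (N + T) and l >= 1/2 the point l x + t is still outside [-N, N], so both values of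
     [g] vanish. *)
  pose B := 2 * (N + T) .
  have LB : L1 (fun x => (2 * N) ^+ 2 * box B x) by exact: L1Z (L1_box _).
  apply: (@Int_DCT R _ _ _ _ _ _ LB _).2 => //.
  - move=> n; apply: measurable_funX; apply: measurable_funB => //.
    exact: measurable_comp_affine.
  - apply: aeW => x; rewrite [X in _ --> X](_ : 0 = (g x - g x) ^+ 2); last by rewrite subrr expr0n.
    have : (fun n => g (l n * x + t n)) @ \oo --> g x.
      rewrite [X in _ --> g X](_ : x = 1 * x + 0); last by rewrite mul1r addr0.
      apply: continuous_cvg; first exact: cg.
      by apply: cvgD => //; apply: cvgM => //; exact: cvg_cst.
    by move=> h; apply: cvg_sqr; apply: cvgB => //; exact: cvg_cst.
  - move=> n x; rewrite ger0_norm ?sqr_ge0// /box; case: ifPn => hx.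
      rewrite mulr1 -[X in _ <= X ^+ 2]ger0_norm ?mulr_ge0//; apply: ler_sqr_norm.
      rewrite [X in _ <= X]ger0_norm ?normr_ge0//.
      rewrite [X in _ <= X]ger0_norm ?mulr_ge0//.
      rewrite (le_trans (ler_normB _ _))//.
      have hb y : `|g y| <= N.
        by rewrite (le_trans (gN y))// /box; case: ifP; rewrite ?mulr1// mulr0.
      have := hb x; have := hb (l n * x + t n); lra.
    have hb y : N < `|y| -> g y = 0.
      move=> Ny; apply/eqP; rewrite -normr_le0 (le_trans (gN y))//.
      by rewrite box_out// mulr0.
    rewrite -ltNge /B in hx.
    rewrite !hb ?subrr ?expr0n ?mulr0//; first by lra.
    have h1 : `|l n * x| <= `|l n * x + t n| + `|t n|.
      by have := ler_normB (l n * x + t n) (t n); rewrite addrK.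
    have h2 : 2^-1 * `|x| <= `|l n * x| by rewrite normrM gtr0_norm// ler_wpM2r.
    have := hT n; lra.
have : \forall n \near \oo, sqnorm (fun x => g (l n * x + t n) - g x) < e / 16.
  have e16 : 0 < e / 16 by rewrite divr_gt0.
  move/cvgrPdist_lt : cvG => /(_ _ e16); apply: filterS => n.
  by rewrite sub0r normrN; exact: le_lt_trans (ler_norm _).
apply: filterS => n hn; rewrite sub0r normrN ger0_norm ?sqnorm_ge0//.
have La := L2_affine (t n) (ln0 n) (L2B Lf Lg).
have Lb := L2B (L2_affine (t n) (ln0 n) Lg) Lg.
have Lc := L2B Lg Lf.
rewrite (_ : sqnorm _ = sqnorm (fun x => (f (l n * x + t n) - g (l n * x + t n)) +
   ((g (l n * x + t n) - g x) + (g x - f x)))); last by apply: eq_Int => x; ring.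
apply: le_trans (sqnormD_le La (L2D Lb Lc)) _.
have := sqnormD_le Lb Lc.
rewrite (sqnorm_affine (f := fun x => f x - g x) (t n) (ln0 n) (L2B Lf Lg)) => h3.
rewrite (sqnormB_sym g f) in h3.
have h4 : `|l n|^-1 * sqnorm (fun x => f x - g x) <= 2 * (e / 16).
  rewrite ler_pM ?invr_ge0 ?sqnorm_ge0// gtr0_norm// -[2]invrK lef_pV2 ?posrE//.
lra.
Qed.

End L2Continuity.

(** * Completeness of L^2 *)

Section L2Complete.
Context {R : realType}.
Implicit Types (f g h : R -> R) (c l t : R).
Local Notation mu := (@lebesgue_measure R).

(** The sum of the series has a finite integral, hence is finite almost everywhere, and each term
    lies below it. *)
Lemma L1_series (h : nat -> R -> R) (a : nat -> R) : (forall n, L1 (h n)) ->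
  (forall n x, 0 <= h n x) -> (forall n, Int (h n) <= a n) ->
  (exists c, forall n, \sum_(0 <= k < n) a k <= c) ->
  {ae mu, forall x, exists c, forall n, h n x <= c}.
Proof.
move=> Lh h0 ha [c hc].
pose S x := (\sum_(0 <= k <oo) (h k x)%:E)%E.
have mh n : measurable_fun setT (fun x => (h n x)%:E) by exact: (measurable_EFin (L1_meas (Lh n))).
have iS : mu.-integrable setT S.
  have mS : measurable_fun [set: R] S.
    by apply: ge0_emeasurable_sum => // n x _ _; rewrite lee_fin.
  apply/integrableP; split; first exact: mS.
  under eq_integral => x _.
    rewrite gee0_abs; last by apply: nneseries_ge0 => n _ _; rewrite lee_fin.
    over.
  rewrite integral_nneseries//; last by move=> n x _; rewrite lee_fin.
  apply: le_lt_trans (_ : (c%:E < +oo)%E); last exact: ltry.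
  apply: lime_le; first by apply: is_cvg_nneseries => n _ _; apply: integral_ge0 => x _; rewrite lee_fin.
  apply: nearW => n.
  under eq_bigr do rewrite EFin_Int//.
  rewrite sumEFin lee_fin; apply: le_trans (hc n).
  by apply: ler_sum.
have [N [mN N0 sN]] := integrable_ae measurableT iS.
exists N; split => // x /= hx; apply: sN => /= hfin; apply: hx.
have {}hfin := hfin I.
exists (fine (S x)) => n; rewrite -lee_fin fineK//.
apply: le_trans (nneseries_lim_ge n.+1 _) => //; last by move=> k _ _; rewrite lee_fin.
rewrite big_nat_recr//= leeDr// sume_ge0// => k _; by rewrite lee_fin.
Qed.

(** The Riesz-Fischer argument: a fast subsequence has geometrically small increments almost
    everywhere, so it converges pointwise, and Fatou's lemma turns the pointwise limit into an L^2
    limit. *)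
Lemma L2_complete (F : nat -> R -> R) : (forall n, L2 (F n)) ->
  (forall e, 0 < e -> exists N, forall m n, (N <= m)%N -> (N <= n)%N ->
     sqnorm (fun x => F m x - F n x) <= e) ->
  exists f, cvg2 F f.
Proof.
move=> LF CF.
have /choice [k hk] : forall j : nat, exists N, forall m n, (N <= m)%N -> (N <= n)%N ->
     sqnorm (fun x => F m x - F n x) <= (8^-1) ^+ j.
  by move=> j; apply: CF; rewrite exprn_gt0.
(* A nondecreasing index that dominates both [k j] and [j]. *)
pose K j := (\sum_(i < j.+1) (k i).+1)%N.
have kK j : (k j <= K j)%N by rewrite /K big_ord_recr/= (leq_trans (leqnSn _))// leq_addl.
have KK j : (K j <= K j.+1)%N by rewrite /K [X in (_ <= X)%N]big_ord_recr/= leq_addr.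
have jK i j : (i <= j)%N -> (K i <= K j)%N.
  by elim: j => [|j IH]; [rewrite leqn0 => /eqP ->|rewrite leq_eqVlt => /orP[/eqP ->//|/IH h]; exact: leq_trans h (KK j)].
(* The weight 4^j is played against the bound 8^-j on squared increments: the integrals are
   summable, and a bound c on all [h j x] gives increments of at most sqrt c / 2^j. *)
pose h j x := 4 ^+ j * (F (K j.+1) x - F (K j) x) ^+ 2.
have Ld m n := L2B (LF m) (LF n).
have := @L1_series h (fun j => 2^-1 ^+ j) _ _ _ _.
case.
- by move=> j; apply: L1Z; exact: (Ld _ _).2.
- by move=> j x; rewrite mulr_ge0 ?sqr_ge0 ?exprn_ge0.
- move=> j; rewrite IntZ ?(Ld _ _).2//.
  have := hk j (K j.+1) (K j) (leq_trans (kK j) (KK j)) (kK j) => e.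
  apply: (@le_trans _ _ (4 ^+ j * 8^-1 ^+ j)); first by rewrite ler_pM2l ?exprn_gt0.
  rewrite -exprMn; have -> : 4 * 8^-1 = 2^-1 :> R by field.
  by [].
- exists 2 => n; elim: n => [|n IH]; first by rewrite big_geq.
  have : forall n, \sum_(0 <= k0 < n) 2^-1 ^+ k0 = 2 - 2 * 2^-1 ^+ n :> R.
    elim=> [|m IHm]; first by rewrite big_geq// expr0 mulr1 subrr.
    by rewrite big_nat_recr//= IHm exprS; field.
  by move=> ->; rewrite gerBl mulr_ge0// exprn_ge0.
move=> Z [mZ Z0 sZ].
have good (x : R) : ~ Z x -> cvgn (fun j => F (K j) x).
  move=> nZ; have [c hc] : exists c, forall n, h n x <= c.
    by apply: contrapT => nc; apply: nZ; exact: sZ.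
  have c0 : 0 <= c by apply: le_trans (hc 0%N); rewrite mulr_ge0 ?sqr_ge0 ?exprn_ge0.
  have d j : `|F (K j.+1) x - F (K j) x| <= Num.sqrt c * 2^-1 ^+ j.
    rewrite -(@ler_pXn2r _ 2) ?nnegrE ?mulr_ge0 ?sqrtr_ge0 ?exprn_ge0//.
    rewrite real_normK ?num_real// exprMn sqr_sqrtr// -exprM mulnC exprM.
    have -> : (2^-1 ^+ 2) = 4^-1 :> R by field.
    by rewrite exprVn ler_pdivlMr ?exprn_gt0// mulrC; exact: hc.
  have d2 i m : `|F (K (i + m)%N) x - F (K i) x| <= Num.sqrt c * 2^-1 ^+ i * (2 - 2 * 2^-1 ^+ m).
    elim: m => [|m IH]; first by rewrite addn0 subrr normr0 expr0 mulr1 subrr mulr0.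
    rewrite addnS -(subrKA (F (K (i + m)%N) x)) (le_trans (ler_normD _ _))//.
    have := d (i + m)%N; rewrite exprD exprS => dm.
    by apply: le_trans (lerD dm IH) _; rewrite le_eqVlt; apply/orP; left; apply/eqP; field.
  apply/cauchy_cvgP/cauchy_exP => e e0.
  have : (fun i => Num.sqrt c * 2^-1 ^+ i * 2) @ \oo --> (0 : R).
    rewrite [X in _ --> X](_ : 0 = Num.sqrt c * 0 * 2); last by rewrite mulr0 mul0r.
    apply: cvgM; last exact: cvg_cst; apply: cvgM; first exact: cvg_cst.
    by apply: cvg_expr; rewrite ger0_norm// invf_lt1// ltr1n.
  move=> /cvgrPdist_lt/(_ _ e0)[i _ /(_ i (leqnn i))]; rewrite /= sub0r normrN => hi.
  exists (F (K i) x), i => // j /= ij; rewrite -ball_normE /= distrC.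
  rewrite -(subnKC ij); apply: le_lt_trans (d2 i _) _; apply: le_lt_trans hi.
  apply: le_trans (ler_norm _); rewrite ler_wpM2l ?mulr_ge0 ?sqrtr_ge0 ?exprn_ge0//.
  by rewrite gerBl mulr_ge0 ?exprn_ge0.
(* Setting the functions to zero on the null set makes them converge everywhere, so that the limit
   is measurable. *)
pose G j : R -> R := F (K j) \_ (~` Z : set R).
pose f (x : R) : R := limn (fun j => G j x).
have mZ' : measurable (~` Z : set R) by exact: measurableC.
have Gf (x : R) : (fun j => G j x) @ \oo --> f x.
  rewrite /f; have [zx|zx] := pselect (Z x).
    have -> : (fun j => G j x) = fun=> 0.
      by apply/funext => j; rewrite /G patchE memNset//= => /(_ zx).
    by rewrite lim_cst//; exact: cvg_cst.
  have -> : (fun j => G j x) = fun j => F (K j) x.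
    by apply/funext => j; rewrite /G patchE mem_set.
  exact: good.
have mG j : measurable_fun [set: R] (G j).
  by apply/(measurable_restrictT _ mZ'); apply: measurable_funTS; exact: (LF _).1.
have mf : measurable_fun [set: R] f.
  by apply: (@measurable_fun_cvg _ _ _ _ G) => // x _; exact: Gf.
have Gae m j : L1 (fun x => (F m x - G j x) ^+ 2) /\
    Int (fun x => (F m x - F (K j) x) ^+ 2) = Int (fun x => (F m x - G j x) ^+ 2).
  apply: L1_ae; last exact: (Ld _ _).2.
    by apply: measurable_funX; apply: measurable_funB => //; exact: (LF _).1.
  exists Z; split => // x /= hx; apply: contrapT => nZ; apply: hx.
  by rewrite /G patchE mem_set.
(* Fatou in the second index, with the first one fixed, passes from the subsequence to the whole
   sequence. *)
have key e : 0 < e -> exists N, forall m, (N <= m)%N ->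
   L1 (fun x => (F m x - f x) ^+ 2) /\ Int (fun x => (F m x - f x) ^+ 2) <= e.
  move=> e0; have [N hN] := CF e e0; exists N => m Nm.
  apply: (@Int_Fatou R (fun j x => (F m x - G (j + N)%N x) ^+ 2)).
  - by move=> j; exact: (Gae _ _).1.
  - by move=> j x; exact: sqr_ge0.
  - move=> x.
    have h2 : (fun j => (F m x - G j x) ^+ 2) @ \oo --> (F m x - f x) ^+ 2.
      by apply: cvg_sqr; apply: cvgB; [exact: cvg_cst|exact: Gf].
    by move: h2; rewrite -(cvg_shiftn N).
  - move=> j; rewrite -(Gae _ _).2; apply: hN => //.
    have jKj n : (n <= K n)%N.
      elim: n => // n IH; rewrite /K big_ord_recr/= addnS ltnS.
      by rewrite (leq_trans IH)// /K leq_addr.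
    by rewrite (leq_trans _ (jKj _))// leq_addl.
have L2f : L2 f.
  have [N /(_ N (leqnn N))[hL _]] := key 1 ltr01.
  have : L2 (fun x => F N x - (F N x - f x)).
    apply: L2B => //; split => //; apply: measurable_funB => //; exact: (LF _).1.
  by apply: eq_L2 => x; ring.
exists f; split => //; apply/cvgrPdist_le => e e0.
have [N hN] := key e e0; exists N => // m /= Nm.
by rewrite sub0r normrN ger0_norm ?sqnorm_ge0//; exact: (hN m Nm).2.
Qed.
End L2Complete.

(** * The fundamental theorem of calculus with singular end points *)

Section FTC.
Context {R : realType}.
Implicit Types (f g G : R -> R) (a b c : R).
Local Notation mu := (@lebesgue_measure R).

Lemma FTC_closed a b G g : a < b ->
  (forall x, a <= x <= b -> is_derive x 1 G (g x)) ->
  (forall x, a <= x <= b -> {for x, continuous g}) ->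
  \int[mu]_(x in `[a, b]) g x = G b - G a.
Proof.
move=> ab dG cg.
have cG x : a <= x <= b -> {for x, continuous G}.
  move=> hx; apply: differentiable_continuous; apply/derivable1_diffP.
  by have [] := dG x hx.
rewrite /Rintegral (@continuous_FTC2 R g G a b ab)//.
- apply: continuous_in_subspaceT => x; rewrite inE/= in_itv/= => hx; exact: cg.
- split.
  + move=> x; rewrite in_itv/= => /andP[ax xb].
    by have [] := dG x ltac:(by rewrite !ltW).
  + by apply: cvg_at_right_filter; apply: cG; rewrite lexx ltW.
  + by apply: cvg_at_left_filter; apply: cG; rewrite lexx ltW.
- move=> x; rewrite in_itv/= => /andP[ax xb].
  by rewrite derive1E; have [_ ->] := dG x ltac:(by rewrite !ltW).
Qed.

Lemma patch_cvg_mono (E : nat -> set R) (D : set R) g x :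
  (forall n, E n `<=` D) -> (D x -> \forall n \near \oo, E n x) ->
  (fun n => (g \_ (E n)) x) @ \oo --> (g \_ D) x.
Proof.
move=> ED DE; have [Dx|nDx] := pselect (D x).
  apply: cvg_near_cst; have := DE Dx; apply: filterS => n Ex.
  by rewrite !patchE !mem_set.
have -> : (g \_ D) x = 0 by rewrite patchE memNset.
have -> : (fun n => (g \_ (E n)) x) = fun=> 0.
  by apply/funext => n; rewrite patchE memNset// => /ED.
exact: cvg_cst.
Qed.

Lemma Int_exhaust (E : nat -> set R) (D : set R) g : (forall n, measurable (E n)) ->
  measurable D -> (forall n, E n `<=` D) ->
  (forall x, D x -> \forall n \near \oo, E n x) -> L1 (g \_ D) ->
  (fun n => Int (g \_ (E n))) @ \oo --> Int (g \_ D).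
Proof.
move=> mE mD ED DE Lg; have mg := L1_meas Lg.
have eq n : g \_ (E n) = (g \_ D) \_ (E n).
  apply/funext => x; rewrite !patchE; case: ifPn => // xE.
  by rewrite mem_set//; apply: ED; rewrite inE in xE; exact: xE.
apply: (@Int_DCT R _ _ (fun x => `|(g \_ D) x|) _ _ _ (L1_norm Lg) _).2 => //.
- by move=> n; rewrite eq; apply/(measurable_restrictT _ (mE n)); exact: measurable_funTS.
- by apply: aeW => x; apply: patch_cvg_mono => //; exact: DE.
- by move=> n x; rewrite eq patchE; case: ifP => // _; rewrite normr0.
Qed.

Lemma near_inv_lt (e : R) : 0 < e -> \forall n \near \oo, n.+1%:R^-1 < e.
Proof.
move=> e0; near=> n; rewrite invf_plt ?posrE//.
apply: lt_le_trans (_ : n%:R <= _); last by rewrite ler_nat.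
by near: n; exact: nbhs_infty_gtr.
Unshelve. all: by end_near. Qed.

Lemma cvg_invS : (fun n => n.+1%:R^-1 : R) @ \oo --> (0 : R).
Proof.
apply/cvgrPdist_lt => e e0; have := near_inv_lt e0; apply: filterS => n.
by rewrite sub0r normrN ger0_norm// invr_ge0.
Qed.

(** [g] may blow up at both end points, as the derivative of a square root does: the classical
    theorem is applied on inner compact intervals that exhaust (a, b). *)
Lemma FTC_open a b G g : a < b ->
  G x @[x --> a^'+] --> G a -> G x @[x --> b^'-] --> G b ->
  (forall x, a < x < b -> is_derive x 1 G (g x)) ->
  (forall x, a < x < b -> {for x, continuous g}) ->
  L1 (g \_ `]a, b[) -> Int (g \_ `]a, b[) = G b - G a.
Proof.
move=> ab Ga Gb dG cg Lg.
(* At most a third of the length, which keeps the inner intervals nondegenerate. *)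
pose d n := (b - a) / 3 * n.+1%:R^-1 : R.
have d0 n : 0 < d n by rewrite mulr_gt0 ?invr_gt0// divr_gt0// subr_gt0.
have d3 n : d n <= (b - a) / 3.
  rewrite /d ler_piMr//; first by rewrite divr_ge0// subr_ge0 ltW.
  by rewrite invf_le1// ler1n.
have dc : d @ \oo --> (0 : R).
  rewrite [X in _ --> X](_ : 0 = (b - a) / 3 * 0); last by rewrite mulr0.
  by apply: cvgM; [exact: cvg_cst|exact: cvg_invS].
have H n : Int (g \_ `[a + d n, b - d n]) = G (b - d n) - G (a + d n).
  have := d0 n; have := d3 n => h1 h2.
  rewrite -Int_patch; apply: FTC_closed; first lra.
  - by move=> x /andP[x1 x2]; apply: dG; lra.
  - by move=> x /andP[x1 x2]; apply: cg; lra.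
have c1 : (fun n => Int (g \_ `[a + d n, b - d n])) @ \oo --> Int (g \_ `]a, b[).
  apply: Int_exhaust => //.
  - move=> n x /=; rewrite !in_itv/= => /andP[]; have := d0 n; lra.
  - move=> x /=; rewrite in_itv/= => /andP[ax xb].
    have e0 : 0 < Num.min (x - a) (b - x) by rewrite lt_min !subr_gt0 ax.
    move/cvgrPdist_lt : dc => /(_ _ e0); apply: filterS => n.
    rewrite sub0r normrN gtr0_norm// lt_min in_itv/= => /andP[]; lra.
have c2 : (fun n => Int (g \_ `[a + d n, b - d n])) @ \oo --> G b - G a.
  under eq_fun do rewrite H.
  apply: cvgB.
    move/cvg_at_leftP : Gb; apply; split; first by move=> n; rewrite ltrBlDr ltrDl.
    by rewrite -[X in _ --> X]subr0; apply: cvgB => //; exact: cvg_cst.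
  move/cvg_at_rightP : Ga; apply; split; first by move=> n; rewrite ltrDl.
  by rewrite -[X in _ --> X]addr0; apply: cvgD => //; exact: cvg_cst.
by rewrite -(cvg_lim _ c1)// -(cvg_lim _ c2).
Qed.

(** The bound on the primitive bounds all integrals over compact subintervals by 2 M, and
    [Int_Fatou] does the rest. A bounded primitive thus replaces any estimate of [g] near [a] or at
    infinity. *)
Lemma L1_halfline a G g (M : R) : (forall x, a < x -> 0 <= g x) ->
  (forall x, a < x -> is_derive x 1 G (g x)) ->
  (forall x, a < x -> {for x, continuous g}) ->
  (forall x, a < x -> `|G x| <= M) ->
  L1 (g \_ `]a, +oo[).
Proof.
move=> g0 dG cg GM.
pose E n : set R := `[a + n.+1%:R^-1, a + n.+2%:R].
have n1 n : n.+1%:R^-1 < n.+2%:R :> R.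
  by rewrite (@le_lt_trans _ _ 1)// ?ltr1n// invf_le1// ler1n.
have p n : 0 < n.+1%:R^-1 :> R by rewrite invr_gt0.
have Ea n x : E n x -> a < x.
  by rewrite /E/= in_itv/= => /andP[h _]; apply: lt_le_trans h; rewrite ltrDl.
have DE x : a < x -> \forall n \near \oo, E n x.
  move=> ax; near=> n; rewrite /E/= in_itv/=; apply/andP; split.
    rewrite -lerBrDl ltW//; near: n; apply: near_inv_lt; by rewrite subr_gt0.
  rewrite -lerBlDl (@le_trans _ _ n%:R)// ?ler_nat//; last by rewrite ltnW.
  by near: n; exact: near_nat_ge.
have LE n : L1 (g \_ (E n)).
  apply: (L1_patch g (measurable_itv _)).1.
  apply: continuous_compact_integrable; first exact: segment_compact.
  by apply: continuous_in_subspaceT => x; rewrite inE => /Ea; exact: cg.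
have [] : L1 (g \_ `]a, +oo[) /\ Int (g \_ `]a, +oo[) <= 2 * M; last by [].
apply: (@Int_Fatou R (fun n => g \_ (E n))) => //.
- by move=> n x; rewrite patchE; case: ifP => // /set_mem /Ea; exact: g0.
- move=> x; apply: patch_cvg_mono.
    by move=> n y /Ea; rewrite /= in_itv/= andbT.
  by rewrite /= in_itv/= andbT; exact: DE.
- move=> n; have -> : Int (g \_ (E n)) = G (a + n.+2%:R) - G (a + n.+1%:R^-1).
    rewrite -Int_patch; apply: FTC_closed; first by rewrite ltrD2l.
      by move=> x h; apply: dG; apply: (Ea n); rewrite /E/= in_itv.
    by move=> x h; apply: cg; apply: (Ea n); rewrite /E/= in_itv.
  have h1 := GM (a + n.+2%:R) ltac:(by rewrite ltrDl).
  have h2 := GM (a + n.+1%:R^-1) ltac:(by rewrite ltrDl).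
  rewrite (le_trans (ler_norm _))// (le_trans (ler_normB _ _))//; lra.
Unshelve. all: by end_near. Qed.

Lemma FTC_halfline a G g l : G x @[x --> a^'+] --> G a ->
  (forall x, a < x -> is_derive x 1 G (g x)) ->
  (forall x, a < x -> {for x, continuous g}) ->
  (fun n => G (a + n.+1%:R)) @ \oo --> l ->
  L1 (g \_ `]a, +oo[) -> Int (g \_ `]a, +oo[) = l - G a.
Proof.
move=> Ga dG cg Gl Lg.
have c1 : (fun n => Int (g \_ `]a, a + n.+1%:R[)) @ \oo --> Int (g \_ `]a, +oo[).
  apply: Int_exhaust => //.
  - by move=> n x /=; rewrite !in_itv/= andbT => /andP[].
  - move=> x /=; rewrite in_itv/= andbT => ax; near=> n.
    rewrite /= in_itv/= ax/= -ltrBlDl (@lt_le_trans _ _ n%:R)// ?ler_nat//.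
    by near: n; exact: nbhs_infty_gtr.
have c2 : (fun n => Int (g \_ `]a, a + n.+1%:R[)) @ \oo --> l - G a.
  rewrite (_ : (fun n => _) = fun n => G (a + n.+1%:R) - G a); last first.
    apply/funext => n; apply: FTC_open => //; rewrite ?ltrDl//.
    - apply: cvg_at_left_filter.
      apply: differentiable_continuous; apply/derivable1_diffP.
      by have [] := dG (a + n.+1%:R) ltac:(by rewrite ltrDl).
    - by move=> x /andP[ax _]; exact: dG.
    - by move=> x /andP[ax _]; exact: cg.
    - apply: (L1_le (L1_norm Lg)).
        apply/(measurable_restrictT _ (measurable_itv _)).
        have := L1_meas Lg; move/(measurable_restrictT _ (measurable_itv _)).
        by apply: measurable_funS => //= x /=; rewrite !in_itv/= andbT => /andP[].
      move=> x; rewrite !patchE; case: ifPn => [|_]; last by rewrite normr0.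
      rewrite inE/= in_itv/= => /andP[ax _].
      by rewrite ifT// inE/= in_itv/= ax.
  by apply: cvgB => //; exact: cvg_cst.
by rewrite -(cvg_lim _ c1)// -(cvg_lim _ c2).
Unshelve. all: by end_near. Qed.

End FTC.

(** * The Hartley transform and Plancherel's identity *)

Section Hartley.
Context {R : realType}.
Implicit Types (f g h k : R -> R) (a b c e t x : R).

Definition ct f (xi : R) := Int (fun x => f x * cos (x * xi)).
Definition st f (xi : R) := Int (fun x => f x * sin (x * xi)).

(* The Hartley transform is symmetric and, up to the factor 2 pi, involutive;
   it encodes the Fourier transform A + iB of a real function as A - B. *)
Definition cas (t : R) : R := cos t + sin t.
Definition hart f (xi : R) := Int (fun x => f x * cas (x * xi)).

Lemma measurable_cos : measurable_fun setT (@cos R).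
Proof. apply: continuous_measurable_fun; exact: continuous_cos. Qed.

Lemma measurable_sin : measurable_fun setT (@sin R).
Proof. apply: continuous_measurable_fun; exact: continuous_sin. Qed.

Lemma norm_cos x : `|cos x : R| <= 1.
Proof. by rewrite ler_norml cos_le1 cos_geN1. Qed.

Lemma norm_sin x : `|sin x : R| <= 1.
Proof. by rewrite ler_norml sin_le1 sin_geN1. Qed.

Lemma norm_cas x : `|cas x| <= 2.
Proof.
by rewrite (le_trans (ler_normD _ _))//; have := norm_cos x; have := norm_sin x; lra.
Qed.

Lemma measurable_cas : measurable_fun setT cas.
Proof. by apply: measurable_funD; [exact: measurable_cos|exact: measurable_sin]. Qed.

Lemma L1M_bounded f g c : L1 f -> measurable_fun setT g -> (forall x, `|g x| <= c) ->
  L1 (fun x => f x * g x).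
Proof.
move=> Lf mg gc; have mf := L1_meas Lf.
apply: (L1_le (L1Z c (L1_norm Lf))); first exact: measurable_funM.
by move=> x; rewrite normrM mulrC ler_wpM2r.
Qed.

Lemma measurable_mul_r (xi : R) : measurable_fun setT (fun x : R => x * xi).
Proof. by apply: measurable_funM. Qed.

Lemma L1_cos f xi : L1 f -> L1 (fun x => f x * cos (x * xi)).
Proof.
move=> Lf; apply: (L1M_bounded (c := 1) Lf) => [|x]; last exact: norm_cos.
exact: (measurableT_comp measurable_cos (measurable_mul_r xi)).
Qed.

Lemma L1_sin f xi : L1 f -> L1 (fun x => f x * sin (x * xi)).
Proof.
move=> Lf; apply: (L1M_bounded (c := 1) Lf) => [|x]; last exact: norm_sin.
exact: (measurableT_comp measurable_sin (measurable_mul_r xi)).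
Qed.

Lemma hartE f xi : L1 f -> hart f xi = ct f xi + st f xi.
Proof.
move=> Lf; rewrite /hart /ct /st -IntD; [|exact: L1_cos|exact: L1_sin].
by apply: eq_Int => x; rewrite mulrDr.
Qed.

Lemma ctN f xi : ct f (- xi) = ct f xi.
Proof. by apply: eq_Int => x; rewrite mulrN cosN. Qed.

Lemma stN f xi : L1 f -> st f (- xi) = - st f xi.
Proof.
move=> Lf; rewrite /st -IntN; last exact: L1_sin.
by apply: eq_Int => x; rewrite mulrN sinN mulrN.
Qed.

Lemma L1_cas f xi : L1 f -> L1 (fun x => f x * cas (x * xi)).
Proof.
move=> Lf; apply: (L1M_bounded (c := 2) Lf) => [|x]; last exact: norm_cas.
exact: (measurableT_comp measurable_cas (measurable_mul_r xi)).
Qed.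

Lemma hart_norm f xi : L1 f -> `|hart f xi| <= 2 * Int (fun x => `|f x|).
Proof.
move=> Lf; apply: le_trans (Int_norm _) _; first exact: L1_cas.
rewrite -IntZ; last exact: L1_norm.
apply: Int_le; [by apply: L1_norm; exact: L1_cas|by apply: L1Z; exact: L1_norm|].
by move=> x; rewrite normrM mulrC ler_wpM2r// norm_cas.
Qed.

Lemma hart_mul f k : L1 f -> L1 k ->
  L1 (fun x => k x * hart f x) /\
  Int (fun x => f x * hart k x) = Int (fun x => k x * hart f x).
Proof.
move=> Lf Lk.
have mK : measurable_fun setT (fun z : R * R => cas (z.2 * z.1)).
  apply: measurableT_comp; first exact: measurable_cas.
  by apply: measurable_funM; [exact: measurable_snd|exact: measurable_fst].
have [_ L ->] := Int_Fubini_prod Lf Lk mK (fun z => norm_cas _).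
have E y : Int (fun x : R => f x * cas ((x, y).2 * (x, y).1)) = hart f y.
  by apply: eq_Int => x /=; rewrite (mulrC x).
by split; [apply: eq_L1 L => y; rewrite E|apply: eq_Int => y; rewrite E].
Qed.

(** Abel's convergence factor. Its cosine transform is a Poisson kernel ([ct_damp]), and it makes
    products with bounded transforms integrable. *)
Definition damp (e x : R) : R := expR (- e * `|x|).

Lemma damp_continuous e : continuous (damp e).
Proof.
move=> x; apply: continuous_comp; last exact: continuous_expR.
by apply: cvgM; [exact: cvg_cst|exact: norm_continuous].
Qed.

Lemma damp_ge0 e x : 0 <= damp e x. Proof. exact: expR_ge0. Qed.

Lemma damp_le1 e x : 0 <= e -> damp e x <= 1.
Proof. by move=> e0; rewrite /damp -expR0 ler_expR mulNr oppr_le0 mulr_ge0. Qed.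

Lemma L1_even f : measurable_fun setT f -> (forall x, f (- x) = f x) ->
  L1 (f \_ `]0, +oo[) -> L1 f /\ Int f = 2 * Int (f \_ `]0, +oo[).
Proof.
move=> mf fe Lp; have Lm := L1_opp Lp.
have [|LL II] := @L1_ae R (fun x => (f \_ `]0, +oo[) x + (f \_ `]0, +oo[) (- x)) f mf _ (L1D Lp Lm).
  exists [set 0]; split => //; first by rewrite lebesgue_measure_set1.
  move=> x /= h; apply: contrapT => x0; apply: h.
  rewrite !patchE; have [lx|lx|x0'] := ltgtP 0 x; last by rewrite -x0' in x0.
    by rewrite mem_set ?memNset ?addr0//= in_itv/= andbT// ltNge oppr_le0 ltW.
  by rewrite memNset ?mem_set ?add0r//= in_itv/= andbT ?oppr_gt0// ltNge ltW.
by split => //; rewrite -II IntD// Int_opp//; ring.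
Qed.

Lemma damp_pos e x : 0 < x -> damp e x = expR (- e * x).
Proof. by move=> x0; rewrite /damp gtr0_norm. Qed.

Lemma L1_exp_halfline e : 0 < e -> L1 ((fun x : R => expR (- e * x)) \_ `]0, +oo[).
Proof.
move=> e0; have ? : e != 0 by rewrite gt_eqF.
apply: (@L1_halfline _ _ (fun x => - e^-1 * expR (- e * x)) _ e^-1).
- by move=> x _; exact: expR_ge0.
- by move=> x _; isd; field.
- by move=> x _; isd_cont.
- move=> x x0; rewrite normrM normrN (ger0_norm (expR_ge0 _)) gtr0_norm ?invr_gt0//.
  by rewrite ler_piMr ?invr_ge0 1?ltW// -expR0 ltr_expR mulNr oppr_lt0 mulr_gt0.
Qed.

Lemma L1_damp e : 0 < e -> L1 (damp e).
Proof.
move=> e0; have L : L1 (damp e \_ `]0, +oo[).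
  apply: eq_L1 (L1_exp_halfline e0) => x; rewrite !patchE; case: ifPn => //.
  by rewrite inE/= in_itv/= andbT => /damp_pos ->.
apply: (L1_even _ _ L).1.
  by apply: continuous_measurable_fun; exact: damp_continuous.
by move=> x; rewrite /damp normrN.
Qed.

Lemma ct_damp e t : 0 < e -> ct (damp e) t = 2 * e / (e ^+ 2 + t ^+ 2).
Proof.
move=> e0; have L := L1_cos t (L1_damp e0).
have d0 : e ^+ 2 + t ^+ 2 != 0 by rewrite gt_eqF// ltr_wpDr ?sqr_ge0// exprn_gt0.
pose g (x : R) : R := expR (- e * x) * cos (x * t).
(* The real part of e^((-e + i t) x) / (-e + i t), a primitive of [g]. *)
pose G (x : R) : R := (e ^+ 2 + t ^+ 2)^-1 * (expR (- e * x) * (t * sin (x * t) - e * cos (x * t))).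
have Eg : (fun x => damp e x * cos (x * t)) \_ `]0, +oo[ = g \_ `]0, +oo[.
  apply/funext => x; rewrite !patchE; case: ifPn => //.
  by rewrite inE/= in_itv/= andbT => /damp_pos ->.
have Lg : L1 (g \_ `]0, +oo[).
  rewrite -Eg; apply: (L1_patch _ (measurable_itv _)).1.
  by apply: integrableS L.
rewrite /ct; have [|//|_ ->] := @L1_even (fun x => damp e x * cos (x * t)) (L1_meas L); last first.
- rewrite Eg; have -> : Int (g \_ `]0, +oo[) = 0 - G 0; last first.
    by rewrite /G mulr0 mul0r expR0 sin0 cos0; field.
  apply: FTC_halfline.
  + have cG x : {for x, continuous G} by rewrite /G; isd_cont.
    by apply: cvg_at_right_filter; exact: cG.
  + by move=> x _; rewrite /G /g; isd; field.
  + by move=> x _; rewrite /g; isd_cont.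
  + under eq_fun do rewrite add0r.
    apply: (@cvgn_squeeze _ _ (fun n => (e ^+ 2 + t ^+ 2)^-1 * ((`|t| + e) * (e^-1 * n.+1%:R^-1)))).
      move=> n; rewrite subr0 /G normrM ger0_norm ?invr_ge0 ?addr_ge0 ?sqr_ge0//.
      rewrite ler_wpM2l ?invr_ge0 ?addr_ge0 ?sqr_ge0// normrM mulrC ler_pM//.
        rewrite (le_trans (ler_normB _ _))// !normrM (gtr0_norm e0) lerD//.
          by rewrite ler_piMr// norm_sin.
        by rewrite ler_piMr ?norm_cos// ltW.
      rewrite ger0_norm ?expR_ge0// mulNr expRN -invfM lef_pV2 ?posrE ?expR_gt0 ?mulr_gt0//.
      by apply: le_trans (expR_ge1Dx _); rewrite lerDr.
    rewrite [X in _ --> X](_ : 0 = (e ^+ 2 + t ^+ 2)^-1 * ((`|t| + e) * (e^-1 * 0))); last by rewrite !mulr0.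
    do 3 (apply: cvgM; first exact: cvg_cst); exact: cvg_invS.
  + by [].
- by rewrite Eg.
- by move=> x; rewrite /damp normrN (mulNr x t) cosN.
Qed.

Lemma st_even f t : L1 f -> (forall x, f (- x) = f x) -> st f t = 0.
Proof.
move=> Lf fe; have := Int_opp (L1_sin t Lf).
have -> : Int (fun x => f (- x) * sin (- x * t)) = - st f t.
  rewrite -IntN; last exact: L1_sin.
  by apply: eq_Int => x; rewrite fe mulNr sinN mulrN.
by rewrite /st; set y := Int _; lra.
Qed.

(** Measurability is read off Fubini's theorem: [hart f] times the positive function [damp 1] is
    integrable by [hart_mul], and the factor is divided out. *)
Lemma hart_measurable f : L1 f -> measurable_fun setT (hart f).
Proof.
move=> Lf; have [L _] := hart_mul Lf (L1_damp ltr01).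
have -> : hart f = fun x => expR `|x| * (damp 1 x * hart f x).
  by apply/funext => x; rewrite /damp mulrA -expRD mulN1r subrr expR0 mul1r.
apply: measurable_funM; last exact: L1_meas L.
by apply: measurableT_comp => //; exact: measurable_expR.
Qed.

End Hartley.

(** * Plancherel's identity by Poisson regularisation *)

Section Plancherel.
Context {R : realType}.
Implicit Types (f g h k : R -> R) (a b c e t x : R).

(** The Poisson kernel at scale one, normalised to total mass 2 pi. *)
Definition cauchyw (t : R) : R := 2 / (1 + t ^+ 2).

Lemma onesq_gt0 t : 0 < 1 + t ^+ 2.
Proof. by rewrite ltr_wpDr ?sqr_ge0. Qed.

Lemma cauchyw_continuous : continuous cauchyw.
Proof.
move=> t; rewrite /cauchyw; isd_cont.
by rewrite gt_eqF ?onesq_gt0.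
Qed.

Lemma cauchyw_ge0 t : 0 <= cauchyw t.
Proof. by rewrite divr_ge0// ltW// onesq_gt0. Qed.

Lemma cauchyw_le2 t : cauchyw t <= 2.
Proof. by rewrite ler_pdivrMr ?onesq_gt0// mulrDr mulr1 lerDl mulr_ge0 ?sqr_ge0. Qed.

Lemma cauchyw_int : L1 cauchyw /\ Int cauchyw = 2 * pi.
Proof.
have da x : is_derive x 1 (fun x : R => 2 * atan x) (cauchyw x).
  have h : is_derive x 1 (@atan R) (1 + x ^+ 2)^-1.
    by apply: DeriveDef; [exact: derivable_atan|rewrite -derive1E derive1_atan].
  by isd; rewrite /cauchyw; ring.
have Lh : L1 (cauchyw \_ `]0, +oo[).
  apply: (@L1_halfline _ _ (fun x => 2 * atan x) _ pi).
  - by move=> x _; exact: cauchyw_ge0.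
  - by move=> x _; exact: cauchyw_continuous.
  - move=> x _; rewrite normrM ger0_norm// -ler_pdivlMl// mulrC ler_norml.
    by rewrite !ltW ?atan_gtNpi2 ?atan_ltpi2.
have [|L ->] := @L1_even R cauchyw (continuous_measurable_fun cauchyw_continuous) _ Lh.
  by move=> x; rewrite /cauchyw sqrrN.
split => //; congr (_ * _).
have -> : pi = 2 * (pi / 2) - 2 * atan 0 :> R by rewrite atan0; field.
apply: FTC_halfline => //.
- by apply: cvg_at_right_filter; exact: isd_continuous (da 0).
- by move=> x _; exact: cauchyw_continuous.
- apply: cvgM; first exact: cvg_cst.
  apply: (cvg_comp _ _ _ (@cvgy_atan R)); rewrite (_ : (fun n => _) = fun n => n.+1%:R); last first.
    by apply/funext => n; rewrite add0r.
  apply/cvgryPge => A; near=> n; rewrite (@le_trans _ _ n%:R) ?ler_nat//.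
  by near: n; exact: near_nat_ge.
Unshelve. all: by end_near. Qed.

Lemma cas_mul (a b : R) : cas a * cas b = cos (a - b) + sin (a + b).
Proof. by rewrite /cas cosB sinD; ring. Qed.

Lemma measurable_hart_damp f e : 0 < e -> L1 f -> L1 (fun x => damp e x * hart f x).
Proof.
move=> e0 Lf; apply: (L1M_bounded (c := 2 * Int (fun x => `|f x|)) (L1_damp e0)).
  exact: hart_measurable.
by move=> x; exact: hart_norm.
Qed.

(** By [cas_mul] the integrand splits into the cosine of the difference, which gives the Poisson
    kernel, and the sine of the sum, which integrates to zero against the even function [damp e]. *)
Lemma hart_damp_cas e x y : 0 < e ->
  hart (fun xi => damp e xi * cas (xi * x)) y = 2 * e / (e ^+ 2 + (x - y) ^+ 2).
Proof.
move=> e0; have Ld := L1_damp e0.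
have z : st (damp e) (x + y) = 0.
  by apply: st_even => // t; rewrite /damp normrN.
rewrite -(ct_damp _ e0) -[RHS]addr0 -z.
rewrite /ct /st -IntD; [|exact: L1_cos|exact: L1_sin].
apply: eq_Int => t; rewrite -mulrA cas_mul -mulrBr -mulrDr.
ring.
Qed.

Lemma hart_damp_dot e f g : 0 < e -> L1 f -> L1 g ->
  Int (fun xi => damp e xi * hart g xi * hart f xi) =
  Int (fun x => f x * Int (fun t => g (e * t + x) * cauchyw t)).
Proof.
move=> e0 Lf Lg; have [_ <-] := hart_mul Lf (measurable_hart_damp e0 Lg).
have en0 : e != 0 by rewrite gt_eqF.
apply: eq_Int => x; congr (_ * _); rewrite /hart.
have Lk := L1_cas x (L1_damp e0).
have [_ h] := hart_mul Lk Lg.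
have -> : Int (fun xi => damp e xi * Int (fun y => g y * cas (y * xi)) * cas (xi * x)) =
    Int (fun xi => damp e xi * cas (xi * x) * hart g xi).
  by apply: eq_Int => xi; rewrite /hart; ring.
rewrite h.
have E y : hart (fun xi => damp e xi * cas (xi * x)) y = 2 * e / (e ^+ 2 + (x - y) ^+ 2).
  exact: hart_damp_cas.
have p y : 0 < e ^+ 2 + (x - y) ^+ 2 by rewrite ltr_wpDr ?sqr_ge0// exprn_gt0.
have Lh : L1 (fun y => g y * (2 * e / (e ^+ 2 + (x - y) ^+ 2))).
  apply: (L1M_bounded (c := 2 / e) Lg).
    apply: continuous_measurable_fun => y; isd_cont.
    by rewrite gt_eqF.
  move=> y; rewrite ger0_norm; last by rewrite divr_ge0 ?mulr_ge0 1?ltW.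
  rewrite ler_pdivrMr// mulrDr (_ : 2 / e * e ^+ 2 = 2 * e); last by field.
  by rewrite lerDl mulr_ge0 ?sqr_ge0// divr_ge0// ltW.
transitivity (Int (fun y => g y * (2 * e / (e ^+ 2 + (x - y) ^+ 2)))).
  by apply: eq_Int => y; rewrite E.
have := Int_affine x en0 Lh; rewrite gtr0_norm// => /(congr1 (fun z => e * z)).
rewrite mulVKf// => <-; rewrite -IntZ; last exact: (L1_affine x en0 Lh).
apply: eq_Int => t; rewrite /cauchyw mulrCA; congr (_ * _).
have := onesq_gt0 t => p1; have -> : e ^+ 2 + (x - (e * t + x)) ^+ 2 = e ^+ 2 * (1 + t ^+ 2) by ring.
by field; rewrite en0 gt_eqF.
Qed.

(** The damped pairing of transforms becomes a Cauchy-weighted mean of the correlations of f and g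
    at the shifts e t, a form in which e can go to 0. *)
Lemma hart_damp_auto e f g : 0 < e -> L1 f -> L2 f -> L1 g -> L2 g ->
  L1 (fun t => cauchyw t * Int (fun x => f x * g (1 * x + e * t))) /\
  Int (fun xi => damp e xi * hart g xi * hart f xi) =
  Int (fun t => cauchyw t * Int (fun x => f x * g (1 * x + e * t))).
Proof.
move=> e0 Lf Lf2 Lg Lg2; rewrite (hart_damp_dot e0 Lf Lg).
have en0 : e != 0 by rewrite gt_eqF.
have mf := L1_meas Lf; have mg := L1_meas Lg.
have mw : measurable_fun setT cauchyw by exact: continuous_measurable_fun cauchyw_continuous.
have Lgx x : L1 (fun t => g (e * t + x) * cauchyw t).
  apply: (L1M_bounded (c := 2) (L1_affine x en0 Lg)) => //.
  by move=> t; rewrite ger0_norm ?cauchyw_ge0 ?cauchyw_le2.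
have Lft t : L1 (fun x => f x * g (1 * x + e * t)).
  by apply: L2_mul => //; apply: L2_affine => //; exact: oner_neq0.
have -> : (fun t => cauchyw t * Int (fun x => f x * g (1 * x + e * t))) =
    fun t => Int (fun x => f x * (g (e * t + x) * cauchyw t)).
  apply/funext => t; rewrite -IntZ//; apply: eq_Int => x.
  by rewrite mul1r (addrC x); ring.
have -> : (fun x => f x * Int (fun t => g (e * t + x) * cauchyw t)) =
    fun x => Int (fun t => f x * (g (e * t + x) * cauchyw t)).
  by apply/funext => x; rewrite IntZ.
have mF : measurable_fun setT (fun z : R * R => f z.1 * (g (e * z.2 + z.1) * cauchyw z.2)).
  apply: measurable_funM; first exact: measurable_pair_fst.
  apply: measurable_funM; last exact: measurable_pair_snd.
  apply: (measurableT_comp mg); apply: measurable_funD; last exact: measurable_fst.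
  by apply: measurable_funM => //; exact: measurable_snd.
have [] := @Int_Fubini_le R (fun z : R * R => f z.1 * (g (e * z.2 + z.1) * cauchyw z.2))
   (fun x => (2 * (e^-1 * Int (fun x => `|g x|))) * `|f x|) mF.
- by move=> x /=; exact: L1Z.
- move=> t /=; apply: eq_L1 (L1Z (cauchyw t) (Lft t)) => x.
  by rewrite mul1r (addrC x); ring.
- by apply: L1Z; exact: L1_norm.
- move=> x /=.
  have Ln := L1_norm (Lgx x).
  under eq_Int do rewrite normrM.
  rewrite IntZ// mulrC ler_wpM2r//.
  have La := L1_affine x en0 (L1_norm Lg).
  have := Int_affine x en0 (L1_norm Lg); rewrite gtr0_norm// => <-.
  rewrite -IntZ//; apply: Int_le => //; first exact: L1Z.
  by move=> t; rewrite normrM mulrC ler_wpM2r// ger0_norm ?cauchyw_ge0// cauchyw_le2.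
by move=> _ L2' E; split.
Qed.

Lemma cvg_damp1 x : (fun n => damp n.+1%:R^-1 x) @ \oo --> (1 : R).
Proof.
rewrite -[X in _ --> X]expR0; apply: continuous_cvg; first exact: continuous_expR.
rewrite [X in _ --> X](_ : 0 = - 0 * `|x|); last by rewrite oppr0 mul0r.
by apply: cvgM; [apply: cvgN; exact: cvg_invS|exact: cvg_cst].
Qed.

(** For fixed t the shift tends to 0, and translations are continuous in L^2; Young's inequality
    bounds all correlations by one constant, so [cauchyw] gives the majorant. *)
Lemma hart_damp_cvg f g : L1 f -> L2 f -> L1 g -> L2 g ->
  (fun n => Int (fun xi => damp n.+1%:R^-1 xi * hart g xi * hart f xi)) @ \oo -->
  2 * pi * Int (fun x => f x * g x).
Proof.
move=> Lf Lf2 Lg Lg2; have [Lw <-] := cauchyw_int.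
have p n : 0 < n.+1%:R^-1 :> R by rewrite invr_gt0.
under eq_fun do rewrite (hart_damp_auto (p _) Lf Lf2 Lg Lg2).2.
rewrite (_ : Int cauchyw * _ = Int (fun t => cauchyw t * Int (fun x => f x * g x))); last first.
  by rewrite mulrC -IntZ//; apply: eq_Int => t; rewrite mulrC.
have Lws : L1 (fun t => (sqnorm f + sqnorm g) / 2 * cauchyw t) by exact: L1Z.
apply: (@Int_DCT R _ _ _ _ _ _ Lws _).2.
- by move=> n; exact: L1_meas (hart_damp_auto (p n) Lf Lf2 Lg Lg2).1.
- by apply: measurable_funM => //; exact: L1_meas Lw.
- apply: aeW => t; apply: cvgM; first exact: cvg_cst.
  have cf : cvg2 (fun _ => f) f.
    split => //; rewrite (_ : (fun n => _) = fun=> 0); first exact: cvg_cst.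
    apply/funext => n; rewrite -[RHS](Int0 (R := R)).
    by apply: eq_Int => x; rewrite subrr expr0n.
  apply: (cvg2_dot cf); apply: (cvg2_affine (l := fun=> 1) (t := fun n => n.+1%:R^-1 * t)) => //.
  + by move=> n; rewrite invf_le1// ler1n.
  + exact: cvg_cst.
  + rewrite [X in _ --> X](_ : 0 = 0 * t); last by rewrite mul0r.
    by apply: cvgM; [exact: cvg_invS|exact: cvg_cst].
- move=> n t; rewrite normrM (ger0_norm (cauchyw_ge0 _)) mulrC ler_wpM2r ?cauchyw_ge0//.
  have := @dot_young R f (fun x => g (1 * x + n.+1%:R^-1 * t)) 1 ltr01 Lf2.
  have o := oner_neq0 R.
  move=> /(_ (L2_affine _ o Lg2)); rewrite (sqnorm_affine _ o Lg2).
  by rewrite normr1 invr1 !mul1r.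
Qed.

(** With g = f the damped integrals are nonnegative and bounded, so Fatou makes [hart f]
    square-integrable. The product of the two transforms is then the majorant under which the
    damping is removed. *)
Theorem plancherel f g : L1 f -> L2 f -> L1 g -> L2 g ->
  [/\ L2 (hart f), L2 (hart g) &
      Int (fun xi => hart f xi * hart g xi) = 2 * pi * Int (fun x => f x * g x)].
Proof.
have sq h : L1 h -> L2 h -> L2 (hart h).
  move=> Lh Lh2; split; first exact: hart_measurable.
  have cv := hart_damp_cvg Lh Lh2 Lh Lh2.
  have [M [_ hM]] := cvg_seq_bounded (cvgP _ cv).
  have LD n : L1 (fun xi => damp n.+1%:R^-1 xi * hart h xi * hart h xi).
    have p : 0 < n.+1%:R^-1 :> R by rewrite invr_gt0.
    apply: (L1M_bounded (measurable_hart_damp p Lh)) (hart_measurable Lh) _.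
    by move=> x; exact: hart_norm.
  apply: (@Int_Fatou R (fun n xi => damp n.+1%:R^-1 xi * hart h xi * hart h xi) _ (M + 1) _ _ _ _).1 => //.
  - by move=> n x; rewrite -mulrA mulr_ge0 ?damp_ge0// -expr2 sqr_ge0.
  - move=> x; rewrite expr2 -[X in _ --> X]mul1r; under eq_fun do rewrite -mulrA.
    by apply: cvgM; [exact: cvg_damp1|exact: cvg_cst].
  - move=> n; apply: le_trans (ler_norm _) _; apply: hM => //; by rewrite ltrDl.
move=> Lf Lf2 Lg Lg2; have Hf := sq f Lf Lf2; have Hg := sq g Lg Lg2; split => //.
have cv := hart_damp_cvg Lf Lf2 Lg Lg2.
have Lfg := L2_mul Hf Hg.
have := @Int_DCT R (fun n xi => damp n.+1%:R^-1 xi * hart g xi * hart f xi)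
  (fun xi => hart f xi * hart g xi) _ _ _ _ (L1_norm Lfg) _.
case.
- move=> n; apply: measurable_funM; last exact: Hf.1.
  by apply: measurable_funM; [exact: continuous_measurable_fun (@damp_continuous R _)|exact: Hg.1].
- exact: L1_meas.
- apply: aeW => x; rewrite -[X in _ --> X]mul1r (mulrC (hart f x)); under eq_fun do rewrite -mulrA.
  by apply: cvgM; [exact: cvg_damp1|exact: cvg_cst].
- move=> n x; rewrite -mulrA normrM (ger0_norm (damp_ge0 _ _)) (mulrC (hart g x)).
  by rewrite ler_piMl// damp_le1// invr_ge0.
by move=> _ cv2; rewrite -(cvg_lim _ cv)// -(cvg_lim _ cv2).
Qed.

End Plancherel.

(** * The energy of the half Laplacian *)

Section FractionalLaplacian.
Context {R : realType}.
Implicit Types (f g h k u w z : R -> R) (a b c e t x : R).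
Local Notation mu := (@lebesgue_measure R).

Definition trunc (n : nat) f x := box n%:R x * f x.

Lemma trunc_norm n f x : `|trunc n f x| <= `|f x|.
Proof. by rewrite /trunc normrM ler_piMl// /box; case: ifP; rewrite ?normr1 ?normr0. Qed.

Lemma trunc_meas n f : measurable_fun setT f -> measurable_fun setT (trunc n f).
Proof. by move=> mf; apply: measurable_funM => //; exact: box_meas. Qed.

Lemma L2_trunc n f : L2 f -> L2 (trunc n f).
Proof.
move=> [mf Lf]; split; first exact: trunc_meas.
apply: (L1_le Lf); first by apply: measurable_funX; exact: trunc_meas.
by move=> x; rewrite ger0_norm ?sqr_ge0//; apply: ler_sqr_norm; exact: trunc_norm.
Qed.

Lemma L1_trunc n f : L2 f -> L1 (trunc n f).
Proof.
move=> Lf; apply: eq_L1 (L2_mul (f := box n%:R) _ Lf) => //.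
split; first exact: box_meas.
apply: eq_L1 (L1_box n%:R) => x.
by rewrite /box; case: ifP; rewrite ?expr1n ?expr0n.
Qed.

Lemma trunc_cvg2 f : L2 f -> cvg2 (fun n => trunc n f) f.
Proof.
move=> Lf; split => //; first by move=> n; exact: L2_trunc.
rewrite -[X in _ --> X](Int0 (R := R)).
have [_ mL] := Lf.
apply: (@Int_DCT R _ _ (fun x => f x ^+ 2) _ _ _ mL _).2 => //.
- by move=> n; have [m _] := L2B (L2_trunc n Lf) Lf; exact: measurable_funX.
- apply: aeW => x; apply: cvg_near_cst; near=> n; rewrite /trunc box_in ?mul1r ?subrr ?expr0n//.
  by near: n; exact: near_nat_ge.
- move=> n x; rewrite ger0_norm ?sqr_ge0// /trunc /box; case: ifP => _.
    by rewrite mul1r subrr expr0n/= sqr_ge0.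
  by rewrite mul0r sub0r sqrrN.
Unshelve. all: by end_near. Qed.

Lemma cvg2_cst f : L2 f -> cvg2 (fun _ => f) f.
Proof.
move=> Lf; split => //; rewrite (_ : (fun n => _) = fun=> 0); first exact: cvg_cst.
apply/funext => n; rewrite -[RHS](Int0 (R := R)).
by apply: eq_Int => x; rewrite subrr expr0n.
Qed.

Lemma hartB f g xi : L1 f -> L1 g -> hart (fun x => f x - g x) xi = hart f xi - hart g xi.
Proof.
move=> Lf Lg; rewrite /hart -IntB; [|exact: L1_cas..].
by apply: eq_Int => x; rewrite mulrBl.
Qed.

Let pi_neq0 : pi != 0 :> R. Proof. by rewrite gt_eqF// pi_gt0. Qed.
Let twopi_gt0 : 0 < 2 * pi :> R. Proof. by rewrite mulr_gt0// pi_gt0. Qed.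

(** The Hartley transform is its own inverse up to 2 pi, so [w] is the function with transform [h];
    truncation makes the integrals converge. *)
Definition inverse_hartley h w :=
  cvg2 (fun n x => (2 * pi)^-1 * hart (trunc n h) x) w.

Lemma inverse_hartley_exists h : L2 h -> exists w, inverse_hartley h w.
Proof.
move=> Lh; have L1h n := L1_trunc n Lh; have L2h n := L2_trunc n Lh.
have LH n : L2 (hart (trunc n h)).
  by have [] := plancherel (L1h n) (L2h n) (L1h n) (L2h n).
apply: L2_complete; first by move=> n; exact: L2Z.
move=> e e0; have [_ _ /cvgrPdist_lt] := trunc_cvg2 Lh.
have e1 : 0 < e * (2 * pi) / 4 by rewrite !mulr_gt0 ?invr_gt0 ?pi_gt0.
move=> /(_ _ e1)[N _ hN]; exists N => m n Nm Nn.
have := hN m Nm; have := hN n Nn; rewrite /= !sub0r !normrN !ger0_norm ?sqnorm_ge0//.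
move=> h1 h2.
rewrite (_ : sqnorm _ = sqnorm (fun x => (2 * pi)^-1 * hart (fun y => trunc m h y - trunc n h y) x)); last first.
  by apply: eq_Int => x; rewrite hartB// mulrBr.
have Lmn1 := L1B (L1h m) (L1h n); have Lmn2 := L2B (L2h m) (L2h n).
have [LHmn _ E] := plancherel Lmn1 Lmn2 Lmn1 Lmn2.
rewrite sqnormZ// (_ : sqnorm _ = 2 * pi * sqnorm (fun y => trunc m h y - trunc n h y)); last exact: E.
rewrite (_ : (2 * pi)^-1 ^+ 2 * (2 * pi * _) = sqnorm (fun y => trunc m h y - trunc n h y) / (2 * pi)); last first.
  by move: pi_neq0; generalize (@pi R) => p p0; field.
rewrite ler_pdivrMr//.
rewrite (_ : sqnorm _ = sqnorm (fun y => (trunc m h y - h y) + (h y - trunc n h y))); last first.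
  by apply: eq_Int => y; ring.
apply: le_trans (sqnormD_le (L2B (L2h m) Lh) (L2B Lh (L2h n))) _.
rewrite (sqnormB_sym h); lra.
Qed.

Lemma inverse_hartley_dot h k w z : L2 h -> L2 k -> inverse_hartley h w ->
  inverse_hartley k z ->
  2 * pi * Int (fun x => w x * z x) = Int (fun x => h x * k x).
Proof.
move=> Lh Lk hw kz; have c1 := cvg2_dot hw kz.
have c2 := cvg2_dot (trunc_cvg2 Lh) (trunc_cvg2 Lk).
have c3 : (fun n => 2 * pi * Int (fun x => (2 * pi)^-1 * hart (trunc n h) x * ((2 * pi)^-1 * hart (trunc n k) x)))
   @ \oo --> 2 * pi * Int (fun x => w x * z x).
  by apply: cvgM => //; exact: cvg_cst.
rewrite -(cvg_lim _ c3)// -(cvg_lim _ c2)//; congr (limn _); apply/funext => n.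
have [L L' E] := plancherel (L1_trunc n Lh) (L2_trunc n Lh) (L1_trunc n Lk) (L2_trunc n Lk).
rewrite (_ : Int _ = (2 * pi)^-1 * (2 * pi)^-1 * Int (fun x => hart (trunc n h) x * hart (trunc n k) x)); last first.
  by rewrite -IntZ; [apply: eq_Int => x; ring|exact: L2_mul].
by rewrite E; move: pi_neq0; generalize (@pi R) => p p0; field.
Qed.

(** Inversion without any pointwise formula: after expanding the square, Plancherel and the symmetry
    [hart_mul] evaluate all three terms, and the error is 2 pi times the mass of [w] lost by
    truncation. *)
Lemma inverse_hartleyP h w : L2 h -> inverse_hartley h w ->
  cvg2 (fun m => hart (trunc m w)) h.
Proof.
move=> Lh hw; have [_ Lw _] := hw.
have L1w n := L1_trunc n Lw; have L2w n := L2_trunc n Lw.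
have L1h n := L1_trunc n Lh; have L2h n := L2_trunc n Lh.
have LH n : L2 (hart (trunc n w)).
  by have [] := plancherel (L1w n) (L2w n) (L1w n) (L2w n).
split => //.
have E m : sqnorm (fun x => hart (trunc m w) x - h x) = 2 * pi * (sqnorm w - sqnorm (trunc m w)).
  have d : Int (fun x => hart (trunc m w) x * h x) = 2 * pi * sqnorm (trunc m w).
    have c1 := cvg2_dot (cvg2_cst (LH m)) (trunc_cvg2 Lh).
    have c2 := cvg2_dot (cvg2_cst (L2w m)) hw.
    have c3 : (fun n => 2 * pi * Int (fun x => trunc m w x * ((2 * pi)^-1 * hart (trunc n h) x))) @ \oo -->
        2 * pi * Int (fun x => trunc m w x * w x).
      by apply: cvgM => //; exact: cvg_cst.
    have -> : sqnorm (trunc m w) = Int (fun x => trunc m w x * w x).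
      by apply: eq_Int => x; rewrite /trunc /box; case: ifP => _; ring.
    rewrite -(cvg_lim _ c1)// -(cvg_lim _ c3)//; congr (limn _); apply/funext => n.
    have [L E] := hart_mul (L1h n) (L1w m).
    transitivity (Int (fun x => trunc n h x * hart (trunc m w) x)); first by apply: eq_Int => x; rewrite mulrC.
    rewrite E -IntZ; first by apply: eq_Int => x; move: pi_neq0; generalize (@pi R) => p p0; field.
    by apply: eq_L1 (L1Z (2 * pi)^-1 L) => x; ring.
  have s := inverse_hartley_dot Lh Lh hw hw.
  have [_ _ P] := plancherel (L1w m) (L2w m) (L1w m) (L2w m).
  have nL := L2Z (-1) Lh.
  rewrite (_ : sqnorm _ = sqnorm (fun x => hart (trunc m w) x + -1 * h x)); last first.
    by apply: eq_Int => x; rewrite mulN1r.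
  rewrite sqnormD2// sqnormZ// sqrrN expr1n mul1r.
  rewrite (_ : Int _ = - (2 * pi * sqnorm (trunc m w))); last first.
    by rewrite -d -IntN; [apply: eq_Int => x; ring|exact: L2_mul].
  rewrite (_ : sqnorm (hart _) = 2 * pi * sqnorm (trunc m w)); last exact: P.
  rewrite (_ : sqnorm h = 2 * pi * sqnorm w); last by rewrite /sqnorm; exact: esym s.
  by ring.
under eq_fun do rewrite E.
have : (fun m => 2 * pi * (sqnorm w - sqnorm (trunc m w))) @ \oo --> 2 * pi * (sqnorm w - sqnorm w).
  apply: cvgM; first exact: cvg_cst.
  by apply: cvgB; [exact: cvg_cst|exact: cvg2_sqnorm (trunc_cvg2 Lw)].
by rewrite subrr mulr0.
Qed.

Lemma L2_Lfun f : L2 f -> f \in Lfun mu 2%:E.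
Proof.
move=> [mf Lf]; rewrite inE; apply/andP; split; rewrite inE//=.
rewrite /finite_norm unlock /=.
rewrite poweR_lty//.
have := EFin_Int Lf.
rewrite (_ : (fun x => _) = (fun x => `|(EFin \o f) x| `^ 2)%E); first by move=> ->; rewrite ltry.
by apply/funext => x; rewrite /= powR_mulrn// real_normK ?num_real.
Qed.

Lemma Lfun_L2 f : f \in Lfun mu 2%:E -> L2 f.
Proof.
move=> Lf; split; last by have := Lfun2_integrable_sqr Lf.
by move: Lf; rewrite inE => /andP[]; rewrite inE.
Qed.

Lemma Rint_trunc f (n : nat) (phi : R -> R) :
  \int[mu]_(x in `[- n%:R, n%:R]) (f x * phi x) = Int (fun x => trunc n f x * phi x).
Proof.
rewrite Int_patch; apply: eq_Int => x; rewrite patchE /trunc box_itv indicE.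
by case: (x \in _); rewrite ?mul1r// !mul0r.
Qed.

Lemma L2_hart f : L1 f -> L2 f -> L2 (hart f).
Proof. by move=> Lf Lf2; have [] := plancherel Lf Lf2 Lf Lf2. Qed.

Lemma L2_opp f : L2 f -> L2 (fun x => f (- x)).
Proof.
move=> Lf; have h : (-1 : R) != 0 by rewrite oppr_eq0 oner_eq0.
by apply: eq_L2 (L2_affine 0 h Lf) => x; rewrite mulN1r addr0.
Qed.

Lemma L2_ct f : L1 f -> L2 f -> L2 (ct f).
Proof.
move=> Lf Lf2; have H := L2_hart Lf Lf2.
apply: eq_L2 (L2Z 2^-1 (L2D H (L2_opp H))) => x.
by rewrite !hartE// ctN stN//; field.
Qed.

Lemma L2_st f : L1 f -> L2 f -> L2 (st f).
Proof.
move=> Lf Lf2; have H := L2_hart Lf Lf2.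
apply: eq_L2 (L2Z 2^-1 (L2B H (L2_opp H))) => x.
by rewrite !hartE// ctN stN//; field.
Qed.

Lemma is_fourierI u A B : L2 u -> L2 A -> L2 B ->
  (fun n => sqnorm (fun xi => A xi - ct (trunc n u) xi) +
            sqnorm (fun xi => B xi + st (trunc n u) xi)) @ \oo --> 0 ->
  is_fourier u A B.
Proof.
move=> Lu LA LB cv; split; try exact: L2_Lfun.
move/cvg_EFinP : cv; apply: cvg_trans; apply: near_eq_cvg; apply: nearW => n.
have L1u := L1_trunc n Lu; have L2u := L2_trunc n Lu.
have La := L2B LA (L2_ct L1u L2u); have Lb := L2D LB (L2_st L1u L2u).
rewrite -IntD; [|exact: La.2|exact: Lb.2].
rewrite -EFin_Int; last exact: L1D La.2 Lb.2.
by apply: eq_integral => xi _; rewrite !Rint_trunc.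
Qed.

Lemma is_fourierE u A B : is_fourier u A B ->
  [/\ L2 u, L2 A, L2 B &
  (fun n => sqnorm (fun xi => A xi - ct (trunc n u) xi) +
            sqnorm (fun xi => B xi + st (trunc n u) xi)) @ \oo --> 0].
Proof.
move=> [/Lfun_L2 Lu /Lfun_L2 LA /Lfun_L2 LB cv]; split => //.
apply/cvg_EFinP; move: cv; apply: cvg_trans; apply: near_eq_cvg; apply: nearW => n.
have L1u := L1_trunc n Lu; have L2u := L2_trunc n Lu.
have La := L2B LA (L2_ct L1u L2u); have Lb := L2D LB (L2_st L1u L2u).
rewrite -IntD; [|exact: La.2|exact: Lb.2].
rewrite -EFin_Int; last exact: L1D La.2 Lb.2.
by apply: eq_integral => xi _; rewrite !Rint_trunc.
Qed.

Definition csupp f := exists N : R, forall x, N < `|x| -> f x = 0.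

Lemma csupp_trunc f : csupp f -> \forall n \near \oo, trunc n f = f.
Proof.
move=> [N hN]; near=> n; apply/funext => x; rewrite /trunc.
have [h|h] := lerP `|x| n%:R; first by rewrite box_in// mul1r.
by rewrite hN ?mulr0// (le_lt_trans _ h)//; near: n; exact: near_nat_ge.
Unshelve. all: by end_near. Qed.

Lemma csupp_L1 f : csupp f -> L2 f -> L1 f.
Proof.
move=> /csupp_trunc[n _ /(_ n (leqnn n))] /= <- Lf.
by have := L1_trunc n Lf; rewrite /trunc; apply: eq_L1 => x; rewrite mulrA /box; case: ifP; rewrite ?mulr1 ?mulr0 ?mul0r.
Qed.

(** Truncations of a compactly supported function are eventually the function itself, so the L^2
    limit is attained. The minus sign is that of e^(- i x xi). *)
Lemma is_fourier_csupp u : csupp u -> L2 u -> is_fourier u (ct u) (fun xi => - st u xi).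
Proof.
move=> su Lu; have L1u := csupp_L1 su Lu.
have LS := L2_st L1u Lu.
apply: is_fourierI => //; first exact: L2_ct.
  by apply: eq_L2 (L2Z (-1) LS) => x; rewrite mulN1r.
apply: cvg_near_cst; move/csupp_trunc : su; apply: filterS => n ->.
rewrite /sqnorm -[RHS]addr0.
by congr (_ + _); rewrite -[RHS](Int0 (R := R)); apply: eq_Int => xi; rewrite ?subrr ?addNr expr0n.
Qed.

Lemma L2_ae0 f : L2 f -> sqnorm f = 0 -> {ae mu, forall x, f x = 0}.
Proof.
move=> [mf Lf] f0.
have h : (\int[mu]_x `|(EFin \o (fun x => (f x ^+ 2)%R)) x| = 0)%E.
  rewrite (_ : 0%E = (Int (fun x => f x ^+ 2))%:E); last by rewrite -[Int _]/(sqnorm f) f0.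
  by rewrite -EFin_Int//; apply: eq_integral => x _ /=; rewrite ger0_norm// sqr_ge0.
have m2 : measurable_fun setT (EFin \o (fun x => (f x ^+ 2)%R)).
  exact: (measurable_EFin (L1_meas Lf)).
have [k _] := @ae_eq_integral_abs _ _ _ mu setT measurableT (EFin \o (fun x => (f x ^+ 2)%R)) m2.
have [N [mN N0 sN]] := k h.
exists N; split => // x /= nx; apply: sN => /= hx; apply: nx.
by have [] := hx I => /eqP; rewrite sqrf_eq0 => /eqP.
Qed.

Lemma fourier_csupp_unique u A B : csupp u -> is_fourier u A B ->
  {ae mu, forall xi, A xi = ct u xi /\ B xi = - st u xi}.
Proof.
move=> su /is_fourierE[Lu LA LB cv]; have L1u := csupp_L1 su Lu.
have LC := L2B LA (L2_ct L1u Lu); have LS := L2D LB (L2_st L1u Lu).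
have E : sqnorm (fun xi => A xi - ct u xi) + sqnorm (fun xi => B xi + st u xi) = 0.
  have c2 : (fun n => sqnorm (fun xi => A xi - ct (trunc n u) xi) +
            sqnorm (fun xi => B xi + st (trunc n u) xi)) @ \oo -->
     sqnorm (fun xi => A xi - ct u xi) + sqnorm (fun xi => B xi + st u xi).
    by apply: cvg_near_cst; move/csupp_trunc : su; apply: filterS => n ->.
  by rewrite -(cvg_lim _ cv)// -(cvg_lim _ c2).
have h1 := sqnorm_ge0 (fun xi => A xi - ct u xi).
have h2 := sqnorm_ge0 (fun xi => B xi + st u xi).
have [N1 [mN1 N10 sN1]] := L2_ae0 LC ltac:(lra).
have [N2 [mN2 N20 sN2]] := L2_ae0 LS ltac:(lra).
exists (N1 `|` N2); split; first exact: measurableU.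
  by rewrite measureU0.
move=> x /= nx; apply: contrapT => /not_orP[n1 n2]; apply: nx; split.
  by apply/eqP; rewrite -subr_eq0; apply/eqP; apply: contrapT => h; apply: n1; exact: sN1.
by apply/eqP; rewrite -addr_eq0; apply/eqP; apply: contrapT => h; apply: n2; exact: sN2.
Qed.

(* The power spectrum |\hat f|^2 and its polarisation. *)
Definition spec f g (xi : R) := ct f xi * ct g xi + st f xi * st g xi.
Definition finite_energy f := L1 (fun xi => `|xi| * spec f f xi).
Definition energy f g := Int (fun xi => `|xi| * spec f g xi).

Lemma Int_sym f : L1 f -> Int f = 2^-1 * Int (fun x => f x + f (- x)).
Proof. by move=> Lf; rewrite IntD//; [rewrite Int_opp//; field|exact: L1_opp]. Qed.

(** A product of Hartley transforms contains cross terms of [ct] and [st], which are odd in xi;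
    adding the value at - xi removes them. *)
Lemma hart_spec f g xi : L1 f -> L1 g ->
  hart f xi * hart g xi + hart f (- xi) * hart g (- xi) = 2 * spec f g xi.
Proof. by move=> Lf Lg; rewrite !hartE// !ctN !stN// /spec; ring. Qed.

Lemma spec_ge0 f xi : 0 <= spec f f xi.
Proof. by rewrite /spec -!expr2 addr_ge0 ?sqr_ge0. Qed.

Lemma spec_meas f g : L1 f -> L1 g -> measurable_fun setT (spec f g).
Proof.
move=> Lf Lg; have mf := hart_measurable Lf; have mg := hart_measurable Lg.
have mo (k : R -> R) : measurable_fun setT k -> measurable_fun setT (fun x => k (- x)).
  by move=> mk; apply: measurableT_comp mk _.
rewrite (_ : spec f g = fun xi => 2^-1 * (hart f xi * hart g xi + hart f (- xi) * hart g (- xi))).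
  by apply: measurable_funM => //; apply: measurable_funD; apply: measurable_funM => //; exact: mo.
by apply/funext => xi; rewrite hart_spec//; field.
Qed.

Lemma plancherel_spec f g : L1 f -> L2 f -> L1 g -> L2 g ->
  L1 (spec f g) /\ Int (spec f g) = 2 * pi * Int (fun x => f x * g x).
Proof.
move=> Lf Lf2 Lg Lg2; have [Hf Hg <-] := plancherel Lf Lf2 Lg Lg2.
have L := L2_mul Hf Hg.
have E : (fun xi => hart f xi * hart g xi + hart f (- xi) * hart g (- xi)) = fun xi => 2 * spec f g xi.
  by apply/funext => xi; exact: hart_spec.
have L' : L1 (fun xi => 2 * spec f g xi) by rewrite -E; exact: L1D L (L1_opp L).
have L'' : L1 (spec f g) by apply: eq_L1 (L1Z 2^-1 L') => x; field.
by split => //; rewrite (Int_sym L) E IntZ//; field.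
Qed.

(** Hartley transform of (-Delta)^(1/4) f, the multiplier being |xi|^(1/2). *)
Definition half_deriv f xi := Num.sqrt `|xi| * hart f xi.

Lemma L2_half_deriv f : L1 f -> finite_energy f -> L2 (half_deriv f).
Proof.
move=> Lf ef; have mf := hart_measurable Lf.
have msq : measurable_fun setT (fun xi : R => Num.sqrt `|xi|).
  apply: continuous_measurable_fun => x; apply: continuous_comp; first exact: norm_continuous.
  exact: sqrt_continuous.
split; first exact: measurable_funM.
have mm : measurable_fun setT (fun xi => half_deriv f xi ^+ 2).
  by apply: measurable_funX; exact: measurable_funM.
apply: (L1_le (L1Z 2 ef)) => // xi.
rewrite ger0_norm ?sqr_ge0// /half_deriv exprMn sqr_sqrtr//.
rewrite (_ : 2 * (_ * _) = `|xi| * (2 * spec f f xi)); last by ring.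
apply: ler_wpM2l => //; have := hart_spec xi Lf Lf; have := sqr_ge0 (hart f (- xi)); rewrite !expr2; lra.
Qed.

Lemma energyE f g : L1 f -> finite_energy f -> L1 g -> finite_energy g ->
  L1 (fun xi => `|xi| * spec f g xi) /\
  Int (fun xi => half_deriv f xi * half_deriv g xi) = energy f g.
Proof.
move=> Lf ef Lg eg; have L := L2_mul (L2_half_deriv Lf ef) (L2_half_deriv Lg eg).
have E : (fun xi => half_deriv f xi * half_deriv g xi + half_deriv f (- xi) * half_deriv g (- xi)) =
    fun xi => 2 * (`|xi| * spec f g xi).
  apply/funext => xi; rewrite /half_deriv normrN.
  transitivity (Num.sqrt `|xi| ^+ 2 * (hart f xi * hart g xi + hart f (- xi) * hart g (- xi))); first by ring.
  by rewrite hart_spec// sqr_sqrtr//; ring.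
have L' : L1 (fun xi => 2 * (`|xi| * spec f g xi)) by rewrite -E; exact: L1D L (L1_opp L).
have L'' : L1 (fun xi => `|xi| * spec f g xi) by apply: eq_L1 (L1Z 2^-1 L') => x; field.
by split => //; rewrite (Int_sym L) E IntZ// /energy; field.
Qed.

(** The weak formulation speaks about every function with the right transform, so one has to be
    produced before it can be used. The even and odd parts of [half_deriv u] are the multiplied
    cosine and sine transforms. *)
Lemma frac_laplacian_exists u : csupp u -> L2 u -> finite_energy u ->
  exists w, is_frac_laplacian 4^-1 u w /\ inverse_hartley (half_deriv u) w.
Proof.
move=> su Lu eu; have L1u := csupp_L1 su Lu.
have Lh := L2_half_deriv L1u eu.
have [w hw] := inverse_hartley_exists Lh.
exists w; split => //; exists (ct u), (fun xi => - st u xi); split; first exact: is_fourier_csupp.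
have [_ _ cv] := inverse_hartleyP Lh hw; have [_ Lw _] := hw.
have pw xi : `|xi| `^ (2 * 4^-1) = Num.sqrt `|xi|.
  by rewrite -powR12_sqrt//; congr (_ `^ _); field.
have Ea : (fun xi => `|xi| `^ (2 * 4^-1) * ct u xi) = fun xi => 2^-1 * (half_deriv u xi + half_deriv u (- xi)).
  by apply/funext => xi; rewrite pw /half_deriv normrN !hartE// ctN stN//; field.
have Eb : (fun xi => `|xi| `^ (2 * 4^-1) * - st u xi) = fun xi => (- 2^-1) * (half_deriv u xi - half_deriv u (- xi)).
  by apply/funext => xi; rewrite pw /half_deriv normrN !hartE// ctN stN//; field.
have LA : L2 (fun xi => `|xi| `^ (2 * 4^-1) * ct u xi).
  by rewrite Ea; apply: L2Z; apply: L2D => //; exact: L2_opp.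
have LB : L2 (fun xi => `|xi| `^ (2 * 4^-1) * - st u xi).
  by rewrite Eb; apply: L2Z; apply: L2B => //; exact: L2_opp.
apply: is_fourierI => //.
move: cv; apply: cvg_trans; apply: near_eq_cvg; apply: nearW => n.
have L1w := L1_trunc n Lw; have L2w := L2_trunc n Lw.
have LD := L2B (L2_hart L1w L2w) Lh.
have La := L2B LA (L2_ct L1w L2w); have Lb := L2D LB (L2_st L1w L2w).
rewrite /sqnorm (Int_sym LD.2) -IntD; [|exact: La.2|exact: Lb.2].
rewrite -IntZ; last by apply: L1D LD.2 (L1_opp LD.2).
apply: eq_Int => xi; rewrite !pw /half_deriv normrN !hartE// !ctN !stN//; by field.
Qed.

(** The factor 2 pi is Parseval's, since [energy] is an unnormalised integral over frequencies. *)
Lemma weak_half_laplacianE a b u g phi : csupp u -> L2 u -> finite_energy u ->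
  test_function a b phi -> csupp phi -> L2 phi -> finite_energy phi ->
  weak_half_laplacian a b u g ->
  energy u phi = 2 * pi * \int[mu]_(x in `]a, b[) (g x * phi x).
Proof.
move=> su Lu eu tphi sphi Lphi ephi.
have L1u := csupp_L1 su Lu; have L1phi := csupp_L1 sphi Lphi.
have [w [uw hw]] := frac_laplacian_exists su Lu eu.
have [z [phiz hz]] := frac_laplacian_exists sphi Lphi ephi.
move=> /(_ phi w z tphi uw phiz) <-.
rewrite (inverse_hartley_dot (L2_half_deriv L1u eu) (L2_half_deriv L1phi ephi) hw hz).
by have [_ ->] := energyE L1u eu L1phi ephi.
Qed.

(** |xi| lies below the Sobolev weight, and compact support identifies the given transform almost
    everywhere with the explicit integrals. *)
Lemma sobolev_finite_energy u : csupp u -> sobolev 2^-1 u -> L2 u /\ finite_energy u.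
Proof.
move=> su [A [B [fu fin]]]; have [Lu LA LB _] := is_fourierE fu.
have L1u := csupp_L1 su Lu; split => //.
have uq := fourier_csupp_unique su fu.
have m1 : measurable_fun setT (fun xi : R => (1 + xi ^+ 2) `^ 2^-1).
  rewrite (_ : (fun _ => _) = fun xi => Num.sqrt (1 + xi ^+ 2)).
    apply: continuous_measurable_fun => x; isd_cont.
    by rewrite onesq_gt0.
  by apply/funext => xi; rewrite powR12_sqrt// ltW// onesq_gt0.
have LS : L1 (fun xi => (1 + xi ^+ 2) `^ 2^-1 * (A xi ^+ 2 + B xi ^+ 2)).
  apply: L1_pos_lty => //.
    by apply: measurable_funM => //; apply: measurable_funD; [exact: L1_meas LA.2|exact: L1_meas LB.2].
  by move=> xi; rewrite mulr_ge0 ?powR_ge0// addr_ge0 ?sqr_ge0.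
have LS' : L1 (fun xi => (1 + xi ^+ 2) `^ 2^-1 * spec u u xi).
  have mS : measurable_fun setT (fun xi : R => (1 + xi ^+ 2) `^ 2^-1 * spec u u xi).
    by apply: measurable_funM => //; exact: spec_meas.
  apply: (L1_ae mS _ LS).1.
  case: uq => N [mN N0 sN]; exists N; split => // x /= h; apply: sN => /= -[hA hB]; apply: h.
  by rewrite hA hB /spec sqrrN !expr2.
apply: (L1_le LS').
  apply: measurable_funM; last exact: spec_meas.
  by apply: continuous_measurable_fun; exact: norm_continuous.
move=> xi; rewrite ger0_norm ?mulr_ge0 ?spec_ge0// ler_wpM2r ?spec_ge0//.
rewrite powR12_sqrt; last by rewrite ltW// onesq_gt0.
by rewrite -sqrtr_sqr ler_wsqrtr// lerDr.
Qed.

End FractionalLaplacian.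

(** * Test functions *)

Section TestFunctions.
Context {R : realType}.
Implicit Types (f g k : R -> R) (a b c d e t x y : R) (p q : {poly R}).

Lemma isd_squeeze f x c : (\forall y \near x, `|f y - f x| <= c * (y - x) ^+ 2) ->
  is_derive x 1 f 0.
Proof.
move=> H; have cv : h^-1 *: (f (h *: 1 + x) - f x) @[h --> 0^'] --> (0 : R).
  apply/cvgrPdist_le => e e0.
  have [r /= r0 hr] := H.
  have c1 : 0 < `|c| + 1 by rewrite ltr_wpDl.
  have m0 : 0 < Num.min r (e / (`|c| + 1)) by rewrite lt_min r0 divr_gt0.
  exists (Num.min r (e / (`|c| + 1))) => // h /=; rewrite sub0r normrN lt_min => /andP[h1 h2] h0.
  rewrite sub0r normrN /GRing.scale/= mulr1 normrM normfV ler_pdivrMl ?normr_gt0//.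
  have /hr : ball x r (h + x) by rewrite -ball_normE /= opprD addrCA subrr addr0 normrN.
  move/le_trans; apply; rewrite addrK -(@real_normK _ h) ?num_real// expr2 mulrCA ler_wpM2l//.
  move: h2; rewrite ltr_pdivlMr// => h2; have := ler_norm c; have := normr_ge0 h; nra.
split; first by apply/cvg_ex; exists 0.
by apply/cvg_lim.
Qed.

(** The classical exp(-1/t), with a power of 1/t carried along so that the family is closed under
    differentiation ([flat_derive]). *)
Definition flat (n : nat) t := if 0 < t then t^-1 ^+ n * expR (- t^-1) else 0 : R.

Lemma flat_le0 n t : t <= 0 -> flat n t = 0.
Proof. by rewrite /flat leNgt => /negbTE ->. Qed.

(** The term of order n + 2 in the exponential series of 1/t beats the power of 1/t by two orders. A
    quadratic bound is what makes the derivative at 0 vanish. *)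
Lemma flat_bound n t : `|flat n t| <= n.+2`!%:R * t ^+ 2.
Proof.
rewrite /flat; case: ifPn => [t0|_]; last by rewrite normr0 mulr_ge0 ?sqr_ge0.
have i0 : 0 < t^-1 by rewrite invr_gt0.
have p0 : 0 <= t^-1 ^+ n by rewrite exprn_ge0// ltW.
rewrite (ger0_norm (mulr_ge0 p0 (expR_ge0 _))).
have := expR_ge1Dxn n.+1 (ltW i0) => h.
have f0 : 0 < n.+2`!%:R :> R by rewrite ltr0n fact_gt0.
rewrite expRN ler_pdivrMr ?expR_gt0//.
have h2 : t^-1 ^+ n.+2 / n.+2`!%:R <= expR t^-1 by lra.
have : n.+2`!%:R * t ^+ 2 * (t^-1 ^+ n.+2 / n.+2`!%:R) <= n.+2`!%:R * t ^+ 2 * expR t^-1.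
  by rewrite ler_wpM2l// mulr_ge0 ?sqr_ge0// ltW.
apply: le_trans; rewrite le_eqVlt; apply/orP; left; apply/eqP.
by rewrite !exprS; field; rewrite !gt_eqF.
Qed.

Lemma flat_derive n t : is_derive t 1 (flat n) (flat n.+2 t - n%:R * flat n.+1 t).
Proof.
have [t0|t0|<-] := ltgtP 0 t.
- have h : is_derive t 1 (fun t => t^-1 ^+ n * expR (- t^-1)) (flat n.+2 t - n%:R * flat n.+1 t).
    isd; first by rewrite gt_eqF.
      by rewrite gt_eqF.
    rewrite /flat t0; case: n => [|n]; first by rewrite !exprS expr0 mul0r; field; rewrite gt_eqF.
    by rewrite /= !exprS; field; rewrite gt_eqF.
  apply: (near_eq_is_derive _ h).
  near=> y; rewrite /flat ifT//; near: y; exact: lt_nbhsr.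
- rewrite !(flat_le0 _ (ltW t0)) mulr0 subr0.
  apply: (@isd_squeeze _ _ 0); near=> y.
  have y0 : y < 0 by near: y; exact: lt_nbhsl.
  by rewrite (flat_le0 _ (ltW y0)) (flat_le0 _ (ltW t0)) subr0 normr0 mul0r.
- rewrite !flat_le0// mulr0 subr0; apply: (@isd_squeeze _ _ n.+2`!%:R); near=> y.
  by rewrite (flat_le0 _ (lexx 0)) !subr0; exact: flat_bound.
Unshelve. all: by end_near. Qed.

(** A syntactic class, with the inner polynomial fixed, that is stable under differentiation: one
    derivative inside the class yields derivatives of all orders ([smooth_closed]). *)
Inductive flatcomb p : (R -> R) -> Prop :=
| flat_term q n : flatcomb p (fun x => q.[x] * flat n p.[x])
| flat_add f g : flatcomb p f -> flatcomb p g -> flatcomb p (fun x => f x + g x).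

Lemma flatcomb_derive p f : flatcomb p f ->
  exists g, flatcomb p g /\ forall x, is_derive x 1 f (g x).
Proof.
elim=> {f} [q n|f g _ [f' [Pf df]] _ [g' [Pg dg]]]; last first.
  by exists (fun x => f' x + g' x); split; [exact: flat_add|move=> x; exact: isdD].
exists (fun x => (q^`().[x] * flat n p.[x] + (q * p^`()).[x] * flat n.+2 p.[x]) +
   (- (n%:R *: (q * p^`()))).[x] * flat n.+1 p.[x]).
split; first by apply: flat_add; [apply: flat_add|]; exact: flat_term.
move=> x; have dq := is_derive_poly q x; have dp := is_derive_poly p x.
have dfl := isd_comp (flat_derive n p.[x]) dp.
by apply: isd_eq (isdM dq dfl) _; rewrite !(hornerN, hornerZ, hornerM); ring.
Qed.

Lemma flatcomb_out p f x : flatcomb p f -> p.[x] <= 0 -> f x = 0.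
Proof.
elim=> {f} [q n|f g _ hf _ hg] px; first by rewrite flat_le0// mulr0.
by rewrite hf// hg// addr0.
Qed.

Lemma flatcomb_continuous p f : flatcomb p f -> continuous f.
Proof. by move=> /flatcomb_derive[g [_ dg]] x; exact: isd_continuous (dg x). Qed.

Lemma smooth_closed (P : (R -> R) -> Prop) :
  (forall f, P f -> exists g, P g /\ forall x, is_derive x 1 f (g x)) ->
  forall f, P f -> forall n x, derivable (derive1n n f) x 1.
Proof.
move=> H f Pf n; elim: n f Pf => [|n IH] f Pf x.
  by have [g [_ dg]] := H f Pf; have [] := dg x.
have [g [Pg dg]] := H f Pf.
rewrite /derive1n iterSr -/(derive1n n _) (_ : derive1 f = g); first exact: IH.
by apply/funext => y; rewrite derive1E; have [_ ->] := dg y.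
Qed.

(** For m > 0 this is positive exactly between [c] and [d], and a large [m] drives the bump to the
    indicator of the interval ([bump_cvg]). *)
Definition quad c d (m : R) : {poly R} := (m *: (('X - c%:P) * (d%:P - 'X)))%R.

Lemma quadE c d m x : (quad c d m).[x] = m * ((x - c) * (d - x)).
Proof. by rewrite /quad !hornerE. Qed.

Lemma quad_le0 c d m x : 0 < m -> c < d -> ~~ (c < x < d) -> (quad c d m).[x] <= 0.
Proof.
move=> m0 cd; rewrite negb_and -!leNgt quadE => /orP[h|h]; rewrite pmulr_rle0//; nra.
Qed.

Lemma quad_gt0 c d m x : 0 < m -> c < x < d -> 0 < (quad c d m).[x].
Proof. by move=> m0 /andP[h1 h2]; rewrite quadE !mulr_gt0// subr_gt0. Qed.

(** The constant polynomial 1 in front makes it an instance of [flat_term]. *)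
Definition bump c d (m : R) x := (1%:P).[x] * flat 0 (quad c d m).[x].

Lemma bump_flatcomb c d m : flatcomb (quad c d m) (bump c d m).
Proof. exact: flat_term. Qed.

Lemma bumpE c d m x : bump c d m x = flat 0 (quad c d m).[x].
Proof. by rewrite /bump hornerC mul1r. Qed.

Lemma flat0_01 t : 0 <= flat 0 t <= 1.
Proof.
rewrite /flat expr0 mul1r; case: ifPn => [t0|_]; last by rewrite lexx ler01.
by rewrite expR_ge0 -expR0 ler_expR oppr_le0 invr_ge0 ltW.
Qed.

Lemma flatcomb_test a b c d m f : a < c -> c < d -> d < b -> 0 < m ->
  flatcomb (quad c d m) f -> test_function a b f.
Proof.
move=> ac cd db m0 Pf; split; first exact: (smooth_closed (@flatcomb_derive _) Pf).
exists `[c, d]; split; first exact: segment_compact.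
  by move=> x /=; rewrite !in_itv/= => /andP[h1 h2]; rewrite (lt_le_trans ac)// (le_lt_trans h2).
move=> x; rewrite /= in_itv/= => /negP h; apply: (flatcomb_out Pf); apply: quad_le0 => //.
by apply: contra h => /andP[/ltW -> /ltW ->].
Qed.

Lemma bump_cvg c d x : c < d -> (fun n => bump c d n.+1%:R x) @ \oo --> (\1_(`]c, d[%classic) x : R).
Proof.
move=> cd; rewrite indicE; have [h|h] := boolP (c < x < d); last first.
  rewrite memNset/= ?in_itv/=; last exact/negP.
  rewrite (_ : (fun _ => _) = fun=> 0); first exact: cvg_cst.
  by apply/funext => n; rewrite bumpE flat_le0// quad_le0.
rewrite mem_set/= ?in_itv//=.
have q0 : 0 < (x - c) * (d - x) by case/andP: h => h1 h2; rewrite mulr_gt0 ?subr_gt0.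
rewrite (_ : (fun _ => _) = fun n => expR (- (n.+1%:R^-1 * ((x - c) * (d - x))^-1))); last first.
  by apply/funext => n; rewrite bumpE /flat quad_gt0// expr0 mul1r quadE invfM.
rewrite -[X in _ --> X]expR0 -[X in expR X]oppr0; apply: continuous_cvg.
  exact: continuous_expR.
apply: cvgN; rewrite [X in _ --> X](_ : 0 = 0 * ((x - c) * (d - x))^-1); last by rewrite mul0r.
by apply: cvgM; [exact: cvg_invS|exact: cvg_cst].
Qed.

Lemma locally_integrable_cc a b c d g : a < c -> d < b -> locally_integrable `]a, b[ g ->
  L1 (g \_ `[c, d]).
Proof.
move=> ac db [mg _ hg]; apply: (L1_patch _ (measurable_itv _)).1.
have s : `[c, d] `<=` `]a, b[.
  by move=> x /=; rewrite !in_itv/= => /andP[h1 h2]; rewrite (lt_le_trans ac)// (le_lt_trans h2).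
apply/integrableP; split.
  by apply: measurable_EFin; exact: measurable_funS mg.
by apply: hg => //; exact: segment_compact.
Qed.

Lemma test_fun_props a b phi : a < b -> test_function a b phi ->
  [/\ continuous phi, forall x, is_derive x 1 phi (derive1 phi x), continuous (derive1 phi) &
    exists c d, [/\ a < c, c < d, d < b & forall x, ~~ (c < x < d) -> phi x = 0]].
Proof.
move=> ab [sm [K [cK Kab Kphi]]].
have d0 x : is_derive x 1 phi (derive1 phi x).
  by apply: DeriveDef; [exact: (sm 0%N)|rewrite derive1E].
have d1 x : derivable (derive1 phi) x 1 by exact: (sm 1%N).
split.
- by move=> x; exact: isd_continuous (d0 x).
- exact: d0.
- by move=> x; apply: differentiable_continuous; apply/derivable1_diffP; exact: d1.
have [K0|/set0P K0] := eqVneq K set0.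
  exists ((2 * a + b) / 3), ((a + 2 * b) / 3); split; [lra|lra|lra|].
  by move=> x _; apply: Kphi; rewrite K0.
have ci : {within K, continuous (fun x : R => x)} by apply: continuous_subspaceT => x; exact: cvg_id.
have [s sK hs] := compact_EVT_max K0 cK ci.
have [i iK hi] := compact_EVT_min K0 cK ci.
rewrite !inE in sK iK.
have := Kab _ sK; have := Kab _ iK; rewrite /= !in_itv/= => /andP[i1 i2] /andP[s1 s2].
have h3 : i <= s by apply: hs; rewrite inE.
(* Midpoints between the extremes of the support and the end points, so that the support lies in an
   interval with room on both sides. *)
exists ((a + i) / 2), ((s + b) / 2); split; [lra|lra|lra|].
move=> x hx; apply: Kphi => Kx; move/negP: hx; apply.
have h1 : i <= x by apply: hi; rewrite inE.
have h2 : x <= s by apply: hs; rewrite inE.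
by apply/andP; split; lra.
Qed.

End TestFunctions.

(** * The fundamental lemma of the calculus of variations *)

Section FundamentalLemma.
Context {R : realType}.
Implicit Types (f g k : R -> R) (a b c d e t x y : R).
Local Notation mu := (@lebesgue_measure R).

Lemma L1_locally g : L1 g -> locally_integrable [set: R] g.
Proof. by move=> Lg; apply: open_integrable_locally => //; exact: openT. Qed.

Lemma near_oo c d x : c < x < d -> \forall y \near x, c < y < d.
Proof.
move=> /andP[cx xd]; near=> y; apply/andP; split; near: y.
  exact: lt_nbhsr.
exact: lt_nbhsl.
Unshelve. all: by end_near. Qed.

(** The primitive from minus infinity of the restricted function is zero near each interior point,
    so its derivative is zero there, while Lebesgue's differentiation theorem makes that derivative
    [g] almost everywhere. *)
Lemma Int_cc0_ae_cc c d g : c < d -> L1 (g \_ `[c, d]) ->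
  (forall x, c < x < d -> Int (g \_ `[c, x]) = 0) ->
  {ae mu, forall x, c < x < d -> g x = 0}.
Proof.
move=> cd Lg g0.
have iG y : mu.-integrable `]-oo, y] (EFin \o (g \_ `[c, d])).
  exact: (integrableS measurableT _ _ Lg).
have main (x : R) : derive1 (fun y => \int[mu]_(t in `]-oo, y]) (g \_ `[c, d]) t) x = (g \_ `[c, d]) x ->
    c < x < d -> g x = 0.
  move=> F' xcd; have -> : g x = (g \_ `[c, d]) x.
    by rewrite patchE mem_set//= in_itv/=; case/andP: xcd => /ltW -> /ltW ->.
  rewrite -F'.
  have nz : \forall y \near x, (fun _ : R => 0) y = \int[mu]_(t in `]-oo, y]) (g \_ `[c, d]) t.
    apply: filterS (near_oo xcd) => y ycd.
    rewrite Int_patch -(g0 y ycd); apply: eq_Int => t; rewrite !patchE !mem_setE !in_itv/=.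
    case: ifP => [/andP[-> ty]|]; first by rewrite ty (le_trans ty)// ltW; case/andP: ycd.
    by move=> ct; case: ifP => // ty; case: ifP => // /andP[ct' _]; rewrite ct' ty in ct.
  by rewrite derive1E -(near_eq_derive _ nz) derive_cst.
have [N [mN N0 sN]] := FTC1Ny iG (L1_locally Lg).
exists N; split => // x /= nx; apply: sN => /= -[dF F']; apply: nx; exact: main.
Qed.

(** Bumps increase to indicators of compact subintervals, so all integrals of [g] over these vanish;
    countably many of them exhaust (a, b). *)
Lemma fundamental_lemma0 a b g : a < b -> locally_integrable `]a, b[ g ->
  (forall phi, test_function a b phi -> \int[mu]_(x in `]a, b[) (g x * phi x) = 0) ->
  {ae mu, forall x, a < x < b -> g x = 0}.
Proof.
move=> ab lg g0.
have key c d : a < c -> c < d -> d < b -> Int (g \_ `[c, d]) = 0.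
  move=> ac cd db; have L := locally_integrable_cc ac db lg.
  have B n : Int (fun x => (g \_ `[c, d]) x * bump c d n.+1%:R x) = 0.
    rewrite -[RHS](g0 (bump c d n.+1%:R)); last first.
      by apply: (flatcomb_test ac cd db _ (bump_flatcomb _ _ _)); rewrite ltr0n.
    rewrite Int_patch; apply: eq_Int => x; rewrite !patchE.
    have [h|h] := boolP (c <= x <= d).
      have h' : (a < x) && (x < b) by case/andP: h => h1 h2; rewrite (lt_le_trans ac)// (le_lt_trans h2).
      by rewrite !mem_set//= in_itv.
    have -> : bump c d n.+1%:R x = 0.
      rewrite bumpE flat_le0// quad_le0//.
      by apply: contra h => /andP[/ltW -> /ltW ->].
    by rewrite !mulr0; case: ifP.
  have mg := L1_meas L.
  have := @Int_DCT R (fun n x => (g \_ `[c, d]) x * bump c d n.+1%:R x) (g \_ `[c, d]) _ _ _ _ (L1_norm L).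
  case.
  - move=> n; apply: measurable_funM => //; apply: continuous_measurable_fun.
    exact: flatcomb_continuous (bump_flatcomb _ _ _).
  - exact: mg.
  - exists [set c; d]; split.
    + exact: measurableU.
    + by rewrite measureU0//; exact: lebesgue_measure_set1.
    move=> x /= nx; apply: contrapT => /not_orP[xc xd]; apply: nx.
    have := @bump_cvg R c d x cd => h.
    have cv2 : (fun n => (g \_ `[c, d]) x * bump c d n.+1%:R x) @ \oo -->
        (g \_ `[c, d]) x * \1_(`]c, d[%classic) x.
      by apply: cvgM => //; exact: cvg_cst.
    have e : (g \_ `[c, d]) x * \1_(`]c, d[%classic) x = (g \_ `[c, d]) x; last by rewrite e in cv2.
    rewrite indicE patchE; case: ifPn => [|_]; last by rewrite mul0r.
    rewrite inE/= in_itv/= => /andP[h1 h2]; rewrite mem_set ?mulr1//= in_itv/= !lt_neqAle h1 h2 !andbT.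
    by apply/andP; split; apply/eqP => E; [apply: xc|apply: xd].
  - move=> n x; rewrite normrM ler_piMr// bumpE ger0_norm; by have /andP[] := flat0_01 (quad c d n.+1%:R).[x].
  move=> _ cv; rewrite -(cvg_lim _ cv)// (_ : (fun n => _) = fun=> 0); first by rewrite lim_cst.
  by apply/funext => n; exact: B.
pose r n := (b - a) / 3 * n.+1%:R^-1 : R.
have r0 n : 0 < r n by rewrite mulr_gt0 ?invr_gt0// divr_gt0// subr_gt0.
have r3 n : r n <= (b - a) / 3.
  rewrite /r ler_piMr//; first by rewrite divr_ge0// subr_ge0 ltW.
  by rewrite invf_le1// ler1n.
have rc : r @ \oo --> (0 : R).
  rewrite [X in _ --> X](_ : 0 = (b - a) / 3 * 0); last by rewrite mulr0.
  by apply: cvgM; [exact: cvg_cst|exact: cvg_invS].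
have H n : mu.-negligible (~` [set x | a + r n < x < b - r n -> g x = 0]).
  have := r0 n; have := r3 n => h1 h2.
  apply: Int_cc0_ae_cc; first lra.
    by apply: (locally_integrable_cc _ _ lg); lra.
  by move=> x /andP[x1 x2]; apply: key; lra.
have := negligible_bigcup H; apply: negligibleS => x /= nx.
have {nx} [xab gx] : a < x < b /\ g x <> 0 by apply: contrapT => h; apply: nx => xab; apply: contrapT => gx; apply: h.
have e0 : 0 < Num.min (x - a) (b - x) by rewrite lt_min !subr_gt0.
move/cvgrPdist_lt : rc => /(_ _ e0)[n _ /(_ n (leqnn n))]; rewrite /= sub0r normrN gtr0_norm// lt_min => /andP[n1 n2].
by exists n => //= h; apply: gx; apply: h; lra.
Qed.

Lemma L1_loc_test a b g phi : a < b -> locally_integrable `]a, b[ g -> test_function a b phi ->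
  L1 ((fun x => g x * phi x) \_ `]a, b[).
Proof.
move=> ab lg tp; have [cp _ _ [c [d [ac cd db p0]]]] := test_fun_props ab tp.
have L := locally_integrable_cc ac db lg.
have [M hM] : exists M, forall x, `|phi x| <= M.
  have ci : {within `[c, d], continuous (fun x => `|phi x|)}.
    by apply: continuous_subspaceT => x; apply: continuous_comp; [exact: cp|exact: norm_continuous].
  have [m mcd hm] := EVT_max (ltW cd) ci.
  exists `|phi m| => x; have [h|h] := boolP (c < x < d); last by rewrite p0// normr0.
  by apply: hm; rewrite in_itv/=; case/andP: h => /ltW -> /ltW ->.
apply: eq_L1 (L1M_bounded L (continuous_measurable_fun cp) hM) => x.
rewrite !patchE; have [h|h] := boolP (c < x < d); last by rewrite p0// !mulr0; case: ifP.
case/andP: h => h1 h2.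
by rewrite !mem_set//= in_itv/=; rewrite ?(ltW h1) ?(ltW h2)// (lt_trans ac)// (lt_trans h2).
Qed.

Lemma fundamental_lemma a b g1 g2 : a < b -> locally_integrable `]a, b[ g1 ->
  locally_integrable `]a, b[ g2 ->
  (forall phi, test_function a b phi ->
    \int[mu]_(x in `]a, b[) (g1 x * phi x) = \int[mu]_(x in `]a, b[) (g2 x * phi x)) ->
  {ae mu, forall x, a < x < b -> g1 x = g2 x}.
Proof.
move=> ab l1 l2 E.
have [] := @fundamental_lemma0 a b (fun x => g1 x - g2 x) ab.
- exact: locally_integrableB.
- move=> phi tp; have := E phi tp; rewrite !Int_patch => e.
  have := IntB (L1_loc_test ab l1 tp) (L1_loc_test ab l2 tp); rewrite e subrr => <-.
  by apply: eq_Int => x; rewrite !patchE; case: ifP; rewrite ?subr0// mulrBl.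
move=> N [mN N0 sN]; exists N; split => // x /= nx; apply: sN => /= h; apply: nx => xab.
by apply/eqP; rewrite -subr_eq0; apply/eqP; exact: h.
Qed.

Lemma isd_Int (F dF : R -> R -> R) G a : (forall x, L1 (F x)) ->
  (forall x y, is_derive x 1 (F^~ y) (dF x y)) -> L1 G ->
  (forall x y, a - 1 < x < a + 1 -> `|dF x y| <= G y) ->
  is_derive a 1 (fun x => Int (F x)) (Int (dF a)).
Proof.
move=> LF dFE LG bd.
have Ia : `]a - 1, a + 1[%classic a by rewrite /= in_itv/= ltrDl ltrBlDr ltrDl ltr01.
have E x y : partial1of2 F x y = dF x y.
  by rewrite partial1of2E; have [_ ->] := dFE x y.
have G0 y : 0 <= G y.
  by apply: le_trans (bd a y _); [exact: normr_ge0|move: Ia; rewrite /= in_itv].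
have b' x y : `]a - 1, a + 1[%classic x -> [set: R] y -> `|partial1of2 F x y| <= G y.
  by rewrite /= in_itv/= E => h _; exact: bd.
have d' x y : `]a - 1, a + 1[%classic x -> [set: R] y -> derivable (F ^~ y) x 1.
  by move=> _ _; have [] := dFE x y.
have i' x : `]a - 1, a + 1[%classic x -> mu.-integrable setT (EFin \o F x) by move=> _; exact: LF.
have D := @derivable_under_integral R _ _ mu F setT measurableT a _ _ Ia i' d' G G0 LG b'.
have V := @differentiation_under_integral R _ _ mu F setT measurableT a _ _ Ia i' d' G G0 LG b'.
apply: DeriveDef; first exact: D.
rewrite -derive1E V; apply: eq_Rintegral => y _.
by rewrite -E partial1of2E.
Qed.

End FundamentalLemma.

(** * Energy under affine changes of variable *)

Section Energy.
Context {R : realType}.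
Implicit Types (f g k q : R -> R) (a b c d e t x y xi l : R).

Lemma ctD f g xi : L1 f -> L1 g -> ct (fun x => f x + g x) xi = ct f xi + ct g xi.
Proof.
move=> Lf Lg; rewrite /ct -IntD; [|exact: L1_cos..].
by apply: eq_Int => x; rewrite mulrDl.
Qed.

Lemma stD f g xi : L1 f -> L1 g -> st (fun x => f x + g x) xi = st f xi + st g xi.
Proof.
move=> Lf Lg; rewrite /st -IntD; [|exact: L1_sin..].
by apply: eq_Int => x; rewrite mulrDl.
Qed.

Lemma ctZ c f xi : L1 f -> ct (fun x => c * f x) xi = c * ct f xi.
Proof.
move=> Lf; rewrite /ct -IntZ; last exact: L1_cos.
by apply: eq_Int => x; rewrite mulrA.
Qed.

Lemma stZ c f xi : L1 f -> st (fun x => c * f x) xi = c * st f xi.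
Proof.
move=> Lf; rewrite /st -IntZ; last exact: L1_sin.
by apply: eq_Int => x; rewrite mulrA.
Qed.

Lemma ct_affine f l t xi : l != 0 -> L1 f ->
  ct (fun x => f (l * x + t)) xi =
  `|l|^-1 * (cos (t * (xi / l)) * ct f (xi / l) + sin (t * (xi / l)) * st f (xi / l)).
Proof.
move=> l0 Lf; have Lc := L1_cos (xi / l) Lf; have Ls := L1_sin (xi / l) Lf.
rewrite /ct /st -!IntZ// -IntD; [|exact: L1Z..].
rewrite -(Int_affine t l0); last by apply: L1D; exact: L1Z.
apply: eq_Int => x.
have -> : x * xi = (l * x + t) * (xi / l) - t * (xi / l) by field.
by rewrite cosB; ring.
Qed.

Lemma st_affine f l t xi : l != 0 -> L1 f ->
  st (fun x => f (l * x + t)) xi =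
  `|l|^-1 * (cos (t * (xi / l)) * st f (xi / l) - sin (t * (xi / l)) * ct f (xi / l)).
Proof.
move=> l0 Lf; have Lc := L1_cos (xi / l) Lf; have Ls := L1_sin (xi / l) Lf.
rewrite /ct /st -!IntZ// -IntB; [|exact: L1Z..].
rewrite -(Int_affine t l0); last by apply: L1B; exact: L1Z.
apply: eq_Int => x.
have -> : x * xi = (l * x + t) * (xi / l) - t * (xi / l) by field.
by rewrite sinB; ring.
Qed.

Lemma spec_affine f g l t xi : l != 0 -> L1 f -> L1 g ->
  spec (fun x => f (l * x + t)) (fun x => g (l * x + t)) xi = l^-1 ^+ 2 * spec f g (xi / l).
Proof.
move=> l0 Lf Lg; rewrite /spec !ct_affine// !st_affine//.
have -> : l^-1 ^+ 2 = `|l|^-1 ^+ 2 by rewrite -normfV real_normK// num_real.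
have := cos2Dsin2 (t * (xi / l)).
move: (cos _) (sin _) => c s h.
transitivity (`|l|^-1 ^+ 2 * (c ^+ 2 + s ^+ 2) * (ct f (xi / l) * ct g (xi / l) + st f (xi / l) * st g (xi / l))); first by ring.
by rewrite h mulr1.
Qed.

Lemma finite_energy_affine f l t : l != 0 -> L1 f -> finite_energy f ->
  finite_energy (fun x => f (l * x + t)).
Proof.
move=> l0 Lf ef; have li : l^-1 != 0 by rewrite invr_eq0.
apply: eq_L1 (L1Z `|l|^-1 (L1_affine 0 li ef)) => xi.
rewrite addr0 spec_affine// (mulrC l^-1) normrM normfV -real_normK ?num_real// normfV.
by rewrite expr2; ring.
Qed.

(** A translation only rotates the pair of cosine and sine transforms. A dilation scales the
    spectrum by l^-2, which is undone by one factor |l| from the weight |xi| and one from d xi. *)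
Lemma energy_affine f g l t : l != 0 -> L1 f -> L1 g -> finite_energy f -> finite_energy g ->
  energy (fun x => f (l * x + t)) (fun x => g (l * x + t)) = energy f g.
Proof.
move=> l0 Lf Lg ef eg; have li : l^-1 != 0 by rewrite invr_eq0.
have [L _] := energyE Lf ef Lg eg.
have n0 : `|l| != 0 by rewrite normr_eq0.
have I := Int_affine 0 li L; rewrite normfV invrK in I.
transitivity (`|l|^-1 * Int (fun x => `|l^-1 * x + 0| * spec f g (l^-1 * x + 0))); last by rewrite I mulKf.
rewrite -IntZ; last exact: (L1_affine 0 li L).
apply: eq_Int => xi.
rewrite addr0 spec_affine// (mulrC l^-1) normrM normfV -[l^-1 ^+ 2]real_normK ?num_real// normfV.
by rewrite expr2; ring.
Qed.

Lemma half_derivD f g xi : L1 f -> L1 g ->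
  half_deriv (fun x => f x + g x) xi = half_deriv f xi + half_deriv g xi.
Proof.
move=> Lf Lg; rewrite /half_deriv !hartE//; last exact: L1D.
by rewrite ctD// stD//; ring.
Qed.

Lemma half_derivZ c f xi : L1 f -> half_deriv (fun x => c * f x) xi = c * half_deriv f xi.
Proof.
move=> Lf; rewrite /half_deriv !hartE//; last exact: L1Z.
by rewrite ctZ// stZ//; ring.
Qed.

Lemma finite_energyP f : L1 f -> L2 (half_deriv f) -> finite_energy f.
Proof.
move=> Lf [_ L]; have L' := L1D L (L1_opp L).
apply: eq_L1 (L1Z 2^-1 L') => xi.
rewrite /half_deriv normrN !exprMn sqr_sqrtr// -mulrDr !expr2 hart_spec//; by field.
Qed.

Lemma finite_energyD f g : L1 f -> L1 g -> finite_energy f -> finite_energy g ->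
  finite_energy (fun x => f x + g x).
Proof.
move=> Lf Lg ef eg; apply: finite_energyP; first exact: L1D.
by apply: eq_L2 (L2D (L2_half_deriv Lf ef) (L2_half_deriv Lg eg)) => xi; rewrite half_derivD.
Qed.

Lemma finite_energyZ c f : L1 f -> finite_energy f -> finite_energy (fun x => c * f x).
Proof.
move=> Lf ef; apply: finite_energyP; first exact: L1Z.
by apply: eq_L2 (L2Z c (L2_half_deriv Lf ef)) => xi; rewrite half_derivZ.
Qed.

Lemma energy_sqnorm f : L1 f -> finite_energy f -> energy f f = sqnorm (half_deriv f).
Proof. by move=> Lf ef; have [_ <-] := energyE Lf ef Lf ef; apply: eq_Int => xi; rewrite expr2. Qed.

Lemma energy_ge0 f : 0 <= energy f f.
Proof. by apply: Int_ge0 => xi; rewrite mulr_ge0// spec_ge0. Qed.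

Lemma energyD f g : L1 f -> L1 g -> finite_energy f -> finite_energy g ->
  energy (fun x => f x + g x) (fun x => f x + g x) = energy f f + 2 * energy f g + energy g g.
Proof.
move=> Lf Lg ef eg; have [_ <-] := energyE Lf ef Lg eg.
have Hf := L2_half_deriv Lf ef; have Hg := L2_half_deriv Lg eg.
rewrite !energy_sqnorm//; [|exact: L1D|exact: finite_energyD].
by rewrite -sqnormD2//; apply: eq_Int => xi; rewrite half_derivD.
Qed.

Lemma energyZ c f : L1 f -> finite_energy f ->
  energy (fun x => c * f x) (fun x => c * f x) = c ^+ 2 * energy f f.
Proof.
move=> Lf ef; rewrite !energy_sqnorm//; [|exact: L1Z|exact: finite_energyZ].
by rewrite -sqnormZ; [apply: eq_Int => xi; rewrite half_derivZ|exact: L2_half_deriv].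
Qed.

Lemma energyDr f g k : L1 f -> L1 g -> L1 k -> finite_energy f -> finite_energy g ->
  finite_energy k ->
  energy f (fun x => g x + k x) = energy f g + energy f k.
Proof.
move=> Lf Lg Lk ef eg ek.
have [_ <-] := energyE Lf ef Lg eg; have [_ <-] := energyE Lf ef Lk ek.
have [_ <-] := energyE Lf ef (L1D Lg Lk) (finite_energyD Lg Lk eg ek).
have Hf := L2_half_deriv Lf ef; have Hg := L2_half_deriv Lg eg; have Hk := L2_half_deriv Lk ek.
rewrite -IntD; [|exact: L2_mul..].
by apply: eq_Int => xi; rewrite half_derivD// mulrDr.
Qed.

Lemma energy_CS f g : L1 f -> L1 g -> finite_energy f -> finite_energy g ->
  `|energy f g| <= Num.sqrt (energy f f) * Num.sqrt (energy g g).
Proof.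
move=> Lf Lg ef eg; have [_ <-] := energyE Lf ef Lg eg.
by rewrite !energy_sqnorm//; apply: dot_CS; exact: L2_half_deriv.
Qed.

Lemma energyD_le f g : L1 f -> L1 g -> finite_energy f -> finite_energy g ->
  energy (fun x => f x + g x) (fun x => f x + g x) <= 2 * energy f f + 2 * energy g g.
Proof.
move=> Lf Lg ef eg; rewrite !energy_sqnorm//; [|exact: L1D|exact: finite_energyD].
apply: le_trans (sqnormD_le (L2_half_deriv Lf ef) (L2_half_deriv Lg eg)).
by rewrite le_eqVlt; apply/orP; left; apply/eqP; apply: eq_Int => xi; rewrite half_derivD.
Qed.

(* [q] is the derivative of [f] in the sense of Fourier transforms. *)
Definition fourier_deriv f q :=
  [/\ L1 f, L1 q & forall xi, ct q xi = xi * st f xi /\ st q xi = - xi * ct f xi].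

Lemma fourier_derivD f g p q : fourier_deriv f p -> fourier_deriv g q ->
  fourier_deriv (fun x => f x + g x) (fun x => p x + q x).
Proof.
move=> [Lf Lp h1] [Lg Lq h2]; split; [exact: L1D|exact: L1D|move=> xi].
have [a1 b1] := h1 xi; have [a2 b2] := h2 xi.
by rewrite !ctD// !stD// a1 b1 a2 b2; split; ring.
Qed.

Lemma fourier_derivZ c f q : fourier_deriv f q ->
  fourier_deriv (fun x => c * f x) (fun x => c * q x).
Proof.
move=> [Lf Lq h]; split; [exact: L1Z|exact: L1Z|move=> xi].
by have [a1 b1] := h xi; rewrite !ctZ// !stZ// a1 b1; split; ring.
Qed.

Lemma fourier_deriv_affine f q l t : l != 0 -> fourier_deriv f q ->
  fourier_deriv (fun x => f (l * x + t)) (fun x => l * q (l * x + t)).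
Proof.
move=> l0 [Lf Lq h]; have Lfa := L1_affine t l0 Lf; have Lqa := L1_affine t l0 Lq.
split => //; first exact: L1Z.
move=> xi; rewrite ctZ// stZ// !ct_affine// !st_affine//.
have [-> ->] := h (xi / l); have : xi = xi / l * l by rewrite divfK.
by generalize (xi / l) => eta ->; split; ring.
Qed.

Lemma fourier_deriv_spec f q xi : fourier_deriv f q -> spec q q xi = xi ^+ 2 * spec f f xi.
Proof. by move=> [_ _ h]; have [a b] := h xi; rewrite /spec a b; ring. Qed.

(** Interpolation by |xi| <= (c + xi^2 / c) / 2 followed by Plancherel. The weight [c] stays free
    because [energy_stretch_smooth] lets it grow with the inverse step. *)
Lemma energy_bound f q c : 0 < c -> fourier_deriv f q -> L2 f -> L2 q ->
  finite_energy f /\ energy f f <= pi * (c * sqnorm f + c^-1 * sqnorm q).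
Proof.
move=> c0 fq Lf2 Lq2; have [Lf Lq _] := fq.
have [Sf If] := plancherel_spec Lf Lf2 Lf Lf2; have [Sq Iq] := plancherel_spec Lq Lq2 Lq Lq2.
have LS : L1 (fun xi => 2^-1 * (c * spec f f xi + c^-1 * spec q q xi)).
  by apply: L1Z; apply: L1D; exact: L1Z.
have le xi : `|xi| * spec f f xi <= 2^-1 * (c * spec f f xi + c^-1 * spec q q xi).
  rewrite (fourier_deriv_spec _ fq) -(@real_normK _ xi) ?num_real//.
  rewrite (_ : 2^-1 * _ = 2^-1 * (c + c^-1 * `|xi| ^+ 2) * spec f f xi); last by ring.
  rewrite ler_wpM2r ?spec_ge0//.
  have : 0 <= c^-1 * (`|xi| - c) ^+ 2 by rewrite mulr_ge0 ?sqr_ge0// invr_ge0 ltW.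
  rewrite (_ : c^-1 * (`|xi| - c) ^+ 2 = c^-1 * `|xi| ^+ 2 - 2 * `|xi| + c); last by field; rewrite gt_eqF.
  lra.
have ef : finite_energy f.
  apply: (L1_le LS).
    apply: measurable_funM; last exact: spec_meas.
    by apply: continuous_measurable_fun; exact: norm_continuous.
  by move=> xi; rewrite ger0_norm ?mulr_ge0 ?spec_ge0.
split => //; apply: le_trans (Int_le ef LS le) _.
rewrite IntZ; last by apply: L1D; exact: L1Z.
rewrite IntD; [|exact: L1Z..]; rewrite !IntZ// If Iq.
rewrite le_eqVlt; apply/orP; left; apply/eqP.
have E k : Int (fun x => k x * k x) = sqnorm k by apply: eq_Int => x; rewrite expr2.
by rewrite !E; generalize (@pi R) => p; field; rewrite gt_eqF.
Qed.

(** Isolates the integration by parts that both transforms share: it is used with [X] the cosine and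
    the sine at frequency xi. *)
Lemma fourier_derivI f q : L1 f -> L1 q ->
  (forall (X dX : R -> R) , (forall x, is_derive x 1 X (dX x)) -> continuous dX ->
     (forall x, `|X x| <= 1) ->
     L1 (fun x => q x * X x) -> L1 (fun x => f x * dX x) ->
     Int (fun x => q x * X x + f x * dX x) = 0) ->
  fourier_deriv f q.
Proof.
move=> Lf Lq H; split => // xi; split.
- have L' : L1 (fun x => f x * (- sin (x * xi) * xi)).
    by apply: eq_L1 (L1Z (- xi) (L1_sin xi Lf)) => x; ring.
  have Lc := L1_cos xi Lq.
  have d1 x : is_derive x 1 (fun x => cos (x * xi)) (- sin (x * xi) * xi) by isd; ring.
  have d2 : continuous (fun x => - sin (x * xi) * xi) by move=> x; isd_cont.
  have := H _ _ d1 d2 (fun x => norm_cos _) Lc L'.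
  rewrite (IntD Lc L') (_ : Int (fun x => f x * _) = - xi * st f xi); last first.
    by rewrite /st -IntZ; [apply: eq_Int => x; ring|exact: L1_sin].
  rewrite -/(ct q xi); lra.
- have L' : L1 (fun x => f x * (cos (x * xi) * xi)).
    by apply: eq_L1 (L1Z xi (L1_cos xi Lf)) => x; ring.
  have Lc := L1_sin xi Lq.
  have d1 x : is_derive x 1 (fun x => sin (x * xi)) (cos (x * xi) * xi) by isd; ring.
  have d2 : continuous (fun x => cos (x * xi) * xi) by move=> x; isd_cont.
  have := H _ _ d1 d2 (fun x => norm_sin _) Lc L'.
  rewrite (IntD Lc L') (_ : Int (fun x => f x * _) = xi * ct f xi); last first.
    by rewrite /ct -IntZ; [apply: eq_Int => x; ring|exact: L1_cos].
  rewrite -/(st q xi); lra.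
Qed.

(** [q] may be unbounded at 0, as it is for the model; only the limit of [f] enters the boundary
    term. *)
Lemma fourier_deriv_halfline f q : L1 f -> L1 q ->
  (forall x, x <= 0 -> f x = 0 /\ q x = 0) ->
  f x @[x --> 0^'+] --> 0 -> (fun n => f n.+1%:R) @ \oo --> 0 ->
  (forall x, 0 < x -> is_derive x 1 f (q x)) ->
  (forall x, 0 < x -> {for x, continuous q}) -> fourier_deriv f q.
Proof.
move=> Lf Lq f0 fr fl df cq; apply: fourier_derivI => // X dX dXE cdX X1 LX LdX.
have LL := L1D LX LdX.
have E : (fun x => q x * X x + f x * dX x) \_ `]0, +oo[ = (fun x => q x * X x + f x * dX x).
  apply/funext => x; rewrite patchE; case: ifPn => //.
  rewrite mem_setE/= in_itv/= andbT -leNgt => x0.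
  by have [-> ->] := f0 x x0; rewrite !mul0r addr0.
have f00 : f 0 = 0 by have [] := f0 0 (lexx 0).
rewrite -[RHS]subr0 -{2}[0](_ : f 0 * X 0 = 0); last by rewrite f00 mul0r.
rewrite -E; apply: (@FTC_halfline R 0 (fun x => f x * X x)).
- rewrite f00 mul0r -[X in _ --> X](mul0r (X 0)); apply: cvgM => //.
  by apply: cvg_at_right_filter; exact: isd_continuous (dXE 0).
- by move=> x x0; exact: (isdM (df x x0) (dXE x)).
- move=> x x0; apply: cvgD; apply: cvgM.
  + exact: cq.
  + exact: isd_continuous (dXE x).
  + exact: isd_continuous (df x x0).
  + exact: cdX.
- apply: (@cvgn_squeeze _ _ (fun n => `|f n.+1%:R|)); last by rewrite -[X in _ --> X](normr0 R); apply: cvg_norm.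
  by move=> n; rewrite subr0 add0r normrM ler_piMr.
- by rewrite E.
Qed.

Lemma csupp_itv a b f : (forall x, ~~ (a < x < b) -> f x = 0) -> csupp f.
Proof.
move=> h; exists (`|a| + `|b|) => x hx; apply: h; apply/negP => /andP[ax xb].
have := ler_norm b; have := ler_norm (- a); rewrite normrN => ha hb.
have := normr_ge0 a; have := normr_ge0 b.
by move: hx; have [x0|x0] := lerP 0 x; [rewrite (ger0_norm x0)|rewrite (ltr0_norm x0)]; lra.
Qed.

Lemma fourier_deriv_open a b f q : a < b -> L1 f -> L1 q ->
  (forall x, ~~ (a < x < b) -> f x = 0 /\ q x = 0) ->
  continuous f ->
  (forall x, a < x < b -> is_derive x 1 f (q x)) ->
  (forall x, a < x < b -> {for x, continuous q}) -> fourier_deriv f q.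
Proof.
move=> ab Lf Lq f0 cf df cq; apply: fourier_derivI => // X dX dXE cdX X1 LX LdX.
have LL := L1D LX LdX.
have E : (fun x => q x * X x + f x * dX x) \_ `]a, b[ = (fun x => q x * X x + f x * dX x).
  apply/funext => x; rewrite patchE; case: ifPn => //.
  rewrite mem_setE/= in_itv/= => x0.
  by have [-> ->] := f0 x x0; rewrite !mul0r addr0.
have cX : continuous (fun x => f x * X x).
  by move=> x; apply: cvgM; [exact: cf|exact: isd_continuous (dXE x)].
have fa : f a = 0 by have [] := f0 a; rewrite ?ltxx.
have fb : f b = 0 by have [] := f0 b; rewrite ?ltxx ?andbF.
transitivity (f b * X b - f a * X a); last by rewrite fa fb !mul0r subrr.
rewrite -E; apply: (@FTC_open R a b (fun x => f x * X x)) => //.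
- exact: cvg_at_right_filter (cX a).
- exact: cvg_at_left_filter (cX b).
- by move=> x x0; exact: (isdM (df x x0) (dXE x)).
- move=> x x0; apply: cvgD; apply: cvgM.
  + exact: cq.
  + exact: isd_continuous (dXE x).
  + exact: cf.
  + exact: cdX.
- by rewrite E.
Qed.

Lemma continuous_csupp_bounded f : continuous f -> csupp f ->
  exists M N, 0 <= M /\ forall x, `|f x| <= M * box N x.
Proof.
move=> cf [N hN].
have cn : {within `[- `|N|, `|N|], continuous (fun x => `|f x|)}.
  by apply: continuous_subspaceT => x; apply: continuous_comp; [exact: cf|exact: norm_continuous].
have N0 : - `|N| <= `|N| by rewrite (@le_trans _ _ 0)// oppr_le0.
have [m _ hm] := EVT_max N0 cn.
exists `|f m|, `|N|; split => // x; have [h|h] := lerP `|x| `|N|.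
  by rewrite box_in// mulr1; apply: hm; rewrite in_itv/= -ler_norml.
by rewrite box_out// mulr0 hN ?normr0// (le_lt_trans (ler_norm _)).
Qed.

Lemma box_le1 N x : box N x <= 1 :> R.
Proof. by rewrite /box; case: ifP. Qed.

Lemma continuous_csupp_L2 f : continuous f -> csupp f -> L2 f.
Proof.
move=> cf sf; have [M [N [M0 h]]] := continuous_csupp_bounded cf sf.
apply: (L2_le (g := fun x => M * box N x)) => //; last exact: continuous_measurable_fun.
split; first by apply: measurable_funM => //; exact: box_meas.
apply: eq_L1 (L1Z (M ^+ 2) (L1_box N)) => x.
by rewrite exprMn /box; case: ifP; rewrite ?expr1n ?expr0n.
Qed.

Lemma test_fun_energy a b phi : a < b -> test_function a b phi ->
  [/\ csupp phi, L2 phi & finite_energy phi].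
Proof.
move=> ab tp; have [cp dp cdp [c [d [ac cd db p0]]]] := test_fun_props ab tp.
have sp := csupp_itv p0.
have d0 x : ~~ (a < x < b) -> derive1 phi x = 0.
  move=> h; have nz : \forall y \near x, (fun _ : R => 0) y = phi y.
    move: h; rewrite negb_and -!leNgt => /orP[xa|bx].
      near=> y; rewrite p0//; apply/negP => /andP[cy _]; have : y < c; last by lra.
      by near: y; apply: lt_nbhsl; lra.
    near=> y; rewrite p0//; apply/negP => /andP[_ yd]; have : d < y; last by lra.
    by near: y; apply: lt_nbhsr; lra.
  by rewrite derive1E -(near_eq_derive _ nz) derive_cst.
have sd := csupp_itv d0.
have Lp := continuous_csupp_L2 cp sp; have Ld := continuous_csupp_L2 cdp sd.
split => //; have F : fourier_deriv phi (derive1 phi).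
  apply: (fourier_deriv_open ab) => //; [exact: csupp_L1|exact: csupp_L1| |].
    move=> x h; split; last exact: d0.
    by apply: p0; apply: contra h => /andP[h1 h2]; apply/andP; split; lra.
  by move=> x _; exact: cdp.
by have [] := energy_bound ltr01 F Lp Ld.
Unshelve. all: by end_near. Qed.

End Energy.

(** * The end point singularity sqrt x * exp (- x) *)

Section Model.
Context {R : realType}.
Implicit Types (f g k q : R -> R) (a b c d e t x y xi l s : R).

Definition onpos f x := if 0 < x then f x else 0 : R.

Lemma onpos_pos f x : 0 < x -> onpos f x = f x.
Proof. by rewrite /onpos => ->. Qed.

Lemma onpos_neg f x : x <= 0 -> onpos f x = 0.
Proof. by rewrite /onpos leNgt => /negbTE ->. Qed.

Lemma onpos_patch f : onpos f = f \_ `]0, +oo[.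
Proof. by apply/funext => x; rewrite /onpos patchE mem_setE/= in_itv/= andbT. Qed.

Lemma onpos_meas f : (forall x, 0 < x -> {for x, continuous f}) -> measurable_fun setT (onpos f).
Proof.
move=> cf; rewrite onpos_patch; apply/(measurable_restrictT _ (measurable_itv _)).
apply: open_continuous_measurable_fun; first exact: interval_open.
by move=> x; rewrite inE/= in_itv/= andbT; exact: cf.
Qed.

(** Integrable at 0, like x^(-1/2), and at infinity, like x^(-3/2), with the bounded primitive 2
    atan (sqrt x). *)
Definition major x : R := (Num.sqrt x * (1 + x))^-1.

Lemma L1_major : L1 (onpos major).
Proof.
rewrite onpos_patch; apply: (@L1_halfline _ _ (fun x => 2 * atan (Num.sqrt x)) _ pi).
- by move=> x x0; rewrite invr_ge0 mulr_ge0 ?sqrtr_ge0// addr_ge0// ltW.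
- move=> x x0; have h : is_derive (Num.sqrt x) 1 (@atan R) (1 + Num.sqrt x ^+ 2)^-1.
    by apply: DeriveDef; [exact: derivable_atan|rewrite -derive1E derive1_atan].
  have h2 := isd_comp h (isd_sqrt x0 (isd_id x)).
  apply: isd_eq (isdM (isd_cst 2 x) h2) _.
  rewrite sqr_sqrtr ?ltW// /major; field.
  by apply/andP; split; rewrite gt_eqF ?sqrtr_gt0// ltr_wpDr// ltW.
- move=> x x0; rewrite /major; isd_cont => //.
  by rewrite mulf_neq0// gt_eqF ?sqrtr_gt0// ltr_wpDr// ltW.
- move=> x _; rewrite normrM ger0_norm// -ler_pdivlMl// mulrC ler_norml.
  by rewrite !ltW ?atan_gtNpi2 ?atan_ltpi2.
Qed.

Lemma L1_onpos f c : (forall x, 0 < x -> {for x, continuous f}) ->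
  (forall x, 0 < x -> `|f x| <= c * major x) -> L1 (onpos f).
Proof.
move=> cf fc; apply: (L1_le (L1Z c L1_major)); first exact: onpos_meas.
by move=> x; rewrite /onpos; case: ifPn => [/fc//|_]; rewrite normr0 mulr0.
Qed.

Lemma L2_bounded f c : L1 f -> (forall x, `|f x| <= c) -> L2 f.
Proof.
move=> Lf fc; have mf := L1_meas Lf; split => //.
by apply: eq_L1 (L1M_bounded Lf mf fc) => x; rewrite expr2.
Qed.

Lemma exp_bounds x : 0 < x -> [/\ expR (- x) <= 1, x * expR (- x) <= 1,
  x ^+ 2 * expR (- x) <= 2 & x ^+ 3 * expR (- x) <= 6].
Proof.
move=> x0; have e0 : 0 < expR x by exact: expR_gt0.
have b (y : R) (c : R) : y <= c * expR x -> y * expR (- x) <= c.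
  by move=> h; rewrite expRN ler_pdivrMr.
have h0 := expR_ge1Dx x.
have h1 := expR_ge1Dxn 1%N (ltW x0); have h2 := expR_ge1Dxn 2%N (ltW x0).
rewrite !factS fact0 in h1; rewrite !factS fact0 in h2.
have -> : expR (- x) = 1 * expR (- x) by rewrite mul1r.
split; rewrite ?mul1r; [|apply: b..].
- by rewrite -[X in _ <= X]expR0 ler_expR oppr_le0 ltW.
- by rewrite mul1r; lra.
- have : x ^+ 2 / 2 <= expR x by lra.
  by rewrite ler_pdivrMr// mulrC.
- have : x ^+ 3 / 6 <= expR x by lra.
  by rewrite ler_pdivrMr// mulrC.
Qed.

Lemma major_bound (y : R) x c : 0 < x -> 0 <= c -> `|y| * Num.sqrt x * (1 + x) <= c -> `|y| <= c * major x.
Proof.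
move=> x0 c0 h; rewrite /major ler_pdivlMr; first by rewrite mulrA.
by rewrite mulr_gt0 ?sqrtr_gt0// ltr_wpDr// ltW.
Qed.

(* Q, Q3 and dQ are the functions s^(1/2) e^(-s), s^(3/2) e^(-s) on the
   positive half-line and the derivative of the former. *)
Definition Q : R -> R := onpos (fun s => Num.sqrt s * expR (- s)).
Definition Q3 : R -> R := onpos (fun s => s * Num.sqrt s * expR (- s)).
Definition dQ : R -> R := onpos (fun s => ((2 * Num.sqrt s)^-1 - Num.sqrt s) * expR (- s)).

Lemma sqrt_pos x : 0 < x -> 0 < Num.sqrt x. Proof. by rewrite sqrtr_gt0. Qed.

Lemma sqr_sqrt x : 0 < x -> Num.sqrt x ^+ 2 = x.
Proof. by move=> x0; rewrite sqr_sqrtr// ltW. Qed.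

Lemma L1_Q : L1 Q.
Proof.
apply: (L1_onpos (c := 3)).
  by move=> x x0; isd_cont.
move=> x x0; apply: major_bound => //.
have p := sqrt_pos x0; have q := sqr_sqrt x0; have [e0 e1 e2 _] := exp_bounds x0.
rewrite ger0_norm ?mulr_ge0 ?expR_ge0 ?sqrtr_ge0//.
rewrite (_ : _ * _ * _ * _ = Num.sqrt x ^+ 2 * (1 + x) * expR (- x)); last by ring.
rewrite q; move: e1 e2; rewrite expr2; lra.
Qed.

Lemma L1_Q3 : L1 Q3.
Proof.
apply: (L1_onpos (c := 8)).
  by move=> x x0; isd_cont.
move=> x x0; apply: major_bound => //.
have p := sqrt_pos x0; have q := sqr_sqrt x0; have [e0 e1 e2 e3] := exp_bounds x0.
rewrite ger0_norm ?mulr_ge0 ?expR_ge0 ?sqrtr_ge0 ?(ltW x0)//.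
rewrite (_ : _ * _ * _ * _ = x * Num.sqrt x ^+ 2 * (1 + x) * expR (- x)); last by ring.
rewrite q; move: e2 e3; rewrite expr2 exprS expr2; lra.
Qed.

Lemma L1_dQ : L1 dQ.
Proof.
apply: (L1_onpos (c := 5)).
  by move=> x x0; isd_cont => //; rewrite mulf_neq0// gt_eqF// sqrt_pos.
move=> x x0; apply: major_bound => //.
have p := sqrt_pos x0; have q := sqr_sqrt x0; have [e0 e1 e2 _] := exp_bounds x0.
have ep := expR_gt0 (- x).
rewrite normrM (ger0_norm (expR_ge0 _)).
rewrite (_ : _ * _ * _ * _ = `|(2 * Num.sqrt x)^-1 - Num.sqrt x| * Num.sqrt x * (1 + x) * expR (- x)); last by ring.
have -> : `|(2 * Num.sqrt x)^-1 - Num.sqrt x| * Num.sqrt x = `|2^-1 - x|.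
  transitivity (`|(2 * Num.sqrt x)^-1 - Num.sqrt x| * `|Num.sqrt x|).
    by rewrite (ger0_norm (ltW p)).
  rewrite -normrM mulrBl -expr2 q; congr (`| _ - _ |).
  by field; rewrite gt_eqF.
have : `|2^-1 - x| <= 2^-1 + x by rewrite ler_norml; apply/andP; split; lra.
move=> h; apply: (@le_trans _ _ ((2^-1 + x) * (1 + x) * expR (- x))).
  by rewrite ler_wpM2r ?expR_ge0// ler_wpM2r// addr_ge0// ltW.
move: e1 e2; rewrite expr2; lra.
Qed.

Lemma sqrt_le_1D x : 0 < x -> Num.sqrt x <= 1 + x.
Proof. by move=> x0; have := sqr_ge0 (Num.sqrt x - 1); have := sqr_sqrt x0; have := sqrt_pos x0; nra. Qed.

Lemma Q_ge0 x : 0 <= Q x.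
Proof. by rewrite /Q /onpos; case: ifP => // _; rewrite mulr_ge0 ?sqrtr_ge0 ?expR_ge0. Qed.

Lemma Q3_ge0 x : 0 <= Q3 x.
Proof. by rewrite /Q3 /onpos; case: ifPn => // x0; rewrite !mulr_ge0 ?sqrtr_ge0 ?expR_ge0// ltW. Qed.

Lemma Q_le x : Q x <= 2.
Proof.
rewrite /Q /onpos; case: ifPn => // x0.
have [e0 e1 _ _] := exp_bounds x0; have := sqrt_le_1D x0 => h.
apply: (@le_trans _ _ ((1 + x) * expR (- x))); first by rewrite ler_wpM2r ?expR_ge0.
lra.
Qed.

Lemma Q3_le x : Q3 x <= 3.
Proof.
rewrite /Q3 /onpos; case: ifPn => // x0.
have [e0 e1 e2 _] := exp_bounds x0; have := sqrt_le_1D x0 => h.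
apply: (@le_trans _ _ (x * (1 + x) * expR (- x))).
  by rewrite ler_wpM2r ?expR_ge0// ler_wpM2l// ltW.
move: e2; rewrite expr2; lra.
Qed.

Lemma L2_Q : L2 Q.
Proof. by apply: (L2_bounded (c := 2) L1_Q) => x; rewrite ger0_norm ?Q_ge0 ?Q_le. Qed.

Lemma L2_Q3 : L2 Q3.
Proof. by apply: (L2_bounded (c := 3) L1_Q3) => x; rewrite ger0_norm ?Q3_ge0 ?Q3_le. Qed.

Lemma sqrt_cvg0 : Num.sqrt x @[x --> (0 : R)^'+] --> (0 : R).
Proof.
by apply: cvg_at_right_filter; rewrite -[X in _ --> X]sqrtr0; exact: sqrt_continuous.
Qed.

Lemma onpos_cvg0 f : f x @[x --> (0 : R)^'+] --> (0 : R) -> onpos f x @[x --> (0 : R)^'+] --> (0 : R).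
Proof.
apply: cvg_trans; apply: near_eq_cvg; near=> x; rewrite onpos_pos//; near: x; exact: nbhs_right_gt.
Unshelve. all: by end_near. Qed.

Lemma isd_onpos f x d : 0 < x -> is_derive x 1 f d -> is_derive x 1 (onpos f) d.
Proof.
move=> x0; apply: near_eq_is_derive; near=> y; rewrite onpos_pos//.
near: y; exact: lt_nbhsr.
Unshelve. all: by end_near. Qed.

Lemma onpos_continuous f x : 0 < x -> {for x, continuous f} -> {for x, continuous (onpos f)}.
Proof.
move=> x0 cf; rewrite /prop_for /continuous_at onpos_pos//; move: cf.
apply: cvg_trans; apply: near_eq_cvg; near=> y; rewrite onpos_pos//.
near: y; exact: lt_nbhsr.
Unshelve. all: by end_near. Qed.

Lemma Q_cvg0 : Q x @[x --> (0 : R)^'+] --> (0 : R).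
Proof.
have ce : {for (0 : R), continuous (fun x : R => expR (- x))} by isd_cont.
have := cvgM sqrt_cvg0 (cvg_at_right_filter ce).
by rewrite mul0r => h; apply: onpos_cvg0; exact: h.
Qed.

Lemma fourier_deriv_Q : fourier_deriv Q dQ.
Proof.
apply: fourier_deriv_halfline; [exact: L1_Q|exact: L1_dQ| | | | | ].
- by move=> x x0; rewrite /Q /dQ !onpos_neg.
- exact: Q_cvg0.
- apply: (@cvgn_squeeze _ _ (fun n => 2 * Num.sqrt (n.+1%:R^-1))).
    move=> n; rewrite subr0 ger0_norm ?Q_ge0// /Q onpos_pos//.
    have x0 : 0 < n.+1%:R :> R by rewrite ltr0n.
    have [_ e1 _ _] := exp_bounds x0; have p := sqrt_pos x0.
    rewrite sqrtrV ?ler0n// -[X in _ <= X]mulr1.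
    rewrite -ler_pdivrMl; last by rewrite mulr_gt0// invr_gt0.
    rewrite invfM invrK mulrA -(mulrA 2^-1) -expr2 sqr_sqrt// -mulrA; lra.
  rewrite -[X in _ --> X](mulr0 2); apply: cvgM; first exact: cvg_cst.
  by apply: cvg_sqrt0; exact: cvg_invS.
- move=> x x0; rewrite /dQ onpos_pos//; apply: isd_onpos => //.
  by isd => //; field; rewrite gt_eqF// sqrt_pos.
- move=> x x0; apply: onpos_continuous => //.
  by isd_cont => //; rewrite mulf_neq0// gt_eqF// sqrt_pos.
Qed.

(** Closes a linear system: differentiating the transforms of Q in xi produces those of Q3, and this
    relation expresses the latter through Q again. *)
Lemma fourier_deriv_Q3 : fourier_deriv Q3 (fun x => 3 / 2 * Q x + -1 * Q3 x).
Proof.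
apply: fourier_deriv_halfline; [exact: L1_Q3| | | | | | ].
- by apply: L1D; apply: L1Z; [exact: L1_Q|exact: L1_Q3].
- by move=> x x0; rewrite /Q /Q3 !onpos_neg// !mulr0 addr0.
- have ce : {for (0 : R), continuous (fun x : R => x * expR (- x))} by isd_cont.
  have h : Num.sqrt x * (x * expR (- x)) @[x --> (0 : R)^'+] --> 0 * (0 * expR (- 0)).
    exact: cvgM sqrt_cvg0 (cvg_at_right_filter ce).
  rewrite mul0r in h; apply: onpos_cvg0; move: h; apply: cvg_trans.
  by apply: near_eq_cvg; near=> x; rewrite mulrCA mulrA.
- apply: (@cvgn_squeeze _ _ (fun n => 2 * Num.sqrt (n.+1%:R^-1))).
    move=> n; rewrite subr0 ger0_norm ?Q3_ge0// /Q3 onpos_pos//.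
    have x0 : 0 < n.+1%:R :> R by rewrite ltr0n.
    have [_ _ e2 _] := exp_bounds x0; have p := sqrt_pos x0.
    rewrite sqrtrV ?ler0n// -[X in _ <= X]mulr1.
    rewrite -ler_pdivrMl; last by rewrite mulr_gt0// invr_gt0.
    rewrite invfM invrK.
    set s := Num.sqrt _ in p *; set e := expR _ in e2 *.
    have -> : 2^-1 * s * (n.+1%:R * s * e) = 2^-1 * (s ^+ 2 * n.+1%:R * e) by ring.
    by rewrite sqr_sqrt// -expr2; lra.
  rewrite -[X in _ --> X](mulr0 2); apply: cvgM; first exact: cvg_cst.
  by apply: cvg_sqrt0; exact: cvg_invS.
- move=> x x0; rewrite /Q /Q3 !onpos_pos//; apply: isd_onpos => //.
  isd => //; have p := sqrt_pos x0; have q := sqr_sqrt x0.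
  by rewrite -{2}q; field; rewrite gt_eqF.
- move=> x x0; apply: cvgD; apply: cvgM; try exact: cvg_cst; apply: onpos_continuous => //; by isd_cont.
Unshelve. all: by end_near. Qed.

Lemma isd_ctQ xi : is_derive xi 1 (ct Q) (- st Q3 xi).
Proof.
have E : - st Q3 xi = Int (fun s => Q s * (- sin (s * xi) * s)).
  rewrite /st -IntN; last exact: L1_sin L1_Q3.
  by apply: eq_Int => s; rewrite /Q /Q3 /onpos; case: ifP => _; ring.
rewrite E; apply: (@isd_Int R (fun xi s => Q s * cos (s * xi)) (fun xi s => Q s * (- sin (s * xi) * s)) Q3 xi).
- by move=> x; exact: L1_cos L1_Q.
- by move=> x y; isd; ring.
- exact: L1_Q3.
- move=> x y _; rewrite /Q /Q3 /onpos; case: ifPn => y0; last by rewrite mul0r normr0.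
  rewrite !normrM normrN (gtr0_norm y0) (ger0_norm (expR_ge0 _)) (ger0_norm (sqrtr_ge0 _)).
  have e0 : 0 <= Num.sqrt y * expR (- y) by rewrite mulr_ge0 ?sqrtr_ge0 ?expR_ge0.
  rewrite (_ : y * _ * _ = Num.sqrt y * expR (- y) * y); last by ring.
  by rewrite ler_wpM2l// ler_piMl ?norm_sin// ltW.
Qed.

Lemma isd_stQ xi : is_derive xi 1 (st Q) (ct Q3 xi).
Proof.
have E : ct Q3 xi = Int (fun s => Q s * (cos (s * xi) * s)).
  by apply: eq_Int => s; rewrite /Q /Q3 /onpos; case: ifP => _; ring.
rewrite E; apply: (@isd_Int R (fun xi s => Q s * sin (s * xi)) (fun xi s => Q s * (cos (s * xi) * s)) Q3 xi).
- by move=> x; exact: L1_sin L1_Q.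
- by move=> x y; isd; ring.
- exact: L1_Q3.
- move=> x y _; rewrite /Q /Q3 /onpos; case: ifPn => y0; last by rewrite mul0r normr0.
  rewrite !normrM (gtr0_norm y0) (ger0_norm (expR_ge0 _)) (ger0_norm (sqrtr_ge0 _)).
  have e0 : 0 <= Num.sqrt y * expR (- y) by rewrite mulr_ge0 ?sqrtr_ge0 ?expR_ge0.
  rewrite (_ : y * _ * _ = Num.sqrt y * expR (- y) * y); last by ring.
  by rewrite ler_wpM2l// ler_piMl ?norm_cos// ltW.
Qed.

Lemma onesq_sqrt_gt0 xi : 0 < (1 + xi ^+ 2) * Num.sqrt (1 + xi ^+ 2).
Proof. by rewrite mulr_gt0 ?onesq_gt0// sqrtr_gt0 onesq_gt0. Qed.

(* The transform of Q is Gamma(3/2) (1 + i xi)^(-3/2): its square modulus solves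
   a first-order linear equation. *)
Lemma specQ_shape : exists c, 0 <= c /\
  forall xi, spec Q Q xi = c / ((1 + xi ^+ 2) * Num.sqrt (1 + xi ^+ 2)).
Proof.
(* The expected shape is c (1 + xi^2)^(-3/2); squaring it makes the conserved quantity polynomial in
   1 + xi^2. *)
have H xi : is_derive xi 1 (fun xi => spec Q Q xi ^+ 2 * (1 + xi ^+ 2) ^+ 3) 0.
  have dA := isd_ctQ xi; have dB := isd_stQ xi; rewrite /spec; isd.
  have [_ _ h] := fourier_deriv_Q3; have [h1 h2] := h xi.
  move: h1 h2; rewrite !ctD ?stD ?ctZ ?stZ; [|exact: L1_Q3|exact: L1_Q|exact: L1_Q3|exact: L1_Q|
    exact: L1Z L1_Q|exact: L1Z L1_Q3|exact: L1Z L1_Q|exact: L1Z L1_Q3].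
  set A := ct Q xi; set B := st Q xi; set A3 := ct Q3 xi; set B3 := st Q3 xi => h1 h2.
  have p := onesq_gt0 xi.
  (* The two relations form a linear system for A3 and B3 with determinant 1 + xi^2. *)
  have e1 : (1 + xi ^+ 2) * A3 = 3 / 2 * (A - xi * B) by nra.
  have e2 : (1 + xi ^+ 2) * B3 = 3 / 2 * (B + xi * A) by nra.
  have E : (1 + xi ^+ 2) * (A * - B3 + B * A3) = - (3 / 2) * xi * (A * A + B * B).
    rewrite mulrDr (mulrCA _ A) (mulrCA _ B) mulrN e1 e2; ring.
  transitivity ((1 + xi ^+ 2) ^+ 2 * (A * A + B * B) *
    (4 * ((1 + xi ^+ 2) * (A * - B3 + B * A3)) + 6 * xi * (A * A + B * B))).
    by rewrite -/A -/B; ring.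
  by rewrite E; field.
exists (spec Q Q 0); split; first exact: spec_ge0.
move=> xi.
have cst : spec Q Q xi ^+ 2 * (1 + xi ^+ 2) ^+ 3 = spec Q Q 0 ^+ 2.
  have := is_derive_0_is_cst xi 0 H; rewrite /= => ->.
  by rewrite expr0n/= addr0 expr1n mulr1.
have p := onesq_sqrt_gt0 xi; have q := onesq_gt0 xi.
have h : spec Q Q xi * ((1 + xi ^+ 2) * Num.sqrt (1 + xi ^+ 2)) = spec Q Q 0.
  apply/eqP; rewrite -(@eqrXn2 _ 2)// ?mulr_ge0 ?spec_ge0 ?sqrtr_ge0 ?(ltW q)//.
  by rewrite -cst exprMn exprMn sqr_sqrtr ?(ltW q)// -exprSr.
by rewrite -h mulfK// gt_eqF.
Qed.

End Model.

(** * The spectrum of the model and two explicit integrals *)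

Section Model2.
Context {R : realType}.
Implicit Types (f g k q : R -> R) (a b c d e t x y xi l s : R).
Local Notation mu := (@lebesgue_measure R).

Definition cauchy32 xi : R := ((1 + xi ^+ 2) * Num.sqrt (1 + xi ^+ 2))^-1.

Lemma isd_cauchy32 x : is_derive x 1 (fun x : R => x / Num.sqrt (1 + x ^+ 2)) (cauchy32 x).
Proof.
have p := onesq_gt0 x; have q := sqrt_pos p; have r := sqr_sqrt p.
isd => //; first by rewrite gt_eqF.
rewrite /cauchy32 /=; set w := Num.sqrt _ in q r *.
have w0 : w != 0 by rewrite gt_eqF.
rewrite -{}r; apply: (@mulIf _ (w ^+ 3)); first by rewrite expf_neq0.
rewrite [RHS](_ : _ = 1); last by field.
rewrite [LHS](_ : _ = w ^+ 2 - x ^+ 2); last by rewrite expr1; field.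
rewrite /w sqr_sqrt//; ring.
Qed.

Lemma cauchy32_continuous x : {for x, continuous cauchy32}.
Proof.
have p := onesq_sqrt_gt0 x; have q := onesq_gt0 x.
by rewrite /cauchy32; isd_cont => //; rewrite gt_eqF.
Qed.

Lemma cauchy32_ge0 x : 0 <= cauchy32 x.
Proof. by rewrite invr_ge0 ltW// onesq_sqrt_gt0. Qed.

Lemma Int_cauchy32 : L1 cauchy32 /\ Int cauchy32 = 2.
Proof.
have mc : measurable_fun setT cauchy32.
  by apply: continuous_measurable_fun => x; exact: cauchy32_continuous.
have b1 x : `|x / Num.sqrt (1 + x ^+ 2)| <= 1.
  have q := sqrt_pos (onesq_gt0 x).
  rewrite normrM normfV (gtr0_norm q) ler_pdivrMr// mul1r -sqrtr_sqr ler_wsqrtr//.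
  by rewrite lerDr.
have L : L1 (cauchy32 \_ `]0, +oo[).
  apply: (L1_halfline (M := 1)) => x x0; [exact: cauchy32_ge0|exact: isd_cauchy32|exact: cauchy32_continuous|exact: b1].
have [|-> ->] := L1_even mc _ L; first by move=> x; rewrite /cauchy32 sqrrN.
split => //; have -> : Int (cauchy32 \_ `]0, +oo[) = 1 - 0 / Num.sqrt (1 + 0 ^+ 2); last by rewrite mul0r subr0 mulr1.
apply: (@FTC_halfline _ _ (fun x : R => x / Num.sqrt (1 + x ^+ 2))) => //.
- have c : {for (0 : R), continuous (fun x : R => x / Num.sqrt (1 + x ^+ 2))}.
    by have p := onesq_gt0 (0 : R); isd_cont => //; rewrite gt_eqF// sqrt_pos.
  exact: cvg_at_right_filter.
- by move=> x _; exact: isd_cauchy32.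
- by move=> x _; exact: cauchy32_continuous.
- apply: cvgn_squeeze (@cvg_invS R) => n; rewrite add0r.
  set x : R := n.+1%:R; have x0 : 0 < x by rewrite ltr0n.
  have q := sqrt_pos (onesq_gt0 x); have r := sqr_sqrt (onesq_gt0 x).
  set w := Num.sqrt _ in q r *.
  have h1 : w <= 1 + x by nra.
  have h2 : x <= w by nra.
  rewrite distrC ger0_norm; last by rewrite subr_ge0 ler_pdivrMr// mul1r.
  rewrite -(@ler_pM2r _ (x * w)) ?mulr_gt0// mulKf ?gt_eqF//.
  rewrite (_ : (1 - x / w) * (x * w) = x * (w - x)); last by field; rewrite gt_eqF.
  nra.
Qed.

Lemma sqnorm_Q : sqnorm (@Q R) = 4^-1.
Proof.
have E : (fun x => Q x ^+ 2) = (fun s : R => s * expR (- (2 * s))) \_ `]0, +oo[.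
  apply/funext => x; rewrite -onpos_patch /Q /onpos; case: ifPn => x0; last by rewrite expr0n.
  rewrite exprMn sqr_sqrt// expr2 -expRD; congr (_ * expR _); ring.
have L := (@L2_Q R).2; rewrite /sqnorm; rewrite E in L *.
transitivity (0 - (fun s : R => - (s / 2 + 4^-1) * expR (- (2 * s))) 0); last first.
  by rewrite /= mulr0 oppr0 expR0 mul0r add0r mulr1 add0r opprK.
apply: (@FTC_halfline _ _ (fun s : R => - (s / 2 + 4^-1) * expR (- (2 * s)))) => //.
- have c : {for (0 : R), continuous (fun s : R => - (s / 2 + 4^-1) * expR (- (2 * s)))} by isd_cont.
  exact: cvg_at_right_filter c.
- by move=> x _; isd; field.
- by move=> x _; isd_cont.
- apply: (@cvgn_squeeze _ _ (fun n => 2 * n.+1%:R^-1)) => [n|].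
    rewrite add0r subr0 normrM normrN (ger0_norm (expR_ge0 _)).
    set x : R := n.+1%:R; have x0 : 0 < x by rewrite ltr0n.
    have x1 : 1 <= x by rewrite ler1n.
    have [e0 e1 e2 _] := exp_bounds x0.
    rewrite ger0_norm; last by lra.
    have -> : expR (- (2 * x)) = expR (- x) * expR (- x) by rewrite -expRD; congr expR; ring.
    rewrite ler_pdivlMr//.
    have e3 := expR_gt0 (- x); set e' := expR _ in e0 e1 e2 e3 *.
    apply: (@le_trans _ _ (x ^+ 2 * e')) => //.
    rewrite (_ : _ * _ * x = (x / 2 + 4^-1) * x * e' * e'); last by ring.
    have h1 : (x / 2 + 4^-1) * x <= x ^+ 2 by nra.
    apply: ler_wpM2r; first exact: ltW.
    apply: (le_trans _ h1); apply: ler_piMr => //; rewrite mulr_ge0//; lra.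
  have h := cvgM (cvg_cst (2 : R)) (@cvg_invS R); rewrite mulr0 in h; exact: h.
Qed.

(** Plancherel fixes the constant c left open by [specQ_shape]: the spectrum has integral 2 c, which
    must be 2 pi times the squared norm 1/4. No value of the Gamma function enters. *)
Lemma specQ xi : spec Q Q xi = pi / 4 * cauchy32 xi.
Proof.
have [c [c0 E]] := @specQ_shape R; have [L I] := Int_cauchy32.
have [_ P] := plancherel_spec (@L1_Q R) (@L2_Q R) (@L1_Q R) (@L2_Q R).
have {}E : spec Q Q = fun x => c * cauchy32 x by apply/funext => x; exact: E.
rewrite E IntZ// I (_ : Int _ = sqnorm (@Q R)) in P; last by apply: eq_Int => x; rewrite expr2.
rewrite sqnorm_Q in P; rewrite E; congr (_ * _).
by rewrite -[c](mulfK (_ : 2 != 0))// P; field.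
Qed.

Lemma Int_box c f : Int (fun x => box c x * f x) = \int[mu]_(x in `[- c, c]) f x.
Proof.
rewrite Int_patch; apply: eq_Int => x; rewrite box_itv indicE patchE.
by case: ifP => _; rewrite ?mul1r ?mul0r.
Qed.

Lemma Int_box1 c : 0 < c -> Int (box c) = 2 * c.
Proof.
move=> c0; rewrite -(eq_Int (f := fun x => box c x * (cst 1) x)); last by move=> x; rewrite mulr1.
rewrite Int_box; transitivity (c - (- c) : R); last by ring.
apply: (@FTC_closed _ _ _ id); first by rewrite gtrN.
by move=> x _; exact: cst_continuous.
Qed.

Lemma box_cos c xi : 0 < c -> xi != 0 -> ct (box c) xi = 2 * sin (c * xi) / xi.
Proof.
move=> c0 x0.
rewrite /ct Int_box; transitivity (sin (c * xi) / xi - sin (- c * xi) / xi).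
  apply: (@FTC_closed _ _ _ (fun x => sin (x * xi) / xi)).
  - by rewrite gtrN.
  - by move=> x _; isd; field.
  - by move=> x _; isd_cont.
by rewrite mulNr sinN; field.
Qed.

Definition onecos x : R := (1 - cos x) / x ^+ 2.

Lemma onecos_ge0 x : 0 <= onecos x.
Proof. by rewrite mulr_ge0 ?invr_ge0 ?sqr_ge0// subr_ge0 cos_le1. Qed.

Lemma onecos_meas : measurable_fun setT onecos.
Proof.
have m : measurable_fun setT (onpos onecos).
  by apply: onpos_meas => x x0; rewrite /onecos; isd_cont => //; rewrite expf_neq0// gt_eqF.
have -> : onecos = fun x => onpos onecos x + onpos onecos (-1 * x + 0).
  apply/funext => x; rewrite addr0 mulN1r /onpos oppr_gt0 (_ : onecos (- x) = onecos x); last by rewrite /onecos cosN sqrrN.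
  have [x0|x0|<-] := ltgtP 0 x; rewrite ?addr0 ?add0r//.
  by rewrite /onecos expr0n invr0 mulr0.
by apply: measurable_funD => //; exact: measurable_comp_affine.
Qed.

(** Plancherel for the box of width one and norm one: its spectrum is (2 sin(x/2) / x)^2 = 2 (1 -
    cos x) / x^2, with integral 2 pi. *)
Lemma Int_onecos : L1 onecos /\ Int onecos = pi.
Proof.
have Lb := @L1_box R 2^-1.
have E2 : (fun x => box 2^-1 x * box 2^-1 x) = box (2^-1 : R).
  by apply/funext => x; rewrite /box; case: ifP => _; rewrite ?mulr1 ?mulr0.
have Lb2 : L2 (box (2^-1 : R)).
  by split; [exact: box_meas|apply: eq_L1 Lb => x; rewrite expr2 -{1}E2].
have [L I] := plancherel_spec Lb Lb2 Lb Lb2; rewrite E2 in I.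
have Ib : Int (box (2^-1 : R)) = 1.
  by rewrite Int_box1//; field.
have [| |L' I'] := L1_ae (f := spec (box 2^-1) (box 2^-1)) (g := fun x => 2 * onecos x) _ _ L.
- by apply: measurable_funM => //; exact: onecos_meas.
- exists [set 0]; split => //; first by rewrite lebesgue_measure_set1.
  move=> x /= h; apply: contrapT => x0; apply: h.
  have {}x0 : x != 0 by apply/eqP.
  rewrite /spec (st_even _ Lb); last by move=> y; rewrite /box normrN.
  rewrite box_cos// mulr0 addr0 /onecos.
  have -> : cos x = cos (2^-1 * x + 2^-1 * x) by congr cos; field.
  rewrite cosD -!expr2 cos2sin2; move: (sin _) => s; by field.
have e : (fun x => 2^-1 * (2 * onecos x)) = onecos by apply/funext => x; field.
by rewrite -e; split; [exact: L1Z|rewrite IntZ// -I' I Ib; field].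
Qed.

End Model2.

(** * Energy of small translations and dilations of the model *)

Section Dilation.
Context {R : realType}.
Implicit Types (f g k q : R -> R) (a b c d e t x y xi l s : R).

Lemma L1_cauchyw : L1 (@cauchyw R).
Proof. exact: (@cauchyw_int R).1. Qed.

Lemma onesq_sqrt_ge xi : `|xi| * (1 + xi ^+ 2) <= (1 + xi ^+ 2) * Num.sqrt (1 + xi ^+ 2).
Proof.
rewrite mulrC ler_wpM2l ?(ltW (onesq_gt0 _))// -sqrtr_sqr ler_wsqrtr//.
by rewrite lerDr.
Qed.

Lemma cauchy32_le xi : `|xi| * cauchy32 xi <= cauchyw xi.
Proof.
have p := onesq_gt0 xi; have q := onesq_sqrt_gt0 xi.
rewrite /cauchy32 /cauchyw ler_pdivrMr// mulrAC ler_pdivlMr//.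
have := onesq_sqrt_ge xi; lra.
Qed.

Lemma L1_cauchy32 : L1 (fun xi => `|xi| * cauchy32 xi).
Proof.
apply: (L1_le L1_cauchyw).
  by apply: measurable_funM; [exact: normr_measurable|exact: L1_meas (@Int_cauchy32 R).1].
move=> x; rewrite ger0_norm ?mulr_ge0 ?cauchy32_ge0//; exact: cauchy32_le.
Qed.

Lemma energy_Q : finite_energy (@Q R).
Proof.
by apply: eq_L1 (L1Z (pi / 4) L1_cauchy32) => xi; rewrite specQ; ring.
Qed.

Lemma energyB f g : L1 f -> L1 g -> finite_energy f -> finite_energy g ->
  finite_energy (fun x => f x - g x).
Proof.
move=> Lf Lg ef eg; have -> : (fun x => f x - g x) = fun x => f x + -1 * g x.
  by apply/funext => x; rewrite mulN1r.
by apply: finite_energyD => //; [exact: L1Z|exact: finite_energyZ].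
Qed.

Lemma spec_translate f t xi : L1 f ->
  spec (fun x => f (1 * x + t) - f x) (fun x => f (1 * x + t) - f x) xi =
  2 * (1 - cos (t * xi)) * spec f f xi.
Proof.
move=> Lf; have -> : (fun x => f (1 * x + t) - f x) = fun x => f (1 * x + t) + -1 * f x.
  by apply/funext => x; rewrite mulN1r.
have Lt := L1_affine t (oner_neq0 R) Lf; have Ln := L1Z (-1) Lf.
have Ec l : l = 1 -> ct (fun x => f (l * x + t)) xi = cos (t * xi) * ct f xi + sin (t * xi) * st f xi.
  by move=> l1; rewrite ct_affine// l1 ?oner_eq0// normr1 invr1 !mulr1 mul1r.
have Es l : l = 1 -> st (fun x => f (l * x + t)) xi = cos (t * xi) * st f xi - sin (t * xi) * ct f xi.
  by move=> l1; rewrite st_affine// l1 ?oner_eq0// normr1 invr1 !mulr1 mul1r.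
rewrite /spec ctD// stD// ctZ// stZ// Ec// Es//.
have := cos2Dsin2 (t * xi); move: (cos _) (sin _) => c s h.
move: (ct f xi) (st f xi) => A B; transitivity (((c ^+ 2 + s ^+ 2) + 1 - 2 * c) * (A * A + B * B)); first by ring.
by rewrite h; ring.
Qed.

Lemma ratio3_le1 x : `|x| ^+ 3 * cauchy32 x <= 1.
Proof.
have p := onesq_gt0 x; have q := onesq_sqrt_gt0 x; have := onesq_sqrt_ge x.
rewrite /cauchy32 ler_pdivrMr// mul1r; apply: le_trans.
by rewrite exprSr mulrC ler_wpM2l// real_normK ?num_real// lerDr.
Qed.

(** A rate for [cauchy32] behaving like |x|^-3 at infinity; this tail alone determines the leading
    energy of a small translation. *)
Lemma ratio3_cvg x : x != 0 -> `| `|x| ^+ 3 * cauchy32 x - 1| <= 3 / x ^+ 2.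
Proof.
move=> x0; have p := onesq_gt0 x; have q := sqrt_pos p; have r := sqr_sqrt p.
have e0 : 0 < `|x| by rewrite normr_gt0.
have e2 : x ^+ 2 = `|x| ^+ 2 by rewrite real_normK ?num_real.
have h := ratio3_le1 x; rewrite distrC ger0_norm ?subr_ge0//.
pose w := Num.sqrt (1 + x ^+ 2); pose y := `|x|.
rewrite (_ : cauchy32 x = (w ^+ 2 * w)^-1); last by rewrite /cauchy32 -/w -[X in (X * _)^-1]r.
have {}r : w ^+ 2 = 1 + y ^+ 2 by rewrite r e2.
rewrite e2 -/y; rewrite -/y in e0; rewrite -/w in q.
have w0 : w != 0 by rewrite gt_eqF.
have y0 : y != 0 by rewrite gt_eqF.
move: w y w0 y0 q e0 r {h e2} => w y w0 y0 q e0 r.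
rewrite ler_pdivlMr ?exprn_gt0//.
rewrite -(@ler_pM2r _ (w ^+ 3)) ?exprn_gt0//.
rewrite [leLHS](_ : _ = (w ^+ 3 - y ^+ 3) * y ^+ 2); last by field.
have yw : y <= w by nra.
have e : (w - y) * (w + y) = 1 by rewrite -subr_sqr r; ring.
have e1 : (w - y) * w <= 1 by nra.
have -> : (w ^+ 3 - y ^+ 3) * y ^+ 2 = ((w - y) * y) * (w ^+ 2 + w * y + y ^+ 2) * y by ring.
have e3 : (w - y) * y <= 1 by nra.
have e4 : (w ^+ 2 + w * y + y ^+ 2) * y <= 3 * w ^+ 3.
  have : w * y <= w * w by nra.
  have : y ^+ 2 <= w ^+ 2 by nra.
  rewrite !exprS expr0; nra.
apply: le_trans e4; rewrite -mulrA ler_piMl// mulr_ge0 ?(ltW e0)// !addr_ge0// ?sqr_ge0// mulr_ge0// ltW//.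
Qed.

(* After the substitution xi = eta / t the integrand converges, under the
   majorant (pi / 2) (1 - cos eta) / eta^2. *)
Lemma energy_translate_Q (t : nat -> R) : (forall n, t n != 0) -> t @ \oo --> (0 : R) ->
  (fun n => energy (fun x => Q (1 * x + t n) - Q x) (fun x => Q (1 * x + t n) - Q x) / `|t n|)
     @ \oo --> pi ^+ 2 / 2.
Proof.
move=> tn0 t0.
(* pi / 2 is the factor 2 of [spec_translate] times the pi / 4 of [specQ]; the cube collects the
   weight |xi| and the powers of t from the substitution. *)
pose F n (x : R) := pi / 2 * (onecos x * (`|x / t n| ^+ 3 * cauchy32 (x / t n))).
have nt0 n : `|t n| != 0 by rewrite normr_eq0.
have E n : energy (fun x => Q (1 * x + t n) - Q x) (fun x => Q (1 * x + t n) - Q x) / `|t n| = Int (F n).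
  have LQ := @L1_Q R; have eQ := energy_Q.
  have L : finite_energy (fun x => Q (1 * x + t n) - Q x).
    have o1 := oner_neq0 R.
    exact: energyB (L1_affine (t n) o1 LQ) LQ (finite_energy_affine (t n) o1 LQ eQ) eQ.
  have ti : (t n)^-1 != 0 by rewrite invr_eq0.
  have := Int_affine 0 ti L; rewrite normfV invrK => I.
  have := IntZ (`|t n| ^- 2) (L1_affine 0 ti L); rewrite I.
  rewrite [X in _ = _ * (_ * X)]/(energy _ _) => J.
  rewrite (_ : energy _ _ / _ = `|t n| ^- 2 * (`|t n| * energy (fun x => Q (1 * x + t n) - Q x) (fun x => Q (1 * x + t n) - Q x))); last by field.
  rewrite -J; apply: eq_Int => x; rewrite addr0 spec_translate// specQ /F /onecos.
  have -> : t n * ((t n)^-1 * x) = x by rewrite mulVKf.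
  rewrite [_^-1 * x]mulrC normrM normfV.
  have [->|x0] := eqVneq x 0; first by rewrite normr0 !mul0r !expr0n/= !(mul0r, mulr0).
  have <- : `|x| ^+ 2 = x ^+ 2 by rewrite real_normK ?num_real.
  have n0 : `|x| != 0 by rewrite normr_eq0.
  by move: (cauchy32 _) (cos x) (nt0 n) n0; move: `|x| `|t n| => y z A B z0 y0; move: pi => p; field; rewrite z0.
have [Lo Io] := @Int_onecos R.
rewrite (_ : pi ^+ 2 / 2 = Int (fun x => pi / 2 * onecos x)); last by rewrite IntZ// Io; field.
rewrite (_ : (fun n => _) = fun n => Int (F n)); last exact/funext.
have mo := @onecos_meas R.
apply: (Int_DCT (g := fun x => pi / 2 * onecos x) _ _ _ _ _).2.
- move=> n; apply: measurable_funM => //; apply: measurable_funM => //.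
  have mf : measurable_fun setT (fun x => `|x| ^+ 3 * cauchy32 x).
    apply: measurable_funM; last exact: L1_meas (@Int_cauchy32 R).1.
    by apply: measurable_funX; exact: normr_measurable.
  have := measurable_comp_affine (t n)^-1 0 mf; apply: eq_measurable_fun => x _.
  by rewrite addr0 (mulrC x).
- exact: measurable_funM.
- apply: aeW => /= x; apply: cvgM; first exact: cvg_cst.
  have [->|x0] := eqVneq (x : R) 0.
    by rewrite /onecos expr0n invr0 mulr0; under eq_fun do rewrite mul0r; exact: cvg_cst.
  rewrite -[X in _ --> X]mulr1; apply: cvgM; first exact: cvg_cst.
  apply: (@cvgn_squeeze _ _ (fun n => 3 * (t n * t n / x ^+ 2))) => [n|].
    have h : x / t n != 0 by rewrite mulf_neq0// invr_eq0.
    apply: le_trans (ratio3_cvg h) _; rewrite exprMn exprVn -expr2 le_eqVlt; apply/orP; left; apply/eqP.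
    by field; rewrite x0 tn0.
  have c : (fun n => 3 / (x : R) ^+ 2 * (t n * t n)) @ \oo --> 3 / (x : R) ^+ 2 * (0 * 0).
    by apply: cvgM; [exact: cvg_cst|exact: cvgM].
  rewrite !mulr0 in c; move: c; apply: cvg_trans.
  by apply: near_eq_cvg; near=> n; rewrite -[LHS]mulrA [X in 3 * X]mulrC.
- exact: L1Z.
- move=> n x; rewrite /F normrM ger0_norm; last by rewrite divr_ge0// pi_ge0.
  rewrite ler_wpM2l ?divr_ge0 ?pi_ge0// normrM (ger0_norm (onecos_ge0 _)).
  rewrite -[X in _ <= X]mulr1 ler_wpM2l ?onecos_ge0// ger0_norm ?ratio3_le1//.
  by rewrite mulr_ge0 ?exprn_ge0// cauchy32_ge0.
Unshelve. all: by end_near. Qed.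

Lemma exp_lip l s : 1 <= l -> 0 < s -> 0 <= expR (- s) - expR (- (l * s)) <= (l - 1) * s * expR (- s).
Proof.
move=> l1 s0; have e := expR_gt0 (- s).
have -> : expR (- (l * s)) = expR (- s) * expR (- ((l - 1) * s)) by rewrite -expRD; congr expR; ring.
have h := expR_ge1Dx (- ((l - 1) * s)).
have h2 : expR (- ((l - 1) * s)) <= 1.
  by rewrite -[X in _ <= X]expR0 ler_expR oppr_le0 mulr_ge0 ?subr_ge0// ltW.
apply/andP; split; nra.
Qed.

(** The factor a = l^(-1/2) makes the singular parts of a Q(l x) and Q(x) agree: their difference
    [psi] is sqrt x (e^(-l x) - e^(-x)), which is O(l - 1) in L^2 together with its derivative. What
    remains is (1 - a) Q(l x), of energy (1 - a)^2 times that of Q. *)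
Lemma energy_dilate_Q : exists C, 0 <= C /\ forall l, 1 <= l <= 2 ->
  finite_energy (fun x => Q (l * x) - Q x) /\
  energy (fun x => Q (l * x) - Q x) (fun x => Q (l * x) - Q x) <= C * (l - 1) ^+ 2.
Proof.
have LG : L2 (fun x : R => 2 * Q x + Q3 x) by apply: L2D; [apply: L2Z|]; [exact: L2_Q|exact: L2_Q3].
exists (2 * energy (@Q R) Q + 2 * (pi * (sqnorm (@Q3 R) + sqnorm (fun x : R => 2 * Q x + Q3 x)))).
have p0 : 0 <= pi :> R by exact: pi_ge0.
split.
  have := sqnorm_ge0 (@Q3 R); have := sqnorm_ge0 (fun x : R => 2 * Q x + Q3 x); have := energy_ge0 (@Q R).
  by move=> e1 e2 e3; rewrite addr_ge0// mulr_ge0// mulr_ge0// addr_ge0.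
move=> l /andP[l1 l2]; have l0 : 0 < l by lra.
have ln0 : l != 0 by rewrite gt_eqF.
pose a := (Num.sqrt l)^-1; have s0 := sqrt_pos l0; have s2 := sqr_sqrt l0.
have a0 : 0 < a by rewrite invr_gt0.
have aE : a * Num.sqrt l = 1 by rewrite mulVf// gt_eqF.
pose psi x := a * Q (l * x + 0) + -1 * Q x.
pose q x := a * (l * dQ (l * x + 0)) + -1 * dQ x.
have LQ := @L1_Q R; have LQ2 := @L2_Q R.
have fd : fourier_deriv psi q.
  apply: fourier_derivD; first by apply/fourier_derivZ/fourier_deriv_affine => //; exact: fourier_deriv_Q.
  by apply: fourier_derivZ; exact: fourier_deriv_Q.
have psiE x : 0 < x -> psi x = Num.sqrt x * (expR (- (l * x)) - expR (- x)).
  move=> x0; rewrite /psi /Q addr0 !onpos_pos// ?mulr_gt0// sqrtrM ?(ltW l0)//.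
  rewrite (_ : a * _ = (a * Num.sqrt l) * (Num.sqrt x * expR (- (l * x)))); last by ring.
  by rewrite aE; ring.
have qE x : 0 < x -> q x = (2 * Num.sqrt x)^-1 * (expR (- (l * x)) - expR (- x)) +
    Num.sqrt x * (expR (- x) - l * expR (- (l * x))).
  move=> x0; have sx := sqrt_pos x0.
  rewrite /q /dQ addr0 !onpos_pos// ?mulr_gt0// sqrtrM ?(ltW l0)// /a.
  move: (expR _) (expR (- x)) s2 s0 sx; move: (Num.sqrt l) (Num.sqrt x) => L S E E' <- L0 S0.
  by field; rewrite !gt_eqF.
have b1 x : `|psi x| <= (l - 1) * Q3 x.
  have [x0|x0] := ltP 0 x; last first.
    by rewrite /psi /Q /Q3 addr0 !onpos_neg// ?mulr0 ?addr0 ?normr0// pmulr_rle0.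
  rewrite psiE// /Q3 onpos_pos// normrM (ger0_norm (sqrtr_ge0 _)) distrC.
  have /andP[h1 h2] := exp_lip l1 x0; rewrite (ger0_norm h1).
  rewrite (_ : _ * (_ * _ * _) = Num.sqrt x * ((l - 1) * x * expR (- x))); last by ring.
  by rewrite ler_wpM2l ?sqrtr_ge0.
have b2 x : `|q x| <= (l - 1) * (2 * Q x + Q3 x).
  have [x0|x0] := ltP 0 x; last first.
    by rewrite /q /Q /Q3 /dQ addr0 !onpos_neg// ?mulr0 ?addr0 ?mulr0 ?normr0// pmulr_rle0.
  have sx := sqrt_pos x0; have sx2 := sqr_sqrt x0.
  rewrite qE// /Q3 /Q !onpos_pos//; have /andP[h1 h2] := exp_lip l1 x0.
  have e0 := expR_gt0 (- x); have e1 := expR_gt0 (- (l * x)).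
  set E := expR _ in h1 h2 e0 *; set E' := expR _ in h1 h2 e1 *.
  apply: (le_trans (ler_normD _ _)).
  have c1 : `|(2 * Num.sqrt x)^-1 * (E' - E)| <= (l - 1) * (Num.sqrt x * E).
    rewrite normrM gtr0_norm ?invr_gt0 ?mulr_gt0// distrC (ger0_norm h1) ler_pdivrMl ?mulr_gt0//.
    rewrite (_ : 2 * _ * _ = 2 * (l - 1) * (Num.sqrt x ^+ 2) * E); last by ring.
    rewrite sx2; nra.
  have c2 : `|Num.sqrt x * (E - l * E')| <= (l - 1) * (Num.sqrt x * E + x * Num.sqrt x * E).
    rewrite normrM (gtr0_norm sx) [leRHS](_ : _ = Num.sqrt x * ((l - 1) * E + (l - 1) * x * E)); last by ring.
    rewrite ler_wpM2l ?sqrtr_ge0// ler_norml; apply/andP; split; nra.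
  lra.
have Lpsi : L2 psi.
  by apply: L2D; apply: L2Z => //; exact: L2_affine.
have Lq : L2 q.
  apply: (L2_le (L2Z (l - 1) LG)) => //.
  by have [_ /L1_meas] := fd.
have [ep Ep] := energy_bound ltr01 fd Lpsi Lq.
have E : (fun x => Q (l * x) - Q x) = fun x => (1 - a) * Q (l * x + 0) + psi x.
  by apply/funext => x; rewrite /psi addr0; ring.
have LQl := L1_affine 0 ln0 LQ; have eQl := finite_energy_affine 0 ln0 LQ energy_Q.
have Lp : L1 psi by have [] := fd.
have LQz := L1Z (1 - a) LQl; have eQz := finite_energyZ (1 - a) LQl eQl.
rewrite E; split; first exact: finite_energyD.
apply: le_trans (energyD_le LQz Lp eQz ep) _.
rewrite (energyZ (1 - a) LQl eQl) (energy_affine 0 ln0 LQ LQ energy_Q energy_Q).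
rewrite [leRHS]mulrDl; apply: lerD.
  have a1 : 1 <= Num.sqrt l by rewrite -[X in X <= _]sqrtr1 ler_wsqrtr.
  have a2 : a <= 1 by rewrite invf_le1.
  have a3 : a * l = Num.sqrt l by rewrite -{1}s2 expr2 mulrA aE mul1r.
  have a4 : (1 - a) ^+ 2 <= (l - 1) ^+ 2 by rewrite lerXn2r ?nnegrE//; nra.
  rewrite -[leRHS]mulrA ler_wpM2l// [leLHS]mulrC; apply: ler_wpM2l; [exact: energy_ge0|exact: a4].
rewrite -!mulrA ler_wpM2l//; apply: le_trans Ep _; rewrite ler_wpM2l//.
rewrite invr1 !mul1r [leRHS]mulrDl; apply: lerD.
  rewrite mulrC -sqnormZ; last exact: L2_Q3.
  by have [_ L] := Lpsi; apply: Int_le => //; [exact: (L2Z _ (@L2_Q3 R)).2|move=> x; rewrite -real_normK ?num_real// lerXn2r ?nnegrE// (le_trans _ (b1 x))].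
rewrite mulrC -sqnormZ//.
have [_ L] := Lq; apply: Int_le => //; first exact: (L2Z _ LG).2.
by move=> x; rewrite -real_normK ?num_real// lerXn2r ?nnegrE// (le_trans _ (b2 x)).
Qed.

End Dilation.

(** * First-order energy of the model under a general dilation *)

Section ModelLimit.
Context {R : realType}.
Implicit Types (f g k q : R -> R) (a b c d e t x y xi l s : R).

(** By Cauchy-Schwarz the cross term, divided by h, is at most the square root of a convergent times
    a vanishing quantity. *)
Lemma energy_perturb (F G : nat -> R -> R) (h : nat -> R) (L : R) :
  (forall n, 0 < h n) ->
  (forall n, L1 (F n) /\ finite_energy (F n)) -> (forall n, L1 (G n) /\ finite_energy (G n)) ->
  (fun n => energy (F n) (F n) / h n) @ \oo --> L ->
  (fun n => energy (G n) (G n) / h n) @ \oo --> (0 : R) ->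
  (fun n => energy (fun x => F n x + G n x) (fun x => F n x + G n x) / h n) @ \oo --> L.
Proof.
move=> h0 LF LG FL G0.
pose A n := energy (F n) (F n) / h n; pose B n := energy (G n) (G n) / h n.
have A0 n : 0 <= A n by rewrite divr_ge0 ?energy_ge0// ltW.
have B0 n : 0 <= B n by rewrite divr_ge0 ?energy_ge0// ltW.
apply: (@cvgn_squeeze _ _ (fun n => `|A n - L| + 2 * (Num.sqrt (A n) * Num.sqrt (B n)) + B n)).
  move=> n; have [LFn eF] := LF n; have [LGn eG] := LG n; have hn := h0 n.
  have CS := energy_CS LFn LGn eF eG.
  have E : Num.sqrt (A n) * Num.sqrt (B n) = Num.sqrt (energy (F n) (F n)) * Num.sqrt (energy (G n) (G n)) / h n.
    have e1 := energy_ge0 (F n); have e2 := energy_ge0 (G n).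
    rewrite /A /B (sqrtrM _ e1) (sqrtrM _ e2) mulrACA; congr (_ * _).
    by rewrite -expr2 sqr_sqrtr// invr_ge0 ltW.
  have -> : energy (fun x => F n x + G n x) (fun x => F n x + G n x) / h n - L =
      (A n - L) + 2 * (energy (F n) (G n) / h n) + B n.
    rewrite (energyD LFn LGn eF eG) /A /B.
    by move: (energy _ _) (energy _ _) (energy _ _) => e1 e2 e3; ring.
  rewrite (le_trans (ler_normD _ _))// (ger0_norm (B0 n)) lerD2r.
  rewrite (le_trans (ler_normD _ _))// lerD2l normrM ger0_norm// ler_wpM2l//.
  have hi : 0 <= (h n)^-1 by rewrite invr_ge0 ltW.
  by rewrite E normrM (ger0_norm hi); apply: ler_wpM2r.
have c1 : (fun n => `|A n - L|) @ \oo --> `|L - L|.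
  by apply: cvg_norm; apply: cvgB => //; exact: cvg_cst.
have c2 : (fun n => Num.sqrt (A n)) @ \oo --> Num.sqrt L.
  by apply: continuous_cvg FL; exact: sqrt_continuous.
have c3 := cvg_sqrt0 G0.
have c : (fun n => `|A n - L| + 2 * (Num.sqrt (A n) * Num.sqrt (B n)) + B n) @ \oo -->
   `|L - L| + 2 * (Num.sqrt L * 0) + 0.
  by apply: cvgD => //; apply: cvgD => //; apply: cvgM; [exact: cvg_cst|exact: cvgM].
by rewrite subrr normr0 !mulr0 !addr0 in c.
Qed.

(** The increment h of the dilation, discretised because dominated convergence is available along
    sequences. *)
Definition step n : R := n.+1%:R^-1.

Lemma step_gt0 n : 0 < step n.
Proof. by rewrite invr_gt0 ltr0n. Qed.

Lemma step_le1 n : step n <= 1.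
Proof. by rewrite invf_le1 ?ltr0n// ler1n. Qed.

Lemma step_cvg : step @ \oo --> (0 : R).
Proof. exact: cvg_invS. Qed.

Lemma stretch_cvg : (fun n => 1 + step n) @ \oo --> (1 : R).
Proof.
have c : (fun n => 1 + step n) @ \oo --> 1 + (0 : R).
  by apply: cvgD; [exact: cvg_cst|exact: step_cvg].
by rewrite addr0 in c.
Qed.

(** The argument equals x + step n (x + c): a dilation centred at - c, whence the [- c] in later
    uses. *)
Definition stretch f c n x := f ((1 + step n) * x + c * step n).

Lemma stretch_neq0 n : 1 + step n != 0.
Proof. by rewrite gt_eqF// ltr_wpDr// ltW// step_gt0. Qed.

(* Dilation contributes O(step^2); only the translation part survives. *)
Lemma energy_stretch_Q c : c <= 0 ->
  (forall n, finite_energy (fun x => stretch Q c n x - Q x)) /\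
  (fun n => energy (fun x => stretch Q c n x - Q x) (fun x => stretch Q c n x - Q x) / step n)
    @ \oo --> pi ^+ 2 / 2 * - c.
Proof.
move=> c0; have LQ := @L1_Q R; have eQ := @energy_Q R; have o1 := oner_neq0 R.
have [C [C0 dQ]] := @energy_dilate_Q R.
(* The affine map is x -> l (x + t). [F] is the increment due to the translation by t and [G] the
   increment due to the dilation by l, read at the translated point, which does not change its
   energy. *)
pose l n := 1 + step n; pose t n := c * step n / l n.
have ln0 n : l n != 0 by exact: stretch_neq0.
have l0 n : 0 < l n by rewrite ltr_wpDr// ltW// step_gt0.
have l12 n : 1 <= l n <= 2.
  by have := step_le1 n; have := step_gt0 n; rewrite /l => *; apply/andP; split; lra.
pose F n x := Q (1 * x + t n) - Q x.
pose G n x := Q (l n * (1 * x + t n)) - Q (1 * x + t n).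
have LF n : L1 (F n) /\ finite_energy (F n).
  have L := L1_affine (t n) o1 LQ; have e := finite_energy_affine (t n) o1 LQ eQ.
  by split; [exact: L1B|exact: energyB L LQ e eQ].
have LG n : [/\ L1 (G n), finite_energy (G n) & energy (G n) (G n) <= C * step n ^+ 2].
  have [ed Ed] := dQ _ (l12 n).
  have Ld : L1 (fun x => Q (l n * x) - Q x).
    by apply: L1B => //; apply: eq_L1 (L1_affine 0 (ln0 n) LQ) => x; rewrite addr0.
  have := energy_affine (t n) o1 Ld Ld ed ed; rewrite -/(G n) => EG.
  split; [exact: (L1_affine (t n) o1 Ld)|exact: (finite_energy_affine (t n) o1 Ld ed)|].
  by rewrite EG; move: Ed; rewrite /l addrAC subrr add0r.
have E n : (fun x => stretch Q c n x - Q x) = fun x => F n x + G n x.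
  apply/funext => x; rewrite /F /G /stretch -/(l n) mul1r.
  rewrite (_ : l n * (x + t n) = l n * x + c * step n); last by rewrite /t; field.
  ring.
have G2 n : L1 (G n) /\ finite_energy (G n) by have [] := LG n.
split; first by move=> n; rewrite E; exact: finite_energyD (LF n).1 (G2 n).1 (LF n).2 (G2 n).2.
rewrite (_ : (fun n => _) = fun n => energy (fun x => F n x + G n x) (fun x => F n x + G n x) / step n); last first.
  by apply/funext => n; rewrite E.
apply: energy_perturb => //; first exact: step_gt0.
  (* When the singularity is the centre of the dilation there is no translation, whereas
     [energy_translate_Q] asks for a nonzero one. *)
  have [c00|cn0] := eqVneq c 0.
    have Z n : energy (F n) (F n) / step n = 0.
      rewrite (_ : F n = fun x => 0 * Q x); last first.
        by apply/funext => x; rewrite /F /t c00 !mul0r mul1r addr0 subrr.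
      by rewrite (energyZ 0 LQ eQ) expr0n/= !mul0r.
    by under eq_fun do rewrite Z; rewrite c00 oppr0 mulr0; exact: cvg_cst.
  have tn0 n : t n != 0.
    by rewrite /t !mulf_neq0 ?invr_eq0// gt_eqF// step_gt0.
  have tc : t @ \oo --> (0 : R).
    have h : t @ \oo --> c * 0 / 1.
      apply: cvgM; first by apply: cvgM; [exact: cvg_cst|exact: step_cvg].
      by apply: cvgV; [rewrite oner_eq0|exact: stretch_cvg].
    by rewrite mulr0 mul0r in h.
  have h : (fun n => energy (F n) (F n) / `|t n| * (- c / l n)) @ \oo --> pi ^+ 2 / 2 * (- c / 1).
    apply: cvgM; first exact: energy_translate_Q.
    by apply: cvgM; [exact: cvg_cst|apply: cvgV; [rewrite oner_eq0|exact: stretch_cvg]].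
  rewrite divr1 in h; move: h; apply: cvg_trans; apply: near_eq_cvg; near=> n.
  have s0 := step_gt0 n; rewrite /t !normrM (ler0_norm c0) (gtr0_norm s0) gtr0_norm ?invr_gt0//.
  by move: (energy _ _) (l n) (ln0 n) => e L L0; field; rewrite ?L0 ?cn0 gt_eqF.
apply: (@cvgn_squeeze _ _ (fun n => C * step n)) => [n|].
  have [_ _ h] := LG n; rewrite subr0 ger0_norm; last by rewrite divr_ge0 ?energy_ge0// ltW// step_gt0.
  by rewrite ler_pdivrMr ?step_gt0// -mulrA -expr2.
have h := cvgM (cvg_cst C) step_cvg; rewrite mulr0 in h; exact: h.
Unshelve. all: by end_near. Qed.

End ModelLimit.

(** * Rough test functions *)

Section Mollify.
Context {R : realType}.
Implicit Types (f g k q K : R -> R) (a b c d e m t x y xi l s M : R).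
Local Notation mu := (@lebesgue_measure R).

Definition conv f K x := Int (fun y => f y * K (x - y)).

Lemma flatcomb_csupp c d m K : c < d -> 0 < m -> flatcomb (quad c d m) K -> csupp K.
Proof.
move=> cd m0 PK; apply: (@csupp_itv R c d) => x h.
by apply: (flatcomb_out PK); exact: quad_le0.
Qed.

Lemma flatcomb_L1_bounded c d m K : c < d -> 0 < m -> flatcomb (quad c d m) K ->
  L1 K /\ exists M, 0 <= M /\ forall x, `|K x| <= M.
Proof.
move=> cd m0 PK; have sK := flatcomb_csupp cd m0 PK; have cK := flatcomb_continuous PK.
split; first exact: csupp_L1 (continuous_csupp_L2 cK sK).
have [M [N [M0 h]]] := continuous_csupp_bounded cK sK; exists M; split => // x.
by rewrite (le_trans (h x))// ler_piMr// box_le1.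
Qed.

Lemma L1_conv f K M x : L1 f -> continuous K -> (forall x, `|K x| <= M) -> L1 (fun y => f y * K (x - y)).
Proof.
move=> Lf cK KM; apply: (L1M_bounded (c := M) Lf) => //.
have := measurable_comp_affine (-1) x (continuous_measurable_fun cK).
by apply: eq_measurable_fun => y _; rewrite mulN1r addrC.
Qed.

Lemma isd_conv c d m f K K' x : c < d -> 0 < m -> L1 f -> flatcomb (quad c d m) K ->
  flatcomb (quad c d m) K' -> (forall x, is_derive x 1 K (K' x)) ->
  is_derive x 1 (conv f K) (conv f K' x).
Proof.
move=> cd m0 Lf PK PK' dK.
have [LK [M [M0 KM]]] := flatcomb_L1_bounded cd m0 PK.
have [LK' [M' [M'0 KM']]] := flatcomb_L1_bounded cd m0 PK'.
apply: (@isd_Int R (fun x y => f y * K (x - y)) (fun x y => f y * K' (x - y)) (fun y => M' * `|f y|) x).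
- by move=> z; apply: (L1_conv (M := M)) => //; exact: flatcomb_continuous PK.
- move=> z y; have h : is_derive z 1 (fun z : R => z - y) 1 by isd; rewrite ?subr0 ?addr0 ?oppr0.
  have h2 := @isd_comp R (fun z => z - y) K z _ _ (dK (z - y)) h.
  have h3 := isdM (isd_cst (f y) z) h2; apply: isd_eq h3 _; rewrite /=; ring.
- by apply: L1Z; exact: L1_norm.
- by move=> z y _; rewrite normrM mulrC ler_wpM2r.
Qed.

(** All derivatives fall on the kernel, whose class [flatcomb] is closed under differentiation. *)
Lemma conv_smooth c d m f K : c < d -> 0 < m -> L1 f -> flatcomb (quad c d m) K ->
  forall n x, derivable (derive1n n (conv f K)) x 1.
Proof.
move=> cd m0 Lf PK.
apply: (@smooth_closed R (fun g => exists K, flatcomb (quad c d m) K /\ g = conv f K)); last by exists K.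
move=> _ [K1 [P1 ->]]; have [K2 [P2 d12]] := flatcomb_derive P1.
by exists (conv f K2); split; [exists K2|move=> x; exact: (isd_conv x cd m0 Lf P1 P2 d12)].
Qed.

Lemma conv_out f K c d e x : (forall y, ~~ (c < y < d) -> f y = 0) ->
  (forall y, ~~ (- e < y < e) -> K y = 0) -> ~~ (c - e < x < d + e) -> conv f K x = 0.
Proof.
move=> f0 K0 h; rewrite /conv -[RHS](@Int0 R); apply: eq_Int => y.
have [hy|hy] := boolP (c < y < d); last by rewrite f0// mul0r.
rewrite K0 ?mulr0//; apply: contra h => /andP[h1 h2]; case/andP: hy => h3 h4.
by apply/andP; split; lra.
Qed.

Lemma conv_test a b c d e f K : 0 < e -> a < c - e -> c < d -> d + e < b -> L1 f ->
  (forall y, ~~ (c < y < d) -> f y = 0) -> flatcomb (quad (- e) e 1) K ->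
  test_function a b (conv f K).
Proof.
move=> e0 ac cd db Lf f0 PK; have ee : - e < e by rewrite gtrN.
split; first exact: (conv_smooth ee ltr01 Lf PK).
exists `[c - e, d + e]; split; first exact: segment_compact.
  by move=> x /=; rewrite !in_itv/= => /andP[h1 h2]; rewrite (lt_le_trans ac)// (le_lt_trans h2).
move=> x; rewrite /= in_itv/= => /negP h; apply: (conv_out f0 (e := e)).
  by move=> y hy; apply: (flatcomb_out PK); apply: quad_le0.
by apply: contra h => /andP[/ltW -> /ltW ->].
Qed.

Lemma Int_reflect f x : L1 f -> L1 (fun y => f (x - y)) /\ Int (fun y => f (x - y)) = Int f.
Proof.
move=> Lf; have n1 : (-1 : R) != 0 by rewrite oppr_eq0 oner_eq0.
have E : (fun y => f (x - y)) = fun y => f (-1 * y + x) by apply/funext => y; rewrite mulN1r addrC.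
by rewrite E; split; [exact: L1_affine|rewrite Int_affine// normrN normr1 invr1 mul1r].
Qed.

(** An even kernel has a real transform, so that the cosine and the sine transform are multiplied by
    the same factor. *)
Lemma fourier_conv f K M xi : L1 f -> L1 K -> continuous K -> (forall x, `|K x| <= M) ->
  (forall x, K (- x) = K x) ->
  ct (conv f K) xi = ct K xi * ct f xi /\ st (conv f K) xi = ct K xi * st f xi.
Proof.
move=> Lf LK cK KM Ke.
have mf := L1_meas Lf; have mK := L1_meas LK; have sK := st_even xi LK Ke.
have o1 := oner_neq0 R.
have gen (w : R -> R) : continuous w -> (forall x, `|w x| <= 1) ->
    Int (fun x => conv f K x * w x) = Int (fun y => f y * Int (fun x => K (x - y) * w x)).
  move=> cw w1; have mw := continuous_measurable_fun cw.
  have LKy y : L1 (fun x => K (x - y) * w x).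
    have h := L1_affine (- y) o1 LK.
    apply: L1M_bounded w1 => //; apply: eq_L1 h => x; by rewrite mul1r.
  have [|||||_ _] := @Int_Fubini_le R (fun z => f z.1 * (K (z.2 - z.1) * w z.2)) (fun y => Int (fun x => `|K x|) * `|f y|).
  - apply: measurable_funM; first exact: measurable_pair_fst.
    apply: measurable_funM; last exact: measurable_pair_snd.
    apply: (measurableT_comp mK); apply: measurable_funB; [exact: measurable_snd|exact: measurable_fst].
  - by move=> y /=; exact: L1Z.
  - move=> x /=; apply: eq_L1 (L1Z (w x) (L1_conv x Lf cK KM)) => y; ring.
  - by apply: L1Z; exact: L1_norm.
  - move=> y /=; under eq_Int do rewrite normrM.
    rewrite IntZ; last exact: L1_norm.
    rewrite mulrC ler_wpM2r//.
    rewrite -(Int_shift (- y) (L1_norm LK)); apply: Int_le; [exact: L1_norm| |].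
      exact: L1_shift (L1_norm LK).
    by move=> x; rewrite normrM ler_piMr.
  move=> E; rewrite -[RHS](_ : Int (fun y => Int (fun x => f y * (K (x - y) * w x))) = _); last first.
    by apply: eq_Int => y; rewrite IntZ.
  rewrite E; apply: eq_Int => x /=; rewrite mulrC -IntZ; last exact: (L1_conv x Lf cK KM).
  by apply: eq_Int => y; ring.
have sh y (w : R -> R) : continuous w -> (forall x, `|w x| <= 1) ->
    Int (fun x => K (x - y) * w x) = Int (fun x => K x * w (x + y)).
  move=> cw w1; have L : L1 (fun x => K x * w (x + y)).
    apply: (L1M_bounded (c := 1) LK) => //.
    have := measurable_comp_affine 1 y (continuous_measurable_fun cw).
    by apply: eq_measurable_fun => x _; rewrite mul1r.
  by rewrite -(Int_shift (- y) L); apply: eq_Int => x; rewrite subrK.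
have cc : continuous (fun x => cos (x * xi)) by move=> x; isd_cont.
have cs : continuous (fun x => sin (x * xi)) by move=> x; isd_cont.
have Lc := L1_cos xi LK; have Ls := L1_sin xi LK.
have Lfc := L1_cos xi Lf; have Lfs := L1_sin xi Lf.
split; [rewrite /ct gen//|rewrite /st gen//]; try (by move=> x; exact: norm_cos); try (by move=> x; exact: norm_sin).
  rewrite -IntZ//; apply: eq_Int => y; rewrite sh//; last by move=> x; exact: norm_cos.
  transitivity (f y * (cos (y * xi) * ct K xi - sin (y * xi) * st K xi)); last by rewrite sK /ct; ring.
  congr (_ * _); rewrite /ct /st -IntZ// -IntZ// -IntB; [|exact: L1Z..].
  by apply: eq_Int => x; rewrite mulrDl cosD; ring.
rewrite -IntZ//; apply: eq_Int => y; rewrite sh//; last by move=> x; exact: norm_sin.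
transitivity (f y * (sin (y * xi) * ct K xi + cos (y * xi) * st K xi)); last by rewrite sK /ct; ring.
congr (_ * _); rewrite /ct /st -IntZ// -IntZ// -IntD; [|exact: L1Z..].
by apply: eq_Int => x; rewrite mulrDl sinD; ring.
Qed.

(** Not normalised; [molli_cvg] divides by the integral instead. *)
Definition molli e := bump (- e) e 1.

Lemma molli_flatcomb e : flatcomb (quad (- e) e 1) (molli e).
Proof. exact: bump_flatcomb. Qed.

Lemma molli_even e x : molli e (- x) = molli e x.
Proof. by rewrite /molli !bumpE !quadE; congr flat; ring. Qed.

Lemma molli_ge0 e x : 0 <= molli e x.
Proof. by rewrite /molli bumpE; have /andP[] := flat0_01 (quad (- e) e 1).[x]. Qed.

Lemma molli_le1 e x : `|molli e x| <= 1.
Proof. by rewrite ger0_norm ?molli_ge0// /molli bumpE; have /andP[] := flat0_01 (quad (- e) e 1).[x]. Qed.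

Lemma molli_out e x : 0 < e -> e <= `|x| -> molli e x = 0.
Proof.
move=> e0 ex; apply: (flatcomb_out (molli_flatcomb e)); apply: quad_le0 => //; first by rewrite gtrN.
by rewrite -ltr_norml -leNgt.
Qed.

Lemma L1_molli e : 0 < e -> L1 (molli e).
Proof.
move=> e0; have ee : - e < e by rewrite gtrN.
by have [] := flatcomb_L1_bounded ee ltr01 (molli_flatcomb e).
Qed.

Lemma Int_molli_gt0 e : 0 < e -> 0 < Int (molli e).
Proof.
move=> e0; have e2 : 0 < e / 2 by rewrite divr_gt0.
(* On |x| <= e / 2 the quadratic e^2 - x^2 is at least 3/4 e^2, and [flat 0] is increasing there. *)
pose dl := flat 0 (3 / 4 * e ^+ 2); have q0 : 0 < 3 / 4 * e ^+ 2 by rewrite mulr_gt0// exprn_gt0.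
have dl0 : 0 < dl by rewrite /dl /flat q0 expr0 mul1r expR_gt0.
apply: (@lt_le_trans _ _ (dl * Int (box (e / 2)))).
  by rewrite mulr_gt0// Int_box1// mulr_gt0.
rewrite -IntZ; last exact: L1_box.
apply: Int_le; [exact: L1Z (L1_box _)|exact: L1_molli|move=> x].
have [h|h] := lerP `|x| (e / 2); last by rewrite box_out// mulr0 molli_ge0.
rewrite box_in// mulr1 /molli bumpE quadE mul1r /dl.
move: h; rewrite ler_norml => /andP[h1 h2].
have h : 3 / 4 * e ^+ 2 <= (x - - e) * (e - x) by nra.
have p := lt_le_trans q0 h; rewrite /flat q0 p !expr0 !mul1r ler_expR lerN2.
by rewrite lef_pV2.
Qed.

Lemma molli_cvg g M (r : nat -> R) x : measurable_fun setT g -> (forall y, `|g y| <= M) ->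
  {for x, continuous g} -> (forall n, 0 < r n) -> r @ \oo --> (0 : R) ->
  (fun n => conv g (molli (r n)) x / Int (molli (r n))) @ \oo --> g x.
Proof.
move=> mg gM cg r0 rc; apply/cvgrPdist_le => /= e e0.
move/cvgrPdist_le : cg => /(_ e e0)/nbhs_ballP[dl /= dl0 hdl].
move/cvgrPdist_lt : rc => /(_ dl dl0); apply: filterS => n; rewrite sub0r normrN (gtr0_norm (r0 n)) => rn.
have c0 := Int_molli_gt0 (r0 n); have LK := L1_molli (r0 n).
have [LKx IKx] := Int_reflect x LK.
have Lg : L1 (fun y => g y * molli (r n) (x - y)).
  by apply: eq_L1 (L1M_bounded LKx mg gM) => y; rewrite mulrC.
rewrite -(ler_pM2r c0) -[X in `|_| * X]gtr0_norm// -normrM mulrBl divfK ?gt_eqF//.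
rewrite -{1 2}IKx -IntZ// -IntZ// -IntB//; last exact: L1Z.
have LB : L1 (fun y => g x * molli (r n) (x - y) - g y * molli (r n) (x - y)) by apply: L1B => //; exact: L1Z.
apply: (le_trans (Int_norm LB)).
apply: Int_le; [exact: L1_norm LB|exact: L1Z|move=> y].
rewrite -mulrBl normrM (ger0_norm (molli_ge0 _ _)).
have [h|h] := lerP (r n) `|x - y|; first by rewrite molli_out// !mulr0.
by rewrite ler_wpM2r ?molli_ge0//; apply: hdl; rewrite /ball/=; exact: lt_trans rn.
Qed.

(* Mollification extends the weak formulation from test functions to
   continuous functions of finite energy. *)
Lemma energy_weak a b c d u g z : a < c -> c < d -> d < b -> L1 u -> finite_energy u ->
  L1 (g \_ `]a, b[) ->
  (forall phi, test_function a b phi -> energy u phi = 2 * pi * \int[mu]_(x in `]a, b[) (g x * phi x)) ->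
  continuous z -> (forall x, ~~ (c < x < d) -> z x = 0) -> finite_energy z ->
  energy u z = 2 * pi * \int[mu]_(x in `]a, b[) (g x * z x).
Proof.
move=> ac cd db Lu eu Lg W cz z0 ez.
have sz := csupp_itv z0; have Lz := csupp_L1 sz (continuous_csupp_L2 cz sz).
have [M [N [M0 zM']]] := continuous_csupp_bounded cz sz.
have zM x : `|z x| <= M by rewrite (le_trans (zM' x))// ler_piMr// box_le1.
have mz := L1_meas Lz.
(* Half the smaller margin, so that mollifiers of radius at most [r0] keep the support inside (a,
   b). *)
pose r0 := Num.min (c - a) (b - d) / 2.
have r00 : 0 < r0 by rewrite divr_gt0// lt_min !subr_gt0 ac db.
have [ra rb] : r0 < c - a /\ r0 < b - d.
  have h1 : Num.min (c - a) (b - d) <= c - a by rewrite ge_min lexx.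
  have h2 : Num.min (c - a) (b - d) <= b - d by rewrite ge_min lexx orbT.
  by rewrite /r0; rewrite /r0 in r00; split; lra.
pose r n := r0 * step n : R.
have rp n : 0 < r n by rewrite mulr_gt0// step_gt0.
have rle n : r n <= r0 by rewrite ler_piMr ?step_le1// ltW.
have rc : r @ \oo --> (0 : R).
  have h := cvgM (cvg_cst r0) (@step_cvg R); rewrite mulr0 in h; exact: h.
pose K n := molli (r n); pose J n := Int (K n).
have J0 n : 0 < J n by exact: Int_molli_gt0.
have LK n : L1 (K n) by exact: L1_molli.
have cK n : continuous (K n) by exact: flatcomb_continuous (molli_flatcomb _).
have KM n x : `|K n x| <= 1 by exact: molli_le1.
have tc n : test_function a b (conv z (K n)).
  apply: (conv_test (rp n) _ cd _ Lz z0 (molli_flatcomb _)); have := rle n; lra.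
have ab : a < b by lra.
have mc n : measurable_fun setT (conv z (K n)).
  by have [cc _ _ _] := test_fun_props ab (tc n); exact: continuous_measurable_fun.
have cM n x : `|conv z (K n) x| <= M * J n.
  have [LKx IKx] := Int_reflect x (LK n).
  have L := L1_conv x Lz (cK n) (KM n).
  apply: le_trans (Int_norm L) _.
  rewrite /J -IKx -IntZ//; apply: Int_le; [exact: L1_norm L|exact: L1Z|move=> y].
  by rewrite normrM (ger0_norm (molli_ge0 _ _)) ler_wpM2r ?molli_ge0.
have Lgc n := L1M_bounded Lg (mc n) (cM n).
have FT n xi := fourier_conv xi Lz (LK n) (cK n) (KM n) (molli_even _).
have [LS _] := energyE Lu eu Lz ez.
(* On the frequency side mollification inserts the factor ct K / J, which is bounded by 1 and tends
   to 1. *)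
have EW n : Int (fun xi => (`|xi| * spec u z xi) * (ct (K n) xi / J n)) =
   2 * pi * Int (fun x => (g \_ `]a, b[) x * (conv z (K n) x / J n)).
  have h := W _ (tc n).
  transitivity ((J n)^-1 * energy u (conv z (K n))).
    rewrite /energy -IntZ; last first.
      have [spc L2c ec] := test_fun_energy ab (tc n).
      by have [] := energyE Lu eu (csupp_L1 spc L2c) ec.
    apply: eq_Int => xi; rewrite /spec; have [-> ->] := FT n xi; ring.
  rewrite h Int_patch mulrCA; congr (_ * _).
  rewrite -[in RHS](eq_Int (f := fun x => (J n)^-1 * ((g \_ `]a, b[) x * conv z (K n) x))); last by move=> x; ring.
  rewrite IntZ//; congr (_ * _); apply: eq_Int => x; rewrite !patchE; case: ifP => // _.
  by rewrite mul0r.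
have cL : (fun n => Int (fun xi => (`|xi| * spec u z xi) * (ct (K n) xi / J n))) @ \oo --> energy u z.
  have ctK1 n xi : `|ct (K n) xi / J n| <= 1.
    rewrite normrM normfV (gtr0_norm (J0 n)) ler_pdivrMr// mul1r.
    apply: le_trans (Int_norm (L1_cos xi (LK n))) _.
    apply: Int_le; [exact: L1_norm (L1_cos xi (LK n))|exact: LK|move=> x].
    by rewrite normrM (ger0_norm (molli_ge0 _ _)) ler_piMr ?molli_ge0 ?norm_cos.
  have lim (xi : R) : (fun n => ct (K n) xi / J n) @ \oo --> (1 : R).
    have cc : continuous (fun x : R => cos (x * xi)) by move=> x; isd_cont.
    have := molli_cvg (continuous_measurable_fun cc) (fun y => norm_cos (y * xi)) (cc 0) rp rc.
    rewrite mul0r cos0; apply: cvg_trans; apply: near_eq_cvg; near=> n.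
    congr (_ / _); apply: eq_Int => y; by rewrite sub0r molli_even mulrC.
  have mct n : measurable_fun setT (fun xi => ct (K n) xi / J n).
    apply: measurable_funM => //; rewrite (_ : ct (K n) = fun xi => 2^-1 * (hart (K n) xi + hart (K n) (-1 * xi + 0))).
      have mh := hart_measurable (LK n).
      by apply: measurable_funM => //; apply: measurable_funD => //; exact: measurable_comp_affine.
    apply/funext => xi; rewrite addr0 mulN1r !hartE ?ctN ?stN//; by field.
  apply: (Int_DCT (g := fun xi => `|(`|xi| * spec u z xi)|) _ _ _ _ _).2.
  - by move=> n; apply: measurable_funM; [exact: L1_meas LS|exact: mct].
  - exact: L1_meas LS.
  - apply: aeW => /= xi; rewrite -[X in _ --> X]mulr1; apply: cvgM; first exact: cvg_cst.
    exact: lim.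
  - exact: L1_norm.
  - by move=> n xi; rewrite normrM ler_piMr.
have cR : (fun n => 2 * pi * Int (fun x => (g \_ `]a, b[) x * (conv z (K n) x / J n))) @ \oo -->
    2 * pi * \int[mu]_(x in `]a, b[) (g x * z x).
  apply: cvgM; first exact: cvg_cst.
  rewrite Int_patch (_ : (_ \_ _) = fun x => (g \_ `]a, b[) x * z x); last first.
    by apply/funext => x; rewrite !patchE; case: ifP => // _; rewrite mul0r.
  apply: (Int_DCT (g := fun x => M * `|(g \_ `]a, b[) x|) _ _ _ _ _).2.
  - move=> n; apply: measurable_funM; first exact: L1_meas Lg.
    exact: measurable_funM.
  - by apply: measurable_funM => //; exact: L1_meas Lg.
  - apply: aeW => /= x; apply: cvgM; first exact: cvg_cst.
    exact: molli_cvg mz zM (cz x) rp rc.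
  - by apply: L1Z; exact: L1_norm.
  - move=> n x; rewrite normrM mulrC ler_wpM2r// normrM normfV (gtr0_norm (J0 n)).
    by rewrite ler_pdivrMr.
rewrite (funext EW : (fun n => _) = _) in cL.
by rewrite -(cvg_lim _ cL)// -(cvg_lim _ cR).
Unshelve. all: by end_near. Qed.

End Mollify.

(* [v] is the square of the solution, extended by zero outside [(a, b)], and
   [s] is the sign of the solution. *)
Record profile (R : realType) (a b M K : R) (v dv s : R -> R) : Prop := {
  pf_ab : a < b;
  pf_M : 0 <= M;
  pf_K : 0 <= K;
  pf_out : forall x, ~~ (a < x < b) -> v x = 0;
  pf_ge0 : forall x, 0 <= v x;
  pf_dv : forall x, a < x < b -> is_derive x 1 v (dv x);
  pf_lip : forall x y, `|v y - v x| <= K * `|y - x|;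
  pf_dK : forall x, a < x < b -> `|dv x| <= K;
  pf_dlip : forall x y, a < x < b -> a < y < b -> `|dv y - dv x| <= M * `|y - x|;
  pf_s : forall x, s x = 1 \/ s x = -1;
  pf_loc : forall x, 0 < v x -> \forall y \near x, s y = s x }.

(** * Signed square roots *)

Section Profile.
Context {R : realType}.
Implicit Types (f F g k q X dX : R -> R) (c d e t x y xi l : R).

Lemma cvg_squeeze (T : Type) (FF : set_system T) (FFF : Filter FF) (f g : T -> R) (l : R) :
  (\forall x \near FF, `|f x - l| <= g x) -> g @ FF --> (0 : R) -> f @ FF --> l.
Proof.
move=> fg g0; apply/cvgrPdist_lt => e e0; move/cvgrPdist_lt : g0 => /(_ e e0).
apply: filterS2 fg => x h; rewrite sub0r normrN => h2.
by rewrite distrC (le_lt_trans h)// (le_lt_trans (ler_norm _)).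
Qed.

Lemma dist_cvg0 K (x : R) : (fun y => K * `|y - x|) @ x --> (0 : R).
Proof.
have c : {for x, continuous (fun y => K * `|y - x|)}.
  apply: cvgM; first exact: cvg_cst.
  by apply: cvg_norm; apply: cvgB; [exact: cvg_id|exact: cvg_cst].
by move: c; rewrite /prop_for /continuous_at subrr normr0 mulr0.
Qed.

Lemma lipschitz_continuous (v : R -> R) K : (forall x y, `|v y - v x| <= K * `|y - x|) -> continuous v.
Proof.
move=> vl x; apply: cvg_squeeze (dist_cvg0 K x).
by near=> y; exact: vl.
Unshelve. all: by end_near. Qed.

Lemma mvt_bound (f df : R -> R) C x y : x < y -> (forall z, x < z < y -> is_derive z 1 f (df z)) ->
  {within `[x, y], continuous f} -> (forall z, x < z < y -> `|df z| <= C) ->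
  `|f y - f x| <= C * (y - x).
Proof.
move=> xy d c b; have d' z : z \in `]x, y[%R -> is_derive z 1 f (df z) by rewrite in_itv/=; exact: d.
have [z zxy ->] := MVT xy d' c.
by rewrite normrM (@gtr0_norm _ (y - x)) ?subr_gt0// ler_wpM2r ?subr_ge0 ?(ltW xy)//; apply: b; move: zxy; rewrite in_itv.
Qed.

Section Fixed.
Context {a b M K : R} {v dv s : R -> R}.
Context (P : profile a b M K v dv s).

Definition root x := s x * Num.sqrt (v x).
(** At a zero of [v] the denominator is 0 and the convention for inverses gives the value 0, so the
    formula is total. *)
Definition droot x := s x * dv x / (2 * Num.sqrt (v x)).

Let ab := pf_ab P.

Lemma pf_cont : continuous v.
Proof. exact: lipschitz_continuous (pf_lip P). Qed.

Lemma pf_sqr x : s x ^+ 2 = 1.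
Proof. by case: (pf_s P x) => ->; rewrite ?sqrrN expr1n. Qed.

Lemma pf_norm x : `|s x| = 1.
Proof. by case: (pf_s P x) => ->; rewrite ?normrN normr1. Qed.

Lemma pf_in x : 0 < v x -> a < x < b.
Proof. by move=> vx; apply: contraTT vx => /(pf_out P) ->; rewrite ltxx. Qed.

(** Only the mean value theorem and the Lipschitz bound on [dv] are used, whence M rather than M /
    2. The auxiliary statement allows either end as expansion point, so that x and y need no
    order. *)
Lemma pf_taylor x y : a < x < b -> a < y < b -> `|v y - v x - dv x * (y - x)| <= M * (y - x) ^+ 2.
Proof.
have half x' y' : a < x' < b -> a < y' < b -> x' < y' -> forall z, (z = x' \/ z = y') ->
    `|v y' - v x' - dv z * (y' - x')| <= M * (y' - x') ^+ 2.
  move=> /andP[h1 h2] /andP[h3 h4] xy z zE.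
  have inn w : x' <= w <= y' -> a < w < b by move=> /andP[? ?]; apply/andP; split; lra.
  have hz : a < z < b by case: zE => ->; apply/andP; split.
  have d w : w \in `]x', y'[%R -> is_derive w 1 v (dv w).
    by rewrite in_itv/= => /andP[/ltW w1 /ltW w2]; apply: (pf_dv P); apply: inn; rewrite w1 w2.
  have [w wxy ->] := MVT xy d (continuous_subspaceT pf_cont).
  move: wxy; rewrite in_itv/= => /andP[w1 w2].
  have hw : a < w < b by apply: inn; rewrite !ltW.
  rewrite -mulrBl normrM (@gtr0_norm _ (y' - x')) ?subr_gt0// expr2 mulrA.
  rewrite ler_wpM2r ?subr_ge0 ?(ltW xy)// (le_trans (pf_dlip P hz hw))//.
  rewrite ler_wpM2l ?(pf_M P)// ler_norml; case: zE => ->; apply/andP; split; lra.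
move=> hx hy; have [xy|xy|<-] := ltgtP x y.
- by apply: half => //; left.
- have := half _ _ hy hx xy x (or_intror erefl); rewrite (_ : (y - x) ^+ 2 = (x - y) ^+ 2); last by ring.
  by rewrite (_ : v x - v y - dv x * (x - y) = - (v y - v x - dv x * (y - x))); [rewrite normrN|ring].
- by rewrite !subrr mulr0 subrr normr0 expr0n mulr0.
Qed.

(* Nonnegativity of v along the parabola of [pf_taylor]. *)
Lemma dv_sqr x : a < x < b -> dv x ^+ 2 <= 4 * (M + `|dv x| / (x - a) + `|dv x| / (b - x)) * v x.
Proof.
move=> hx; have /andP[xa xb] := hx; have M0 := pf_M P; have v0 := pf_ge0 P x.
have A0 : 0 <= `|dv x| / (x - a) by rewrite divr_ge0// subr_ge0 ltW.
have B0 : 0 <= `|dv x| / (b - x) by rewrite divr_ge0// subr_ge0 ltW.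
have tay t : a < x + t < b -> 0 <= v x + dv x * t + M * t ^+ 2.
  move=> h; have := pf_taylor hx h; rewrite [x + t]addrC addrK ler_norml addrC => /andP[_ h2].
  by have := pf_ge0 P (x + t); lra.
(* Minimise v - D t + M t^2 for 0 < t < d: take t = D / (2 M) if this is less than d; otherwise t =
   d / 2 already gives D d <= 4 v. *)
have bd (D d : R) : 0 < d -> 0 <= D -> (forall t, 0 < t -> t < d -> 0 <= v x - D * t + M * t ^+ 2) ->
    D ^+ 2 <= 4 * (M + D / d) * v x.
  move=> d0 D0 h.
  have Kd0 : 0 <= D / d by rewrite divr_ge0// ltW.
  have [Dd|Dd] := ltP D (2 * M * d).
    have M1 : 0 < M by rewrite lt_neqAle M0 andbT; apply/negP => /eqP e; move: Dd; rewrite -e mulr0 mul0r; lra.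
    have [->|Dn0] := eqVneq D 0; first by rewrite mul0r addr0 expr0n/= mulr_ge0// mulr_ge0.
    have Dp : 0 < D by rewrite lt_neqAle eq_sym Dn0.
    have t0 : 0 < D / (2 * M) by rewrite divr_gt0// mulr_gt0.
    have := h _ t0; rewrite ltr_pdivrMr ?mulr_gt0// mulrC => /(_ Dd).
    have -> : v x - D * (D / (2 * M)) + M * (D / (2 * M)) ^+ 2 = v x - D ^+ 2 / (4 * M) by field; rewrite gt_eqF.
    rewrite subr_ge0 ler_pdivrMr ?mulr_gt0// => e; apply: le_trans e _.
    by rewrite mulrC ler_wpM2r// ler_wpM2l// lerDl.
  have d2 : 0 < d / 2 by rewrite divr_gt0.
  have d2d : d / 2 < d by lra.
  have := h _ d2 d2d => e.
  have e1 : D * d <= 4 * v x by nra.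
  have e2 : D ^+ 2 * d <= 4 * D * v x by nra.
  rewrite -(ler_pM2r d0) (le_trans e2)// [leRHS](_ : _ = 4 * M * v x * d + 4 * D * v x).
    by rewrite lerDr !mulr_ge0// ltW.
  by field; rewrite gt_eqF.
(* The parabola descends towards [a] when [dv x] is nonnegative and towards [b] when it is negative,
   which decides the distance that limits t. *)
have [D0|D0] := lerP 0 (dv x).
  apply: le_trans (bd (dv x) (x - a) _ D0 _) _; first by rewrite subr_gt0.
    move=> t t0 tx; have := tay (- t); rewrite sqrrN mulrN; apply; apply/andP; split; lra.
  by rewrite -{1}(ger0_norm D0) ler_wpM2r// ler_wpM2l// lerDl.
rewrite -sqrrN; apply: le_trans (bd (- dv x) (b - x) _ _ _) _; [by rewrite subr_gt0|lra| |].
  move=> t t0 tx; have := tay t; rewrite mulNr opprK; apply; apply/andP; split; lra.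
by rewrite -(ltr0_norm D0) ler_wpM2r// ler_wpM2l// addrAC lerDl.
Qed.

Lemma dv_zero x : a < x < b -> v x = 0 -> dv x = 0.
Proof.
move=> hx vx; have := dv_sqr hx; rewrite vx mulr0 => h.
by apply/eqP; rewrite -sqrf_eq0 eq_le h sqr_ge0.
Qed.

Lemma root_sqr x : root x ^+ 2 = v x.
Proof. by rewrite exprMn pf_sqr mul1r sqr_sqrtr// (pf_ge0 P). Qed.

Lemma root_norm x : `|root x| = Num.sqrt (v x).
Proof. by rewrite normrM pf_norm mul1r ger0_norm// sqrtr_ge0. Qed.

Lemma root_out x : ~~ (a < x < b) -> root x = 0.
Proof. by move=> h; rewrite /root (pf_out P h) sqrtr0 mulr0. Qed.

Lemma droot_out x : ~~ (a < x < b) -> droot x = 0.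
Proof. by move=> h; rewrite /droot (pf_out P h) sqrtr0 mulr0 invr0 mulr0. Qed.

Lemma droot_zero x : v x = 0 -> droot x = 0.
Proof. by move=> h; rewrite /droot h sqrtr0 mulr0 invr0 mulr0. Qed.

Lemma isd_root x : 0 < v x -> is_derive x 1 root (droot x).
Proof.
move=> vx; have h : is_derive x 1 (fun y => s x * Num.sqrt (v y)) (droot x).
  have d := pf_dv P (pf_in vx); apply: isd_eq (isdM (isd_cst (s x) x) (isd_sqrt vx d)) _.
  by rewrite /droot mul0r add0r mulrA.
by apply: near_eq_is_derive h; apply: filterS (pf_loc P vx) => y e; rewrite /root e.
Qed.

(** A regularised signed root. Subtracting sqrt e makes it vanish with [v], so that jumps of [s] at
    zeros of [v] are harmless, and it is differentiable at interior zeros, where [root] need not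
    be. *)
Definition sroot e x := s x * (Num.sqrt (v x + e) - Num.sqrt e).
Definition dsroot e x := s x * dv x / (2 * Num.sqrt (v x + e)).

Lemma sroot_bound e x : 0 < e -> `|sroot e x| <= v x / (2 * Num.sqrt e).
Proof.
move=> e0; have v0 := pf_ge0 P x; rewrite normrM pf_norm mul1r.
have se := sqrt_pos e0; have se2 := sqr_sqrt e0.
have ve : 0 < v x + e by rewrite ltr_wpDl.
have w0 := sqrt_pos ve; have w2 := sqr_sqrt ve.
set w := Num.sqrt (v x + e) in w0 w2 *; set z := Num.sqrt e in se se2 *.
have zw : z <= w by nra.
rewrite ger0_norm ?subr_ge0// ler_pdivlMr ?mulr_gt0//.
have -> : v x = (w - z) * (w + z) by rewrite -subr_sqr w2 se2; ring.
by rewrite ler_wpM2l ?subr_ge0//; lra.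
Qed.

Lemma sroot_le e x : 0 < e -> `|sroot e x| <= Num.sqrt (v x).
Proof.
move=> e0; have v0 := pf_ge0 P x; rewrite normrM pf_norm mul1r.
rewrite ger0_norm; last by rewrite subr_ge0 ler_wsqrtr// lerDr.
rewrite lerBlDr; have := sqrtr_ge0 (v x); have := sqrtr_ge0 e => s1 s2.
rewrite -[leRHS]ger0_norm ?addr_ge0// -sqrtr_sqr ler_wsqrtr// sqrrD !sqr_sqrtr// ?(ltW e0)//.
by have := mulr_ge0 s1 s2; rewrite mulr2n; lra.
Qed.

Lemma sroot_zero e x : v x = 0 -> sroot e x = 0.
Proof. by move=> h; rewrite /sroot h add0r subrr mulr0. Qed.

Lemma sroot_continuous e : 0 < e -> continuous (sroot e).
Proof.
move=> e0 x; have [vx|vx|vx] := ltgtP (v x) 0; first by have := pf_ge0 P x; lra.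
  have c : {for x, continuous (fun y => s x * (Num.sqrt (v y + e) - Num.sqrt e))}.
    apply: cvgM; first exact: cvg_cst.
    apply: cvgB; last exact: cvg_cst.
    apply: continuous_cvg; first exact: sqrt_continuous.
    by apply: cvgD; [exact: pf_cont|exact: cvg_cst].
  rewrite /prop_for /continuous_at {2}/sroot; move: c; apply: cvg_trans.
  by apply: near_eq_cvg; apply: filterS (pf_loc P vx) => y E; rewrite /sroot E.
rewrite /prop_for /continuous_at sroot_zero//.
apply: (@cvg_squeeze _ _ _ _ (fun y => v y / (2 * Num.sqrt e))).
  by near=> y; rewrite subr0; exact: sroot_bound.
have h : (fun y => v y / (2 * Num.sqrt e)) @ x --> v x / (2 * Num.sqrt e).
  by apply: cvgM; [exact: pf_cont|exact: cvg_cst].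
by rewrite vx mul0r in h.
Unshelve. all: by end_near. Qed.

(** At an interior zero, [v] is at most M (y - x)^2 because [dv] vanishes as well, and [sroot_bound]
    is linear in [v]: the increment is quadratic and the derivative 0. *)
Lemma isd_sroot e x : 0 < e -> a < x < b -> is_derive x 1 (sroot e) (dsroot e x).
Proof.
move=> e0 hx; have d := pf_dv P hx.
have [vx|vx|vx] := ltgtP (v x) 0; first by have := pf_ge0 P x; lra.
  have ve : 0 < v x + e by rewrite addr_gt0.
  have h : is_derive x 1 (fun y => s x * (Num.sqrt (v y + e) - Num.sqrt e)) (dsroot e x).
    have h1 := isdD d (isd_cst e x); have h2 := @isd_sqrt R (fun y => v y + e) x _ ve h1.
    have h3 := isdD h2 (isd_cst (- Num.sqrt e) x); apply: isd_eq (isdM (isd_cst (s x) x) h3) _.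
    by rewrite /dsroot !addr0 mul0r add0r mulrA.
  by apply: near_eq_is_derive h; apply: filterS (pf_loc P vx) => y E; rewrite /sroot E.
have dv0 := dv_zero hx vx; rewrite /dsroot dv0 mulr0 mul0r.
apply: (@isd_squeeze R _ _ (M / (2 * Num.sqrt e))).
apply: filterS (near_oo hx) => y hy; rewrite (sroot_zero _ vx) subr0.
apply: le_trans (sroot_bound _ e0) _; rewrite mulrAC ler_wpM2r ?invr_ge0 ?mulr_ge0 ?sqrtr_ge0//.
have := pf_taylor hx hy; rewrite vx dv0 mul0r !subr0; apply: le_trans; exact: ler_norm.
Qed.

Lemma dv_continuous x : a < x < b -> {for x, continuous dv}.
Proof.
move=> hx; apply: cvg_squeeze (dist_cvg0 M x).
by apply: filterS (near_oo hx) => y hy; exact: (pf_dlip P hx hy).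
Qed.

Lemma dsroot_continuous e x : 0 < e -> a < x < b -> {for x, continuous (dsroot e)}.
Proof.
move=> e0 hx; have cd := dv_continuous hx.
have ve y : 0 < v y + e by rewrite ltr_wpDl// (pf_ge0 P).
have [vx|vx|vx] := ltgtP (v x) 0; first by have := pf_ge0 P x; lra.
  have c : {for x, continuous (fun y => s x * dv y / (2 * Num.sqrt (v y + e)))}.
    apply: cvgM; first by apply: cvgM => //; exact: cvg_cst.
    apply: cvgV; first by rewrite gt_eqF// mulr_gt0// sqrt_pos.
    apply: cvgM; first exact: cvg_cst.
    apply: continuous_cvg; first exact: sqrt_continuous.
    by apply: cvgD; [exact: pf_cont|exact: cvg_cst].
  rewrite /prop_for /continuous_at {2}/dsroot; move: c; apply: cvg_trans.
  by apply: near_eq_cvg; apply: filterS (pf_loc P vx) => y E; rewrite /dsroot E.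
have dv0 := dv_zero hx vx; rewrite /prop_for /continuous_at {2}/dsroot dv0 mulr0 mul0r.
apply: (@cvg_squeeze _ _ _ _ (fun y => `|dv y| / (2 * Num.sqrt e))).
  near=> y; rewrite subr0 /dsroot !normrM pf_norm mul1r ler_wpM2l// normfV.
  have s1 := sqrt_pos e0; have s2 := sqrt_pos (ve y).
  rewrite gtr0_norm ?mulr_gt0// lef_pV2 ?posrE ?mulr_gt0// ler_pM2l// ler_wsqrtr//.
  by rewrite lerDr (pf_ge0 P).
have h : (fun y => `|dv y| / (2 * Num.sqrt e)) @ x --> `|dv x| / (2 * Num.sqrt e).
  by apply: cvgM; [exact: cvg_norm|exact: cvg_cst].
by rewrite dv0 normr0 mul0r in h.
Unshelve. all: by end_near. Qed.

Lemma dsroot_le e x : 0 < e -> a < x < b -> `|dsroot e x| <= `|droot x|.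
Proof.
move=> e0 hx; have [vx|vx|vx] := ltgtP (v x) 0; first by have := pf_ge0 P x; lra.
  have ve : 0 < v x + e by rewrite addr_gt0.
  rewrite /dsroot /droot !normrM !pf_norm !mul1r ler_wpM2l// !normfV.
  have s1 := sqrt_pos vx; have s2 := sqrt_pos ve.
  rewrite !gtr0_norm ?mulr_gt0// lef_pV2 ?posrE ?mulr_gt0// ler_pM2l// ler_wsqrtr//.
  by rewrite lerDl ltW.
by rewrite /dsroot (dv_zero hx vx) mulr0 mul0r normr0.
Qed.

Lemma shift_cvg x : (fun n => Num.sqrt (v x + step n)) @ \oo --> Num.sqrt (v x).
Proof.
have h : (fun n => v x + step n) @ \oo --> v x + (0 : R) by apply: cvgD; [exact: cvg_cst|exact: step_cvg].
rewrite addr0 in h; apply: continuous_cvg h; exact: sqrt_continuous.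
Qed.

Lemma sroot_cvg x : (fun n => sroot (step n) x) @ \oo --> root x.
Proof.
have h0 := cvg_sqrt0 (@step_cvg R).
have h : (fun n => sroot (step n) x) @ \oo --> s x * (Num.sqrt (v x) - 0).
  by apply: cvgM; [exact: cvg_cst|apply: cvgB => //; exact: shift_cvg].
by rewrite subr0 in h.
Qed.

Lemma dsroot_cvg x : a < x < b -> (fun n => dsroot (step n) x) @ \oo --> droot x.
Proof.
move=> hx; have [vx|vx|vx] := ltgtP (v x) 0; first by have := pf_ge0 P x; lra.
  apply: cvgM; first exact: cvg_cst.
  apply: cvgV; first by rewrite gt_eqF// mulr_gt0// sqrt_pos.
  by apply: cvgM; [exact: cvg_cst|exact: shift_cvg].
rewrite droot_zero// /dsroot (dv_zero hx vx); under eq_fun do rewrite mulr0 mul0r.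
exact: cvg_cst.
Qed.

Lemma root_continuous : continuous root.
Proof.
move=> x; have [vx|vx|vx] := ltgtP (v x) 0; first by have := pf_ge0 P x; lra.
  exact: isd_continuous (isd_root vx).
rewrite /prop_for /continuous_at {2}/root vx sqrtr0 mulr0.
apply: (@cvg_squeeze _ _ _ _ (fun y => Num.sqrt (v y))); first by near=> y; rewrite subr0 root_norm.
have h : (fun y => Num.sqrt (v y)) @ x --> Num.sqrt (v x).
  by apply: continuous_cvg; [exact: sqrt_continuous|exact: pf_cont].
by rewrite vx sqrtr0 in h.
Unshelve. all: by end_near. Qed.

End Fixed.
End Profile.

(** * Integrability of the derivative and the chain rule across zeros *)

Section ChainRule.
Context {R : realType}.
Implicit Types (f F g k q X dX : R -> R) (c d e t x y xi l C : R).
Local Notation mu := (@lebesgue_measure R).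

Lemma continuous_bounded_itv f c d : continuous f -> exists C, 0 <= C /\ forall x, c <= x <= d -> `|f x| <= C.
Proof.
move=> cf; have [cd|dc] := leP c d; last by exists 0; split => // x /andP[h1 h2]; lra.
have ci : {within `[c, d], continuous (fun x => `|f x|)}.
  by apply: continuous_subspaceT => x; apply: continuous_comp; [exact: cf|exact: norm_continuous].
have [m _ hm] := EVT_max cd ci; by exists `|f m|; split => // x h; apply: hm; rewrite in_itv.
Qed.

Lemma open_continuous_meas f c d : (forall x, c < x < d -> {for x, continuous f}) ->
  measurable_fun setT (f \_ `]c, d[).
Proof.
move=> cf; apply/(measurable_restrictT _ (measurable_itv _)).
apply: open_continuous_measurable_fun; first exact: interval_open.
by move=> x; rewrite inE/= in_itv/=; exact: cf.
Qed.

Lemma patch_oo f c d x : (f \_ `]c, d[) x = if c < x < d then f x else 0.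
Proof. by rewrite patchE mem_setE/= in_itv. Qed.

Definition ind c d x : R := if c < x < d then 1 else 0.

Lemma ind_ge0 c d x : 0 <= ind c d x.
Proof. by rewrite /ind; case: ifP. Qed.

Lemma L1_ind c d : L1 (ind c d).
Proof.
apply: (L1_le (L1_box (`|c| + `|d|))).
  have -> : ind c d = ((fun _ : R => 1 : R) : R -> R) \_ `]c, d[ by apply/funext => x; rewrite patch_oo.
  by apply: open_continuous_meas => x _; exact: cst_continuous.
move=> x; rewrite /ind; case: ifPn => h; last by rewrite normr0 /box; case: ifP.
rewrite normr1 box_in//; case/andP: h => h1 h2; rewrite ler_norml.
have := ler_norm d; have := ler_norm (- c); rewrite normrN => hc hd.
have := normr_ge0 c; have := normr_ge0 d => *; apply/andP; split; lra.
Qed.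

Section Fixed.
Context {a b M K : R} {v dv s : R -> R}.
Context (P : profile a b M K v dv s).
Let ab := pf_ab P.
Local Notation U := (@root R v s).
Local Notation p := (@droot R v dv s).

Lemma v_le_left x : a <= x -> v x <= K * (x - a).
Proof.
move=> ax; have := pf_lip P a x; rewrite (pf_out P (x := a)) ?ltxx// subr0.
by rewrite !ger0_norm ?subr_ge0// (pf_ge0 P).
Qed.

Lemma root_bounded x : `|U x| <= Num.sqrt (K * (b - a)).
Proof.
rewrite (root_norm P); have [h|h] := boolP (a < x < b); last first.
  by rewrite (pf_out P h) sqrtr0 sqrtr_ge0.
case/andP: h => h1 h2; apply: ler_wsqrtr; apply: le_trans (v_le_left (ltW h1)) _.
by rewrite ler_wpM2l ?(pf_K P)//; lra.
Qed.

(** [dv_sqr] says that droot^2 is at most M + K / (x - a) + K / (b - x). The resulting inverse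
    square roots are traded for [major], at the price of the factor 1 + (b - a), since [major] is
    integrable on a half-line. *)
Definition droot_majorant x := Num.sqrt M * ind a b x +
  Num.sqrt K * (1 + (b - a)) * (onpos major (1 * x + - a) + onpos major (-1 * x + b)).

Lemma L1_majorant : L1 droot_majorant.
Proof.
apply: L1D; apply: L1Z; [exact: L1_ind|apply: L1D; apply: L1_affine; try exact: L1_major].
- exact: oner_neq0.
- by rewrite oppr_eq0 oner_eq0.
Qed.

Lemma droot_le x : `|p x| <= droot_majorant x.
Proof.
have M0 := pf_M P; have K0 := pf_K P.
have mj y : 0 <= onpos (@major R) y.
  by rewrite /onpos; case: ifPn => // y0; rewrite invr_ge0 mulr_ge0 ?sqrtr_ge0// addr_ge0// ltW.
have b0 : 0 <= Num.sqrt K * (1 + (b - a)) by rewrite mulr_ge0 ?sqrtr_ge0// addr_ge0// subr_ge0 ltW.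
rewrite /droot_majorant /ind; case: ifPn => hx; last first.
  by rewrite (droot_out P hx) normr0 mulr0 add0r mulr_ge0// addr_ge0.
rewrite mulr1; have /andP[xa xb] := hx.
have sq y : 0 < y -> y <= b - a -> Num.sqrt (K / y) <= Num.sqrt K * (1 + (b - a)) * onpos major y.
  move=> y0 yb; rewrite onpos_pos// sqrtrM// sqrtrV ?(ltW y0)// -mulrA ler_wpM2l ?sqrtr_ge0//.
  have s0 := sqrt_pos y0; rewrite /major invfM mulrCA ler_peMr ?invr_ge0 ?(ltW s0)//.
  by rewrite ler_pdivlMr ?mul1r ?lerD2l// addr_gt0.
have q1 := sq (1 * x + - a); have q2 := sq (-1 * x + b).
rewrite mul1r in q1 *; rewrite mulN1r in q2 *; rewrite mulrDr addrA.
apply: (@le_trans _ _ (Num.sqrt M + Num.sqrt (K / (x - a)) + Num.sqrt (K / (- x + b)))); last first.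
  by apply: lerD; [apply: lerD => //; apply: q1|apply: q2]; lra.
have [vx|vx|vx] := ltgtP (v x) 0; first by have := pf_ge0 P x; lra.
  have A0 : 0 <= K / (x - a) by rewrite divr_ge0// subr_ge0 ltW.
  have B0 : 0 <= K / (- x + b) by rewrite divr_ge0// addrC subr_ge0 ltW.
  have s1 := sqrtr_ge0 M; have s2 := sqrtr_ge0 (K / (x - a)); have s3 := sqrtr_ge0 (K / (- x + b)).
  have e1 := sqr_sqrtr M0; have e2 := sqr_sqrtr A0; have e3 := sqr_sqrtr B0.
  have h : `|p x| ^+ 2 <= M + K / (x - a) + K / (- x + b).
    rewrite real_normK ?num_real// /droot exprMn exprMn (pf_sqr P) mul1r exprVn exprMn sqr_sqrt//.
    have := dv_sqr P hx; rewrite (addrC (- x)) => h.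
    rewrite ler_pdivrMr ?mulr_gt0// ?exprn_gt0//; apply: le_trans h _.
    rewrite [leRHS](_ : _ = 4 * (M + K / (x - a) + K / (b - x)) * v x); last by ring.
    have dK := pf_dK P hx; rewrite ler_wpM2r ?(pf_ge0 P)// ler_wpM2l// lerD//; last by rewrite ler_wpM2r// invr_ge0 subr_ge0 ltW.
    by rewrite lerD2l ler_wpM2r// invr_ge0 subr_ge0 ltW.
  rewrite -(@ler_pXn2r _ 2)// ?nnegrE ?addr_ge0//; apply: le_trans h _.
  rewrite -{1}e1 -{1}e2 -{1}e3.
  move: (Num.sqrt M) (Num.sqrt (K / (x - a))) (Num.sqrt _) s1 s2 s3 => A B C A' B' C'.
  have := mulr_ge0 A' B'; have := mulr_ge0 A' C'; have := mulr_ge0 B' C'; rewrite !expr2; nra.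
by rewrite droot_zero// normr0 !addr_ge0 ?sqrtr_ge0.
Qed.

Lemma droot_meas : measurable_fun setT p.
Proof.
apply: (@measurable_fun_cvg _ _ _ _ (fun n => dsroot (v := v) (dv := dv) (s := s) (step n) \_ `]a, b[)).
  move=> n; apply: open_continuous_meas => x hx; apply: (dsroot_continuous P) => //; exact: step_gt0.
move=> x _; rewrite /=; have [hx|hx] := boolP (a < x < b).
  under eq_fun do rewrite patch_oo hx; exact: (dsroot_cvg P).
by under eq_fun do rewrite patch_oo (negbTE hx); rewrite (droot_out P hx); exact: cvg_cst.
Qed.

Lemma L1_droot : L1 p.
Proof. by apply: (L1_le L1_majorant) => //; [exact: droot_meas|exact: droot_le]. Qed.

(** [root] may fail to be differentiable where [v] vanishes, so the fundamental theorem is applied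
    to X F(sroot) and the regularisation is removed by dominated convergence, [dsroot] being bounded
    by the integrable [droot]. *)
Lemma chain_Int f F X dX c d : a <= c -> c < d -> d <= b -> continuous f ->
  (forall y, is_derive y 1 F (f y)) -> (forall x, is_derive x 1 X (dX x)) -> continuous dX ->
  L1 ((fun x => X x * (f (U x) * p x) + dX x * F (U x)) \_ `]c, d[) /\
  Int ((fun x => X x * (f (U x) * p x) + dX x * F (U x)) \_ `]c, d[) =
    X d * F (U d) - X c * F (U c).
Proof.
move=> ac cd db cf dF dXE cdX.
have cF y : {for y, continuous F} by exact: isd_continuous (dF y).
have cX y : {for y, continuous X} by exact: isd_continuous (dXE y).
pose B := Num.sqrt (K * (b - a)).
have [Cf [Cf0 hf]] := continuous_bounded_itv (- B) B cf.
have [CF [CF0 hF]] := continuous_bounded_itv (- B) B cF.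
have [CX [CX0 hX]] := continuous_bounded_itv c d cX.
have [CdX [CdX0 hdX]] := continuous_bounded_itv c d cdX.
pose Un n := sroot (v := v) (s := s) (step n); pose pn n := dsroot (v := v) (dv := dv) (s := s) (step n).
have UnB n x : - B <= Un n x <= B.
  rewrite -ler_norml; apply: le_trans (sroot_le P x (step_gt0 n)) _.
  by rewrite -(root_norm P); exact: root_bounded.
have inab x : c < x < d -> a < x < b by move=> /andP[h1 h2]; apply/andP; split; lra.
pose g n x := X x * (f (Un n x) * pn n x) + dX x * F (Un n x).
pose G x := CX * Cf * `|p x| + CdX * CF * ind a b x.
have LG : L1 G.
  by apply: L1D; apply: L1Z; [exact: L1_norm L1_droot|exact: L1_ind].
have gG n x : `|(g n \_ `]c, d[) x| <= G x.
  rewrite patch_oo; case: ifPn => hx; last first.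
    by rewrite normr0 addr_ge0 ?mulr_ge0// ind_ge0.
  have hc : c <= x <= d by case/andP: hx => h1 h2; rewrite !ltW.
  rewrite /G /ind inab// mulr1 (le_trans (ler_normD _ _))// lerD//; last first.
    by rewrite normrM; apply: ler_pM => //; [exact: hdX|exact: hF].
  rewrite normrM [`|f _ * _|]normrM mulrA; apply: ler_pM; [exact: mulr_ge0|exact: normr_ge0| |].
    by apply: ler_pM => //; [exact: hX|exact: hf].
  exact: (dsroot_le P (step_gt0 n) (inab _ hx)).
have cg n x : c < x < d -> {for x, continuous (g n)}.
  move=> hx; have cU := sroot_continuous P (step_gt0 n).
  apply: cvgD; apply: cvgM.
  - exact: cX.
  - apply: cvgM; last exact: (dsroot_continuous P (step_gt0 n) (inab _ hx)).
    by apply: continuous_comp; [exact: cU|exact: cf].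
  - exact: cdX.
  - by apply: continuous_comp; [exact: cU|exact: cF].
have mg n : measurable_fun setT (g n \_ `]c, d[) by apply: open_continuous_meas; exact: cg.
have Lg n : L1 (g n \_ `]c, d[) by exact: (L1_le LG).
have FT n : Int (g n \_ `]c, d[) = X d * F (Un n d) - X c * F (Un n c).
  have cU := sroot_continuous P (step_gt0 n).
  have cH : continuous (fun x => X x * F (Un n x)).
    by move=> x; apply: cvgM; [exact: cX|apply: continuous_comp; [exact: cU|exact: cF]].
  apply: (@FTC_open R c d (fun x => X x * F (Un n x))) => //.
  - exact: cvg_at_right_filter (cH c).
  - exact: cvg_at_left_filter (cH d).
  - move=> x hx; have dU := isd_sroot P (step_gt0 n) (inab _ hx).
    have dG := @isd_comp R (Un n) F x _ _ (dF _) dU.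
    apply: isd_eq (isdM (dXE x) dG) _; exact: addrC.
  - exact: cg.
pose h x := X x * (f (U x) * p x) + dX x * F (U x).
have gh x : c < x < d -> (fun n => g n x) @ \oo --> h x.
  move=> hx; have cU := @sroot_cvg R v s x.
  apply: cvgD; apply: cvgM; try exact: cvg_cst.
    apply: cvgM; last exact: (dsroot_cvg P (inab _ hx)).
    by apply: continuous_cvg cU; exact: cf.
  by apply: continuous_cvg cU; exact: cF.
have gh' x : (fun n => (g n \_ `]c, d[) x) @ \oo --> (h \_ `]c, d[) x.
  rewrite patch_oo; under eq_fun do rewrite patch_oo.
  by case: ifP => [/gh//|_]; exact: cvg_cst.
have mh : measurable_fun setT (h \_ `]c, d[).
  by apply: (measurable_fun_cvg mg) => x _; exact: gh'.
have gae : {ae mu, forall x, (fun n => (g n \_ `]c, d[) x) @ \oo --> (h \_ `]c, d[) x}.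
  by apply: aeW => /= x; exact: gh'.
have [Lh cvI] := Int_DCT mg mh gae LG gG.
split => //; have cvE : (fun n => Int (g n \_ `]c, d[)) @ \oo --> X d * F (U d) - X c * F (U c).
  rewrite (funext FT : (fun n => _) = _).
  by apply: cvgB; apply: cvgM; try exact: cvg_cst; apply: continuous_cvg; try exact: cF; exact: sroot_cvg.
by rewrite -(cvg_lim _ cvI)// -(cvg_lim _ cvE).
Qed.

Lemma patch_support g : (forall x, ~~ (a < x < b) -> g x = 0) -> g \_ `]a, b[ = g.
Proof. by move=> g0; apply/funext => x; rewrite patch_oo; case: ifPn => // /g0. Qed.

Lemma root_csupp : csupp U.
Proof. by apply: csupp_itv => x; exact: (root_out P). Qed.

Lemma L2_root : L2 U.
Proof. exact: continuous_csupp_L2 (root_continuous P) root_csupp. Qed.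

Lemma L1_root : L1 U.
Proof. exact: csupp_L1 root_csupp L2_root. Qed.

Lemma fourier_deriv_root : fourier_deriv U p.
Proof.
apply: fourier_derivI => [||X dX dXE cdX X1 LX LdX]; [exact: L1_root|exact: L1_droot|].
have c1 : continuous (fun _ : R => 1 : R) by move=> x; exact: cst_continuous.
have [_] := @chain_Int _ id X dX a b (lexx a) ab (lexx b) c1 (fun y => isd_id y) dXE cdX.
rewrite (root_out P (x := a)) ?ltxx// (root_out P (x := b)) ?ltxx ?andbF// !mulr0 subrr => <-.
rewrite patch_support.
  by apply: eq_Int => x; rewrite mul1r; ring.
by move=> x hx; rewrite (root_out P hx) (droot_out P hx) !mulr0 addr0.
Qed.

End Fixed.
End ChainRule.

(** * Integral primitives and one-sided limits *)

Section Primitive.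
Context {R : realType}.
Implicit Types (f F g k q : R -> R) (c d e t x y xi l C : R).

(** Absolute continuity with an integrable density. It complements [fourier_deriv] where pointwise
    increments have to be estimated. *)
Definition primitive f q := L1 q /\ forall x y, x < y -> f y - f x = Int (q \_ `]x, y[).

Lemma L1_patch_oo q x y : L1 q -> L1 (q \_ `]x, y[).
Proof.
move=> Lq; apply: (L1_le (L1_norm Lq)).
  apply/(measurable_restrictT _ (measurable_itv _)); exact: measurable_funS (L1_meas Lq).
by move=> z; rewrite patch_oo; case: ifP; rewrite ?normr0.
Qed.

Lemma primitiveD f g p q : primitive f p -> primitive g q ->
  primitive (fun x => f x + g x) (fun x => p x + q x).
Proof.
move=> [Lp hp] [Lq hq]; split; first exact: L1D.
move=> x y xy; rewrite opprD addrACA hp// hq// -IntD; [|exact: L1_patch_oo..].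
by apply: eq_Int => z; rewrite !patch_oo; case: ifP; rewrite ?addr0.
Qed.

Lemma primitiveZ c f q : primitive f q -> primitive (fun x => c * f x) (fun x => c * q x).
Proof.
move=> [Lq hq]; split; first exact: L1Z.
move=> x y xy; rewrite -mulrBr hq// -IntZ; last exact: L1_patch_oo.
by apply: eq_Int => z; rewrite !patch_oo; case: ifP; rewrite ?mulr0.
Qed.

Lemma primitive_affine f q l t : l != 0 -> primitive f q ->
  primitive (fun x => f (l * x + t)) (fun x => l * q (l * x + t)).
Proof.
move=> l0 [Lq hq]; split; first by apply: L1Z; exact: L1_affine.
move=> x y xy; have [lp|ln|e] := ltgtP l 0; last by rewrite e eqxx in l0.
  rewrite -opprB hq; last by rewrite ltrD2r ltr_nM2l.
  have := Int_affine t l0 (L1_patch_oo (l * y + t) (l * x + t) Lq); rewrite ltr0_norm// => h.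
  rewrite -[X in - X](mulKf (_ : (- l)^-1 != 0)) ?invr_eq0 ?oppr_eq0// -h invrK mulNr opprK.
  rewrite -IntZ; last by apply: L1_affine => //; exact: L1_patch_oo.
  apply: eq_Int => z; rewrite !patch_oo !ltrD2r !ltr_nM2l// andbC; case: ifP; by rewrite ?mulr0.
rewrite hq; last by rewrite ltrD2r ltr_pM2l.
have := Int_affine t l0 (L1_patch_oo (l * x + t) (l * y + t) Lq); rewrite gtr0_norm// => h.
rewrite -[LHS](mulKf (_ : l^-1 != 0)) ?invr_eq0// -h invrK.
rewrite -IntZ; last by apply: L1_affine => //; exact: L1_patch_oo.
apply: eq_Int => z; rewrite !patch_oo !ltrD2r !ltr_pM2l//; case: ifP; by rewrite ?mulr0.
Qed.

Lemma Int_ind x y : x < y -> Int (ind x y) = y - x.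
Proof.
move=> xy; have E : ind x y = ((fun _ : R => 1 : R) : R -> R) \_ `]x, y[.
  by apply/funext => z; rewrite patch_oo.
have L := L1_ind x y; rewrite E in L *; apply: (@FTC_open R x y id) => //.
- by apply: cvg_at_right_filter; exact: cvg_id.
- by apply: cvg_at_left_filter; exact: cvg_id.
- by move=> z _; exact: cst_continuous.
Qed.

Lemma primitive_le f q C x y : primitive f q -> x < y -> (forall z, x < z < y -> `|q z| <= C) ->
  `|f y - f x| <= C * (y - x).
Proof.
move=> [Lq hq] xy b; rewrite hq// -Int_ind// -IntZ; last exact: L1_ind.
have L := L1_patch_oo x y Lq; apply: le_trans (Int_norm L) _.
apply: Int_le; [exact: L1_norm|by apply: L1Z; exact: L1_ind|move=> z].
by rewrite patch_oo /ind; case: ifP => [/b|_]; rewrite ?mulr1// mulr0 normr0.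
Qed.

Lemma primitive_Q : primitive (@Q R) dQ.
Proof.
split => [|x y xy]; first exact: L1_dQ.
have Q0 z : z <= 0 -> Q z = 0 :> R by move=> h; rewrite /Q onpos_neg.
have dQ0 z : z <= 0 -> dQ z = 0 :> R by move=> h; rewrite /dQ onpos_neg.
have pos c d : 0 <= c -> c < d -> Q d - Q c = Int (dQ \_ `]c, d[) :> R.
  move=> c0 cd; have d0 : 0 < d by lra.
  have isdQ (z : R) : 0 < z -> is_derive z 1 (@Q R) (dQ z).
    move=> z0; rewrite /dQ onpos_pos//; apply: isd_onpos => //.
    by isd => //; field; rewrite gt_eqF// sqrt_pos.
  have cdQ (z : R) : 0 < z -> {for z, continuous (@dQ R)}.
    move=> z0; apply: onpos_continuous => //.
    by isd_cont => //; rewrite mulf_neq0// gt_eqF// sqrt_pos.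
  have cQ (z : R) : 0 < z -> {for z, continuous (@Q R)} by move=> /isdQ; exact: isd_continuous.
  symmetry; apply: FTC_open => //.
  - have [c1|c1|->] := ltgtP c 0; first by lra.
      exact: cvg_at_right_filter (cQ _ c1).
    by rewrite Q0//; exact: Q_cvg0.
  - exact: cvg_at_left_filter (cQ _ d0).
  - by move=> z /andP[z0 _]; apply: isdQ; lra.
  - by move=> z /andP[z0 _]; apply: cdQ; lra.
  - exact: L1_patch_oo (@L1_dQ R).
have [x0|x0] := leP 0 x; first exact: pos.
have [y0|y0] := leP y 0.
  rewrite !Q0 ?(ltW x0)// subrr -[LHS](@Int0 R); apply: eq_Int => z; rewrite patch_oo.
  by case: ifP => // /andP[_ zy]; rewrite dQ0//; lra.
rewrite (Q0 x (ltW x0)) subr0 -[LHS]subr0 -{1}(Q0 0 (lexx 0)) pos//.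
apply: eq_Int => z; rewrite !patch_oo; have [z0|z0] := ltP 0 z.
  by rewrite (lt_trans x0 z0).
by rewrite dQ0//; case: ifP.
Qed.

Lemma dQ_near y : 0 < y -> `|dQ y - (2 * Num.sqrt y)^-1| <= 2 * Num.sqrt y.
Proof.
move=> y0; rewrite /dQ onpos_pos//; have s0 := sqrt_pos y0; have s2 := sqr_sqrt y0.
have e1 : expR (- y) <= 1 by have [] := exp_bounds y0.
have e0 := expR_gt0 (- y); have e2 : 1 - Num.sqrt y ^+ 2 <= expR (- y) by rewrite s2; exact: expR_ge1Dx.
move: (expR _) (Num.sqrt y) s0 e0 e1 e2 {s2} => E S S0 E0 E1 E2.
have -> : ((2 * S)^-1 - S) * E - (2 * S)^-1 = - ((2 * S)^-1 * (1 - E) + S * E) by field; rewrite gt_eqF.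
rewrite normrN ger0_norm; last first.
  by rewrite addr_ge0// mulr_ge0 ?invr_ge0 ?subr_ge0 ?mulr_ge0// ltW.
have h : (2 * S)^-1 * (1 - E) <= S by rewrite ler_pdivrMl ?mulr_gt0//; nra.
nra.
Qed.

(** The rate 1 / (1 + y^2) stays square-integrable after multiplication by y, which is what a
    dilation increment costs in [energy_rem]. *)
Lemma dQ_far e : 0 < e -> exists C, 0 <= C /\ forall y, (y <= 0) || (e <= y) -> `|dQ y| <= C / (1 + y ^+ 2).
Proof.
move=> e0; have se := sqrt_pos e0; have i0 : 0 <= (2 * Num.sqrt e)^-1 by rewrite invr_ge0 mulr_ge0// ltW.
exists (10 * ((2 * Num.sqrt e)^-1 + 1)); split; first by rewrite mulr_ge0// addr_ge0.
move=> y /orP[y0|ey].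
  by rewrite /dQ onpos_neg// normr0 divr_ge0 ?(ltW (onesq_gt0 _))// mulr_ge0// addr_ge0.
have y0 : 0 < y by lra.
have s0 := sqrt_pos y0; have s1 := sqrt_le_1D y0; have [e1 e2 e3 e4] := exp_bounds y0.
rewrite /dQ onpos_pos// ler_pdivlMr ?onesq_gt0// normrM (ger0_norm (expR_ge0 _)).
have E0 := expR_gt0 (- y).
have h1 : `|(2 * Num.sqrt y)^-1 - Num.sqrt y| <= ((2 * Num.sqrt e)^-1 + 1) * (1 + y).
  have h2 : (2 * Num.sqrt y)^-1 <= (2 * Num.sqrt e)^-1.
    by rewrite lef_pV2 ?posrE ?mulr_gt0// ler_pM2l// ler_wsqrtr.
  have h3 : 0 <= (2 * Num.sqrt y)^-1 by rewrite invr_ge0 mulr_ge0// ltW.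
  rewrite ler_norml; apply/andP; split; nra.
set A := `|_| in h1 *; set B := _ + 1 in h1 *; have B0 : 0 <= B by rewrite addr_ge0.
have h4 : (1 + y) * expR (- y) * (1 + y ^+ 2) <= 10.
  move: e1 e2 e3 e4; rewrite !exprS expr0; nra.
have p := onesq_gt0 y.
apply: (@le_trans _ _ (B * ((1 + y) * expR (- y) * (1 + y ^+ 2)))); last by rewrite mulrC ler_wpM2r.
by rewrite !mulrA ler_wpM2r ?(ltW p)// ler_wpM2r ?(ltW E0).
Qed.

(** The function g x + C x is nondecreasing, so its infimum is its limit at [c]; [L] is that infimum
    minus C c. *)
Lemma lipschitz_left_limit g C c d : c < d -> 0 <= C ->
  (forall x y, c < x < d -> c < y < d -> `|g y - g x| <= C * `|y - x|) ->
  exists L, forall x, c < x < d -> `|g x - L| <= C * (x - c).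
Proof.
move=> cd C0 gl; pose A := [set g x + C * x | x in [set x | c < x < d]].
have hm : c < (c + d) / 2 < d by apply/andP; split; lra.
have lbA x : c < x < d -> lbound A (g x - C * (x - c) + C * c).
  move=> hx _ [y hy <-]; have := gl _ _ hx hy; rewrite ler_norml => /andP[h1 _].
  have [xy|yx] := leP x y.
    by rewrite ger0_norm ?subr_ge0// in h1; move/andP: hx => [h2 _]; nra.
  by rewrite ltr0_norm ?subr_lt0// in h1; move/andP: hy => [h2 _]; nra.
have iA : has_inf A.
  split; first by exists (g ((c + d) / 2) + C * ((c + d) / 2)); exists ((c + d) / 2).
  by eexists; exact: lbA hm.
exists (inf A - C * c) => x hx; rewrite ler_norml.
have h1 : inf A <= g x + C * x by apply: ge_inf; [case: iA|exists x].
have h2 : g x - C * (x - c) + C * c <= inf A by apply: lb_le_inf; [case: iA|exact: lbA].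
apply/andP; split; nra.
Qed.

End Primitive.

(** * Behaviour of the signed root at the end points *)

Section BoundaryBehaviour.
Context {R : realType}.
Implicit Types (f F g k q : R -> R) (c d e t x y xi l C A : R).

(** The reflection x -> a + b - x exchanges the end points, so that only the left one has to be
    analysed. *)
Lemma profile_reflect (a b M K : R) (v dv s : R -> R) : profile a b M K v dv s ->
  profile a b M K (fun x => v (-1 * x + (a + b))) (fun x => - dv (-1 * x + (a + b)))
    (fun x => s (-1 * x + (a + b))).
Proof.
move=> P; have E x : -1 * x + (a + b) = a + b - x by ring.
have hin x : (a < -1 * x + (a + b) < b) = (a < x < b).
  rewrite E; apply/idP/idP => /andP[h1 h2]; apply/andP; split; lra.
split; [exact: pf_ab P|exact: pf_M P|exact: pf_K P| | | | | | | |].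
- by move=> x; rewrite -hin; exact: (pf_out P).
- by move=> x; exact: (pf_ge0 P).
- move=> x; rewrite -hin => hx; have d : is_derive x 1 (fun x : R => -1 * x + (a + b)) (-1) by isd; ring.
  by apply: isd_eq (@isd_comp R _ v x _ _ (pf_dv P hx) d) _; rewrite mulrN1.
- move=> x y; apply: le_trans (pf_lip P _ _) _.
  by rewrite (_ : _ - _ = x - y) ?(distrC x)//; ring.
- by move=> x; rewrite -hin normrN; exact: (pf_dK P).
- move=> x y; rewrite -(hin x) -(hin y) => hx hy; rewrite -opprD normrN; apply: le_trans (pf_dlip P hx hy) _.
  by rewrite (_ : _ - _ = x - y) ?(distrC x)//; ring.
- by move=> x; exact: (pf_s P).
- move=> x vx; have c : {for x, continuous (fun x : R => -1 * x + (a + b))} by isd_cont.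
  exact: (c _ (pf_loc P vx)).
Qed.

Section Fixed.
Context {a b M K : R} {v dv s : R -> R}.
Context (P : profile a b M K v dv s).
Let ab := pf_ab P.
Local Notation U := (@root R v s).
Local Notation p := (@droot R v dv s).

(** The interval is first clipped to [a, b], outside of which both functions vanish; [chain_Int]
    with the identity and X = 1 does the rest. *)
Lemma primitive_root : primitive U p.
Proof.
split => [|x y xy]; first exact: L1_droot P.
have zero z : ~~ (a < z < b) -> U z = 0 by exact: (root_out P).
have pz z : ~~ (a < z < b) -> p z = 0 by exact: (droot_out P).
have c1 : continuous (fun _ : R => 1 : R) by move=> z; exact: cst_continuous.
have c0 : continuous (fun _ : R => 0 : R) by move=> z; exact: cst_continuous.
pose c := Num.max x a; pose d := Num.min y b.
have cI z : (c < z) = (x < z) && (a < z) by rewrite /c gt_max.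
have dI z : (z < d) = (z < y) && (z < b) by rewrite /d lt_min.
have [cd|dc] := ltP c d; last first.
  have outI z : x < z < y -> ~~ (a < z < b).
    move=> /andP[h1 h2]; apply/negP => /andP[h3 h4].
    have : c < z by rewrite cI h1. have : z < d by rewrite dI h2.
    lra.
  have xo : ~~ (a < x < b) \/ True by right.
  have Ux : U x = 0.
    apply: zero; apply/negP => /andP[h1 h2].
    have : c = x by rewrite /c max_l// ltW. have : x < d by rewrite dI xy.
    lra.
  have Uy : U y = 0.
    apply: zero; apply/negP => /andP[h1 h2].
    have : d = y by rewrite /d min_l// ltW. have : c < y by rewrite cI xy.
    lra.
  rewrite Ux Uy subrr -[LHS](@Int0 R); apply: eq_Int => z; rewrite patch_oo.
  by case: ifP => // /outI /pz.
have ac : a <= c by rewrite /c le_max lexx orbT.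
have db : d <= b by rewrite /d ge_min lexx orbT.
have [_] := @chain_Int R a b M K v dv s P _ id _ _ c d ac cd db c1 (fun y => isd_id y)
   (fun z => isd_cst 1 z) c0.
have -> : U c = U x.
  rewrite /c; have [h|h] := leP a x; first by [].
  rewrite !zero//; last by rewrite ltxx.
  by apply/negP => /andP[h1 _]; lra.
have -> : U d = U y.
  rewrite /d; have [h|h] := leP y b; first by [].
  rewrite !zero//; last by rewrite ltxx andbF.
  by apply/negP => /andP[_ h1]; lra.
rewrite !mul1r => <-; apply: eq_Int => z; rewrite !patch_oo cI dI !mul1r mul0r addr0.
have [h|/pz ->] := boolP (a < z < b); last by do 2 case: ifP.
by case/andP: h => -> ->; rewrite !andbT.
Qed.

Lemma left_slope A : (forall x, a < x < b -> `|dv x - A| <= M * (x - a)) ->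
  0 <= A /\ forall x, a < x < b -> `|v x - A * (x - a)| <= M * (x - a) ^+ 2.
Proof.
move=> hA; have M0 := pf_M P; have ab' : a < b := ab.
have h x : a < x < b -> `|v x - A * (x - a)| <= M * (x - a) ^+ 2.
  move=> /andP[h1 h2].
  have d z : z \in `]a, x[%R -> is_derive z 1 v (dv z).
    by rewrite in_itv/= => /andP[z1 z2]; apply: (pf_dv P); apply/andP; split; lra.
  have [z] := MVT h1 d (continuous_subspaceT (pf_cont P)).
  rewrite (pf_out P (x := a)) ?ltxx// subr0 in_itv/= => /andP[z1 z2] ->.
  have hz : a < z < b by apply/andP; split; lra.
  rewrite -mulrBl normrM (@gtr0_norm _ (x - a)) ?subr_gt0// expr2 mulrA.
  rewrite ler_wpM2r ?subr_ge0 ?(ltW h1)//; apply: le_trans (hA z hz) _.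
  by rewrite ler_wpM2l//; lra.
split => //; rewrite leNgt; apply/negP => A0.
(* So close to [a] that M y <= - A / 2; then A y + M y^2 < 0, against the sign of [v]. *)
pose y := Num.min ((b - a) / 2) (- A / (2 * (M + 1))).
have y0 : 0 < y by rewrite lt_min !divr_gt0// ?subr_gt0// ?oppr_gt0//; rewrite mulr_gt0//; lra.
have y1 : y <= (b - a) / 2 by rewrite /y ge_min lexx.
have y2 : y <= - A / (2 * (M + 1)) by rewrite /y ge_min lexx orbT.
rewrite ler_pdivlMr in y2; last by rewrite mulr_gt0//; lra.
have hy : a < a + y < b by apply/andP; split; lra.
have := h _ hy; rewrite addrAC subrr add0r ler_norml => /andP[_ h2].
have := pf_ge0 P (a + y) => h3; nra.
Qed.

(* The leading term of u' at an end point is that of alpha * sqrt (x - a). *)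
Lemma left_droot : exists al e C, [/\ 0 < e, e < b - a, 0 <= C,
  forall x, a < x < b -> `|dv x - al ^+ 2| <= M * (x - a) &
  forall x, a < x < a + e -> `|p x - al * (2 * Num.sqrt (x - a))^-1| <= C].
Proof.
have M0 := pf_M P; have ab' : a < b := ab.
have [A hA] := lipschitz_left_limit ab M0 (fun x y => @pf_dlip _ _ _ _ _ _ _ _ P x y).
have [A0 hv] := left_slope hA.
have [Az|Ap] : A = 0 \/ 0 < A.
- by have [h|h|->] := ltgtP A 0; [lra|right|left].
(* With zero slope |dv| <= M (x - a), and left of the midpoint x - a <= b - x, so each of the three
   terms of [dv_sqr] is at most M. *)
- exists 0, ((b - a) / 2), (Num.sqrt (3 * M)); split; [by rewrite divr_gt0// subr_gt0|lra|exact: sqrtr_ge0| |].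
    by move=> x hx; rewrite expr0n/= subr0; have := hA x hx; rewrite Az subr0.
  move=> x /andP[h1 h2]; rewrite mul0r subr0.
  have hx : a < x < b by apply/andP; split; lra.
  have := hA x hx; rewrite Az subr0 => hd.
  have [vx|vx|vx] := ltgtP (v x) 0; first by have := pf_ge0 P x; lra.
    have q1 : `|dv x| / (x - a) <= M by rewrite ler_pdivrMr ?subr_gt0.
    have q2 : `|dv x| / (b - x) <= M.
      rewrite ler_pdivrMr ?subr_gt0; last by lra.
      by apply: le_trans hd _; rewrite ler_wpM2l//; lra.
    have h : `|p x| ^+ 2 <= 3 * M.
      rewrite real_normK ?num_real// /droot exprMn exprMn (pf_sqr P) mul1r exprVn exprMn sqr_sqrt//.
      rewrite ler_pdivrMr ?mulr_gt0// ?exprn_gt0//; apply: le_trans (dv_sqr P hx) _.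
      rewrite [leRHS](_ : _ = 4 * (M + M + M) * v x); last by ring.
      by rewrite ler_wpM2r ?(ltW vx)// ler_wpM2l// lerD// lerD2l.
    rewrite -[leLHS]ger0_norm// -sqrtr_sqr ler_wsqrtr//.
  by rewrite droot_zero// normr0 sqrtr_ge0.
(* On this length M (x - a) <= A / 2, hence v >= A (x - a) / 2 > 0 and the sign has a constant value
   [s0]. *)
pose e := Num.min ((b - a) / 2) (A / (2 * (M + 1))).
have e0 : 0 < e by rewrite lt_min !divr_gt0// ?subr_gt0//; rewrite mulr_gt0//; lra.
have e1 : e <= (b - a) / 2 by rewrite /e ge_min lexx.
have e2 : e <= A / (2 * (M + 1)) by rewrite /e ge_min lexx orbT.
rewrite ler_pdivlMr in e2; last by rewrite mulr_gt0//; lra.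
have hin x : a < x < a + e -> a < x < b by move=> /andP[? ?]; apply/andP; split; lra.
have lo x : a < x < a + e -> A * (x - a) / 2 <= v x.
  move=> hx; have := hv x (hin x hx); rewrite ler_norml => /andP[h1 _].
  case/andP: hx => h2 h3; have : M * (x - a) <= A / 2 by nra.
  move=> h4; have : M * (x - a) ^+ 2 <= A / 2 * (x - a) by rewrite expr2 mulrA ler_wpM2r//; lra.
  lra.
have vp x : a < x < a + e -> 0 < v x.
  move=> hx; apply: lt_le_trans (lo x hx); rewrite divr_gt0// mulr_gt0//.
  by case/andP: hx; lra.
have [s0 hs0] : exists s0, forall x, a < x < a + e -> s x = s0.
  exists (s (a + e / 2)) => x hx.
  have hm : a < a + e / 2 < a + e by apply/andP; split; lra.
  have ds z : a < z < a + e -> is_derive z 1 s 0.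
    move=> hz; have h := isd_cst (s z) z; apply: near_eq_is_derive h.
    by apply: filterS (pf_loc P (vp z hz)) => w ->.
  have cst y z : a < y < a + e -> a < z < a + e -> y < z -> s z = s y.
    move=> /andP[y1 y2] /andP[z1 z2] yz.
    have inn w : y <= w <= z -> a < w < a + e by move=> /andP[? ?]; apply/andP; split; lra.
    have c : {within `[y, z], continuous s}.
      apply: continuous_in_subspaceT => w; rewrite inE/= in_itv/= => hw.
      exact: isd_continuous (ds w (inn w hw)).
    have h : `|s z - s y| <= 0 * (z - y).
      apply: (@mvt_bound R s (fun _ => 0)) => // w /andP[w1 w2]; last by rewrite normr0.
      by apply: ds; apply: inn; rewrite !ltW.
    by apply/eqP; move: h; rewrite mul0r normr_le0 subr_eq0.
  by have [h|h|->//] := ltgtP x (a + e / 2); [rewrite (cst x (a + e / 2))|rewrite (cst (a + e / 2) x)].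
have s01 : s0 ^+ 2 = 1.
  have hm : a < a + e / 2 < a + e by apply/andP; split; lra.
  by rewrite -(hs0 _ hm) (pf_sqr P).
have sA0 := sqrt_pos Ap; have sA2 := sqr_sqrt Ap.
exists (s0 * Num.sqrt A), e, (2 * M * Num.sqrt e / Num.sqrt A); split => //; first by lra.
- by rewrite divr_ge0 ?mulr_ge0 ?sqrtr_ge0.
- by move=> x hx; rewrite exprMn s01 mul1r sA2; exact: hA.
move=> x hx; have hxb := hin x hx; have vx := vp x hx.
have s1 : `|s0| = 1.
  by rewrite -(hs0 x hx) (pf_norm P).
rewrite /droot (hs0 x hx) -!mulrA -mulrBr normrM s1 mul1r.
have y0 : 0 < x - a by case/andP: hx; lra.
have sy0 := sqrt_pos y0; have sy2 := sqr_sqrt y0.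
have sv0 := sqrt_pos vx; have sv2 := sqr_sqrt vx.
have ye : Num.sqrt (x - a) <= Num.sqrt e by rewrite ler_wsqrtr//; case/andP: hx; lra.
have h3 := hA x hxb; have h2 := hv x hxb; have h1 := lo x hx.
rewrite -{1}sA2 -{1}sy2 in h3; rewrite -{1}sv2 -{1}sA2 -{1 2}sy2 in h2.
rewrite -{1}sv2 -{1}sA2 -{1}sy2 in h1; move: h1 h2 h3.
move: (Num.sqrt (x - a)) (Num.sqrt (v x)) (Num.sqrt A) (Num.sqrt e) (dv x) sy0 sv0 sA0 ye.
move=> Y V B E D Y0 V0 B0 YE h1 h2 h3.
have VB : B * Y <= 2 * V by nra.
(* Here Y, V, B are the roots of x - a, v and A. The difference of squares B^2 Y^2 - V^2 is O(Y^4),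
   and division by B Y + V leaves O(Y^3). *)
have k1 : `|B * Y - V| <= M * Y ^+ 3 / B.
  have f : `|B * Y - V| * (B * Y + V) <= M * (Y ^+ 2) ^+ 2.
    rewrite -[X in _ * X]gtr0_norm ?addr_gt0 ?mulr_gt0// -normrM -subr_sqr distrC exprMn.
    by apply: le_trans h2.
  rewrite ler_pdivlMr//; have n0 := normr_ge0 (B * Y - V).
  rewrite -(ler_pM2r Y0); apply: le_trans (_ : `|B * Y - V| * (B * Y + V) <= _).
    by rewrite -mulrA ler_wpM2l// lerDl ltW.
  by apply: le_trans f _; rewrite le_eqVlt; apply/orP; left; apply/eqP; ring.
rewrite [X in `|X|](_ : _ = ((D - B ^+ 2) * Y + B * (B * Y - V)) / (2 * V * Y)); last by field; rewrite !gt_eqF.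
rewrite normrM normfV (@gtr0_norm _ (2 * V * Y)) ?mulr_gt0// ler_pdivrMr ?mulr_gt0//.
apply: (@le_trans _ _ (2 * M * Y ^+ 3)).
  apply: le_trans (ler_normD _ _) _; rewrite !normrM (gtr0_norm Y0) (gtr0_norm B0).
  have : `|D - B ^+ 2| * Y <= M * Y ^+ 2 * Y by rewrite ler_wpM2r// ltW.
  have : B * `|B * Y - V| <= B * (M * Y ^+ 3 / B) by rewrite ler_wpM2l// ltW.
  rewrite [X in _ <= X -> _](_ : _ = M * Y ^+ 3); last by field; rewrite gt_eqF.
  rewrite (_ : M * Y ^+ 2 * Y = M * Y ^+ 3); last by ring.
  lra.
rewrite [leRHS](_ : _ = 2 * M * (E * (2 * V) * Y / B)); last by field; rewrite gt_eqF.
rewrite ler_wpM2l// ?mulr_ge0//.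
rewrite ler_pdivlMr// (_ : Y ^+ 3 * B = Y * (B * Y) * Y); last by ring.
rewrite ler_wpM2r ?(ltW Y0)//; apply: ler_pM; [exact: ltW|by rewrite mulr_ge0// ltW|done|done].
Qed.

End Fixed.
End BoundaryBehaviour.

(** * Removing the end point singularities *)

Section Remainder.
Context {R : realType}.
Implicit Types (f F g k q : R -> R) (c d e t x y xi l C A W : R).

Lemma stretch_diff_L2 f c n : L2 f -> L2 (fun x => stretch f c n x - f x).
Proof. by move=> Lf; apply: L2B => //; apply: L2_affine => //; exact: stretch_neq0. Qed.

(** [energy_bound] with weight eta / step splits the energy into at most pi eta W step and pi step /
    eta times the squared norm of [dg n]. That norm tends to 0 by continuity of dilations in L^2,
    and eta is arbitrary. *)
Lemma energy_stretch_smooth f q c W : fourier_deriv f q -> L2 f -> L2 q -> 0 <= W ->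
  (forall n, sqnorm (fun x => stretch f c n x - f x) <= W * step n ^+ 2) ->
  [/\ finite_energy f, forall n, finite_energy (fun x => stretch f c n x - f x) &
    (fun n => energy (fun x => stretch f c n x - f x) (fun x => stretch f c n x - f x) / step n)
      @ \oo --> (0 : R)].
Proof.
move=> fd Lf Lq W0 hW; have [Lf1 Lq1 _] := fd; have [ef _] := energy_bound ltr01 fd Lf Lq.
have ln0 n := @stretch_neq0 R n; have p0 : 0 < pi :> R by exact: pi_gt0.
pose g n x := stretch f c n x - f x.
pose h n x := stretch q c n x - q x.
pose dg n x := (1 + step n) * stretch q c n x + -1 * q x.
have fdg n : fourier_deriv (g n) (dg n).
  rewrite (_ : g n = fun x => stretch f c n x + -1 * f x); last by apply/funext => x; rewrite mulN1r.
  by apply: fourier_derivD; [exact: fourier_deriv_affine|exact: fourier_derivZ].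
have Lg n : L2 (g n) by exact: stretch_diff_L2.
have Lh n : L2 (h n) by exact: stretch_diff_L2.
have E n : dg n = fun x => (1 + step n) * h n x + step n * q x.
  by apply/funext => x; rewrite /dg /h; ring.
have Ldg n : L2 (dg n) by rewrite E; apply: L2D; exact: L2Z.
have eg n := energy_bound ltr01 (fdg n) (Lg n) (Ldg n).
split => //; first by move=> n; have [] := eg n.
pose D n := sqnorm (dg n).
have D0 : D @ \oo --> (0 : R).
  have h12 n : 2^-1 <= 1 + step n :> R by have := @step_gt0 R n; lra.
  have tc : (fun n => c * step n) @ \oo --> (0 : R).
    have c0 := cvgM (cvg_cst c) (@step_cvg R); rewrite mulr0 in c0; exact: c0.
  have [_ _ ch] := cvg2_affine Lq h12 (@stretch_cvg R) tc.
  apply: (@cvgn_squeeze _ _ (fun n => 2 * ((1 + step n) ^+ 2 * sqnorm (h n)) + 2 * (step n ^+ 2 * sqnorm q))).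
    move=> n; rewrite subr0 ger0_norm ?sqnorm_ge0// /D E.
    rewrite -sqnormZ// -sqnormZ//; apply: sqnormD_le; exact: L2Z.
  have c1 : (fun n => 2 * ((1 + step n) ^+ 2 * sqnorm (h n)) + 2 * (step n ^+ 2 * sqnorm q)) @ \oo -->
     2 * (1 ^+ 2 * 0) + 2 * (0 ^+ 2 * sqnorm q).
    apply: cvgD; apply: cvgM; try exact: cvg_cst; apply: cvgM => //; try exact: cvg_cst.
      by rewrite expr2; apply: cvgM; exact: stretch_cvg.
    by rewrite expr2; apply: cvgM; exact: step_cvg.
  by rewrite mulr0 expr0n mul0r !mulr0 addr0 in c1.
apply/cvgrPdist_le => /= e e0.
(* Makes pi eta W at most e / 2, which leaves e / 2 for the derivative term. *)
pose eta := e / (2 * pi * (W + 1)).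
have eta0 : 0 < eta by rewrite divr_gt0// mulr_gt0 ?mulr_gt0//; lra.
have e1 : 0 < e * eta / (2 * pi) by apply: divr_gt0; apply: mulr_gt0.
move/cvgrPdist_le : D0 => /(_ _ e1); apply: filterS => n; rewrite !sub0r !normrN.
have s0 := @step_gt0 R n; rewrite ger0_norm ?sqnorm_ge0// => hD.
have [_ B] := energy_bound (divr_gt0 eta0 s0) (fdg n) (Lg n) (Ldg n).
rewrite ger0_norm; last by rewrite divr_ge0 ?energy_ge0// ltW.
rewrite ler_pdivrMr//; apply: le_trans B _; rewrite invf_div -/(D n).
have h1 : eta / step n * sqnorm (g n) <= eta * W * step n.
  rewrite -(ler_pM2r s0) [leRHS](_ : _ = eta * (W * step n ^+ 2)); last by ring.
  rewrite [leLHS](_ : _ = eta * sqnorm (g n)); last by field; rewrite gt_eqF.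
  by rewrite ler_wpM2l ?(ltW eta0)//; exact: hW.
have h2 : step n / eta * D n <= step n * (e / (2 * pi)).
  rewrite -mulrA ler_wpM2l ?(ltW s0)// ler_pdivrMl//.
  by rewrite mulrA (mulrC eta).
have pn : pi != 0 :> R by rewrite gt_eqF.
have h3 : pi * (eta * W) <= e / 2.
  rewrite /eta (_ : pi * _ = e / 2 * (W / (W + 1))); last first.
    have W1 : W + 1 != 0 by rewrite gt_eqF//; lra.
    by move: pn; generalize (@pi R) => w w0; field; rewrite w0 W1.
  rewrite -[leRHS]mulr1 ler_wpM2l ?divr_ge0 ?(ltW e0)// ler_pdivrMr; lra.
apply: (@le_trans _ _ (pi * (eta * W * step n + step n * (e / (2 * pi))))).
  by rewrite ler_pM2l// lerD.
rewrite [leLHS](_ : _ = (pi * (eta * W) + e / 2) * step n); last first.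
  by move: pn; generalize (@pi R) => w w0; field.
by rewrite ler_wpM2r ?(ltW s0)//; lra.
Qed.

Section Fixed.
Context {a b M K : R} {v dv s : R -> R}.
Context (P : profile a b M K v dv s).
Let ab := pf_ab P.
Local Notation U := (@root R v s).
Local Notation p := (@droot R v dv s).

Definition Qa x : R := Q (1 * x + - a).
Definition Qb x : R := Q (-1 * x + b).
Definition dQa x : R := 1 * dQ (1 * x + - a).
Definition dQb x : R := -1 * dQ (-1 * x + b).
(** Each singular function continues past the opposite end point, so the remainder is not supported
    in (a, b); outside, its derivative is controlled by decay ([drem_outside]). *)
Definition rem al be x := U x + -1 * (al * Qa x + be * Qb x).
Definition drem al be x := p x + -1 * (al * dQa x + be * dQb x).

Lemma droot_middle e : 0 < e -> exists C, forall x, a + e <= x <= b - e -> `|p x| <= C.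
Proof.
move=> e0; have se := sqrt_pos e0.
exists (Num.sqrt M + Num.sqrt K * (1 + (b - a)) * ((Num.sqrt e)^-1 + (Num.sqrt e)^-1)) => x /andP[h1 h2].
apply: le_trans (droot_le P x) _; rewrite /droot_majorant.
have K1 : 0 <= Num.sqrt K * (1 + (b - a)) by rewrite mulr_ge0 ?sqrtr_ge0//; have := ab; lra.
have mj y : e <= y -> onpos (@major R) y <= (Num.sqrt e)^-1.
  move=> ey; have y0 : 0 < y by lra.
  rewrite onpos_pos// /major lef_pV2 ?posrE ?mulr_gt0 ?sqrt_pos//; last by lra.
  apply: (@le_trans _ _ (Num.sqrt y)); first by rewrite ler_wsqrtr.
  by rewrite ler_peMr ?sqrtr_ge0//; lra.
apply: lerD.
  rewrite -[leRHS]mulr1 ler_wpM2l ?sqrtr_ge0// /ind; by case: ifP.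
by rewrite ler_wpM2l// lerD//; apply: mj; lra.
Qed.

Lemma drem_inside : exists al be C, [/\ 0 <= C,
  forall x, a < x < b -> `|dv x - al ^+ 2| <= M * (x - a),
  forall x, a < x < b -> `|dv x + be ^+ 2| <= M * (b - x) &
  forall x, a < x < b -> `|drem al be x| <= C].
Proof.
have ab' : a < b := ab.
have [al [e1 [C1 [e10 e1b C10 h1 n1]]]] := left_droot P.
have [be [e2 [C2 [e20 e2b C20 h2 n2]]]] := left_droot (profile_reflect P).
have {}n2 x : b - e2 < x < b -> `|p x - - be * (2 * Num.sqrt (b - x))^-1| <= C2.
  move=> /andP[x1 x2]; have hx : a < a + b - x < a + e2 by apply/andP; split; lra.
  have := n2 _ hx; rewrite /droot (_ : -1 * (a + b - x) + (a + b) = x); last by ring.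
  rewrite (_ : a + b - x - a = b - x); last by ring.
  rewrite -[X in X <= _ -> _]normrN; apply: le_trans; rewrite le_eqVlt; apply/orP; left; apply/eqP.
  by congr `|_|; rewrite mulrN !mulNr !opprD !opprK.
have {}h2 x : a < x < b -> `|dv x + be ^+ 2| <= M * (b - x).
  move=> /andP[x1 x2]; have hx : a < a + b - x < b by apply/andP; split; lra.
  have := h2 _ hx; rewrite (_ : -1 * (a + b - x) + (a + b) = x); last by ring.
  rewrite (_ : a + b - x - a = b - x); last by ring.
  by rewrite -opprD normrN.
(* A point within [e1] of [a] is at least [dl] away from [b], and symmetrically with [e2]; the
   middle region keeps [dl] from both. *)
pose dl := Num.min (Num.min e1 e2) (Num.min (b - a - e1) (b - a - e2)).
have dl0 : 0 < dl by rewrite !lt_min e10 e20 !subr_gt0 e1b e2b.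
have dle1 : dl <= e1 by rewrite /dl !ge_min lexx.
have dle2 : dl <= e2 by rewrite /dl !ge_min lexx !orbT.
have dle3 : dl <= b - a - e1 by rewrite /dl !ge_min lexx !orbT.
have dle4 : dl <= b - a - e2 by rewrite /dl !ge_min lexx !orbT.
have [D [D0 hD]] := dQ_far dl0.
have hD1 y : (y <= 0) || (dl <= y) -> `|dQ y| <= D.
  move=> /hD /le_trans; apply; rewrite ler_pdivrMr ?onesq_gt0// ler_peMr//.
  by rewrite lerDl sqr_ge0.
have [C3' hC3] := droot_middle dl0.
pose C3 := `|C3'|; have C30 : 0 <= C3 by exact: normr_ge0.
pose S := 2 * Num.sqrt (b - a).
have S0 : 0 <= S by rewrite mulr_ge0 ?sqrtr_ge0.
have near_ y : 0 < y -> y <= b - a -> `|dQ y - (2 * Num.sqrt y)^-1| <= S.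
  move=> y0 yb; apply: le_trans (dQ_near y0) _; rewrite ler_wpM2l// ler_wsqrtr//.
have al0 := normr_ge0 al; have be0 := normr_ge0 be.
have alS := mulr_ge0 al0 S0; have beS := mulr_ge0 be0 S0.
have alD := mulr_ge0 al0 D0; have beD := mulr_ge0 be0 D0.
pose T := C1 + C2 + C3 + `|al| * S + `|be| * S + `|al| * D + `|be| * D.
have T0 : 0 <= T by rewrite /T; lra.
exists al, be, T; split => // x hx.
have /andP[xa xb] := hx.
  rewrite /drem /dQa /dQb !mul1r !mulN1r (addrC (- x)).
have [r1|r1] := ltP x (a + e1).
  have hxe : a < x < a + e1 by rewrite xa.
  have k1 := n1 x hxe.
  have k2 : `|dQ (x - a) - (2 * Num.sqrt (x - a))^-1| <= S by apply: near_; lra.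
  have k3 : `|dQ (b - x)| <= D by apply: hD1; apply/orP; right; lra.
  have k4 := ler_wpM2l al0 k2; have k5 := ler_wpM2l be0 k3; rewrite -!normrM in k4 k5.
  rewrite (_ : _ - _ = (p x - al * (2 * Num.sqrt (x - a))^-1)
    - al * (dQ (x - a) - (2 * Num.sqrt (x - a))^-1) + be * dQ (b - x)); last by ring.
  apply: le_trans (ler_normD _ _) _; have := ler_normB (p x - al * (2 * Num.sqrt (x - a))^-1) (al * (dQ (x - a) - (2 * Num.sqrt (x - a))^-1)).
  rewrite /T; move: k1 k4 k5 C10 C20 C30 alS beS alD beD; clear; move=> *; lra.
have [r2|r2] := ltP (b - e2) x.
  have hxe : b - e2 < x < b by rewrite xb r2.
  have k1 := n2 x hxe.
  have k2 : `|dQ (b - x) - (2 * Num.sqrt (b - x))^-1| <= S by apply: near_; lra.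
  have k3 : `|dQ (x - a)| <= D by apply: hD1; apply/orP; right; lra.
  have k4 := ler_wpM2l be0 k2; have k5 := ler_wpM2l al0 k3; rewrite -!normrM in k4 k5.
  rewrite (_ : _ - _ = (p x - - be * (2 * Num.sqrt (b - x))^-1)
    + be * (dQ (b - x) - (2 * Num.sqrt (b - x))^-1) - al * dQ (x - a)); last by ring.
  apply: le_trans (ler_normB _ _) _; have := ler_normD (p x - - be * (2 * Num.sqrt (b - x))^-1) (be * (dQ (b - x) - (2 * Num.sqrt (b - x))^-1)).
  rewrite /T; move: k1 k4 k5 C10 C20 C30 alS beS alD beD; clear; move=> *; lra.
have k1 : `|p x| <= C3.
  apply: le_trans (hC3 x _) _; first by apply/andP; split; lra.
  exact: ler_norm.
have k2 : `|dQ (b - x)| <= D by apply: hD1; apply/orP; right; lra.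
have k3 : `|dQ (x - a)| <= D by apply: hD1; apply/orP; right; lra.
have k4 := ler_wpM2l be0 k2; have k5 := ler_wpM2l al0 k3; rewrite -!normrM in k4 k5.
rewrite (_ : _ - _ = p x - al * dQ (x - a) + be * dQ (b - x)); last by ring.
apply: le_trans (ler_normD _ _) _; have := ler_normB (p x) (al * dQ (x - a)).
rewrite /T; move: k1 k4 k5 C10 C20 C30 alS beS alD beD; clear; move=> *; lra.
Qed.

(** Outside (a, b) only the singular function of the far end point survives, and x is at least as
    far from that end point as from any c in [a, b]; so the decay may be centred at c. *)
Lemma drem_outside al be : exists C, 0 <= C /\ forall c x, a <= c <= b -> ~~ (a < x < b) ->
  `|drem al be x| <= C / (1 + (x - c) ^+ 2).
Proof.
have ab' : a < b := ab; have ba0 : 0 < b - a by rewrite subr_gt0.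
have [D [D0 hD]] := dQ_far ba0.
have al0 := mulr_ge0 (normr_ge0 al) D0; have be0 := mulr_ge0 (normr_ge0 be) D0.
exists (`|al| * D + `|be| * D); split; first exact: addr_ge0.
move=> c x /andP[ac cb] hx; rewrite ler_pdivlMr ?onesq_gt0//.
have far y (A : R) : (y <= 0) || (b - a <= y) -> (x - c) ^+ 2 <= y ^+ 2 ->
    `|A * dQ y| * (1 + (x - c) ^+ 2) <= `|A| * D.
  move=> hy cy; have p1 := onesq_gt0 y; have p2 := onesq_gt0 (x - c).
  have := hD y hy; rewrite ler_pdivlMr// => k.
  by rewrite normrM -mulrA ler_wpM2l//; apply: le_trans k; rewrite ler_wpM2l// lerD2l.
rewrite /drem /dQa /dQb (droot_out P hx).
move: hx; rewrite negb_and -!leNgt => /orP[xa|xb].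
  rewrite (_ : dQ (1 * x + - a) = 0); last by rewrite /dQ onpos_neg// mul1r subr_le0.
  rewrite (_ : 0 + _ = be * dQ (-1 * x + b)); last by ring.
  have hy : (-1 * x + b <= 0) || (b - a <= -1 * x + b) by apply/orP; right; lra.
  have k : (x - c) ^+ 2 <= (-1 * x + b) ^+ 2.
    rewrite -subr_ge0 (_ : _ - _ = (b - c) * (b + c - 2 * x)); last by ring.
    by apply: mulr_ge0; lra.
  by apply: le_trans (far _ be hy k) _; rewrite lerDr.
rewrite (_ : dQ (-1 * x + b) = 0); last by rewrite /dQ onpos_neg//; lra.
rewrite (_ : 0 + _ = - al * dQ (1 * x + - a)); last by ring.
have hy : (1 * x + - a <= 0) || (b - a <= 1 * x + - a) by apply/orP; right; lra.
have k : (x - c) ^+ 2 <= (1 * x + - a) ^+ 2.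
  rewrite -subr_ge0 (_ : _ - _ = (c - a) * (2 * x - c - a)); last by ring.
  by apply: mulr_ge0; lra.
by apply: le_trans (far _ (- al) hy k) _; rewrite normrN lerDl.
Qed.

(** The bound is centred at an arbitrary c in [a, b], the future centre of dilation; inside (a, b)
    this costs the factor 1 + (b - a)^2. *)
Lemma slopes : exists al be C, [/\ 0 <= C,
  forall x, a < x < b -> `|dv x - al ^+ 2| <= M * (x - a),
  forall x, a < x < b -> `|dv x + be ^+ 2| <= M * (b - x) &
  forall c x, a <= c <= b -> `|drem al be x| <= C / (1 + (x - c) ^+ 2)].
Proof.
have [al [be [T [T0 h1 h2 hT]]]] := drem_inside.
have [C [C0 hC]] := drem_outside al be.
have T1 := mulr_ge0 T0 (ltW (onesq_gt0 (b - a))).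
exists al, be, (T * (1 + (b - a) ^+ 2) + C); split => //; first exact: addr_ge0.
move=> c x hc; have p := onesq_gt0 (x - c).
have [hx|hx] := boolP (a < x < b); last first.
  apply: le_trans (hC c x hc hx) _; rewrite ler_wpM2r ?lerDr// invr_ge0 ltW//.
rewrite ler_pdivlMr//; apply: (@le_trans _ _ (T * (1 + (b - a) ^+ 2))); last by rewrite lerDl.
apply: ler_pM => //; [exact: ltW|exact: hT|rewrite lerD2l].
move: hc hx => /andP[c1 c2] /andP[x1 x2].
rewrite -subr_ge0 (_ : _ - _ = (b - a - (x - c)) * (b - a + (x - c))); last by ring.
by apply: mulr_ge0; lra.
Qed.

End Fixed.
End Remainder.

(** * Dilations of the solution *)

Section Stretch.
Context {R : realType}.
Implicit Types (f F g k q : R -> R) (c d e t x y xi l C A W : R).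

Lemma L1_stretch_diff f c n : L1 f -> L1 (fun x => stretch f c n x - f x).
Proof. by move=> Lf; apply: L1B => //; apply: L1_affine => //; exact: stretch_neq0. Qed.

Section Fixed.
Context {a b M K : R} {v dv s : R -> R}.
Context (P : profile a b M K v dv s).
Let ab := pf_ab P.
Local Notation U := (@root R v s).
Local Notation Qa := (@Qa R a).
Local Notation Qb := (@Qb R b).

Let o1 := oner_neq0 R.
Let on1 : (-1 : R) != 0. Proof. by rewrite oppr_eq0 oner_eq0. Qed.

Lemma L1_Qa : L1 Qa. Proof. exact: L1_affine (@L1_Q R). Qed.
Lemma L1_Qb : L1 Qb. Proof. exact: L1_affine (@L1_Q R). Qed.
Lemma L2_Qa : L2 Qa. Proof. exact: L2_affine (@L2_Q R). Qed.
Lemma L2_Qb : L2 Qb. Proof. exact: L2_affine (@L2_Q R). Qed.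
Lemma energy_Qa : finite_energy Qa.
Proof. exact: finite_energy_affine (@L1_Q R) (@energy_Q R). Qed.
Lemma energy_Qb : finite_energy Qb.
Proof. exact: finite_energy_affine (@L1_Q R) (@energy_Q R). Qed.

Lemma fourier_deriv_rem al be : fourier_deriv (@rem R a b v s al be) (@drem R a b v dv s al be).
Proof.
apply: fourier_derivD; first exact: fourier_deriv_root P.
apply: fourier_derivZ; apply: fourier_derivD; apply: fourier_derivZ; apply: fourier_deriv_affine => //; exact: fourier_deriv_Q.
Qed.

Lemma primitive_rem al be : primitive (@rem R a b v s al be) (@drem R a b v dv s al be).
Proof.
apply: primitiveD; first exact: primitive_root P.
apply: primitiveZ; apply: primitiveD; apply: primitiveZ; apply: primitive_affine => //; exact: primitive_Q.
Qed.

Lemma L2_rem al be : L2 (@rem R a b v s al be).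
Proof.
apply: L2D; first exact: L2_root P.
by apply: L2Z; apply: L2D; apply: L2Z; [exact: L2_Qa|exact: L2_Qb].
Qed.

(** The dilation moves x away from [c], so the bound on the derivative at x holds along the whole
    path. The increment is at most C step |x - c| / (1 + (x - c)^2), whose square is integrable:
    this is the O(step) in L^2 that [energy_stretch_smooth] needs. *)
Lemma energy_rem al be C c : 0 <= C -> a <= c <= b ->
  (forall c x, a <= c <= b -> `|@drem R a b v dv s al be x| <= C / (1 + (x - c) ^+ 2)) ->
  let r := @rem R a b v s al be in
  [/\ finite_energy r, forall n, finite_energy (fun x => stretch r (- c) n x - r x) &
    (fun n => energy (fun x => stretch r (- c) n x - r x) (fun x => stretch r (- c) n x - r x) / step n)
      @ \oo --> (0 : R)].
Proof.
move=> C0 hc hC r; pose q := @drem R a b v dv s al be.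
have fd := fourier_deriv_rem al be; have pr := primitive_rem al be; have Lr := L2_rem al be.
have [_ Lq1 _] := fd.
have Lq : L2 q.
  apply: (L2_bounded (c := C)) => // x; apply: le_trans (hC c x hc) _.
  by rewrite ler_pdivrMr ?onesq_gt0// ler_peMr// lerDl sqr_ge0.
have [Lw Iw] := @cauchyw_int R.
have Lwc := L1_affine (- c) o1 Lw.
apply: (energy_stretch_smooth fd Lr Lq (W := C ^+ 2 / 2 * Int (fun x => cauchyw (1 * x + - c)))).
  rewrite mulr_ge0 ?Int_ge0//; first by rewrite divr_ge0 ?sqr_ge0.
  by move=> x; exact: cauchyw_ge0.
move=> n; have s0 := @step_gt0 R n.
rewrite mulrAC -IntZ//.
have [_ L] := stretch_diff_L2 (- c) n Lr.
apply: Int_le => //; first exact: L1Z.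
move=> x; rewrite mul1r.
have bd : `|stretch r (- c) n x - r x| <= C / (1 + (x - c) ^+ 2) * (step n * `|x - c|).
  have hz z : `|x - c| <= `|z - c| -> `|q z| <= C / (1 + (x - c) ^+ 2).
    move=> h; apply: le_trans (hC c z hc) _; rewrite ler_wpM2l// lef_pV2 ?posrE ?onesq_gt0// lerD2l.
    by rewrite -(real_normK (num_real (x - c))) -(real_normK (num_real (z - c))) lerXn2r ?nnegrE.
  have E : (1 + step n) * x + - c * step n = x + step n * (x - c) by ring.
  rewrite /stretch E; have [h|h|h] := ltgtP x c.
  - have h1 : x + step n * (x - c) < x by rewrite gtrDl pmulr_rlt0// subr_lt0.
    have k := primitive_le (C := C / (1 + (x - c) ^+ 2)) pr h1; rewrite distrC in k.
    apply: le_trans (k _) _.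
      by move=> z /andP[z1 z2]; apply: (hz z); rewrite !ltr0_norm ?subr_lt0//; lra.
    by rewrite ltr0_norm ?subr_lt0// le_eqVlt; apply/orP; left; apply/eqP; ring.
  - have h1 : x < x + step n * (x - c) by rewrite ltrDl mulr_gt0// subr_gt0.
    have k := primitive_le (C := C / (1 + (x - c) ^+ 2)) pr h1.
    apply: le_trans (k _) _.
      by move=> z /andP[z1 z2]; apply: (hz z); rewrite !gtr0_norm ?subr_gt0//; lra.
    by rewrite gtr0_norm ?subr_gt0// le_eqVlt; apply/orP; left; apply/eqP; ring.
  - by rewrite h subrr normr0 !mulr0 addr0 subrr normr0.
rewrite -(real_normK (num_real (_ - r x))); apply: (@le_trans _ _ ((C / (1 + (x - c) ^+ 2) * (step n * `|x - c|)) ^+ 2)).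
  by rewrite lerXn2r ?nnegrE// (le_trans _ bd).
have p1 := onesq_gt0 (x - c).
rewrite !exprMn real_normK ?num_real// /cauchyw exprVn.
rewrite [leLHS](_ : _ = C ^+ 2 * step n ^+ 2 * ((x - c) ^+ 2 / (1 + (x - c) ^+ 2) ^+ 2)); last by field; rewrite gt_eqF.
rewrite [leRHS](_ : _ = C ^+ 2 * step n ^+ 2 * (1 + (x - c) ^+ 2)^-1); last by field; rewrite gt_eqF.
rewrite ler_wpM2l//; first by rewrite mulr_ge0// sqr_ge0.
rewrite ler_pdivrMr ?exprn_gt0// [(1 + _) ^+ 2]expr2 mulKf ?gt_eqF//.
by rewrite lerDr.
Qed.

Lemma energy_Qa_stretch c : a <= c ->
  (forall n, finite_energy (fun x => stretch Qa (- c) n x - Qa x)) /\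
  (fun n => energy (fun x => stretch Qa (- c) n x - Qa x) (fun x => stretch Qa (- c) n x - Qa x) / step n)
    @ \oo --> pi ^+ 2 / 2 * (c - a).
Proof.
move=> ac; have h : a - c <= 0 by lra.
have [eQ cQ] := energy_stretch_Q h; rewrite opprB in cQ.
pose g n x := stretch Q (a - c) n x - Q x : R.
have E n : (fun x => stretch Qa (- c) n x - Qa x) = fun x => g n (1 * x + - a).
  by apply/funext => x; rewrite /g /Qa /stretch; congr (Q _ - Q _); ring.
have Lg n : L1 (g n).
  exact: L1_stretch_diff (@L1_Q R).
split; first by move=> n; rewrite E; exact: finite_energy_affine (Lg n) (eQ n).
move: cQ; apply: cvg_trans; apply: near_eq_cvg; near=> n; rewrite E.
by rewrite (energy_affine (- a) o1 (Lg n) (Lg n) (eQ n) (eQ n)).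
Unshelve. all: by end_near. Qed.

Lemma energy_Qb_stretch c : c <= b ->
  (forall n, finite_energy (fun x => stretch Qb (- c) n x - Qb x)) /\
  (fun n => energy (fun x => stretch Qb (- c) n x - Qb x) (fun x => stretch Qb (- c) n x - Qb x) / step n)
    @ \oo --> pi ^+ 2 / 2 * (b - c).
Proof.
move=> cb; have h : c - b <= 0 by lra.
have [eQ cQ] := energy_stretch_Q h; rewrite opprB in cQ.
pose g n x := stretch Q (c - b) n x - Q x : R.
have E n : (fun x => stretch Qb (- c) n x - Qb x) = fun x => g n (-1 * x + b).
  by apply/funext => x; rewrite /g /Qb /stretch; congr (Q _ - Q _); ring.
have Lg n : L1 (g n).
  exact: L1_stretch_diff (@L1_Q R).
split; first by move=> n; rewrite E; exact: finite_energy_affine (Lg n) (eQ n).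
move: cQ; apply: cvg_trans; apply: near_eq_cvg; near=> n; rewrite E.
by rewrite (energy_affine b on1 (Lg n) (Lg n) (eQ n) (eQ n)).
Unshelve. all: by end_near. Qed.

Lemma cvg_sum3_0 (x y z : nat -> R) : x @ \oo --> (0 : R) -> y @ \oo --> (0 : R) -> z @ \oo --> (0 : R) ->
  (fun n => 2 * (2 * x n + 2 * y n) + 2 * z n) @ \oo --> (0 : R).
Proof.
move=> cx cy cz; have h : (fun n => 2 * (2 * x n + 2 * y n) + 2 * z n) @ \oo --> 2 * (2 * 0 + 2 * 0) + 2 * (0 : R).
  apply: cvgD; apply: cvgM => //; try exact: cvg_cst.
  by apply: cvgD; apply: cvgM => //; exact: cvg_cst.
by rewrite !mulr0 !addr0 mulr0 in h.
Qed.

Lemma energy_vanish (g : nat -> R -> R) A :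
  (fun n => energy (g n) (g n) / step n) @ \oo --> A ->
  (fun n => energy (g n) (g n)) @ \oo --> (0 : R).
Proof.
move=> h; have c : (fun n => energy (g n) (g n) / step n * step n) @ \oo --> A * 0.
  by apply: cvgM => //; exact: step_cvg.
rewrite mulr0 in c; move: c; apply: cvg_trans; apply: near_eq_cvg; near=> n.
by rewrite divfK// gt_eqF// step_gt0.
Unshelve. all: by end_near. Qed.

(* Of the two end points only the one away from the centre of the dilation
   contributes to first order. *)
Lemma energy_root_stretch : exists al be,
  [/\ forall x, a < x < b -> `|dv x - al ^+ 2| <= M * (x - a),
      forall x, a < x < b -> `|dv x + be ^+ 2| <= M * (b - x), finite_energy U &
  forall c, a <= c <= b ->
  let e n := energy (fun x => stretch U (- c) n x - U x) (fun x => stretch U (- c) n x - U x) in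
  [/\ forall n, finite_energy (fun x => stretch U (- c) n x - U x),
      e @ \oo --> (0 : R) &
      c = a \/ c = b -> (fun n => e n / step n) @ \oo -->
        pi ^+ 2 / 2 * (al ^+ 2 * (c - a) + be ^+ 2 * (b - c))]].
Proof.
have ab' : a < b := ab.
have [al [be [C [C0 hal hbe hC]]]] := slopes P.
pose r := @rem R a b v s al be.
have Lr : L1 r by have [] := fourier_deriv_rem al be.
have hac : a <= a <= b by rewrite lexx ltW.
have [er _ _] := energy_rem C0 hac hC.
have LA := L1Z al L1_Qa; have LB := L1Z be L1_Qb.
have eA := finite_energyZ al L1_Qa energy_Qa; have eB := finite_energyZ be L1_Qb energy_Qb.
have UE : U = fun x => (al * Qa x + be * Qb x) + r x.
  by apply/funext => x; rewrite /r /rem; ring.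
exists al, be; split => //.
  rewrite UE; exact: (finite_energyD (L1D LA LB) Lr (finite_energyD LA LB eA eB) er).
move=> c hc e; have /andP[ac cb] := hc.
have [eA1 cA1] := energy_Qa_stretch ac; have [eB1 cB1] := energy_Qb_stretch cb.
have [_ er1 cr1] := energy_rem C0 hc hC.
pose gA n x := al * (stretch Qa (- c) n x - Qa x); pose gB n x := be * (stretch Qb (- c) n x - Qb x).
pose gr n x := stretch r (- c) n x - r x.
have LgA n : L1 (gA n) /\ finite_energy (gA n).
  by have L := L1_stretch_diff (- c) n L1_Qa; split; [exact: L1Z|exact: (finite_energyZ al L (eA1 n))].
have LgB n : L1 (gB n) /\ finite_energy (gB n).
  by have L := L1_stretch_diff (- c) n L1_Qb; split; [exact: L1Z|exact: (finite_energyZ be L (eB1 n))].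
have Lgr n : L1 (gr n) /\ finite_energy (gr n).
  by split; [exact: L1_stretch_diff|exact: er1].
have LAB n : L1 (fun x => gA n x + gB n x) /\ finite_energy (fun x => gA n x + gB n x).
  by have [l1 f1] := LgA n; have [l2 f2] := LgB n; split; [exact: L1D|exact: finite_energyD].
have E n : (fun x => stretch U (- c) n x - U x) = fun x => (gA n x + gB n x) + gr n x.
  by rewrite UE; apply/funext => x; rewrite /gA /gB /gr /stretch; ring.
have cA : (fun n => energy (gA n) (gA n) / step n) @ \oo --> al ^+ 2 * (pi ^+ 2 / 2 * (c - a)).
  have h : (fun n => al ^+ 2 * (energy (fun x => stretch Qa (- c) n x - Qa x) (fun x => stretch Qa (- c) n x - Qa x) / step n))
      @ \oo --> al ^+ 2 * (pi ^+ 2 / 2 * (c - a)) by apply: cvgM => //; exact: cvg_cst.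
  move: h; apply: cvg_trans; apply: near_eq_cvg; near=> n.
  by rewrite /gA (energyZ al (L1_stretch_diff (- c) n L1_Qa) (eA1 n)) mulrA.
have cB : (fun n => energy (gB n) (gB n) / step n) @ \oo --> be ^+ 2 * (pi ^+ 2 / 2 * (b - c)).
  have h : (fun n => be ^+ 2 * (energy (fun x => stretch Qb (- c) n x - Qb x) (fun x => stretch Qb (- c) n x - Qb x) / step n))
      @ \oo --> be ^+ 2 * (pi ^+ 2 / 2 * (b - c)) by apply: cvgM => //; exact: cvg_cst.
  move: h; apply: cvg_trans; apply: near_eq_cvg; near=> n.
  by rewrite /gB (energyZ be (L1_stretch_diff (- c) n L1_Qb) (eB1 n)) mulrA.
have eE : e = fun n => energy (fun x => (gA n x + gB n x) + gr n x) (fun x => (gA n x + gB n x) + gr n x).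
  by apply/funext => n; rewrite /e E.
split.
- move=> n; rewrite E; have [l1 f1] := LAB n; have [l2 f2] := Lgr n; exact: finite_energyD.
- apply: (@cvgn_squeeze _ _ (fun n => 2 * (2 * energy (gA n) (gA n) + 2 * energy (gB n) (gB n)) + 2 * energy (gr n) (gr n))).
    move=> n; rewrite subr0 eE ger0_norm; last exact: energy_ge0.
    have [l1 f1] := LAB n; have [l2 f2] := Lgr n; have [l3 f3] := LgA n; have [l4 f4] := LgB n.
    apply: (le_trans (energyD_le l1 l2 f1 f2)); rewrite lerD2r; apply: ler_wpM2l; first exact: ler0n.
    exact: (energyD_le l3 l4 f3 f4).
  have v1 := energy_vanish cA; have v2 := energy_vanish cB; have v3 := energy_vanish cr1.
  exact: cvg_sum3_0 v1 v2 v3.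
(* At an end point one of [gA] and [gB] has energy o(step), so [energy_perturb] applies twice; at an
   interior centre both may be of order step, with a cross term. *)
move=> hcab; rewrite eE; apply: energy_perturb => //; first exact: step_gt0.
case: hcab => hE; rewrite hE subrr !mulr0 ?add0r ?addr0.
  rewrite hE subrr !mulr0 in cA; rewrite hE in cB.
  rewrite (_ : pi ^+ 2 / 2 * _ = be ^+ 2 * (pi ^+ 2 / 2 * (b - a))); last by rewrite mulrCA.
  have := energy_perturb (@step_gt0 R) LgB LgA cB cA; apply: cvg_trans; apply: near_eq_cvg; near=> n.
  by rewrite (_ : (fun x => gA n x + gB n x) = fun x => gB n x + gA n x)//; apply/funext => x; exact: addrC.
rewrite hE subrr !mulr0 in cB; rewrite hE in cA.
rewrite (_ : pi ^+ 2 / 2 * _ = al ^+ 2 * (pi ^+ 2 / 2 * (b - a))); last by rewrite mulrCA.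
exact: energy_perturb (@step_gt0 R) LgA LgB cA cB.
Unshelve. all: by end_near. Qed.

End Fixed.
End Stretch.

(** * Pohozaev identities *)

Section Pohozaev.
Context {R : realType}.
Implicit Types (f F k q : R -> R) (c d e t x y xi l C A W : R).
Local Notation mu := (@lebesgue_measure R).

Section Fixed.
Context {a b M K : R} {v dv s : R -> R}.
Context (P : profile a b M K v dv s).
Let ab := pf_ab P.
Local Notation U := (@root R v s).
Local Notation p := (@droot R v dv s).

Lemma sqrt_dist (y z : R) : 0 <= y -> 0 <= z -> (Num.sqrt y - Num.sqrt z) ^+ 2 <= `|y - z|.
Proof.
move=> y0 z0; have h1 := sqrtr_ge0 y; have h2 := sqrtr_ge0 z.
rewrite -{2}(sqr_sqrtr y0) -{2}(sqr_sqrtr z0) subr_sqr normrM (@ger0_norm _ (Num.sqrt y + Num.sqrt z)) ?addr_ge0//.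
rewrite -[leLHS]real_normK ?num_real// expr2 ler_wpM2l// ler_norml; apply/andP; split; lra.
Qed.

(** With equal signs this is the Hoelder bound for the square root. With opposite signs U has a zero
    z in between, and the square of the difference is at most 2 (v x + v y) <= 2 K ((z - x) + (y -
    z)) for x < y. *)
Lemma root_holder x y : (U y - U x) ^+ 2 <= 2 * K * `|y - x|.
Proof.
have K0 := pf_K P.
wlog xy : x y / x < y.
  move=> H; have [h|h|->] := ltgtP x y; first exact: H.
    by rewrite -sqrrN opprB distrC; exact: H.
  by rewrite subrr expr0n/= mulr_ge0// mulr_ge0.
have lip := pf_lip P x y; have vx := pf_ge0 P x; have vy := pf_ge0 P y.
rewrite (@gtr0_norm _ (y - x)) ?subr_gt0// in lip *.
have same : (Num.sqrt (v y) - Num.sqrt (v x)) ^+ 2 <= 2 * K * (y - x).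
  apply: le_trans (sqrt_dist vy vx) _; apply: le_trans lip _.
  by rewrite ler_wpM2r ?subr_ge0 ?(ltW xy)// ler_peMl// ler1n.
have [sxy|sxy] : s x = s y \/ s x = - s y.
- by case: (pf_s P x) => ->; case: (pf_s P y) => ->; rewrite ?opprK; tauto.
- by rewrite /root sxy -mulrBr exprMn (pf_sqr P) mul1r.
have [z /andP[zx zy] Uz] : exists2 z, x <= z <= y & U z = 0.
  have sgn : U x <= 0 <= U y \/ U y <= 0 <= U x.
    rewrite /root sxy; have := sqrtr_ge0 (v x); have := sqrtr_ge0 (v y).
    by case: (pf_s P y) => -> h1 h2; [left|right]; apply/andP; split; lra.
  have [|z] := @IVT R U x y 0 (ltW xy) (continuous_subspaceT (root_continuous P)).
    by case: sgn => /andP[h1 h2]; rewrite ge_min le_max h1 h2 ?orbT.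
  by rewrite in_itv/= => zxy Uz; exists z.
have vz : v z = 0 by rewrite -(root_sqr P) Uz expr0n.
have l1 := pf_lip P z y; have l2 := pf_lip P z x; rewrite vz !subr0 in l1 l2.
rewrite (ger0_norm vy) ger0_norm ?subr_ge0// in l1.
rewrite (ger0_norm vx) distrC ger0_norm ?subr_ge0// in l2.
have := root_sqr P x; have := root_sqr P y; move: (U x) (U y) => A B eB eA.
have : 0 <= (A + B) ^+ 2 by exact: sqr_ge0.
nra.
Qed.

(** Three regimes: where v > 0 the sign is constant and [v] is Lipschitz; at an interior zero U^2 =
    v is quadratic; off [a, b] everything vanishes. *)
Lemma root_quadratic x : x != a -> x != b ->
  exists C, \forall y \near x, (U y - U x) ^+ 2 <= C * (y - x) ^+ 2.
Proof.
move=> xa xb; have [vx|vx|vx] := ltgtP (v x) 0; first by have := pf_ge0 P x; lra.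
  exists (K ^+ 2 / v x); apply: filterS (pf_loc P vx) => y sy.
  rewrite /root sy -mulrBr exprMn (pf_sqr P) mul1r mulrAC ler_pdivlMr//.
  have h1 := sqrtr_ge0 (v y); have h2 := sqrt_pos vx; have e1 := sqr_sqrtr (pf_ge0 P y); have e2 := sqr_sqrt vx.
  apply: (@le_trans _ _ ((v y - v x) ^+ 2)).
    have E : v y - v x = (Num.sqrt (v y) - Num.sqrt (v x)) * (Num.sqrt (v y) + Num.sqrt (v x)).
      by rewrite -subr_sqr e1 e2.
    rewrite E exprMn ler_wpM2l ?sqr_ge0// -[leLHS]e2 lerXn2r ?nnegrE ?(ltW h2) ?addr_ge0 ?(ltW h2)//.
    by rewrite lerDr.
  have := pf_lip P x y => l.
  by rewrite -exprMn -(real_normK (num_real (v y - v x))) -(real_normK (num_real (_ * (y - x)))) lerXn2r ?nnegrE// normrM (ger0_norm (pf_K P)).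
have Ux : U x = 0 by rewrite /root vx sqrtr0 mulr0.
exists M; have [hx|hx] := boolP (a < x < b).
  apply: filterS (near_oo hx) => y hy; rewrite Ux subr0 (root_sqr P).
  have := pf_taylor P hx hy; rewrite vx (dv_zero P hx vx) mul0r !subr0; apply: le_trans; exact: ler_norm.
have M0 := pf_M P.
have [h|h] : x < a \/ b < x.
- by move: hx; rewrite negb_and -!leNgt !le_eqVlt (negbTE xa) [b == x]eq_sym (negbTE xb)/= => /orP[]; [left|right].
- near=> y; rewrite Ux (root_out P) ?subr0 ?expr0n/=; first exact: mulr_ge0 M0 (sqr_ge0 _).
  by apply/negP => /andP[h1 _]; have : y < a; [near: y; exact: lt_nbhsl|lra].
near=> y; rewrite Ux (root_out P) ?subr0 ?expr0n/=; first exact: mulr_ge0 M0 (sqr_ge0 _).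
by apply/negP => /andP[_ h1]; have : b < y; [near: y; exact: lt_nbhsr|lra].
Unshelve. all: by end_near. Qed.

Lemma stretch_out c n x : a <= c <= b -> ~~ (a < x < b) -> stretch U (- c) n x = 0.
Proof.
move=> /andP[ac cb] hx; apply: (root_out P); have s0 := @step_gt0 R n.
rewrite (_ : _ + _ = x + step n * (x - c)); last by ring.
move: hx; rewrite negb_and -!leNgt => /orP[h|h]; apply/negP => /andP[h1 h2]; nra.
Qed.

Lemma stretch_continuous c n : continuous (stretch U c n).
Proof.
move=> x; apply: (continuous_comp (f := fun x => (1 + step n) * x + c * step n)); last exact: root_continuous P _.
by isd_cont.
Qed.

(* u(x + h) - u(x) = O(h^(1/2)) uniformly and O(h) off {a, b}. *)
Lemma sqnorm_stretch_root c : a <= c <= b ->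
  (fun n => sqnorm (fun x => stretch U (- c) n x - U x) / step n) @ \oo --> (0 : R).
Proof.
move=> hc; have /andP[ac cb] := hc.
pose g n x := (stretch U (- c) n x - U x) ^+ 2 / step n.
have E n x : (1 + step n) * x + - c * step n = x + step n * (x - c) by ring.
have mg n : measurable_fun setT (g n).
  apply: continuous_measurable_fun => x; apply: cvgM; last exact: cvg_cst.
  have h : {for x, continuous (fun x => stretch U (- c) n x - U x)}.
    by apply: cvgB; [exact: stretch_continuous|exact: (root_continuous P)].
  by rewrite expr2; apply: cvgM; exact: h.
have gb n x : `|g n x| <= 2 * K * (b - a) * ind a b x.
  have s0 := @step_gt0 R n.
  rewrite /g ger0_norm; last by rewrite divr_ge0 ?sqr_ge0// ltW.
  rewrite /ind; case: ifPn => hx; last by rewrite stretch_out// (root_out P hx) subrr expr0n/= mul0r mulr0.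
  rewrite ler_pdivrMr// mulr1; apply: le_trans (root_holder _ _) _; rewrite E addrAC subrr add0r.
  rewrite normrM (gtr0_norm s0) [leRHS](_ : _ = 2 * K * (step n * (b - a))); last by ring.
  rewrite ler_wpM2l ?mulr_ge0 ?(pf_K P)// ler_wpM2l ?(ltW s0)//.
  case/andP: hx => h1 h2; rewrite ler_norml; apply/andP; split; lra.
have ptw (x : R) : x != a -> x != b -> (fun n => g n x) @ \oo --> (0 : R).
  move=> xa xb; have [C hC] := root_quadratic xa xb.
  have An : (fun n => x + step n * (x - c)) @ \oo --> x + 0 * (x - c).
    by apply: cvgD; [exact: cvg_cst|apply: cvgM; [exact: step_cvg|exact: cvg_cst]].
  rewrite mul0r addr0 in An.
  have hn : \forall n \near \oo, (U (x + step n * (x - c)) - U x) ^+ 2 <= C * (x + step n * (x - c) - x) ^+ 2.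
    exact: (An _ hC).
  apply: (@cvg_squeeze _ _ _ _ _ (fun n => C * (x - c) ^+ 2 * step n)).
    apply: filterS hn => n h; have s0 := @step_gt0 R n.
    rewrite subr0 /g ger0_norm; last by rewrite divr_ge0 ?sqr_ge0// ltW.
    rewrite ler_pdivrMr// /stretch E; apply: le_trans h _; rewrite addrAC subrr add0r.
    by rewrite le_eqVlt; apply/orP; left; apply/eqP; ring.
  have h := cvgM (cvg_cst (C * (x - c) ^+ 2)) (@step_cvg R); rewrite mulr0 in h; exact: h.
have gae : {ae mu, forall x, (fun n => g n x) @ \oo --> (cst 0 : R -> R) x}.
  exists [set a; b]; split.
  - exact: measurableU.
  - by rewrite measureU0//; exact: lebesgue_measure_set1.
  move=> x /= nx; apply: contrapT => /not_orP[xa xb]; apply: nx.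
  by apply: ptw; apply/eqP.
have m0 : measurable_fun setT (cst 0 : R -> R) by exact: measurable_cst.
have [_ h] := Int_DCT mg m0 gae (L1Z (2 * K * (b - a)) (L1_ind a b)) gb.
rewrite (_ : Int (cst 0) = 0) in h; last exact: Int0.
move: h; apply: cvg_trans; apply: near_eq_cvg; near=> n.
rewrite /g /sqnorm mulrC -IntZ; last by have [] := stretch_diff_L2 (- c) n (L2_root P).
by apply: eq_Int => x; rewrite mulrC.
Unshelve. all: by end_near. Qed.

Context {g G : R -> R} {L : R}.
Local Notation B := (Num.sqrt (K * (b - a))).
Context (cg : continuous g).
Context (dG : forall y, is_derive y 1 G (g y)).
Context (G0 : G 0 = 0).
Context (L0 : 0 <= L).
Context (gl : forall x y, `|x| <= B -> `|y| <= B -> `|g y - g x| <= L * `|y - x|).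

Lemma G_taylor x y : `|x| <= B -> `|y| <= B -> `|G y - G x - g x * (y - x)| <= L * (y - x) ^+ 2.
Proof.
move=> hx hy; have cG z : {for z, continuous G} by exact: isd_continuous (dG z).
have bd z : `|z - x| <= `|y - x| -> `|z| <= B -> `|(g z - g x) * (y - x)| <= L * (y - x) ^+ 2.
  move=> h hz; rewrite normrM -(real_normK (num_real (y - x))) expr2 mulrA ler_wpM2r//.
  by apply: le_trans (gl hx hz) _; rewrite ler_wpM2l.
have d x' y' (z : R) : z \in `]x', y'[%R -> is_derive z 1 G (g z) by move=> _; exact: dG.
have /andP[x1 x2] : - B <= x <= B by rewrite -ler_norml.
have /andP[y1 y2] : - B <= y <= B by rewrite -ler_norml.
have [xy|yx|<-] := ltgtP x y.
- have [z + ->] := MVT xy (d x y) (continuous_subspaceT cG); rewrite in_itv/= => /andP[z1 z2].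
  rewrite -mulrBl; apply: bd; first by rewrite !gtr0_norm ?subr_gt0//; lra.
  rewrite ler_norml; apply/andP; split; lra.
- have [z + e] := MVT yx (d y x) (continuous_subspaceT cG); rewrite in_itv/= => /andP[z1 z2].
  rewrite (_ : _ - _ = (g z - g x) * (y - x)); last by move: e; lra.
  apply: bd; first by rewrite !ltr0_norm ?subr_lt0//; lra.
  rewrite ler_norml; apply/andP; split; lra.
by rewrite !subrr mulr0 subrr normr0 expr0n mulr0.
Qed.

Lemma continuous_gU : continuous (fun x => g (U x)).
Proof. by move=> x; apply: continuous_comp; [exact: (root_continuous P)|exact: cg]. Qed.

Lemma L1_gU : L1 ((fun x => g (U x)) \_ `]a, b[).
Proof.
have [C [C0 hC]] := continuous_bounded_itv a b continuous_gU.
apply: (L1_le (L1Z C (L1_ind a b))); first by apply: open_continuous_meas => x _; exact: continuous_gU.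
move=> x; rewrite patch_oo /ind; case: ifP => [/andP[h1 h2]|_]; last by rewrite normr0 mulr0.
by rewrite mulr1; apply: hC; rewrite !ltW.
Qed.

Lemma GU_out x : ~~ (a < x < b) -> G (U x) = 0.
Proof. by move=> h; rewrite (root_out P h). Qed.

Lemma L1_GU : L1 (fun x => G (U x)).
Proof.
have cG : continuous G by move=> z; exact: isd_continuous (dG z).
have c : continuous (fun x => G (U x)).
  by move=> x; apply: continuous_comp; [exact: (root_continuous P)|exact: cG].
have sG : csupp (fun x => G (U x)) by apply: csupp_itv => x; exact: GU_out.
exact: csupp_L1 sG (continuous_csupp_L2 c sG).
Qed.

Context (eU : finite_energy U).
Context (W : forall phi, test_function a b phi ->
  energy U phi = 2 * pi * \int[mu]_(x in `]a, b[) (g (U x) * phi x)).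
Context (mid_energy : forall c, a <= c <= b ->
  (forall n, finite_energy (fun x => stretch U (- c) n x - U x)) /\
  (fun n => energy (fun x => stretch U (- c) n x - U x) (fun x => stretch U (- c) n x - U x)) @ \oo --> (0 : R)).

(* The approximations are compactly supported: dilations about the midpoint. *)
Lemma energy_pair l t : 0 < l -> l * a + t <= a -> b <= l * b + t ->
  energy U (fun x => U (l * x + t)) =
  2 * pi * Int (fun x => ((fun x => g (U x)) \_ `]a, b[) x * U (l * x + t)).
Proof.
move=> l0 la lb; have ab' : a < b := ab; have ln : l != 0 by rewrite gt_eqF.
pose m := (a + b) / 2; have hm : a <= m <= b by rewrite /m; apply/andP; split; lra.
have [em cm] := mid_energy hm.
pose z n x := stretch U (- m) n (l * x + t).
have LU := L1_root P; have LUA := L1_affine t ln LU; have eUA := finite_energy_affine t ln LU eU.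
have Ls n : L1 (stretch U (- m) n) by apply: L1_affine => //; exact: stretch_neq0.
have es n : finite_energy (stretch U (- m) n) by exact: finite_energy_affine (stretch_neq0 n) LU eU.
have Lz n : L1 (z n) by exact: L1_affine t ln (Ls n).
have ez n : finite_energy (z n) by exact: finite_energy_affine t ln (Ls n) (es n).
have cz n : continuous (z n).
  move=> x; apply: (continuous_comp (f := fun x => l * x + t)); last exact: stretch_continuous.
  by isd_cont.
have Wz n : energy U (z n) = 2 * pi * \int[mu]_(x in `]a, b[) (g (U x) * z n x).
  (* The stretch about the midpoint lives on m - rho, m + rho with rho < (b - a) / 2. Since x -> l x
     + t maps (a, b) onto an interval containing it, the preimage [c, d] lies strictly inside (a,
     b). *)
  have s0 := @step_gt0 R n; pose rho := (b - a) / (2 * (1 + step n)).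
  have r1 : rho * (1 + step n) = (b - a) / 2 by rewrite /rho; field; rewrite gt_eqF//; lra.
  have rho0 : 0 < rho by rewrite divr_gt0 ?subr_gt0// mulr_gt0//; lra.
  have rho1 : rho < (b - a) / 2 by nra.
  pose c := (m - rho - t) / l; pose d := (m + rho - t) / l.
  have cl : c * l = m - rho - t by rewrite /c divfK.
  have dl : d * l = m + rho - t by rewrite /d divfK.
  have ac : a < c by rewrite -(ltr_pM2r l0) cl /m; lra.
  have cd : c < d by rewrite -(ltr_pM2r l0) cl dl; lra.
  have db : d < b by rewrite -(ltr_pM2r l0) dl /m; lra.
  apply: (energy_weak ac cd db LU eU L1_gU W (cz n) _ (ez n)) => x hx.
  rewrite /z /stretch (root_out P)//; apply: contra hx.
  rewrite (_ : _ + _ = m + (1 + step n) * (l * x + t - m)); last by ring.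
  move=> /andP[h1 h2]; rewrite -(ltr_pM2r l0) -[x < d](ltr_pM2r l0) cl dl.
  apply/andP; split; rewrite /m in h1 h2 *; nra.
have lhs : (fun n => energy U (z n)) @ \oo --> energy U (fun x => U (l * x + t)).
  pose D n x := stretch U (- m) n x - U x.
  have LD n : L1 (D n) by exact: L1B (Ls n) LU.
  pose DA n x := D n (l * x + t).
  have LDA n : L1 (DA n) by exact: L1_affine t ln (LD n).
  have eDA n : finite_energy (DA n) by exact: finite_energy_affine t ln (LD n) (em n).
  have enD n : energy (DA n) (DA n) = energy (D n) (D n) by exact: energy_affine t ln (LD n) (LD n) (em n) (em n).
  have zE n : z n = fun x => U (l * x + t) + DA n x by apply/funext => x; rewrite /DA /D /z; ring.
  apply: (@cvgn_squeeze _ _ (fun n => Num.sqrt (energy U U) * Num.sqrt (energy (D n) (D n)))) => [n|].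
    rewrite zE (energyDr LU LUA (LDA n) eU eUA (eDA n)) addrAC subrr add0r -enD.
    exact: (energy_CS LU (LDA n) eU (eDA n)).
  have h := cvgM (cvg_cst (Num.sqrt (energy U U))) (cvg_sqrt0 cm); rewrite mulr0 in h; exact: h.
have mfz n : measurable_fun setT (z n) by exact: L1_meas (Lz n).
have rhs : (fun n => 2 * pi * \int[mu]_(x in `]a, b[) (g (U x) * z n x)) @ \oo -->
    2 * pi * Int (fun x => ((fun x => g (U x)) \_ `]a, b[) x * U (l * x + t)).
  apply: cvgM; first exact: cvg_cst.
  have zI n : \int[mu]_(x in `]a, b[) (g (U x) * z n x) = Int (fun x => ((fun x => g (U x)) \_ `]a, b[) x * z n x).
    by rewrite Int_patch; apply: eq_Int => x; rewrite !patch_oo; case: ifP => // _; rewrite mul0r.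
  rewrite (funext zI : (fun n => _) = _).
  apply: (Int_DCT (g := fun x => B * `|((fun x => g (U x)) \_ `]a, b[) x|) _ _ _ _ _).2.
  - by move=> n; apply: measurable_funM => //; exact: L1_meas L1_gU.
  - by apply: measurable_funM; [exact: L1_meas L1_gU|exact: L1_meas LUA].
  - apply: aeW => /= x; apply: cvgM; first exact: cvg_cst.
    have An : (fun n => (1 + step n) * (l * (x : R) + t) + - m * step n) @ \oo --> 1 * (l * (x : R) + t) + - m * 0.
      apply: cvgD; apply: cvgM; try exact: cvg_cst; [exact: stretch_cvg|exact: step_cvg].
    rewrite mulr0 addr0 mul1r in An; apply: continuous_cvg An; exact: (root_continuous P).
  - by apply: L1Z; exact: L1_norm L1_gU.
  - by move=> n x; rewrite normrM mulrC ler_wpM2r//; exact: (root_bounded P).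
rewrite (funext Wz : (fun n => _) = _) in lhs.
by rewrite -(cvg_lim _ lhs)// -(cvg_lim _ rhs).
Qed.

(** The constant is 2 from polarisation times 2 pi from the weak formulation. [energy_pair] is
    applied to the stretch and, with the trivial affine map, to U itself. *)
Lemma energy_stretch_identity c n : a <= c <= b ->
  energy (fun x => stretch U (- c) n x - U x) (fun x => stretch U (- c) n x - U x) =
  - (4 * pi) * Int (fun x => ((fun x => g (U x)) \_ `]a, b[) x * (stretch U (- c) n x - U x)).
Proof.
move=> hc; have /andP[ac cb] := hc; have s0 := @step_gt0 R n.
have [ed _] := mid_energy hc; have LU := L1_root P.
have ln := @stretch_neq0 R n; have lp : 0 < 1 + step n :> R by lra.
have k1 : (1 + step n) * a + - c * step n <= a.
  by rewrite -subr_ge0 (_ : _ - _ = step n * (c - a)); [rewrite mulr_ge0 ?subr_ge0// ltW|ring].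
have k2 : b <= (1 + step n) * b + - c * step n.
  by rewrite -subr_ge0 (_ : _ - _ = step n * (b - c)); [rewrite mulr_ge0 ?subr_ge0// ltW|ring].
have k3 : 1 * a + 0 <= a by rewrite mul1r addr0.
have k4 : b <= 1 * b + 0 by rewrite mul1r addr0.
have I1 := energy_pair lp k1 k2.
have I2 := energy_pair ltr01 k3 k4.
have Ls : L1 (stretch U (- c) n) by exact: L1_affine.
pose D x := stretch U (- c) n x - U x.
have LD : L1 D by exact: L1B.
have E1 : energy (stretch U (- c) n) (stretch U (- c) n) = energy U U.
  exact: (energy_affine (- c * step n) ln LU LU eU eU).
have SE : stretch U (- c) n = fun x => U x + D x by apply/funext => x; rewrite /D; ring.
have E2 := energyD LU LD eU (ed n); rewrite -SE E1 in E2.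
have E3 : energy U (stretch U (- c) n) = energy U U + energy U D.
  by rewrite {1}SE; exact: (energyDr LU LU LD eU eU (ed n)).
have LgU := L1_gU; have mU := L1_meas LU.
have Lgs : L1 (fun x => ((fun x => g (U x)) \_ `]a, b[) x * stretch U (- c) n x).
  exact: (L1M_bounded (c := B) LgU (L1_meas Ls) (fun x => root_bounded P _)).
have LgUU : L1 (fun x => ((fun x => g (U x)) \_ `]a, b[) x * U x).
  exact: (L1M_bounded (c := B) LgU mU (fun x => root_bounded P _)).
have I1' : energy U (stretch U (- c) n) = 2 * pi * Int (fun x => ((fun x => g (U x)) \_ `]a, b[) x * stretch U (- c) n x).
  exact: I1.
have I2' : energy U U = 2 * pi * Int (fun x => ((fun x => g (U x)) \_ `]a, b[) x * U x).
  have h : (fun x => U (1 * x + 0)) = U by apply/funext => x; rewrite mul1r addr0.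
  rewrite h in I2; rewrite I2.
  by congr (_ * Int _); apply/funext => x; rewrite mul1r addr0.
rewrite -/D -[X in _ = _ * X](_ : Int (fun x => ((fun x => g (U x)) \_ `]a, b[) x * stretch U (- c) n x) -
   Int (fun x => ((fun x => g (U x)) \_ `]a, b[) x * U x) = _); last first.
  by rewrite -(IntB Lgs LgUU); apply: eq_Int => x; rewrite mulrBr.
have : energy D D = - 2 * (energy U (stretch U (- c) n) - energy U U).
  rewrite E3; move: E2; move: (energy U U) (energy U D) (energy D D) => x y z h.
  by apply: (addrI (x + 2 * y)); rewrite -h; ring.
rewrite I1' I2' => ->; move: (Int _) (Int _) => x y; ring.
Qed.

(** A change of variable gives the integral of G(U_h) exactly, as that of G(U) divided by 1 + step.
    Comparison with the Taylor expansion leaves at most L |U_h - U|^2, whose integral is o(step) by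
    [sqnorm_stretch_root]. *)
Lemma pohozaev_limit c A : a <= c <= b ->
  (fun n => energy (fun x => stretch U (- c) n x - U x) (fun x => stretch U (- c) n x - U x) / step n)
    @ \oo --> A ->
  4 * pi * Int (fun x => G (U x)) = A.
Proof.
move=> hc hA; have LGU := L1_GU; have LgU := L1_gU.
pose Ul n := stretch U (- c) n; pose D n x := Ul n x - U x.
have LU := L1_root P; have Ls n : L1 (Ul n) by apply: L1_affine => //; exact: stretch_neq0.
have LD n : L1 (D n) by exact: L1B.
have [mD LD2] : (forall n, measurable_fun setT (D n)) /\ forall n, L1 (fun x => D n x ^+ 2).
  by split=> n; have [] := stretch_diff_L2 (- c) n (L2_root P).
have LgD n : L1 (fun x => ((fun x => g (U x)) \_ `]a, b[) x * D n x).
  apply: (L1M_bounded (c := B + B) LgU (mD n)) => x; rewrite (le_trans (ler_normB _ _))// lerD//; exact: (root_bounded P).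
have LGl n : L1 (fun x => G (Ul n x)) by exact: (L1_affine (- c * step n) (stretch_neq0 n) LGU).
pose rm n x := G (Ul n x) - G (U x) - ((fun x => g (U x)) \_ `]a, b[) x * D n x.
have Lrm n : L1 (rm n) by apply: L1B => //; exact: L1B.
have rmb n x : `|rm n x| <= L * D n x ^+ 2.
  rewrite /rm patch_oo; case: ifPn => hx; first by apply: G_taylor; exact: (root_bounded P).
  by rewrite /D /Ul stretch_out// (root_out P hx) !subrr mul0r subr0 normr0 expr0n mulr0.
have IG n : Int (fun x => G (Ul n x)) = (1 + step n)^-1 * Int (fun x => G (U x)).
  have s0 := @step_gt0 R n; rewrite -[in RHS](@gtr0_norm _ (1 + step n)); last by lra.
  exact: (Int_affine (- c * step n) (stretch_neq0 n) LGU).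
have ID n : Int (fun x => ((fun x => g (U x)) \_ `]a, b[) x * D n x) =
    - (step n / (1 + step n)) * Int (fun x => G (U x)) - Int (rm n).
  have E : Int (rm n) = (Int (fun x => G (Ul n x)) - Int (fun x => G (U x))) -
      Int (fun x => ((fun x => g (U x)) \_ `]a, b[) x * D n x).
    by rewrite -IntB// -IntB//; exact: L1B.
  rewrite E IG; move: (Int _) (Int _) => X Y; have s0 := @step_gt0 R n.
  by field; rewrite gt_eqF//; lra.
have En n : energy (fun x => stretch U (- c) n x - U x) (fun x => stretch U (- c) n x - U x) / step n =
    4 * pi * (Int (fun x => G (U x)) / (1 + step n) + Int (rm n) / step n).
  rewrite (energy_stretch_identity n hc) ID; move: (Int (rm n)) (Int _) => X Y.
  have s0 := @step_gt0 R n; generalize (@pi R) => w; field.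
  by rewrite !gt_eqF//; lra.
have crm : (fun n => Int (rm n) / step n) @ \oo --> (0 : R).
  apply: (@cvgn_squeeze _ _ (fun n => L * (sqnorm (D n) / step n))) => [n|].
    have s0 := @step_gt0 R n; rewrite subr0 normrM normfV (gtr0_norm s0) mulrA.
    rewrite ler_wpM2r ?invr_ge0 ?(ltW s0)//; apply: le_trans (Int_norm (Lrm n)) _.
    by rewrite -IntZ//; apply: Int_le => //; [exact: L1_norm|exact: L1Z].
  have h := cvgM (cvg_cst L) (sqnorm_stretch_root hc); rewrite mulr0 in h; exact: h.
have lim : (fun n => 4 * pi * (Int (fun x => G (U x)) / (1 + step n) + Int (rm n) / step n)) @ \oo -->
    4 * pi * (Int (fun x => G (U x)) / 1 + 0).
  apply: cvgM; first exact: cvg_cst.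
  apply: cvgD => //; apply: cvgM; first exact: cvg_cst.
  by apply: cvgV; [exact: oner_neq0|exact: stretch_cvg].
rewrite divr1 addr0 in lim; rewrite (funext En : (fun n => _) = _) in hA.
by rewrite -(cvg_lim _ hA)// -(cvg_lim _ lim).
Qed.

(** Integration by parts with G(U) as primitive of g(U) U'; the boundary terms vanish because U is
    zero at [a] and [b] and G 0 = 0. It is used with X = 1 and X = x. *)
Lemma chain_zero (X dX : R -> R) : (forall x, is_derive x 1 X (dX x)) -> continuous dX ->
  L1 (fun x => X x * (g (U x) * p x)) /\
  Int (fun x => X x * (g (U x) * p x)) = - Int (fun x => dX x * G (U x)).
Proof.
move=> dXE cdX.
have cX : continuous X by move=> x; exact: isd_continuous (dXE x).
have out x : ~~ (a < x < b) -> X x * (g (U x) * p x) + dX x * G (U x) = 0.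
  by move=> hx; rewrite (droot_out P hx) GU_out// !mulr0 addr0.
have [LL II] := chain_Int P (lexx a) ab (lexx b) cg dG dXE cdX.
rewrite (patch_support out) in LL II.
have LG : L1 (fun x => dX x * G (U x)).
  have [C [C0 hC]] := continuous_bounded_itv a b cdX.
  apply: (L1_le (L1Z C (L1_norm L1_GU))).
    by apply: measurable_funM; [exact: continuous_measurable_fun|exact: L1_meas L1_GU].
  move=> x; rewrite normrM; have [hx|hx] := boolP (a < x < b); last by rewrite GU_out// normr0 !mulr0.
  by rewrite ler_wpM2r//; apply: hC; case/andP: hx => h1 h2; rewrite !ltW.
have LX : L1 (fun x => X x * (g (U x) * p x)) by apply: eq_L1 (L1B LL LG) => x; ring.
split => //; rewrite (IntD LX LG) (root_out P (x := a)) ?ltxx// in II.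
rewrite (root_out P (x := b)) ?ltxx ?andbF// G0 !mulr0 subrr in II.
by apply/eqP; rewrite -subr_eq0 opprK; apply/eqP.
Qed.

End Fixed.

Lemma pohozaev (a b M K : R) (v dv s g G : R -> R) (L : R) (P : profile a b M K v dv s) :
  continuous g -> (forall y, is_derive y 1 G (g y)) -> G 0 = 0 -> 0 <= L ->
  (forall x y, `|x| <= Num.sqrt (K * (b - a)) -> `|y| <= Num.sqrt (K * (b - a)) ->
     `|g y - g x| <= L * `|y - x|) ->
  (forall phi, test_function a b phi ->
    energy (@root R v s) phi = 2 * pi * \int[mu]_(x in `]a, b[) (g (@root R v s x) * phi x)) ->
  exists La Lb,
    [/\ forall x, a < x < b -> `|dv x - La| <= M * (x - a),
        forall x, a < x < b -> `|dv x + Lb| <= M * (b - x),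
        Int (fun x => g (@root R v s x) * (@droot R v dv s x)) = pi / 8 * (La - Lb) &
        L1 (fun x => x * (g (@root R v s x) * (@droot R v dv s x))) /\
        Int (fun x => x * (g (@root R v s x) * (@droot R v dv s x))) = pi / 8 * (La * a - Lb * b)].
Proof.
move=> cg dG G0 L0 gl W; have ab := pf_ab P.
have [al [be [hal hbe eU hc]]] := energy_root_stretch P.
have mid c : a <= c <= b -> (forall n, finite_energy (fun x => stretch (@root R v s) (- c) n x - (@root R v s x))) /\
  (fun n => energy (fun x => stretch (@root R v s) (- c) n x - (@root R v s x)) (fun x => stretch (@root R v s) (- c) n x - (@root R v s x)))
    @ \oo --> (0 : R) by move=> /hc[].
have ha : a <= a <= b by rewrite lexx ltW.
have hb : a <= b <= b by rewrite lexx ltW.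
have [_ _ ca] := hc a ha; have [_ _ cb] := hc b hb.
have Ia := pohozaev_limit P cg dG G0 L0 gl eU W mid ha (ca (or_introl erefl)).
have Ib := pohozaev_limit P cg dG G0 L0 gl eU W mid hb (cb (or_intror erefl)).
have c0 : continuous (fun _ : R => 0 : R) by move=> x; exact: cst_continuous.
have c1 : continuous (fun _ : R => 1 : R) by move=> x; exact: cst_continuous.
have [_ J1] := chain_zero P cg dG G0 (fun x => isd_cst 1 x) c0.
have [L2 J2] := chain_zero P cg dG G0 (fun x => isd_id x) c1.
have I1 : Int (fun x => 0 * G (@root R v s x)) = 0.
  by rewrite -[RHS](@Int0 R); apply: eq_Int => x; rewrite mul0r.
have I2 : Int (fun x => 1 * G (@root R v s x)) = Int (fun x => G (@root R v s x)).
  by apply: eq_Int => x; rewrite mul1r.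
rewrite I1 oppr0 in J1; rewrite I2 in J2.
have p0 : pi != 0 :> R by rewrite gt_eqF// pi_gt0.
rewrite !subrr !mulr0 ?add0r ?addr0 in Ia Ib.
move: (Int (fun x => G (@root R v s x))) Ia Ib J2 => I Ia Ib J2.
have ba : b - a != 0 by rewrite subr_eq0 gt_eqF.
(* The centre [a] detects the slope at [b]; pi / 8 is pi^2 / 2 divided by 4 pi. *)
have Eb : I = pi / 8 * (be ^+ 2 * (b - a)).
  apply: (@mulfI _ (4 * pi)); first by rewrite mulf_neq0.
  by rewrite Ia; generalize (@pi R) => w; field.
have Ea : I = pi / 8 * (al ^+ 2 * (b - a)).
  apply: (@mulfI _ (4 * pi)); first by rewrite mulf_neq0.
  by rewrite Ib; generalize (@pi R) => w; field.
have ab2 : al ^+ 2 = be ^+ 2.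
  have h : pi / 8 * (b - a) != 0 :> R by rewrite !mulf_neq0// invr_eq0.
  apply: (mulIf h); move: Ea; rewrite Eb => E; rewrite mulrCA -E mulrCA mulrC -mulrA.
  by congr (_ * _); rewrite mulrC.
exists (al ^+ 2), (be ^+ 2); split => //.
(* The slopes coincide, so both sides of the first identity are zero. *)
- rewrite ab2 subrr mulr0 -[RHS]J1; apply: eq_Int => x; by rewrite mul1r.
- by split => //; rewrite J2 Eb ab2; ring.
Qed.

End Pohozaev.

(** * Boundary values and sign of the solution *)

Section Translates.
Context {R : realType}.
Implicit Types (f F g k q u : R -> R) (c d e t x y xi l C A W : R).
Local Notation mu := (@lebesgue_measure R).

(** In [sqnorm_translate] the linear bound provides the majorant and the quadratic one the pointwise
    limit. *)
Lemma onecos_bounds y : 0 <= 1 - cos y /\ 1 - cos y <= `|y| /\ 1 - cos y <= y ^+ 2.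
Proof.
split; first by rewrite subr_ge0 cos_le1.
wlog y0 : y / 0 <= y.
  move=> H; have [h|h] := leP 0 y; first exact: H.
  by rewrite -cosN -normrN -sqrrN; apply: H; rewrite oppr_ge0 ltW.
have [->|yn] := eqVneq y 0; first by rewrite cos0 subrr normr0 expr0n.
have yp : 0 < y by rewrite lt_neqAle eq_sym yn.
have ds (z : R) : is_derive z 1 (@sin R) (cos z) by apply: isd_eq (isd_sin (isd_id z)) _; rewrite mulr1.
have dc (z : R) : is_derive z 1 (@cos R) (- sin z) by apply: isd_eq (isd_cos (isd_id z)) _; rewrite mulr1.
have cs : continuous (@sin R) by move=> z; exact: isd_continuous (ds z).
have cc : continuous (@cos R) by move=> z; exact: isd_continuous (dc z).
have sb (z : R) : 0 < z -> `|sin z| <= z.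
  move=> z0; have := @mvt_bound R sin cos 1 0 z z0 (fun w _ => ds w) (continuous_subspaceT cs) (fun w _ => norm_cos w).
  by rewrite sin0 subr0 subr0 mul1r.
have b C : (forall z, 0 < z < y -> `|sin z| <= C) -> 1 - cos y <= C * y.
  move=> h; have := @mvt_bound R cos (fun z => - sin z) C 0 y yp (fun w _ => dc w) (continuous_subspaceT cc).
  rewrite cos0 subr0 distrC => H; apply: le_trans (ler_norm _) (H _) => z hz; rewrite normrN; exact: h.
split.
  by rewrite ger0_norm// -[leRHS]mul1r; apply: b => z _; exact: norm_sin.
rewrite expr2; apply: b => z /andP[z0 zy]; apply: le_trans (sb z z0) (ltW zy).
Qed.

(** By Plancherel the quotient is a constant times the integral of 2 (1 - cos(kap h xi)) / h against
    the spectrum. The factor is at most 2 |kap| |xi|, which finite energy makes integrable, and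
    tends to 0 at each frequency. *)
Lemma sqnorm_translate u kap : L1 u -> L2 u -> finite_energy u ->
  (fun n => sqnorm (fun x => u (1 * x + kap * step n) - u x) / step n) @ \oo --> (0 : R).
Proof.
move=> Lu Lu2 eu; have o1 := oner_neq0 R.
pose g n x := u (1 * x + kap * step n) - u x.
have Lg n : L1 (g n) by apply: L1B => //; exact: L1_affine.
have Lg2 n : L2 (g n) by apply: L2B => //; exact: L2_affine.
pose F n xi := 2 * ((1 - cos (kap * step n * xi)) / step n) * spec u u xi.
have E n : sqnorm (g n) / step n = (2 * pi)^-1 * Int (F n).
  have [LS IS] := plancherel_spec (Lg n) (Lg2 n) (Lg n) (Lg2 n).
  have p0 : 2 * pi != 0 :> R by rewrite mulf_neq0// gt_eqF// pi_gt0.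
  have -> : sqnorm (g n) = (2 * pi)^-1 * Int (spec (g n) (g n)).
    by rewrite IS mulKf//; apply: eq_Int => x; rewrite expr2.
  rewrite -mulrA; congr (_ * _); rewrite mulrC -(IntZ _ LS); apply: eq_Int => xi.
  by rewrite spec_translate// /F; ring.
rewrite (_ : (fun n => _) = fun n => (2 * pi)^-1 * Int (F n)); last exact/funext.
have Lsp := (plancherel_spec Lu Lu2 Lu Lu2).1; have msp := L1_meas Lsp.
have bF n xi : `|F n xi| <= 2 * `|kap| * (`|xi| * spec u u xi).
  have s0 := @step_gt0 R n; have [c0 [c1 _]] := onecos_bounds (kap * step n * xi).
  rewrite /F normrM (ger0_norm (spec_ge0 _ _)) [leRHS]mulrA; apply: ler_wpM2r; first exact: spec_ge0.
  rewrite ger0_norm; last by rewrite mulr_ge0// divr_ge0// ltW.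
  rewrite -[leRHS]mulrA ler_wpM2l// ler_pdivrMr//; apply: le_trans c1 _.
  by rewrite !normrM (gtr0_norm s0) mulrAC.
have m0 : measurable_fun setT (cst 0 : R -> R) by exact: measurable_cst.
have lim (xi : R) : (fun n => F n xi) @ \oo --> (0 : R).
  apply: (@cvgn_squeeze _ _ (fun n => 2 * kap ^+ 2 * xi ^+ 2 * spec u u xi * step n)) => [n|].
    have s0 := @step_gt0 R n; have [c0 [_ c2]] := onecos_bounds (kap * step n * xi).
    rewrite subr0 /F ger0_norm; last by rewrite !mulr_ge0 ?spec_ge0 ?invr_ge0// ltW.
    rewrite [leRHS](_ : _ = 2 * (kap ^+ 2 * xi ^+ 2 * step n) * spec u u xi); last by ring.
    rewrite ler_wpM2r ?spec_ge0// ler_wpM2l// ler_pdivrMr//; apply: le_trans c2 _.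
    by rewrite le_eqVlt; apply/orP; left; apply/eqP; ring.
  have h := cvgM (cvg_cst (2 * kap ^+ 2 * xi ^+ 2 * spec u u xi)) (@step_cvg R); rewrite mulr0 in h; exact: h.
have mF n : measurable_fun setT (F n).
  apply: measurable_funM => //; apply: continuous_measurable_fun => x.
  have c : {for x, continuous (fun xi : R => 2 * ((1 - cos (kap * step n * xi)) * (step n)^-1))} by isd_cont.
  exact: c.
have lae : {ae mu, forall xi, (fun n => F n xi) @ \oo --> (cst 0 : R -> R) xi}.
  by apply: aeW => /= xi; exact: lim.
have [_ h] := Int_DCT mF m0 lae (L1Z (2 * `|kap|) eu) bF.
rewrite (_ : Int (cst 0) = 0) in h; last exact: Int0.
have h2 := cvgM (cvg_cst ((2 * pi)^-1 : R)) h; rewrite mulr0 in h2; exact: h2.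
Qed.

(** Squared increments of at least A on an interval of length step contribute A step, against the
    o(step) of [sqnorm_translate]. *)
Lemma translate_lower u kap e A : L1 u -> L2 u -> finite_energy u -> 0 < A -> 0 < e ->
  (forall m, step m <= e -> exists x0, forall x, x0 < x < x0 + step m ->
     A <= (u (1 * x + kap * step m) - u x) ^+ 2) -> False.
Proof.
move=> Lu Lu2 eu A0 e0 H; have cv := sqnorm_translate kap Lu Lu2 eu; have o1 := oner_neq0 R.
have c2 : (fun n => step n) @ \oo --> (0 : R) by exact: step_cvg.
move/cvgrPdist_lt : cv => /(_ A A0) h1; move/cvgrPdist_lt : c2 => /(_ e e0) h2.
have [m _ /(_ m (leqnn m)) [/= k1 k2]] := filterI h1 h2.
have s0 := @step_gt0 R m; rewrite sub0r normrN gtr0_norm// in k2.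
have [x0 hx0] := H m (ltW k2).
have [_ L] : L2 (fun x => u (1 * x + kap * step m) - u x) by apply: L2B => //; exact: L2_affine.
rewrite sub0r normrN ger0_norm in k1; last by rewrite divr_ge0 ?sqnorm_ge0// ltW.
rewrite ltr_pdivrMr// in k1; move: k1; rewrite ltNge => /negP; apply.
have xs : x0 < x0 + step m by rewrite ltrDl.
rewrite -[X in A * X](_ : Int (ind x0 (x0 + step m)) = _); last by rewrite Int_ind// addrAC subrr add0r.
rewrite -IntZ; last exact: L1_ind.
apply: Int_le => //; first by apply: L1Z; exact: L1_ind.
by move=> x; rewrite /ind; case: ifP => [/hx0|_]; rewrite ?mulr1// mulr0 sqr_ge0.
Qed.

(** A tent with its peak at y, left unnormalised so that no division occurs: its slopes are d - y
    and c - y. *)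
Definition tent c d y x := Num.max 0 (Num.min ((x - c) * (d - y)) ((d - x) * (y - c))).

Lemma min_dist (p q p' q' D : R) : `|p' - p| <= D -> `|q' - q| <= D ->
  `|Num.min p' q' - Num.min p q| <= D.
Proof.
rewrite !ler_norml => /andP[h1 h2] /andP[h3 h4].
by have [a1|a1] := leP p q; have [a2|a2] := leP p' q'; apply/andP; split; lra.
Qed.

Lemma max0_dist (p q : R) : `|Num.max 0 p - Num.max 0 q| <= `|p - q|.
Proof.
have [a1|a1] := leP 0 p; have [a2|a2] := leP 0 q => //.
- by rewrite subr0 !ger0_norm; lra.
- by rewrite sub0r normrN distrC !ger0_norm; lra.
- by rewrite subrr normr0.
Qed.

Section Tent.
Context {c d y : R}.
Context (cyd : c < y < d).

Lemma tent_left x : c <= x <= y -> tent c d y x = (x - c) * (d - y).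
Proof.
case/andP: cyd => cy yd /andP[cx xy]; rewrite /tent min_l; last first.
  by rewrite -subr_ge0 (_ : _ - _ = (y - x) * (d - c)); [rewrite mulr_ge0//; lra|ring].
by rewrite max_r// mulr_ge0//; lra.
Qed.

Lemma tent_right x : y <= x <= d -> tent c d y x = (d - x) * (y - c).
Proof.
case/andP: cyd => cy yd /andP[cx xy]; rewrite /tent min_r; last first.
  by rewrite -subr_ge0 (_ : _ - _ = (x - y) * (d - c)); [rewrite mulr_ge0//; lra|ring].
by rewrite max_r// mulr_ge0//; lra.
Qed.

Lemma tent_out x : ~~ (c < x < d) -> tent c d y x = 0.
Proof.
case/andP: cyd => cy yd; rewrite negb_and -!leNgt => h; rewrite /tent max_l//.
by rewrite ge_min; case/orP: h => h; apply/orP; [left|right]; rewrite mulr_le0_ge0//; lra.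
Qed.

Lemma tent_lip x x' : `|tent c d y x' - tent c d y x| <= (d - c) * `|x' - x|.
Proof.
case/andP: cyd => cy yd; have n0 := normr_ge0 (x' - x).
have h1 : `|(x' - c) * (d - y) - (x - c) * (d - y)| <= (d - c) * `|x' - x|.
  rewrite -mulrBl (_ : x' - c - _ = x' - x); last by ring.
  by rewrite normrM mulrC ler_wpM2r// ger0_norm; lra.
have h2 : `|(d - x') * (y - c) - (d - x) * (y - c)| <= (d - c) * `|x' - x|.
  rewrite -mulrBl (_ : d - x' - _ = x - x'); last by ring.
  by rewrite normrM distrC mulrC ler_wpM2r// ger0_norm; lra.
by apply: le_trans (max0_dist _ _) _; exact: min_dist.
Qed.

End Tent.
End Translates.

(** * Local constancy of the sign *)

Section Sign.
Context {R : realType}.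
Implicit Types (f g k q u : R -> R) (c d e t x y xi l C A W : R).
Local Notation mu := (@lebesgue_measure R).

Definition sgn u x : R := if 0 < u x then 1 else -1.

Lemma sgn_meas u : measurable_fun setT u -> measurable_fun setT (sgn u).
Proof.
move=> mu; apply: measurable_fun_ifT => //.
by apply: measurable_fun_ltr => //; exact: measurable_cst.
Qed.

Lemma sgn_norm u x : `|sgn u x| <= 1.
Proof. by rewrite /sgn; case: ifP => _; rewrite ?normrN normr1. Qed.

(** Opposite signs with both squares at least A force a squared increment of at least A, so sign
    changes are paid for by the L^2 increment of [u]. *)
Lemma sgn_diff u x x' A : 0 < A -> A <= u x ^+ 2 -> A <= u x' ^+ 2 ->
  `|sgn u x - sgn u x'| <= 2 / A * (u x' - u x) ^+ 2.
Proof.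
move=> A0 h h'; rewrite mulrAC ler_pdivlMr//.
have opp (a b : R) : A <= a ^+ 2 -> A <= b ^+ 2 -> 0 < a -> b <= 0 -> 2 * A <= 2 * (b - a) ^+ 2.
  by move=> h1 h2 h3 h4; nra.
rewrite /sgn; have [p|p] := ltP 0 (u x); have [p'|p'] := ltP 0 (u x').
- by rewrite subrr normr0 mul0r mulr_ge0// sqr_ge0.
- by rewrite opprK (_ : 1 + 1 = 2 :> R); [rewrite ger0_norm//; exact: opp|ring].
- rewrite (_ : -1 - 1 = - 2 :> R); last by ring.
  by rewrite normrN ger0_norm// -sqrrN opprB; exact: opp.
- by rewrite subrr normr0 mul0r mulr_ge0// sqr_ge0.
Qed.

Definition dtent c d y x := (d - y) * ind c y x - (y - c) * ind y d x.

Lemma tent_meas c d y : c < y < d -> measurable_fun setT (tent c d y).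
Proof. by move=> h; apply: continuous_measurable_fun; exact: lipschitz_continuous (tent_lip h). Qed.

Lemma ind_split c y d : c < y < d -> {ae mu, forall x, ind c d x = ind c y x + ind y d x}.
Proof.
move=> /andP[cy yd]; exists [set y]; split => //; first by rewrite lebesgue_measure_set1.
move=> x /= nx; apply: contrapT => /eqP xy; apply: nx; rewrite /ind.
have [h|h|h] := ltgtP x y; last by rewrite h eqxx in xy.
  by rewrite (lt_trans h yd) !andbT addr0.
by rewrite (lt_trans cy h) /= add0r.
Qed.

Lemma tent_quotient c d y x : c < y < d -> x != c -> x != y -> x != d ->
  (fun n => (tent c d y x - tent c d y (1 * x + -1 * step n)) / step n) @ \oo --> dtent c d y x.
Proof.
move=> cyd xc xy xd; have /andP[cy yd] := cyd.
have near_le (e : R) : 0 < e -> \forall n \near \oo, step n < e :> R.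
  move=> e0; have /cvgrPdist_lt/(_ e e0) := @step_cvg R; apply: filterS => n.
  by rewrite sub0r normrN gtr0_norm// step_gt0.
have E n : 1 * x + -1 * step n = x - step n by ring.
have main (e D : R) : 0 < e -> (forall h, 0 < h -> h < e -> tent c d y x - tent c d y (x - h) = D * h) ->
    (fun n => (tent c d y x - tent c d y (1 * x + -1 * step n)) / step n) @ \oo --> D.
  move=> e0 H; apply: cvg_near_cst; apply: filterS (near_le e e0) => n hn.
  by rewrite E H ?step_gt0// mulfK// gt_eqF// step_gt0.
rewrite /dtent /ind; have [xlc|cx|e] := ltgtP x c; last by rewrite e eqxx in xc.
- rewrite (_ : y < x = false); last by apply/negbTE; rewrite -leNgt; lra.
  rewrite /= !mulr0 subrr; apply: (main 1) => // h h0 _; rewrite mul0r !tent_out ?subrr//; apply/negP => /andP[? _]; lra.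
have [xly|yx|e] := ltgtP x y; last by rewrite e eqxx in xy.
- rewrite mulr1 mulr0 subr0; apply: (main (x - c)); first by rewrite subr_gt0.
  move=> h h0 h1; rewrite !tent_left//; [ring|apply/andP; split; lra|apply/andP; split; lra].
have [xld|dx|e] := ltgtP x d; last by rewrite e eqxx in xd.
- rewrite mulr0 mulr1 sub0r; apply: (main (x - y)); first by rewrite subr_gt0.
  move=> h h0 h1; rewrite !tent_right//; [ring|apply/andP; split; lra|apply/andP; split; lra].
rewrite !mulr0 subrr; apply: (main (x - d)); first by rewrite subr_gt0.
by move=> h h0 h1; rewrite mul0r !tent_out ?subrr//; apply/negP => /andP[_ ?]; lra.
Qed.

(** The distributional derivative of [sgn u] is zero, tested on tents: the difference quotient is
    moved onto [sgn u], where [sgn_diff] and [sqnorm_translate] make it vanish. The margin e leaves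
    room for translates beyond d. *)
Lemma sgn_tent u c d y e A : L1 u -> L2 u -> finite_energy u -> 0 < A -> 0 < e -> c < y < d ->
  (forall x, c < x < d + e -> A <= u x ^+ 2) ->
  Int (fun x => sgn u x * dtent c d y x) = 0.
Proof.
move=> Lu Lu2 eu A0 e0 cyd hA; have /andP[cy yd] := cyd; have cd : c < d by lra.
have ms := sgn_meas (L1_meas Lu); have mt := tent_meas cyd; have o1 := oner_neq0 R.
have tb x : `|tent c d y x| <= (d - c) ^+ 2 * ind c d x.
  rewrite /ind; case: ifPn => hx; last by rewrite tent_out// normr0 mulr0.
  have := tent_lip cyd c x; rewrite (tent_out cyd (x := c)) ?ltxx// subr0 mulr1 => h; apply: le_trans h _.
  rewrite expr2 ler_wpM2l ?subr_ge0 ?(ltW cd)//; case/andP: hx => h1 h2; rewrite ger0_norm; lra.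
have Lt : L1 (tent c d y) by apply: (L1_le (L1Z ((d - c) ^+ 2) (L1_ind c d))).
have Lst : L1 (fun x => sgn u x * tent c d y x).
  by apply: eq_L1 (L1M_bounded Lt ms (sgn_norm u)) => x; rewrite mulrC.
pose Tn n x := tent c d y (1 * x + -1 * step n).
have mTn n : measurable_fun setT (Tn n) by exact: measurable_comp_affine.
have LTn n : L1 (fun x => sgn u x * Tn n x).
  have L := L1_affine (-1 * step n) o1 Lt.
  by apply: eq_L1 (L1M_bounded L ms (sgn_norm u)) => x; rewrite mulrC.
pose sn n x := sgn u (1 * x + 1 * step n).
have msn n : measurable_fun setT (sn n) by exact: measurable_comp_affine.
have Lsn n : L1 (fun x => sn n x * tent c d y x).
  by apply: eq_L1 (L1M_bounded Lt (msn n) (fun x => sgn_norm u _)) => x; rewrite mulrC.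
pose q n := Int (fun x => sgn u x * ((tent c d y x - Tn n x) / step n)).
have q0 : q @ \oo --> (0 : R).
  have sh n : Int (fun x => sn n x * tent c d y x) = Int (fun x => sgn u x * Tn n x).
    have h := Int_affine (1 * step n) o1 (LTn n); rewrite normr1 invr1 [RHS]mul1r in h; rewrite -h.
    by apply: eq_Int => x; rewrite /sn /Tn; congr (_ * tent c d y _); ring.
  have qE n : q n = (step n)^-1 * Int (fun x => (sgn u x - sn n x) * tent c d y x).
    rewrite -[in RHS](eq_Int (f := fun x => sgn u x * tent c d y x - sn n x * tent c d y x)); last by move=> x; rewrite mulrBl.
    rewrite (IntB Lst (Lsn n)) sh -(IntB Lst (LTn n)) -IntZ; last exact: L1B.
    by apply: eq_Int => x; ring.
  pose C := 2 / A * (d - c) ^+ 2.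
  have C0 : 0 <= 2 / A by rewrite divr_ge0// ltW.
  have cv := sqnorm_translate 1 Lu Lu2 eu.
  have cvC : (fun n => C * (sqnorm (fun x => u (1 * x + 1 * step n) - u x) / step n)) @ \oo --> (0 : R).
    have h := cvgM (cvg_cst C) cv; rewrite mulr0 in h; exact: h.
  apply: cvg_squeeze cvC; have /cvgrPdist_lt/(_ e e0) := @step_cvg R; apply: filterS => n.
  have s0 := @step_gt0 R n; rewrite sub0r normrN gtr0_norm// => sne.
  rewrite subr0 qE normrM gtr0_norm ?invr_gt0// mulrA mulrC ler_wpM2r ?invr_ge0 ?(ltW s0)//.
  have Ls : L1 (fun x => (sgn u x - sn n x) * tent c d y x).
    by apply: eq_L1 (L1B Lst (Lsn n)) => x; rewrite mulrBl.
  have [_ L] : L2 (fun x => u (1 * x + 1 * step n) - u x) by apply: L2B => //; exact: L2_affine.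
  apply: le_trans (Int_norm Ls) _; rewrite -IntZ//; apply: Int_le; [exact: L1_norm|exact: L1Z|move=> x].
  have [hx|hx] := boolP (c < x < d); last by rewrite tent_out// mulr0 normr0 mulr_ge0 ?sqr_ge0// mulr_ge0// sqr_ge0.
  rewrite normrM /C mulrAC; apply: ler_pM => //; last first.
    by apply: le_trans (tb x) _; rewrite /ind hx mulr1.
  case/andP: hx => h1 h2; apply: sgn_diff => //; apply: hA; apply/andP; split; lra.
have lim : q @ \oo --> Int (fun x => sgn u x * dtent c d y x).
  have md : measurable_fun setT (dtent c d y).
    have m1 := L1_meas (L1_ind c y); have m2 := L1_meas (L1_ind y d).
    by apply: measurable_funB; apply: measurable_funM.
  apply: (Int_DCT (g := fun x => (d - c) * ind (c) (d + 1) x) _ _ _ _ _).2.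
  - move=> n; apply: measurable_funM => //; apply: measurable_funM => //.
    exact: measurable_funB.
  - exact: measurable_funM.
  - exists [set c; y; d]; split.
    + by apply: measurableU => //; apply: measurableU.
    + rewrite measureU0//; last exact: lebesgue_measure_set1.
        by rewrite measureU0//; exact: lebesgue_measure_set1.
      by apply: measurableU.
    move=> x /= nx; apply: contrapT => /not_orP[/not_orP[xc xy] xd]; apply: nx.
    apply: cvgM; first exact: cvg_cst.
    by apply: tent_quotient => //; apply/eqP.
  - by apply: L1Z; exact: L1_ind.
  move=> n x; have s0 := @step_gt0 R n; have s1 := @step_le1 R n.
  rewrite normrM; apply: (@le_trans _ _ `|(tent c d y x - Tn n x) / step n|).
    by rewrite ler_piMl// sgn_norm.
  rewrite normrM normfV (gtr0_norm s0) ler_pdivrMr// /Tn (_ : 1 * x + -1 * step n = x - step n); last by ring.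
  rewrite /ind; case: ifPn => hx.
    have := tent_lip cyd (x - step n) x; rewrite mulr1 (_ : x - (x - step n) = step n); last by ring.
    by rewrite (gtr0_norm s0).
  rewrite mulr0 mul0r !tent_out ?subrr ?normr0//; apply: contra hx => /andP[h1 h2]; apply/andP; split; lra.
by rewrite -(cvg_lim _ q0)// -(cvg_lim _ lim).
Qed.

(** By [sgn_tent] the means of [sgn u] over (c, y) and (y, d) agree for every y. So the integral of
    sgn u - kap over (c, y) is zero, and Lebesgue differentiation concludes. *)
Lemma sgn_const u c d e A : L1 u -> L2 u -> finite_energy u -> 0 < A -> 0 < e -> c < d ->
  (forall x, c < x < d + e -> A <= u x ^+ 2) ->
  exists kap, {ae mu, forall x, c < x < d -> sgn u x = kap}.
Proof.
move=> Lu Lu2 eu A0 e0 cd hA; have ms := sgn_meas (L1_meas Lu).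
have Ls c' d' : L1 (fun x => sgn u x * ind c' d' x).
  by apply: eq_L1 (L1M_bounded (L1_ind c' d') ms (sgn_norm u)) => x; rewrite mulrC.
pose kap := Int (fun x => sgn u x * ind c d x) / (d - c); exists kap.
have dc : d - c != 0 by rewrite subr_eq0 gt_eqF.
have ae0 y : {ae mu, forall x : R, ((fun x => sgn u x - kap) \_ `[c, y]) x = sgn u x * ind c y x - kap * ind c y x}.
  exists [set c; y]; split.
  - exact: measurableU.
  - by rewrite measureU0//; exact: lebesgue_measure_set1.
  move=> x /= nx; apply: contrapT => /not_orP[xc xy]; apply: nx.
  rewrite patchE mem_setE in_itv/= /ind !le_eqVlt eq_sym.
  move/eqP/negbTE : xc => ->; move/eqP/negbTE : xy => ->; rewrite /=.
  by case: ifP => _; rewrite ?mulr1// !mulr0 subrr.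
have Lp y : L1 (fun x => sgn u x * ind c y x - kap * ind c y x).
  by apply: L1B => //; apply: L1Z; exact: L1_ind.
have mp y : measurable_fun setT ((fun x => sgn u x - kap) \_ `[c, y]).
  apply/(measurable_restrictT _ (measurable_itv _)); apply: measurable_funS (_ : measurable_fun setT _) => //.
  exact: measurable_funB.
have LI y : L1 ((fun x => sgn u x - kap) \_ `[c, y]) /\
    Int ((fun x => sgn u x - kap) \_ `[c, y]) = Int (fun x => sgn u x * ind c y x - kap * ind c y x).
  have [|L ->] := L1_ae (f := fun x => sgn u x * ind c y x - kap * ind c y x) (mp y) _ (Lp y) => //.
  by have := ae0 y; apply: (filterS (F := almost_everywhere mu)) => x ->.
have [Ld _] := LI d.
have := Int_cc0_ae_cc cd Ld; move=> H.
have {}H : {ae mu, forall x, c < x < d -> sgn u x - kap = 0}.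
  apply: H => y cyd; have /andP[cy yd] := cyd; have [_ ->] := LI y.
  rewrite IntB//; last by apply: L1Z; exact: L1_ind.
  rewrite IntZ ?Int_ind//; last exact: L1_ind.
  have T := sgn_tent Lu Lu2 eu A0 e0 cyd hA.
  have T1 : (d - y) * Int (fun x => sgn u x * ind c y x) = (y - c) * Int (fun x => sgn u x * ind y d x).
    apply/eqP; rewrite -subr_eq0 -IntZ// -IntZ// -IntB; [|exact: L1Z..].
    by apply/eqP; rewrite -[RHS]T; apply: eq_Int => x; rewrite /dtent; ring.
  have T2 : Int (fun x => sgn u x * ind c d x) = Int (fun x => sgn u x * ind c y x) + Int (fun x => sgn u x * ind y d x).
    rewrite -IntD//; have [||_ ->] := L1_ae (f := fun x => sgn u x * ind c d x) (g := fun x => sgn u x * ind c y x + sgn u x * ind y d x) _ _ (Ls c d) => //.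
      exact: L1_meas (L1D (Ls c y) (Ls y d)).
    by have := ind_split cyd; apply: (filterS (F := almost_everywhere mu)) => x ->; rewrite mulrDr.
  apply/eqP; rewrite subr_eq0 /kap T2; apply/eqP; apply: (mulIf dc).
  rewrite [RHS]mulrAC divfK// [RHS]mulrC [RHS]mulrDr -T1; ring.
by apply: (filterS (F := almost_everywhere mu)) H => x h /h/eqP; rewrite subr_eq0 => /eqP.
Qed.

End Sign.

(** * From the hypotheses on the solution to a profile *)

Section Regularity.
Context {R : realType}.
Implicit Types (f g k q u v : R -> R) (a b c d e t x y xi l A C K M kap : R).
Local Notation mu := (@lebesgue_measure R).

(** The second derivative is bounded, since it extends continuously to a compact interval; the mean
    value theorem then bounds increments of v' and, starting from the midpoint, v' itself. *)
Lemma C2_closed_bounds a b v : a < b -> C2_closed a b v ->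
  exists M K, [/\ 0 <= M, 0 <= K, forall x, a < x < b -> is_derive x 1 v (derive1 v x),
    forall x, a < x < b -> `|derive1 v x| <= K &
    forall x y, a < x < b -> a < y < b -> `|derive1 v y - derive1 v x| <= M * `|y - x|].
Proof.
move=> ab [dv [h [ch hE]]].
have ci : {within `[a, b], continuous (fun x => `|h x|)}.
  by move=> x; apply: continuous_comp; [exact: ch|exact: norm_continuous].
have [m _ hm] := EVT_max (ltW ab) ci.
have M0 : 0 <= `|h m| by exact: normr_ge0.
have d2 z : a < z < b -> is_derive z 1 (derive1 v) (h z).
  move=> hz; have [_ D] := dv z hz; split => //.
  by rewrite -derive1E -(hE z hz) derive1nS derive1n1.
have lip x y : a < x < b -> a < y < b -> `|derive1 v y - derive1 v x| <= `|h m| * `|y - x|.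
  wlog xy : x y / x <= y.
    move=> W hx hy; have [xy|yx] := leP x y; first exact: W.
    by rewrite distrC [X in _ * X]distrC; apply: W => //; exact: ltW.
  move=> /andP[ax xb] /andP[ay yb]; move: xy; rewrite le_eqVlt => /orP[/eqP ->|xy].
    by rewrite !subrr normr0 mulr0.
  rewrite (gtr0_norm (x := y - x)) ?subr_gt0//; apply: (mvt_bound (df := h)) => //.
  - by move=> z /andP[h1 h2]; apply: d2; rewrite (lt_trans ax h1) (lt_trans h2 yb).
  - apply: derivable_within_continuous => z; rewrite in_itv/= => /andP[h1 h2].
    by have [] := dv z _ => //; rewrite (lt_le_trans ax h1) (le_lt_trans h2 yb).
  by move=> z /andP[h1 h2]; apply: hm; rewrite in_itv/= (ltW (lt_trans ax h1)) (ltW (lt_trans h2 yb)).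
have [h1 h2] : a < (a + b) / 2 /\ (a + b) / 2 < b by split; lra.
exists `|h m|, (`|derive1 v ((a + b) / 2)| + `|h m| * (b - a)); split => //.
- by rewrite addr_ge0// mulr_ge0// subr_ge0 ltW.
- by move=> x hx; have [D _] := dv x hx; rewrite derive1E; exact: derivableP.
move=> x hx; have /andP[ax xb] := hx; set z := (a + b) / 2 in h1 h2 *.
have hz : a < z < b by rewrite h1.
rewrite -[derive1 v x](subrK (derive1 v z)) addrC; apply: le_trans (ler_normD _ _) _.
rewrite lerD2l; apply: le_trans (lip z x hz hx) _; rewrite ler_wpM2l// ler_norml.
by apply/andP; split; lra.
Qed.

(** u^2 has a limit L at [c] from the right. If L > 0, the absolute value of [u] jumps from 0 to
    about sqrt L across [c], which [translate_lower] excludes. *)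
Lemma vanish_left u C c d : L1 u -> L2 u -> finite_energy u -> c < d -> 0 <= C ->
  (forall x, x <= c -> u x = 0) ->
  (forall x y, c < x < d -> c < y < d -> `|u y ^+ 2 - u x ^+ 2| <= C * `|y - x|) ->
  forall x, c < x < d -> u x ^+ 2 <= C * (x - c).
Proof.
move=> Lu Lu2 eu cd C0 u0 lip.
have [L hL] := lipschitz_left_limit cd C0 lip.
suff L0 : L <= 0 by move=> x hx; have := hL x hx; rewrite ler_norml => /andP[_ ?]; lra.
rewrite leNgt; apply/negP => L0.
have C1 : 0 < 2 * C + 1 by lra.
have r0 : 0 < L / (2 * C + 1) by rewrite divr_gt0.
(* Keeps C step <= L / 2, so that u^2 >= L / 2 just to the right of [c]. *)
pose e := Num.min (L / (2 * C + 1)) (d - c).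
have e0 : 0 < e by rewrite lt_min r0 subr_gt0.
apply: (translate_lower (kap := 1) (e := e) (A := L / 2) Lu Lu2 eu) => //; first by rewrite divr_gt0.
move=> m; rewrite /e le_min ler_pdivlMr// => /andP[h1 h2]; have s0 := @step_gt0 R m.
exists (c - step m) => x /andP[x1 x2]; rewrite (u0 x) ?subr0; last lra.
have hx : c < 1 * x + 1 * step m < d by apply/andP; split; lra.
have := hL _ hx; rewrite ler_norml => /andP[h3 _].
have : C * (1 * x + 1 * step m - c) <= C * step m by rewrite ler_wpM2l//; lra.
by have : 0 <= C * step m by [rewrite mulr_ge0// ltW]; lra.
Qed.

Lemma vanish_right u C c d : L1 u -> L2 u -> finite_energy u -> c < d -> 0 <= C ->
  (forall x, d <= x -> u x = 0) ->
  (forall x y, c < x < d -> c < y < d -> `|u y ^+ 2 - u x ^+ 2| <= C * `|y - x|) ->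
  forall x, c < x < d -> u x ^+ 2 <= C * (d - x).
Proof.
move=> Lu Lu2 eu cd C0 u0 lip x /andP[cx xd].
have o1 : (-1 : R) != 0 by rewrite oppr_eq0 oner_neq0.
have E z : -1 * z + 0 = - z :> R by ring.
have eu' : finite_energy (fun z => u (-1 * z + 0)) by exact: finite_energy_affine.
have := vanish_left (L1_affine 0 o1 Lu) (L2_affine 0 o1 Lu2) eu' (c := - d) (d := - c) (C := C) _ C0 _ _ (x := - x).
rewrite E opprK; move=> H; rewrite (_ : d - x = - x - - d); last ring.
apply: H.
- by rewrite ltrN2.
- by move=> z hz; rewrite E u0//; lra.
- move=> z y /andP[h1 h2] /andP[h3 h4]; rewrite !E.
  rewrite (_ : y - z = - (- y - - z)); last ring.
  by rewrite normrN; apply: lip; apply/andP; split; lra.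
by rewrite !ltrN2 xd.
Qed.

Lemma lipschitz_zero_ext a b K v : (forall x, ~~ (a < x < b) -> v x = 0) -> (forall x, 0 <= v x) -> 0 <= K ->
  (forall x, a < x < b -> v x <= K * (x - a)) -> (forall x, a < x < b -> v x <= K * (b - x)) ->
  (forall x y, a < x < b -> a < y < b -> `|v y - v x| <= K * `|y - x|) ->
  forall x y, `|v y - v x| <= K * `|y - x|.
Proof.
move=> v0 vp K0 vl vr lip.
have one x y : a < x < b -> ~~ (a < y < b) -> `|v y - v x| <= K * `|y - x|.
  move=> hx hy; rewrite (v0 y)// sub0r normrN ger0_norm//.
  have /andP[ax xb] := hx; move: hy; rewrite negb_and -!leNgt => /orP[ya|yb].
    apply: le_trans (vl x hx) _; rewrite ler_wpM2l// distrC ger0_norm; lra.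
  apply: le_trans (vr x hx) _; rewrite ler_wpM2l// ger0_norm; lra.
move=> x y; have [hx|hx] := boolP (a < x < b); have [hy|hy] := boolP (a < y < b).
- exact: lip.
- exact: one.
- by rewrite distrC [X in _ * X]distrC; exact: one.
by rewrite !v0// subrr normr0 mulr_ge0.
Qed.

Lemma ae_oo_inhabited c d : c < d -> {ae mu, forall x, c < x < d -> False} -> False.
Proof.
move=> cd [N [mN N0 sN]].
have : (mu `]c, d[ <= mu N)%E.
  by apply: le_measure; rewrite ?inE// => x /=; rewrite in_itv/= => hx; apply: sN => /= h; exact: h.
by rewrite N0 lebesgue_measure_itv/= lte_fin cd -EFinB lee_fin subr_le0 leNgt cd.
Qed.

(** The sign is prescribed almost everywhere only, because [u] may have the opposite sign on a null
    set. *)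
Definition local_sign u x kap :=
  exists e, 0 < e /\ {ae mu, forall y, x - e < y < x + e -> sgn u y = kap}.

Lemma local_sign_uniq u x kap kap' : local_sign u x kap -> local_sign u x kap' -> kap = kap'.
Proof.
move=> [e [e0 h]] [e' [e0' h']]; apply/eqP/negPn/negP => /eqP ne.
pose r := Num.min e e'; have r0 : 0 < r by rewrite lt_min e0.
have [re re'] : r <= e /\ r <= e' by split; rewrite ge_min lexx ?orbT.
apply: (@ae_oo_inhabited (x - r) (x + r)); first lra.
apply: (filterS2 (F := almost_everywhere mu)) h h' => y hy hy' /andP[h1 h2]; apply: ne.
by rewrite -hy ?hy'//; apply/andP; split; lra.
Qed.

Lemma sgn_pm u x : sgn u x = 1 \/ sgn u x = -1.
Proof. by rewrite /sgn; case: ifP; [left|right]. Qed.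

Lemma sgn_sqrt u x : u x = sgn u x * Num.sqrt (u x ^+ 2).
Proof.
by rewrite sqrtr_sqr /sgn; case: ltP => h; [rewrite gtr0_norm// mul1r|rewrite ler0_norm// mulrNN mul1r].
Qed.

Lemma local_sign_exists u x : L1 u -> L2 u -> finite_energy u -> continuous (fun y => u y ^+ 2) ->
  0 < u x ^+ 2 -> exists e kap, [/\ 0 < e, kap = 1 \/ kap = -1 &
    {ae mu, forall y, x - e < y < x + e -> sgn u y = kap}].
Proof.
move=> Lu Lu2 eu cv ux0.
have A0 : 0 < u x ^+ 2 / 2 by rewrite divr_gt0.
have /cvgrPdist_lt/(_ _ A0)/nbhs_ballP[r /= r0 hr] := cv x.
have hA y : x - r / 2 < y < x + r / 2 + r / 2 -> u x ^+ 2 / 2 <= u y ^+ 2.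
  move=> /andP[h1 h2]; have /= := hr y; rewrite /ball/= => H.
  have {}H : `|u x ^+ 2 - u y ^+ 2| < u x ^+ 2 / 2 by apply: H; rewrite ltr_norml; apply/andP; split; lra.
  by move: H; rewrite ltr_norml => /andP[_ ?]; lra.
have r2 : 0 < r / 2 by rewrite divr_gt0.
have cd : x - r / 2 < x + r / 2 by lra.
have [kap hk] := sgn_const Lu Lu2 eu A0 r2 cd hA.
exists (r / 2), (if kap == 1 then 1 else -1); split => //; first by case: ifP; [left|right].
apply: (filterS (F := almost_everywhere mu)) hk => y h /h <-.
by have [->|->] := sgn_pm u y; rewrite ?eqxx//; case: ifP => // /eqP.
Qed.

(** The default -1 also covers the points where neither sign prevails; under the hypotheses of
    [local_sign_exists] these are zeros of u^2. *)
Definition local_sgn u x : R := if `[< local_sign u x 1 >] then 1 else -1.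

Lemma local_sgnE u x kap : kap = 1 \/ kap = -1 -> local_sign u x kap -> local_sgn u x = kap.
Proof.
rewrite /local_sgn => -[->|->] h; case: asboolP => // h'.
exact: local_sign_uniq h' h.
Qed.

Lemma local_sign_near u x e kap y : {ae mu, forall z, x - e < z < x + e -> sgn u z = kap} ->
  x - e < y < x + e -> local_sign u y kap.
Proof.
move=> h /andP[h1 h2]; exists (Num.min (y - (x - e)) (x + e - y)).
have p : 0 < Num.min (y - (x - e)) (x + e - y) by rewrite lt_min !subr_gt0 h1.
split => //; apply: (filterS (F := almost_everywhere mu)) h => z hz /andP[h3 h4]; apply: hz.
have q1 : Num.min (y - (x - e)) (x + e - y) <= y - (x - e) by rewrite ge_min lexx.
have q2 : Num.min (y - (x - e)) (x + e - y) <= x + e - y by rewrite ge_min lexx orbT.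
by apply/andP; split; lra.
Qed.

Lemma local_sgn_near u x : L1 u -> L2 u -> finite_energy u -> continuous (fun y => u y ^+ 2) ->
  0 < u x ^+ 2 -> \forall y \near x, local_sgn u y = local_sgn u x.
Proof.
move=> Lu Lu2 eu cv /(local_sign_exists Lu Lu2 eu cv)[e [kap [e0 hk h]]].
have E y : x - e < y < x + e -> local_sgn u y = kap.
  by move=> hy; apply: local_sgnE => //; exact: local_sign_near h hy.
have Ex : x - e < x < x + e by apply/andP; split; lra.
by apply: filterS (near_oo Ex) => y /E ->; rewrite E.
Qed.

(** Near a point with u^2 > 0 the sign is right off a null set that depends on the point; intervals
    with rational ends reduce these to countably many null sets. *)
Lemma local_sgn_ae u : L1 u -> L2 u -> finite_energy u -> continuous (fun y => u y ^+ 2) ->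
  {ae mu, forall x, u x = local_sgn u x * Num.sqrt (u x ^+ 2)}.
Proof.
move=> Lu Lu2 eu cv.
pose good (q r : rat) := exists kap, (kap = 1 \/ kap = -1) /\
  {ae mu, forall y, ratr q < y < ratr r -> sgn u y = kap}.
(* [unpickle] enumerates the pairs of rationals; a code of no pair gives a trivial statement. *)
pose Pn n y := if unpickle n is Some (q, r) then good q r -> ratr q < y < ratr r ->
  sgn u y = local_sgn u y else True.
have H n : {ae mu, forall y : R, Pn n y}.
  rewrite /Pn; case: unpickle => [[q r]|]; last by apply: aeW.
  have [[kap [hk h]]|ng] := pselect (good q r); last by apply: aeW => y /= /ng.
  apply: (filterS (F := almost_everywhere mu)) (h) => y hy _ yqr; rewrite hy//; apply/esym.
  apply: local_sgnE => //; pose m : R := (ratr q + ratr r) / 2.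
  apply: (@local_sign_near u m ((ratr r - ratr q) / 2)); last by case/andP: yqr => h1 h2; rewrite /m; apply/andP; split; lra.
  by apply: (filterS (F := almost_everywhere mu)) h => z hz /andP[h1 h2]; apply: hz; rewrite /m in h1 h2; apply/andP; split; lra.
have := ae_foralln H; apply: (filterS (F := almost_everywhere mu)) => y hy.
have [u0|/eqP u0] := eqVneq (u y) 0; first by rewrite u0 expr2 mul0r sqrtr0 mulr0.
have u2 : 0 < u y ^+ 2 by rewrite lt_def sqr_ge0 sqrf_eq0 andbT; apply/eqP.
have [e [kap [e0 hk h]]] := local_sign_exists Lu Lu2 eu cv u2.
have [q] : exists q : rat, ratr q \in `]y - e, y[%R by apply: (@rat_in_itvoo R); rewrite ltrBlDr ltrDl.
have [r] : exists r : rat, ratr r \in `]y, y + e[%R by apply: (@rat_in_itvoo R); rewrite ltrDl.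
rewrite !in_itv/= => /andP[r1 r2] /andP[q1 q2].
have := hy (pickle (q, r)); rewrite /Pn pickleK => {}hy.
rewrite -hy ?q2//; first exact: sgn_sqrt.
exists kap; split => //; apply: (filterS (F := almost_everywhere mu)) h => z hz /andP[h1 h2]; apply: hz.
by apply/andP; split; lra.
Qed.

(** [vanish_left] and [vanish_right] exclude jumps at the end points, so the Lipschitz bound extends
    to the whole line; the continuity of u^2 obtained in this way makes the local sign available. *)
Lemma profile_exists a b u : a < b -> L1 u -> L2 u -> finite_energy u ->
  (forall x, ~~ (a < x < b) -> u x = 0) -> C2_closed a b (fun x => u x ^+ 2) ->
  exists M K, profile a b M K (fun x => u x ^+ 2) (derive1 (fun x => u x ^+ 2)) (local_sgn u) /\
    {ae mu, forall x, u x = root (v := fun x => u x ^+ 2) (s := local_sgn u) x}.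
Proof.
move=> ab Lu Lu2 eu u0 c2; have [M [K [M0 K0 dv dK dlip]]] := C2_closed_bounds ab c2.
pose v x := u x ^+ 2.
have lin x y : a < x < b -> a < y < b -> `|v y - v x| <= K * `|y - x|.
  wlog xy : x y / x <= y.
    move=> W hx hy; have [xy|yx] := leP x y; first exact: W.
    by rewrite distrC [X in _ * X]distrC; apply: W => //; exact: ltW.
  move=> /andP[ax xb] /andP[ay yb]; move: xy; rewrite le_eqVlt => /orP[/eqP ->|xy].
    by rewrite !subrr normr0 mulr0.
  rewrite (gtr0_norm (x := y - x)) ?subr_gt0//; apply: (mvt_bound (df := derive1 v)) => //.
  - by move=> z /andP[h1 h2]; apply: dv; rewrite (lt_trans ax h1) (lt_trans h2 yb).
  - apply: derivable_within_continuous => z; rewrite in_itv/= => /andP[h1 h2].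
    by have [] := dv z _ => //; rewrite (lt_le_trans ax h1) (le_lt_trans h2 yb).
  by move=> z /andP[h1 h2]; apply: dK; rewrite (lt_trans ax h1) (lt_trans h2 yb).
have vlip : forall x y, `|v y - v x| <= K * `|y - x|.
  apply: (lipschitz_zero_ext (a := a) (b := b)) => //.
  - by move=> x hx; rewrite /v u0// expr2 mul0r.
  - by move=> x; exact: sqr_ge0.
  - apply: (vanish_left Lu Lu2 eu) => // x hx; apply: u0; rewrite negb_and -leNgt hx//.
  - apply: (vanish_right Lu Lu2 eu) => // x hx; apply: u0; rewrite negb_and -!leNgt hx ?orbT//.
have cv : continuous v by exact: lipschitz_continuous vlip.
exists M, K; split; last exact: local_sgn_ae.
split => //.
- by move=> x hx; rewrite u0// expr2 mul0r.
- by move=> x; exact: sqr_ge0.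
- by move=> x; rewrite /local_sgn; case: ifP; [left|right].
- by move=> x; exact: local_sgn_near.
Qed.

End Regularity.

(** * Conclusion *)

Section Assembly.
Context {R : realType}.
Implicit Types (f g k p q u v : R -> R) (a b c d e t x y xi l A C K M kap : R).
Local Notation mu := (@lebesgue_measure R).

(** Every point is a Lebesgue point of a continuous function, so the integral from minus infinity is
    differentiable everywhere; compact support makes it converge. *)
Lemma csupp_primitive g : continuous g -> csupp g ->
  exists G, (forall y, is_derive y 1 G (g y)) /\ G 0 = 0.
Proof.
move=> cg sg; have Lg : L1 g by apply: csupp_L1 => //; exact: continuous_csupp_L2.
have H y : is_derive y 1 (fun z => \int[mu]_(t in `]-oo, z]) g t) (g y).
  have y1 : y < y + 1 by rewrite ltrDl.
  have I : mu.-integrable [set` Interval -oo%O (BRight (y + 1))] (EFin \o g) by apply: integrableS Lg.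
  have lp : lebesgue_pt g y.
    apply: (@continuous_lebesgue_pt R g y setT); [|exact: measurableT| |exact: cg].
      by split => //; exact: openT.
    exact: continuous_measurable_fun.
  have [|D <-] := FTC1_lebesgue_pt y1 I _ lp; first by rewrite /Order.lt/=.
  by rewrite derive1E; exact: derivableP.
exists (fun z => \int[mu]_(t in `]-oo, z]) g t - \int[mu]_(t in `]-oo, 0]) g t).
split => [y|]; last exact: subrr.
by apply: isd_eq (isdD (H y) (isd_cst _ y)) _; rewrite addr0.
Qed.

(** Multiplication by a continuous plateau, 1 on [-B, B] and 0 from B + 1 on. It supplies the
    integrability that [csupp_primitive] relies on. *)
Lemma truncation_exists f (B : R) : continuous f -> exists g,
  [/\ continuous g, csupp g & forall y, `|y| <= B -> g y = f y].
Proof.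
move=> cf; pose chi y : R := Num.max 0 (Num.min 1 (B + 1 - `|y|)).
exists (fun y => chi y * f y); split.
- have cchi : continuous chi.
    apply: (@lipschitz_continuous R chi 1) => x y; rewrite /chi mul1r.
    have e : `|(1 : R) - 1| <= `|y - x| by rewrite subrr normr0.
    apply: (le_trans (max0_dist _ _)); apply: (min_dist e).
    rewrite (_ : B + 1 - `|y| - (B + 1 - `|x|) = - (`|y| - `|x|)); last by ring.
    by rewrite normrN; exact: ler_dist_dist.
  by move=> y; apply: cvgM; [exact: cchi|exact: cf].
- exists (B + 1) => y hy; rewrite /chi (_ : Num.max 0 _ = 0) ?mul0r//.
  by apply/max_idPl; rewrite ge_min; apply/orP; right; lra.
move=> y hy; rewrite /chi (_ : Num.min _ _ = 1); last by apply/min_idPl; lra.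
by rewrite (_ : Num.max _ _ = 1) ?mul1r//; apply/max_idPr.
Qed.

Lemma lipschitz_bound f : lipschitz f -> exists L, 0 <= L /\ forall x y, `|f y - f x| <= L * `|y - x|.
Proof.
move=> [M [_ hM]]; exists (Num.max M 0 + 1); split.
  by rewrite addr_ge0// le_max lexx orbT.
move=> x y; apply: (hM (Num.max M 0 + 1) _ (y, x)) => //.
by rewrite ltr_pwDr// le_max lexx.
Qed.

Lemma energy_ae u U phi : L1 u -> measurable_fun setT U -> {ae mu, forall x, u x = U x} ->
  energy u phi = energy U phi.
Proof.
move=> Lu mU uU.
have T (h : R -> R) C xi : measurable_fun setT h -> (forall x, `|h x| <= C) ->
    Int (fun x => u x * h x) = Int (fun x => U x * h x).
  move=> mh hC; have [] // := L1_ae (f := fun x => u x * h x) (g := fun x => U x * h x).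
  - exact: measurable_funM.
  - by apply: (filterS (F := almost_everywhere mu)) uU => x ->.
  exact: L1M_bounded hC.
apply: eq_Int => xi; congr (_ * _); rewrite /spec; congr (_ * _ + _ * _).
- apply: (T _ 1) => [//||x]; last exact: cos_max.
  by apply: continuous_measurable_fun => x; apply: continuous_comp; [exact: mulrr_continuous|exact: continuous_cos].
apply: (T _ 1) => [//||x]; last exact: sin_max.
by apply: continuous_measurable_fun => x; apply: continuous_comp; [exact: mulrr_continuous|exact: continuous_sin].
Qed.

Lemma Int_patch_ae a b f g : L1 (f \_ `]a, b[) -> measurable_fun `]a, b[ g ->
  {ae mu, forall x, a < x < b -> g x = f x} ->
  mu.-integrable `]a, b[ (EFin \o g) /\
  \int[mu]_(x in `]a, b[) g x = Int (f \_ `]a, b[).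
Proof.
move=> Lf mg fg; rewrite Int_patch.
have [] := L1_ae (f := f \_ `]a, b[) (g := g \_ `]a, b[) _ _ Lf.
- by apply/(measurable_restrictT _ (measurable_itv _)).
- apply: (filterS (F := almost_everywhere mu)) fg => x h; rewrite !patch_oo; case: ifP => // /h ->//.
by move=> L ->; split => //; apply/(L1_patch _ (measurable_itv _)).
Qed.

Lemma L1_locally_oo a b f : L1 f -> locally_integrable `]a, b[ f.
Proof.
move=> Lf; apply: open_integrable_locally; first exact: interval_open.
exact: integrableS Lf.
Qed.

(** [chain_Int] with F the identity and X the test function, which vanishes at both end points. *)
Lemma weak_derivative_root a b M K v dv s : profile a b M K v dv s ->
  weak_derivative a b (@root R v s) (@droot R v dv s).
Proof.
move=> P; have ab := pf_ab P; split; first exact: L1_locally_oo (L1_droot P).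
move=> phi tp; have [cp dp cdp [c [d [ac cd db p0]]]] := test_fun_props ab tp.
have pa : phi a = 0 by apply: p0; rewrite negb_and -leNgt (ltW ac).
have pb : phi b = 0 by apply: p0; rewrite negb_and -!leNgt (ltW db) orbT.
have c1 : continuous (fun _ : R => 1 : R) by move=> ?; exact: cvg_cst.
have [L E] := chain_Int P (lexx a) ab (lexx b) c1 (@isd_id R) dp cdp.
rewrite pa pb !mul0r subrr in E; rewrite !Int_patch.
have L2' : L1 ((fun x => droot (v := v) (dv := dv) (s := s) x * phi x) \_ `]a, b[).
  exact: L1_loc_test ab (L1_locally_oo _ _ (L1_droot P)) tp.
have L3 : L1 ((fun x => root (v := v) (s := s) x * derive1 phi x) \_ `]a, b[).
  rewrite patch_support; last by move=> x hx; rewrite (root_out P hx) mul0r.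
  have sU : csupp (fun x => root (v := v) (s := s) x * derive1 phi x).
    by apply: (csupp_itv (a := a) (b := b)) => x hx; rewrite (root_out P hx) mul0r.
  apply: csupp_L1 => //; apply: continuous_csupp_L2 => // x.
  by apply: cvgM; [exact: (root_continuous P)|exact: cdp].
apply/eqP; rewrite -addr_eq0; apply/eqP; rewrite -(IntD L3 L2') -[RHS]E.
apply: eq_Int => x; rewrite !patch_oo; case: ifP => _; last by rewrite addr0.
by rewrite addrC mul1r mulrC [X in _ + X]mulrC.
Qed.

Lemma weak_derivative_ae a b u U p : a < b -> csupp U -> continuous U -> measurable_fun setT u ->
  {ae mu, forall x, u x = U x} -> weak_derivative a b U p -> weak_derivative a b u p.
Proof.
move=> ab sU cU mu' uU [lp h]; split => // phi tp; rewrite -(h _ tp).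
have [cp dp cdp _] := test_fun_props ab tp.
have L : L1 (fun x => U x * derive1 phi x).
  apply: csupp_L1; first by case: sU => N hN; exists N => x /hN ->; rewrite mul0r.
  apply: continuous_csupp_L2; last by case: sU => N hN; exists N => x /hN ->; rewrite mul0r.
  by move=> x; apply: cvgM; [exact: cU|exact: cdp].
rewrite [RHS]Int_patch; apply: (Int_patch_ae (L1_patch_oo _ _ L) _ _).2.
  apply: (measurable_funS measurableT) => //; apply: measurable_funM => //.
  exact: continuous_measurable_fun.
by apply: (filterS (F := almost_everywhere mu)) uU => x ->.
Qed.

Lemma left_quotient_limit a b A M v : a < b ->
  (forall x, a < x < b -> `|v x - A * (x - a)| <= M * (x - a) ^+ 2) ->
  v x / (x - a) @[x --> a^'+] --> A.
Proof.
move=> ab h; have c := cvg_at_right_filter (dist_cvg0 M a).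
apply: cvg_squeeze c; near=> x.
have ax : a < x by near: x; exact: nbhs_right_gt.
have xb : x < b by near: x; exact: nbhs_right_lt.
have xa : 0 < x - a by rewrite subr_gt0.
rewrite (gtr0_norm xa) (_ : v x / (x - a) - A = (v x - A * (x - a)) / (x - a)); last first.
  by field; rewrite gt_eqF.
rewrite normrM normfV (gtr0_norm xa) ler_pdivrMr// -mulrA -expr2; apply: h.
by rewrite ax.
Unshelve. all: by end_near. Qed.

Lemma right_quotient_limit a b A M v : a < b ->
  (forall x, a < x < b -> `|v x - A * (b - x)| <= M * (b - x) ^+ 2) ->
  v x / (b - x) @[x --> b^'-] --> A.
Proof.
move=> ab h; have c := cvg_at_left_filter (dist_cvg0 M b).
apply: cvg_squeeze c; near=> x.
have xb : x < b by near: x; exact: nbhs_left_lt.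
have ax : a < x by near: x; exact: nbhs_left_gt.
have xa : 0 < b - x by rewrite subr_gt0.
rewrite -(distrC b x) (gtr0_norm xa) (_ : v x / (b - x) - A = (v x - A * (b - x)) / (b - x)); last first.
  by field; rewrite gt_eqF.
rewrite normrM normfV (gtr0_norm xa) ler_pdivrMr// -mulrA -expr2; apply: h.
by rewrite ax.
Unshelve. all: by end_near. Qed.

Lemma right_slope a b M K v dv s A : profile a b M K v dv s ->
  (forall x, a < x < b -> `|dv x + A| <= M * (b - x)) ->
  forall x, a < x < b -> `|v x - A * (b - x)| <= M * (b - x) ^+ 2.
Proof.
move=> P hA x /andP[ax xb]; have P' := profile_reflect P.
have [|_ h] := left_slope P' (A := A).
  move=> y /andP[h1 h2]; rewrite -opprD normrN (_ : y - a = b - (-1 * y + (a + b))); last by ring.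
  by apply: hA; apply/andP; split; lra.
have := h (a + b - x); rewrite (_ : -1 * (a + b - x) + (a + b) = x); last by ring.
rewrite (_ : a + b - x - a = b - x); last by ring.
by apply; apply/andP; split; lra.
Qed.

End Assembly.

Theorem theorem1p8 (R : realType) (a b : R) (f u : R -> R)
    (hab : a < b)
    (hf : lipschitz f)
    (hu : sobolev 2^-1 u)
    (heq : weak_half_laplacian a b u (fun x => f (u x)))
    (hu0 : forall x, ~~ (a < x < b) -> u x = 0)
    (hu2 : C2_closed a b (fun x => u x ^+ 2)) :
  (* u' exists on (a, b), as a weak derivative *)
  (exists p : R -> R, weak_derivative a b u p) /\
  exists La Lb : R,
    [/\ u x ^+ 2 / (x - a) @[x --> a^'+] --> La,
        u x ^+ 2 / (b - x) @[x --> b^'-] --> Lb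
      (* p = u' and g = (-Delta)^(1/2) u on (a, b) *)
      & forall p g : R -> R,
          weak_derivative a b u p ->
          locally_integrable `]a, b[ g ->
          weak_half_laplacian a b u g ->
          [/\ (@lebesgue_measure R).-integrable `]a, b[
                (fun x => (p x * g x)%:E),
              \int[@lebesgue_measure R]_(x in `]a, b[) (p x * g x)
                = pi / 8 * (La - Lb),
              (@lebesgue_measure R).-integrable `]a, b[
                (fun x => (p x * x * g x)%:E)
            & \int[@lebesgue_measure R]_(x in `]a, b[) (p x * x * g x)
                = pi / 8 * (La * a - Lb * b)]].
Proof.
have su := csupp_itv hu0.
have [Lu2 eu] := sobolev_finite_energy su hu; have Lu := csupp_L1 su Lu2.
have [M [K [P uU]]] := profile_exists hab Lu Lu2 eu hu0 hu2.
set v := (fun x => u x ^+ 2) in P uU *; set dv := derive1 v in P *; set s := local_sgn u in P uU *.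
pose U := @root R v s; pose p0 := @droot R v dv s.
have cU : continuous U := root_continuous P.
have sU : csupp U := root_csupp P.
have mp0 := L1_meas (L1_droot P).
have [L [L0 fL]] := lipschitz_bound hf.
have cf : continuous f := lipschitz_continuous fL.
(* sqrt (K (b - a)) bounds U by [root_bounded], so that [g] and [f] agree at all values of U. *)
have [g [cg sg gf]] := truncation_exists (Num.sqrt (K * (b - a))) cf.
have [G [dG G0]] := csupp_primitive cg sg.
have [C [N [C0 gC]]] := continuous_csupp_bounded cg sg.
have {}gC y : `|g y| <= C.
  by apply: le_trans (gC y) _; rewrite ler_piMr// box_le1.
have gU x : g (U x) = f (U x) by apply: gf; exact: root_bounded P x.
have cgU : continuous (fun x => g (U x)).
  by move=> x; apply: continuous_comp; [exact: cU|exact: cg].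
have W phi : test_function a b phi -> energy U phi = 2 * pi * \int[@lebesgue_measure R]_(x in `]a, b[) (g (U x) * phi x).
  move=> tp; have [sp Lp ep] := test_fun_energy hab tp; have [cp _ _ _] := test_fun_props hab tp.
  rewrite -(energy_ae phi Lu (continuous_measurable_fun cU) uU).
  rewrite (weak_half_laplacianE su Lu2 eu tp sp Lp ep heq); congr (_ * _).
  rewrite [RHS]Int_patch.
  have LgU : L1 (fun x => g (U x) * phi x).
    apply: eq_L1 (L1M_bounded (csupp_L1 sp Lp) (continuous_measurable_fun cgU) (fun x => gC (U x))) => x.
    by rewrite mulrC.
  apply: (Int_patch_ae (L1_patch_oo _ _ LgU) _ _).2.
    apply: (measurable_funS measurableT) => //; apply: measurable_funM.
      apply: measurableT_comp; [exact: continuous_measurable_fun|exact: L1_meas].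
    exact: continuous_measurable_fun.
  by apply: (filterS (F := almost_everywhere (@lebesgue_measure R))) uU => x -> _; rewrite -gU.
have gl x y : `|x| <= Num.sqrt (K * (b - a)) -> `|y| <= Num.sqrt (K * (b - a)) ->
    `|g y - g x| <= L * `|y - x|.
  by move=> hx hy; rewrite !gf.
have [La [Lb [hLa hLb I1 [L2 I2]]]] := pohozaev P cg dG G0 L0 gl W.
have L1' : L1 (fun x => g (U x) * p0 x).
  apply: eq_L1 (L1M_bounded (L1_droot P) (continuous_measurable_fun cgU) (fun x => gC (U x))) => x.
  by rewrite mulrC.
have wd : weak_derivative a b u p0.
  exact: weak_derivative_ae hab sU cU (L1_meas Lu) uU (weak_derivative_root P).
split; first by exists p0.
exists La, Lb; split.
- by apply: (left_quotient_limit (M := M) (v := v) hab); exact: (left_slope P hLa).2.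
- by apply: (right_quotient_limit (M := M) (v := v) hab); exact: right_slope P hLb.
move=> p g' [lp hp] lg' hg'.
(* Uniqueness of weak derivatives: on (a, b) the given [p] is [droot] almost everywhere. *)
have pp0 : {ae @lebesgue_measure R, forall x, a < x < b -> p x = p0 x}.
  apply: fundamental_lemma hab lp wd.1 _ => phi tp; apply: oppr_inj.
  by rewrite -hp// -wd.2.
have LgU : L1 ((fun x => g (U x)) \_ `]a, b[).
  apply: (L1_le (L1Z C (L1_ind a b))).
    by apply: open_continuous_meas => x _; exact: cgU.
  by move=> x; rewrite patch_oo /ind; case: ifP => _; rewrite ?mulr1// mulr0 normr0.
(* Both g' and g(U) represent the energy pairing of [u] with test functions, so they agree almost
   everywhere on (a, b). *)
have gg : {ae @lebesgue_measure R, forall x, a < x < b -> g' x = g (U x)}.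
  apply: (fundamental_lemma hab lg').
    apply: open_integrable_locally; first exact: interval_open.
    by apply/(L1_patch _ (measurable_itv _)).
  move=> phi tp; have [sp Lp ep] := test_fun_energy hab tp.
  have p2 : 2 * pi != 0 :> R by rewrite mulf_neq0// gt_eqF// pi_gt0.
  apply: (mulfI p2); rewrite -(W phi tp) -(energy_ae phi Lu (continuous_measurable_fun cU) uU).
  by rewrite (weak_half_laplacianE su Lu2 eu tp sp Lp ep hg').
have mp : measurable_fun `]a, b[ p by case: lp.
have mg : measurable_fun `]a, b[ g' by case: lg'.
have out (x : R) : ~~ (a < x < b) -> p0 x = 0 by move=> hx; rewrite /p0 (droot_out P hx).
have e1 : (fun x => g (U x) * p0 x) \_ `]a, b[ = fun x => g (U x) * p0 x.
  by apply: patch_support => x /out ->; rewrite mulr0.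
have e2 : (fun x => x * (g (U x) * p0 x)) \_ `]a, b[ = fun x => x * (g (U x) * p0 x).
  by apply: patch_support => x /out ->; rewrite !mulr0.
have [J1 E1] : (@lebesgue_measure R).-integrable `]a, b[ (EFin \o (fun x => p x * g' x)) /\
    \int[@lebesgue_measure R]_(x in `]a, b[) (p x * g' x) = Int (fun x => g (U x) * p0 x).
  rewrite -[in RHS]e1; apply: Int_patch_ae.
  - by rewrite e1.
  - exact: measurable_funM.
  apply: (filterS2 (F := almost_everywhere (@lebesgue_measure R))) pp0 gg => x h1 h2 hx.
  by rewrite h1// h2// mulrC.
have [J2 E2] : (@lebesgue_measure R).-integrable `]a, b[ (EFin \o (fun x => p x * x * g' x)) /\
    \int[@lebesgue_measure R]_(x in `]a, b[) (p x * x * g' x) = Int (fun x => x * (g (U x) * p0 x)).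
  rewrite -[in RHS]e2; apply: Int_patch_ae.
  - by rewrite e2.
  - by apply: measurable_funM => //; apply: measurable_funM.
  apply: (filterS2 (F := almost_everywhere (@lebesgue_measure R))) pp0 gg => x h1 h2 hx.
  by rewrite h1// h2//; ring.
by split => //; rewrite ?E1 ?E2.
Qed.
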